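(* Let $E$ be a symmetric quasi-Banach function space on $\mathbb{R}_+$ which is $s$-convex for some $0<s<\infty$. Let $\mathcal{M},\mathcal{N}$ be von Neumann algebras equipped with normal, semi-finite, faithful traces $\tau$ and $\sigma$, respectively. Suppose that $0<p<q\leq\infty$ and for every $k\geq1$ let $T_k:L^p(\mathcal{M})_+ + L^q(\mathcal{M})_+\to S(\sigma)_+$ be positive midpoint convex maps such that for some constants $C_p,C_q>0$ depending only on $p$ and $q$, respectively, $$\Big\|\sum_{k\geq1}T_k(x_k)\Big\|_{L^{r,\infty}(\mathcal{N})}\leq C_r\Big\|\sum_{k\geq1}x_k\Big\|_{L^r(\mathcal{M})}\qquad(x_k\in L^r(\mathcal{M})_+,\ k\geq1,\ r=p,q).$$ If $p<p_E\leq q_E<q<\infty$, or $p<p_E$ and $q=\infty$, then for any sequence $(x_k)_{k\geq1}$ in $E(\mathcal{M})_+$, $$\Big\|\sum_{k\geq1}T_k(x_k)\Big\|_{E(\mathcal{N})}\leq4\|\Theta_{p,q}\|\max\{C_p,C_q\}\Big\|\sum_{k\geq1}x_k\Big\|_{E(\mathcal{M})},$$ where the sums converge in norm.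
   Context: Commutative notions. For measurable a.e. finite $f$ on $\mathbb{R}_+$ or $\mathbb{R}_+\times\mathbb{R}_+$, $d(v;f)=\lambda(|f|>v)$ ($\lambda$ Lebesgue measure); $S(\cdot)$ denotes those $f$ with $d(v;f)<\infty$ for some $v>0$; $\mu_t(f)=\inf\{v>0:d(v;f)\le t\}$. A symmetric quasi-Banach function space $E$ on $\mathbb{R}_+$ is a complete quasi-normed linear subspace of $S(\mathbb{R}_+)$ such that $f\in S(\mathbb{R}_+)$, $g\in E$, $\mu(f)\le\mu(g)$ imply $f\in E$, $\|f\|_E\le\|g\|_E$. $E(\mathbb{R}_+\times\mathbb{R}_+)=\{f\in S(\mathbb{R}_+\times\mathbb{R}_+):\mu(f)\in E\}$ with quasi-norm $\|\mu(f)\|_E$. $E$ is $s$-convex if for some $C$, $\|(\sum_i|f_i|^s)^{1/s}\|_E\le C(\sum_i\|f_i\|_E^s)^{1/s}$ for all finite sequences in $E$. With $(D_af)(u)=f(au)$ on $E$, the Boyd indices are $p_E=\lim_{u\to\infty}\frac{\log u}{\log\|D_{1/u}\|}$ and $q_E=\lim_{u\downarrow0}\frac{\log u}{\log\|D_{1/u}\|}$ ($=\infty$ if the denominator vanishes). $\Theta_{p,q}f(s,t)=f(s)\big(t^{-1/q}\chi_{(0,1)}(t)+t^{-1/p}\chi_{[1,\infty)}(t)\big)$ ($t^{-1/\infty}=1$), and $\|\Theta_{p,q}\|$ is its operator norm from $E$ to $E(\mathbb{R}_+\times\mathbb{R}_+)$ (finite under the index conditions). Noncommutative notions. For a closed densely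 defined operator $x$ affiliated with $\mathcal{M}$, $d(v;x)=\tau(e^{|x|}(v,\infty))$, with $e^{|x|}$ the spectral measure of $|x|$; $S(\tau)$ is the $*$-algebra of $\tau$-measurable operators ($d(v;x)<\infty$ for some $v>0$), $S(\tau)_+$ its positive cone, which induces the usual order; $\mu_t(x)=\inf\{v>0:d(v;x)\le t\}$. $E(\mathcal{M})=\{x\in S(\tau):\mu(x)\in E\}$, $\|x\|_{E(\mathcal{M})}=\|\mu(x)\|_E$, $E(\mathcal M)_+=E(\mathcal M)\cap S(\tau)_+$; similarly for $(\mathcal{N},\sigma)$. $L^r(\mathcal{M})$ is the case $E=L^r$ ($L^\infty(\mathcal M)=\mathcal M$), $\|x\|_{L^{r,\infty}}=\sup_{t>0}t^{1/r}\mu_t(x)$ ($L^{\infty,\infty}=L^\infty$). A map $T:D\to S(\sigma)_+$ on a convex set $D\subset S(\tau)$ is midpoint convex if $T(\frac12x+\frac12y)\le\frac12T(x)+\frac12T(y)$ for all $x,y\in D$. *)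

(* Defs.v *)
From HB Require Import structures.
From mathcomp Require Import all_boot all_order all_algebra.
From mathcomp Require Import sesquilinear complex.
From mathcomp Require Import all_classical all_reals all_analysis.
Set Implicit Arguments.
Unset Strict Implicit.
Unset Printing Implicit Defensive.
Import Order.TTheory GRing.Theory Num.Theory.
Import numFieldNormedType.Exports.
Local Open Scope classical_set_scope.
Local Open Scope ring_scope.

(** * Quasi-normed spaces realised inside an ambient type *)

(* [qn] is only meaningful on [carrier]; [enorm] is its extension by +oo. *)
Record qspace (R : realType) (V : Type) := QSpace {
  carrier : set V ;
  qn : V -> R }.

Definition enorm (R : realType) (V : Type) (E : qspace R V) (f : V) : \bar R :=
  if `[< carrier E f >] then (qn E f)%:E else +oo%E.

(* Operator norm, with value +oo when T does not map E boundedly into F. *)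
Definition opnorm (R : realType) (V W : Type) (E : qspace R V) (F : qspace R W)
    (T : V -> W) : \bar R :=
  ereal_inf [set c%:E | c in [set c : R | 0 <= c /\
    forall f, carrier E f -> carrier F (T f) /\ qn F (T f) <= c * qn E f]].

(** * Commutative notions *)

Section Commutative.
Context {R : realType}.

(* t |-> inf {v > 0 : d v <= t}; relevant only for t > 0. *)
Definition singular (d : R -> \bar R) (t : R) : R :=
  inf [set v | 0 < v /\ (d v <= t%:E)%E].

Definition distr d (T : measurableType d) (m : set T -> \bar R) (D : set T)
    (f : T -> R) (v : R) : \bar R :=
  m (D `&` [set x | v < `|f x|]).

Definition Sfun d (T : measurableType d) (m : set T -> \bar R) (D : set T) :
    set (T -> R) :=
  [set f | measurable_fun D f /\
           exists v, 0 < v /\ (distr m D f v < +oo)%E].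

Definition Rplus : set R := `]0, +oo[.

(* A function on R_+ is represented by a total function R -> R of which only
   the restriction to ]0, +oo[ is relevant (likewise on R_+ x R_+). *)
Definition S1 : set (R -> R) := Sfun (@lebesgue_measure R) Rplus.
Definition mu1 (f : R -> R) : R -> R :=
  singular (distr (@lebesgue_measure R) Rplus f).

Definition leb2 : set (R * R) -> \bar R :=
  (@lebesgue_measure R \x @lebesgue_measure R)%E.
Definition S2 : set (R * R -> R) := Sfun leb2 (Rplus `*` Rplus).
Definition mu2 (f : R * R -> R) : R -> R :=
  singular (distr leb2 (Rplus `*` Rplus) f).

Record symmetric_quasi_banach (E : qspace R (R -> R)) : Prop := {
  sqb_sub : carrier E `<=` S1 ;
  sqb_0 : carrier E (fun=> 0) ;
  sqb_D : forall f g, carrier E f -> carrier E g -> carrier E (f \+ g) ;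
  sqb_Z : forall c f, carrier E f -> carrier E (fun u => c * f u) ;
  sqb_ge0 : forall f, carrier E f -> 0 <= qn E f ;
  sqb_normZ : forall c f, carrier E f ->
    qn E (fun u => c * f u) = `|c| * qn E f ;
  sqb_definite : forall f, carrier E f -> qn E f = 0 ->
    {ae (@lebesgue_measure R), forall u, Rplus u -> f u = 0} ;
  sqb_quasi : exists K, forall f g, carrier E f -> carrier E g ->
    qn E (f \+ g) <= K * (qn E f + qn E g) ;
  sqb_complete : forall u : nat -> R -> R, (forall n, carrier E (u n)) ->
    (forall e : R, 0 < e -> exists n0, forall m n, (n0 <= m)%N -> (n0 <= n)%N ->
      qn E (u m \- u n) < e) ->
    exists2 f, carrier E f & qn E (u n \- f) @[n --> \oo] --> 0 ;
  sqb_symmetric : forall f g, S1 f -> carrier E g ->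
    (forall t, 0 < t -> mu1 f t <= mu1 g t) ->
    carrier E f /\ qn E f <= qn E g }.

Definition s_convex (s : R) (E : qspace R (R -> R)) : Prop :=
  exists C : R, forall n (f : 'I_n -> R -> R), (forall i, carrier E (f i)) ->
    qn E (fun u => (\sum_(i < n) `|f i u| `^ s) `^ s^-1)
      <= C * (\sum_(i < n) qn E (f i) `^ s) `^ s^-1.

Definition Espace2 (E : qspace R (R -> R)) : qspace R (R * R -> R) :=
  QSpace [set f | S2 f /\ carrier E (mu2 f)] (fun f => qn E (mu2 f)).

Definition dilation (a : R) (f : R -> R) : R -> R := fun u => f (a * u).

Definition boyd_quotient (E : qspace R (R -> R)) (u : R) : \bar R :=
  let l := lne (opnorm E E (dilation u^-1)) in
  (if l == 0 then +oo else (ln u)%:E / l)%E.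

Definition boyd_p (E : qspace R (R -> R)) : \bar R :=
  lim (boyd_quotient E u @[u --> +oo%R]).
Definition boyd_q (E : qspace R (R -> R)) : \bar R :=
  lim (boyd_quotient E u @[u --> 0^'+]).

(* 1 / r for r in ]0, +oo], with 1 / +oo = 0 *)
Definition recip (r : \bar R) : R := fine (r^-1)%E.

Definition Theta (p q : \bar R) (f : R -> R) : R * R -> R := fun z =>
  f z.1 * (z.2 `^ (- recip q) * \1_(`]0, 1[ : set R) z.2
           + z.2 `^ (- recip p) * \1_(`[1, +oo[ : set R) z.2).

Definition Theta_norm (p q : \bar R) (E : qspace R (R -> R)) : \bar R :=
  opnorm E (Espace2 E) (Theta p q).

Definition Lr_norm (r : \bar R) (f : R -> R) : \bar R :=
  Lnorm (@lebesgue_measure R) r (EFin \o (f \_ Rplus)).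

Definition Lr (r : \bar R) : qspace R (R -> R) :=
  QSpace [set f | S1 f /\ (Lr_norm r f < +oo)%E] (fun f => fine (Lr_norm r f)).

End Commutative.

(** * Hilbert spaces, bounded operators, von Neumann algebras, traces *)

Definition dot_norm (R : realType) (H : lmodType R[i])
    (dot : {dot H for @Num.conj R[i]}) (xi : H) : R :=
  Num.sqrt (complex.Re (dot xi xi)).

(* The form is linear in its first argument, conjugate-linear in its second. *)
Record hilbert (R : realType) := Hilbert {
  hsort :> lmodType R[i] ;
  hdot : {dot hsort for @Num.conj R[i]} ;
  hcomplete : forall u : nat -> hsort,
    (forall e : R, 0 < e -> exists n0, forall m n, (n0 <= m)%N -> (n0 <= n)%N ->
      dot_norm hdot (u m - u n) < e) ->
    exists l, dot_norm hdot (u n - l) @[n --> \oo] --> (0 : R) }.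

Section Bounded.
Context {R : realType} {H : hilbert R}.
Implicit Types (a b u : H -> H) (S M : set (H -> H)).

Definition hnorm (xi : H) : R := dot_norm (hdot H) xi.

Definition bounded_linear a : Prop :=
  linear a /\ exists C, forall xi, hnorm (a xi) <= C * hnorm xi.

Definition is_adjoint a b : Prop :=
  forall xi eta, hdot H (a xi) eta = hdot H xi (b eta).

Definition commutant S : set (H -> H) :=
  [set b | bounded_linear b /\ forall a, S a -> a \o b = b \o a].

Definition von_neumann M : Prop :=
  (forall a, M a -> exists2 b, M b & is_adjoint a b) /\
  commutant (commutant M) = M.

Definition pos a : Prop := forall xi, 0 <= hdot H (a xi) xi.
Definition ble a b : Prop := pos (fun xi => b xi - a xi).
Definition pos_part M : set (H -> H) := M `&` pos.

(* Least upper bound of D among the positive elements of M. *)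
Definition is_lub M (D : set (H -> H)) a : Prop :=
  [/\ pos_part M a, forall b, D b -> ble b a &
      forall c, pos_part M c -> (forall b, D b -> ble b c) -> ble a c].

(* Only the values of tau on the positive part of M are relevant. *)
Record nsf_trace M (tau : (H -> H) -> \bar R) : Prop := {
  tr_ge0 : forall a, pos_part M a -> (0 <= tau a)%E ;
  tr_D : forall a b, pos_part M a -> pos_part M b ->
    tau (fun xi => a xi + b xi) = (tau a + tau b)%E ;
  tr_Z : forall (c : R) a, 0 <= c -> pos_part M a ->
    tau (fun xi => c%:C%C *: a xi) = (c%:E * tau a)%E ;
  tr_tracial : forall a b, M a -> M b -> is_adjoint a b ->
    tau (b \o a) = tau (a \o b) ;
  tr_normal : forall (D : set (H -> H)) a, D !=set0 -> D `<=` pos_part M ->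
    (forall b c, D b -> D c -> exists2 d, D d & ble b d /\ ble c d) ->
    is_lub M D a -> tau a = ereal_sup [set tau b | b in D] ;
  tr_semifinite : forall a, pos_part M a -> a <> (fun=> 0) ->
    exists b, [/\ pos_part M b, b <> (fun=> 0), ble b a & (tau b < +oo)%E] ;
  tr_faithful : forall a, pos_part M a -> tau a = 0%E -> a = (fun=> 0) }.

End Bounded.

Record traced_vna (R : realType) := TracedVNA {
  vspace_of : hilbert R ;
  valg : set (vspace_of -> vspace_of) ;
  vtrace : (vspace_of -> vspace_of) -> \bar R ;
  valgP : von_neumann valg ;
  vtraceP : nsf_trace valg vtrace }.
Arguments vspace_of {R} _.
Arguments valg {R} _ _.
Arguments vtrace {R} _ _.

(** * Unbounded operators, represented by their graphs *)

(* (xi, omega) in x means: xi is in the domain of x and x xi = omega. *)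
Definition graph (R : realType) (H : hilbert R) : Type := set (H * H).

Section Unbounded.
Context {R : realType} {H : hilbert R}.
Implicit Types (x y : graph H) (e : set R -> H -> H).

Definition graph_closure x : graph H :=
  [set z | forall eps, 0 < eps -> exists2 w, x w &
    hnorm (z.1 - w.1) < eps /\ hnorm (z.2 - w.2) < eps].

Record closed_dd x : Prop := {
  cdd_0 : x (0, 0) ;
  cdd_lin : forall c z w, x z -> x w -> x (c *: z.1 + w.1, c *: z.2 + w.2) ;
  cdd_fun : forall omega, x (0, omega) -> omega = 0 ;
  cdd_closed : graph_closure x `<=` x ;
  cdd_dense : forall xi eps, 0 < eps ->
    exists2 z, x z & hnorm (xi - z.1) < eps }.

Definition graph_adjoint x : graph H :=
  [set z | forall w, x w -> hdot H w.2 z.1 = hdot H w.1 z.2].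

Definition graph_comp x y : graph H :=
  [set z | exists2 eta, y (z.1, eta) & x (eta, z.2)].

Definition positive_sa x : Prop :=
  [/\ closed_dd x, graph_adjoint x = x & forall z, x z -> 0 <= hdot H z.2 z.1].

(* |x| is the positive self-adjoint operator whose square is x^* x. *)
Definition modulus x : graph H :=
  xget set0 [set y | positive_sa y /\
                     graph_comp y y = graph_comp (graph_adjoint x) x].

Definition projection (a : H -> H) : Prop :=
  [/\ bounded_linear a, is_adjoint a a & a \o a = a].

Definition scalar_measure e (xi : H)
    (m : {measure set (measurableTypeR R) -> \bar R}) : Prop :=
  forall A : set (measurableTypeR R), measurable A ->
    m A = (complex.Re (hdot H (e A xi) xi))%:E.

(* Projection-valued Borel measure on R. *)
Record resolution e : Prop := {
  res_proj : forall A : set (measurableTypeR R), measurable A ->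
    projection (e A) ;
  res_T : e setT = id ;
  res_I : forall A B : set (measurableTypeR R), measurable A -> measurable B ->
    e (A `&` B) = e A \o e B ;
  res_meas : forall xi, exists m, scalar_measure e xi m }.

(* y is the integral of lambda with respect to de(lambda): the domain of y is
   {xi : lambda in L^2(<e xi, xi>)}, and on it <y xi, xi> is the integral of
   lambda with respect to <e xi, xi>. *)
Definition is_spectral_measure y e : Prop :=
  resolution e /\
  forall xi (m : {measure set (measurableTypeR R) -> \bar R}),
    scalar_measure e xi m ->
    ((exists omega, y (xi, omega)) <->
       (\int[m]_(l in setT) (l ^+ 2)%:E < +oo)%E) /\
    (forall omega, y (xi, omega) ->
       hdot H omega xi = (\int[m]_(l in setT) l)%:C%C).

Definition spectral_measure y : set R -> H -> H :=
  xget (fun _ _ => 0) [set e | is_spectral_measure y e].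

(* Strong operations: closures of the algebraic ones. *)
Definition sadd x y : graph H :=
  graph_closure [set z | exists o1 o2,
    [/\ x (z.1, o1), y (z.1, o2) & z.2 = o1 + o2]].
Definition sscale (c : R) x : graph H :=
  graph_closure [set z | exists2 o, x (z.1, o) & z.2 = c%:C%C *: o].
Definition szero : graph H := [set z | z.2 = 0].
Definition ssub x y : graph H := sadd x (sscale (-1) y).

Fixpoint spartial (x : nat -> graph H) (n : nat) : graph H :=
  if n is m.+1 then sadd (spartial x m) (x m) else szero.

Definition series_cvg (nu : graph H -> \bar R) (x : nat -> graph H)
    (X : graph H) : Prop :=
  nu (ssub (spartial x n) X) @[n --> \oo] --> 0%E.

End Unbounded.

(** * Measurable operators and noncommutative function spaces *)

Section Measurable.
Context {R : realType} (M : traced_vna R).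
Let H := vspace_of M.
Implicit Types (x y : graph H).

Definition affiliated x : Prop :=
  forall u v : H -> H, commutant (valg M) u -> is_adjoint u v ->
    u \o v = id -> v \o u = id ->
    forall z, x z -> x (u z.1, u z.2).

Definition ddist x (v : R) : \bar R :=
  vtrace M (spectral_measure (modulus x) `]v, +oo[).

Definition Stau : set (graph H) :=
  [set x | [/\ closed_dd x, affiliated x &
               exists v, 0 < v /\ (ddist x v < +oo)%E]].

Definition Stau_pos : set (graph H) := [set x | Stau x /\ positive_sa x].

Definition sle x y : Prop := Stau_pos (ssub y x).

Definition mu x : R -> R := singular (ddist x).

Definition NC (E : qspace R (R -> R)) : qspace R (graph H) :=
  QSpace [set x | Stau x /\ carrier E (mu x)] (fun x => qn E (mu x)).

Definition NC_pos (E : qspace R (R -> R)) : set (graph H) :=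
  carrier (NC E) `&` Stau_pos.

Definition weakLr (r : \bar R) x : \bar R :=
  if r == +oo%E then enorm (NC (Lr +oo%E)) x
  else if `[< Stau x >] then
    ereal_sup [set (t `^ recip r * mu x t)%:E | t in [set t : R | 0 < t]]
  else +oo%E.

(* L^p(M)_+ + L^q(M)_+ *)
Definition Lsum_pos (p q : \bar R) : set (graph H) :=
  [set x | exists y z, [/\ NC_pos (Lr p) y, NC_pos (Lr q) z & x = sadd y z]].

End Measurable.
Arguments NC_pos {R} M E _.
Arguments Lsum_pos {R} M p q _.
Arguments weakLr {R} M r x.
Arguments NC {R} M E.

Section Maps.
Context {R : realType} (M N : traced_vna R).
Implicit Types (T : graph (vspace_of M) -> graph (vspace_of N)).
Implicit Types (D : set (graph (vspace_of M))).

Definition midpoint_convex D T : Prop :=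
  forall x y, D x -> D y ->
    sle (T (sadd (sscale 2^-1 x) (sscale 2^-1 y)))
        (sadd (sscale 2^-1 (T x)) (sscale 2^-1 (T y))).

(* Positivity of a possibly nonlinear map on a set of positive operators:
   besides taking positive values, it preserves the order (for additive maps
   the second condition is a consequence of the first). *)
Definition positive_map D T : Prop :=
  (forall x, D x -> Stau_pos (T x)) /\
  (forall x y, D x -> D y -> sle x y -> sle (T x) (T y)).

(* ||sum T_k(x_k)||_{L^{r,oo}(N)} <= C ||sum x_k||_{L^r(M)}, for every sequence
   in L^r(M)_+ whose sum converges in norm. *)
Definition weak_type (T : nat -> graph (vspace_of M) -> graph (vspace_of N))
    (r : \bar R) (C : R) : Prop :=
  forall (x : nat -> graph (vspace_of M)) X,
    (forall k, NC_pos M (Lr r) (x k)) ->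
    carrier (NC M (Lr r)) X -> series_cvg (enorm (NC M (Lr r))) x X ->
    exists Y, [/\ Stau Y,
      series_cvg (weakLr N r) (fun k => T k (x k)) Y &
      (weakLr N r Y <= C%:E * enorm (NC M (Lr r)) X)%E].

End Maps.

(* Main.v *)
(* For positive x_k with partial sum W and a level w, let P be the spectral
   projection of W for [0, w] and P' = 1 - P. Then x_k <= 2 P x_k P + 2 P' x_k P',
   so by monotonicity and midpoint convexity T_k(x_k) lies below the average of
   T_k(4 P x_k P) and T_k(4 P' x_k P'). The sums over k of the arguments are 4 P W P
   in L^q and 4 P' W P' in L^p, and the weak-type hypotheses with
   w = v / (4 C), C = max(C_p, C_q), give
     d(v; sum T_k(x_k)) <= d(v; Theta_{p,q}(4 C mu(W))).
   Applied to tails this makes the image series Cauchy in measure, and the estimate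
   passes to its limit.

   Distribution functions are handled geometrically: d(v; x) is the tau-dimension
   of the orthogonal complement of the subspace of u with |(x^* x)^n u| = O(v^(2n)),
   and inequalities between quadratic forms become comparisons of dimensions of
   M-invariant subspaces.

   Theta_{p,q} f is dominated by countably many dilations of mu(f), indexed by the
   intervals [b^k, b^(k+1)[ of the second variable. By the index conditions a large
   base b makes their norms decay faster than the powers of the constant in the
   quasi-triangle inequality grow, so the dominating series converges in E. *)

Require Import Defs.
From HB Require Import structures.
From mathcomp Require Import all_boot all_order all_algebra.
From mathcomp Require Import sesquilinear complex.
From mathcomp Require Import all_classical all_reals all_analysis.
From mathcomp Require Import measurable_realfun ess_sup_inf ring lra.
Set Implicit Arguments.
Unset Strict Implicit.
Unset Printing Implicit Defensive.
Import Order.TTheory GRing.Theory Num.Theory.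
Import numFieldNormedType.Exports.
Local Open Scope classical_set_scope.
Local Open Scope ring_scope.

(** * Hilbert spaces *)

(** The constant 4 is a product of two factors 2: comparing [x] with its two compressions loses one,
    and writing the bound as a midpoint, as convexity requires, costs the other. The level [w] is
    chosen so that [4 w C = v]; then both weak-type constants are absorbed. What remains, with
    [f = 4 C mu(W)], are the integrals of [(f/v)^p] over [{f > v}] and of [(f/v)^q] over [{f <= v}]
    (nothing if [q] is infinite). Their sum bounds the measure of [{Theta f > v}] from below,
    section by section: this is where [Theta_{p,q}] enters. The modulus and its spectral measure are
    chosen from a specification, so their existence has to be proved; the description by growth of
    powers depends on [x^* x] alone and is valid for whatever was chosen. Inequalities between
    unbounded operators are used only as inequalities of forms at vectors common to countably many
    domains. Such vectors contain M-invariant subspaces of arbitrarily small codimension, and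
    comparison of dimensions turns the form inequality into one between distribution functions.
    Limits cost an arbitrarily small shift of the level, which singular values do not see. *)

Lemma quad_disc (R : realType) (a b c : R) : 0 <= a -> 0 <= c ->
  (forall t, 0 <= a + 2 * t * b + t ^+ 2 * c) -> b ^+ 2 <= a * c.
Proof.
move=> a0 c0 h; have [c_eq0|cn0] := eqVneq c 0.
  have [->|bn0] := eqVneq b 0; first by rewrite expr0n /= mulr_ge0.
  (* This value of [t] makes the affine expression equal to [-1]. *)
  have := h (- (a + 1) / (2 * b)); rewrite c_eq0 mulr0 addr0.
  have -> : 2 * (- (a + 1) / (2 * b)) * b = - (a + 1) by field.
  lra.
have cp : 0 < c by rewrite lt_def cn0.
have := h (- b / c).
have -> : a + 2 * (- b / c) * b + (- b / c) ^+ 2 * c = (a * c - b ^+ 2) / c.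
  by field.
by rewrite pmulr_lge0 ?invr_gt0// subr_ge0.
Qed.

Lemma squeeze0 (R : realType) (a b : nat -> R) :
  (forall n, 0 <= a n <= b n) -> b @ \oo --> (0 : R) -> a @ \oo --> (0 : R).
Proof.
move=> ab b0; apply: (squeeze_cvgr _ (cvg_cst 0) b0).
by apply: nearW.
Qed.

Lemma cvgr0P (R : realType) (a : nat -> R) :
  a @ \oo --> (0 : R) <->
  (forall e : R, 0 < e -> exists N, forall n, (N <= n)%N -> `|a n| < e).
Proof.
split.
  move=> /cvgr0Pnorm_lt h e e0; have [N _ hN] := h _ e0.
  by exists N => n /hN.
move=> h; apply/cvgr0Pnorm_lt => e /h[N hN].
by exists N => // n /= /hN.
Qed.

Lemma cvg_inv_nat (R : realType) : (fun n : nat => n.+1%:R^-1 : R) @ \oo --> (0 : R).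
Proof. exact: cvg_harmonic. Qed.

Section HilbertBasics.
Context {R : realType} {H : hilbert R}.
Local Notation C := R[i].
Implicit Types (u v w : H) (c : C) (r : R).

Definition ip u v : C := hdot H u v.
Definition rip u v : R := complex.Re (ip u v).

Lemma ReDc (x y : C) : complex.Re (x + y) = complex.Re x + complex.Re y.
Proof. by case: x => ? ?; case: y. Qed.
Lemma ReNc (x : C) : complex.Re (- x) = - complex.Re x.
Proof. by case: x. Qed.
Lemma ReMr r (x : C) : complex.Re (r%:C%C * x) = r * complex.Re x.
Proof. by case: x => a b /=; rewrite mul0r subr0. Qed.

Lemma ipDl u v w : ip (u + v) w = ip u w + ip v w.
Proof. by rewrite /ip linearDl. Qed.
Lemma ipDr u v w : ip w (u + v) = ip w u + ip w v.
Proof. by rewrite /ip linearDr. Qed.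
Lemma ipNl u v : ip (- u) v = - ip u v.
Proof. by rewrite /ip linearNl. Qed.
Lemma ipNr u v : ip u (- v) = - ip u v.
Proof. by rewrite /ip linearNr. Qed.
Lemma ipBl u v w : ip (u - v) w = ip u w - ip v w.
Proof. by rewrite ipDl ipNl. Qed.
Lemma ipBr u v w : ip w (u - v) = ip w u - ip w v.
Proof. by rewrite ipDr ipNr. Qed.
Lemma ip0l u : ip 0 u = 0.
Proof. by rewrite -(subrr u) ipBl subrr. Qed.
Lemma ip0r u : ip u 0 = 0.
Proof. by rewrite -(subrr u) ipBr subrr. Qed.
Lemma ipZl c u v : ip (c *: u) v = c * ip u v.
Proof. by rewrite /ip linearZl_LR. Qed.
Lemma ipZr c u v : ip u (c *: v) = Num.conj c * ip u v.
Proof. by rewrite /ip linearZr_LR. Qed.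
Lemma ipC u v : ip u v = Num.conj (ip v u).
Proof. by rewrite /ip (hermC (hdot H)) expr0 mul1r. Qed.
Lemma ip_ge0 u : 0 <= ip u u.
Proof.
have [->|/(@neq0_dnorm_gt0 _ _ _ (hdot H))/ltW//] := eqVneq u 0.
by rewrite ip0l.
Qed.
Lemma ip_eq0 u : ip u u = 0 -> u = 0.
Proof.
have [//|/(@neq0_dnorm_gt0 _ _ _ (hdot H))] := eqVneq u 0.
by rewrite -/(ip u u) => /[swap] ->; rewrite ltxx.
Qed.

Lemma ReJ (x : C) : complex.Re (Num.conj x) = complex.Re x.
Proof. by case: x. Qed.
Lemma ImJ (x : C) : complex.Im (Num.conj x) = - complex.Im x.
Proof. by case: x. Qed.

Lemma ripDl u v w : rip (u + v) w = rip u w + rip v w.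
Proof. by rewrite /rip ipDl ReDc. Qed.
Lemma ripDr u v w : rip w (u + v) = rip w u + rip w v.
Proof. by rewrite /rip ipDr ReDc. Qed.
Lemma ripNl u v : rip (- u) v = - rip u v.
Proof. by rewrite /rip ipNl ReNc. Qed.
Lemma ripNr u v : rip u (- v) = - rip u v.
Proof. by rewrite /rip ipNr ReNc. Qed.
Lemma ripBl u v w : rip (u - v) w = rip u w - rip v w.
Proof. by rewrite ripDl ripNl. Qed.
Lemma ripBr u v w : rip w (u - v) = rip w u - rip w v.
Proof. by rewrite ripDr ripNr. Qed.
Lemma rip0l u : rip 0 u = 0.
Proof. by rewrite /rip ip0l. Qed.
Lemma rip0r u : rip u 0 = 0.
Proof. by rewrite /rip ip0r. Qed.
Lemma ripC u v : rip u v = rip v u.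
Proof. by rewrite /rip ipC ReJ. Qed.
Lemma ripZl r u v : rip (r%:C%C *: u) v = r * rip u v.
Proof. by rewrite /rip ipZl ReMr. Qed.
Lemma ripZr r u v : rip u (r%:C%C *: v) = r * rip u v.
Proof. by rewrite ripC ripZl ripC. Qed.

Lemma rip_ge0 u : 0 <= rip u u.
Proof. by have := ip_ge0 u; rewrite lecE => /andP[_]. Qed.
Lemma ip_self u : ip u u = (rip u u)%:C%C.
Proof.
apply/eqP; rewrite eq_complex /= eqxx /=.
by have := ip_ge0 u; rewrite lecE => /andP[].
Qed.
(** The form is conjugate-linear in its second argument, so replacing [v] by [i v] turns the
    imaginary part into a real part. Hence [rip] determines [ip], and most computations can stay in
    the reals. *)
Lemma Im_ip u v : complex.Im (ip u v) = rip u ('i%C *: v).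
Proof.
rewrite /rip ipZr; case: (ip u v) => a b /=.
by rewrite mul0r mulN1r opprK add0r.
Qed.
Lemma ipE u v : ip u v = (rip u v +i* rip u ('i%C *: v))%C.
Proof. by rewrite -Im_ip /rip; case: (ip u v). Qed.

Lemma ip_eq0P u v : (forall c, rip u (c *: v) = 0) -> ip u v = 0.
Proof. by move=> h; rewrite ipE h -(scale1r v) h. Qed.

Lemma hnorm2 u : hnorm u ^+ 2 = rip u u.
Proof. by rewrite /hnorm /dot_norm sqr_sqrtr// rip_ge0. Qed.
Lemma hnorm_ge0 u : 0 <= hnorm u.
Proof. exact: sqrtr_ge0. Qed.
Hint Resolve hnorm_ge0 : core.
Lemma hnorm_eq0 u : hnorm u = 0 -> u = 0.
Proof.
move=> h; apply: ip_eq0; rewrite ip_self -hnorm2 h.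
by rewrite expr0n.
Qed.
Lemma hnorm0 : hnorm (0 : H) = 0.
Proof. by rewrite /hnorm /dot_norm -/(ip 0 0) ip0l sqrtr0. Qed.
Lemma hnorm_gt0 u : u <> 0 -> 0 < hnorm u.
Proof.
by move=> h; rewrite lt_def hnorm_ge0 andbT; apply/eqP => /hnorm_eq0.
Qed.
Lemma hnormN u : hnorm (- u) = hnorm u.
Proof. by rewrite /hnorm /dot_norm -!/(ip _ _) ipNl ipNr opprK. Qed.
Lemma hnormBC u v : hnorm (u - v) = hnorm (v - u).
Proof. by rewrite -hnormN opprB. Qed.

Lemma ip_sqrD u v : rip (u + v) (u + v) = rip u u + 2 * rip u v + rip v v.
Proof. by rewrite !ripDl !ripDr (ripC v u); ring. Qed.
Lemma ip_sqrB u v : rip (u - v) (u - v) = rip u u - 2 * rip u v + rip v v.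
Proof. by rewrite !ripBl !ripBr (ripC v u); ring. Qed.

Lemma rip_sq_le u v : rip u v ^+ 2 <= rip u u * rip v v.
Proof.
apply: quad_disc; rewrite ?rip_ge0// => t.
have := rip_ge0 (u + t%:C%C *: v).
by rewrite ip_sqrD !ripZr !ripZl; congr (_ <= _); ring.
Qed.
Lemma rip_le u v : rip u v <= hnorm u * hnorm v.
Proof.
apply: (le_trans (ler_norm _)).
rewrite -(@ler_pXn2r _ 2)// ?nnegrE ?mulr_ge0//.
by rewrite -normrX ger0_norm ?sqr_ge0// exprMn !hnorm2 rip_sq_le.
Qed.
Lemma rip_abs_le u v : `|rip u v| <= hnorm u * hnorm v.
Proof.
by rewrite ler_norml rip_le andbT lerNl -ripNl (le_trans (rip_le _ _))// hnormN.
Qed.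
Lemma hnormD u v : hnorm (u + v) <= hnorm u + hnorm v.
Proof.
rewrite -(@ler_pXn2r _ 2)// ?nnegrE ?addr_ge0//.
rewrite sqrrD !hnorm2 ip_sqrD lerD2r lerD2l -mulr_natl.
by have := rip_le u v; lra.
Qed.
Lemma hnormB u v : hnorm (u - v) <= hnorm u + hnorm v.
Proof. by rewrite (le_trans (hnormD _ _))// hnormN. Qed.
Lemma hnormDB u v w : hnorm (u - w) <= hnorm (u - v) + hnorm (v - w).
Proof. by rewrite (le_trans _ (hnormD _ _))// addrA subrK. Qed.
Lemma hnormBr u v : hnorm u - hnorm v <= hnorm (u - v).
Proof. by rewrite lerBlDr (le_trans _ (hnormD _ _))// subrK. Qed.
Lemma parallelogram u v :
  hnorm (u + v) ^+ 2 + hnorm (u - v) ^+ 2 = 2 * (hnorm u ^+ 2 + hnorm v ^+ 2).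
Proof. by rewrite !hnorm2 ip_sqrD ip_sqrB; ring. Qed.

Lemma hnormZr r u : hnorm (r%:C%C *: u) = `|r| * hnorm u.
Proof.
apply/eqP; rewrite -(@eqrXn2 _ 2)// ?mulr_ge0//.
by rewrite exprMn !hnorm2 ripZl ripZr mulrA -expr2 -normrX ger0_norm ?sqr_ge0.
Qed.
Lemma rip_ZZ c u v :
  rip (c *: u) (c *: v) = (complex.Re c ^+ 2 + complex.Im c ^+ 2) * rip u v.
Proof.
rewrite /rip ipZl ipZr; case: c => a b; case: (ip u v) => x y /=; ring.
Qed.
Definition cnorm c : R := Num.sqrt (complex.Re c ^+ 2 + complex.Im c ^+ 2).
Lemma hnormZ c u : hnorm (c *: u) = cnorm c * hnorm u.
Proof.
apply/eqP; rewrite -(@eqrXn2 _ 2)// ?mulr_ge0// ?sqrtr_ge0//.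
by rewrite exprMn !hnorm2 rip_ZZ sqr_sqrtr// addr_ge0// sqr_ge0.
Qed.
Lemma cnorm_ge0 c : 0 <= cnorm c.
Proof. exact: sqrtr_ge0. Qed.

Lemma ip_extl u v : (forall w, rip u w = rip v w) -> u = v.
Proof.
move=> h; apply/eqP; rewrite -subr_eq0; apply/eqP/hnorm_eq0/eqP.
by rewrite -sqrf_eq0 hnorm2 ripBl h subrr.
Qed.

Lemma eq_ip u v : (forall w, ip u w = ip v w) -> u = v.
Proof. by move=> h; apply: ip_extl => w; rewrite /rip h. Qed.
Lemma eq_ipr u v : (forall w, ip w u = ip w v) -> u = v.
Proof. by move=> h; apply: eq_ip => w; rewrite ipC h -ipC. Qed.
(** Vector identities are proved by pairing with an arbitrary vector, which reduces them to scalar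
    identities for [ring]. *)
Ltac vec := apply: eq_ip => ?; rewrite ?(ipDl, ipNl, ipZl, ip0l); ring.
Definition hcvg (u : nat -> H) (l : H) : Prop :=
  (fun n => hnorm (u n - l)) @ \oo --> (0 : R).

Lemma hcvgP (s : nat -> H) l : hcvg s l <->
  (forall e : R, 0 < e -> exists N, forall n, (N <= n)%N -> hnorm (s n - l) < e).
Proof.
split => [/cvgr0P h e /h[N hN]|h].
  by exists N => n /hN; rewrite ger0_norm.
by apply/cvgr0P => e /h[N hN]; exists N => n /hN; rewrite ger0_norm.
Qed.

Lemma hcauchy_cvg (s : nat -> H) :
  (forall e : R, 0 < e -> exists N, forall m n, (N <= m)%N -> (N <= n)%N ->
     hnorm (s m - s n) < e) -> exists l, hcvg s l.
Proof. by move=> /hcomplete. Qed.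

Lemma hcvg_cst l : hcvg (fun=> l) l.
Proof. by apply/hcvgP => e e0; exists 0%N => n _; rewrite subrr hnorm0. Qed.

Lemma hcvg_le (s : nat -> H) l (b : nat -> R) :
  (forall n, hnorm (s n - l) <= b n) -> b @ \oo --> (0 : R) -> hcvg s l.
Proof. by move=> h; apply: squeeze0 => n; rewrite hnorm_ge0 h. Qed.

Lemma hcvg_uniq (s : nat -> H) l m : hcvg s l -> hcvg s m -> l = m.
Proof.
move=> /hcvgP hl /hcvgP hm; apply/eqP; rewrite -subr_eq0; apply/eqP/hnorm_eq0.
apply/eqP; rewrite eq_le hnorm_ge0 andbT leNgt; apply/negP => h.
have h' : 0 < hnorm (l - m) / 2 by rewrite divr_gt0.
have [N1 h1] := hl _ h'; have [N2 h2] := hm _ h'.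
have := h1 (maxn N1 N2) (leq_maxl _ _).
have := h2 (maxn N1 N2) (leq_maxr _ _).
have := hnormDB l (s (maxn N1 N2)) m.
rewrite (hnormBC l (s _)); lra.
Qed.

Lemma hcvgD (s t : nat -> H) l m : hcvg s l -> hcvg t m ->
  hcvg (fun n => s n + t n) (l + m).
Proof.
move=> hs ht; apply: (@hcvg_le _ _ (fun n => hnorm (s n - l) + hnorm (t n - m))).
  by move=> n; rewrite opprD addrACA hnormD.
by rewrite -(addr0 0); apply: cvgD.
Qed.
Lemma hcvgZ (s : nat -> H) l c : hcvg s l -> hcvg (fun n => c *: s n) (c *: l).
Proof.
move=> hs; apply: (@hcvg_le _ _ (fun n => cnorm c * hnorm (s n - l))).
  by move=> n; rewrite -scalerBr hnormZ.
by rewrite -(mulr0 (cnorm c)); apply: cvgM => //; apply: cvg_cst.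
Qed.
Lemma hcvgN (s : nat -> H) l : hcvg s l -> hcvg (fun n => - s n) (- l).
Proof.
by move=> hs; rewrite /hcvg; under eq_fun do rewrite -opprD hnormN.
Qed.
Lemma hcvgB (s t : nat -> H) l m : hcvg s l -> hcvg t m ->
  hcvg (fun n => s n - t n) (l - m).
Proof. by move=> hs /hcvgN; apply: hcvgD. Qed.

Lemma hcvg_rip (s : nat -> H) l w : hcvg s l ->
  (fun n => rip (s n) w) @ \oo --> rip l w.
Proof.
move=> hs; apply/cvgrPdist_lt => e e0.
have : (fun n => hnorm (s n - l) * hnorm w) @ \oo --> (0 : R).
  by rewrite -(mul0r (hnorm w)); apply: cvgM => //; apply: cvg_cst.
move=> /cvgr0P/(_ e e0)[N hN]; exists N => // n /= /hN.
rewrite ger0_norm ?mulr_ge0//; apply: le_lt_trans.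
by rewrite -ripBl hnormBC rip_abs_le.
Qed.

Lemma hcvg_hnorm (s : nat -> H) l : hcvg s l ->
  (fun n => hnorm (s n)) @ \oo --> hnorm l.
Proof.
move=> /hcvgP hs; apply/cvgrPdist_lt => e /hs[N hN]; exists N => // n /= /hN.
apply: le_lt_trans; rewrite ler_norml (hnormBC (s n)) hnormBr andbT.
by rewrite lerNl opprB (hnormBC l) hnormBr.
Qed.

Lemma hcvg_shift (s : nat -> H) l k : hcvg s l -> hcvg (fun n => s (n + k)%N) l.
Proof.
move=> /hcvgP h; apply/hcvgP => e /h[N hN]; exists N => n Nn.
by apply: hN; rewrite (leq_trans Nn)// leq_addr.
Qed.

Lemma ip_cvg_const (s : nat -> H) l w c : hcvg s l ->
  (forall n, ip (s n) w = c) -> ip l w = c.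
Proof.
move=> hs h; rewrite ipE.
have e x (d : R) : (forall n, rip (s n) x = d) -> rip l x = d.
  move=> hd; have := @hcvg_rip _ _ x hs; under eq_fun do rewrite hd.
  by move=> /(cvg_unique (@Rhausdorff R)); apply; exact: cvg_cst.
rewrite (e w (complex.Re c)); last by move=> n; rewrite /rip h.
rewrite (e _ (complex.Im c)); last by move=> n; rewrite -Im_ip h.
by case: c {h}.
Qed.

Record csub (K : set H) : Prop := {
  cs0 : K 0 ;
  csL : forall c u v, K u -> K v -> K (c *: u + v) ;
  csC : forall s l, (forall n, K (s n)) -> hcvg s l -> K l }.

Section Csub.
Context {K : set H} (hK : csub K).
Lemma csD u v : K u -> K v -> K (u + v).
Proof. by move=> hu hv; rewrite -(scale1r u); apply: csL. Qed.
Lemma csZ c u : K u -> K (c *: u).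
Proof. by move=> hu; rewrite -(addr0 (c *: u)); apply: csL => //; apply: cs0. Qed.
Lemma csN u : K u -> K (- u).
Proof. by move=> hu; rewrite -scaleN1r; apply: csZ. Qed.
Lemma csB u v : K u -> K v -> K (u - v).
Proof. by move=> hu hv; apply: csD => //; apply: csN. Qed.

(** A minimizing sequence is Cauchy: the parallelogram law for [u - s m] and [u - s n] involves the
    distance from [u] to the midpoint of [s m] and [s n], which lies in [K]. *)
Lemma csub_dist_min u : exists2 p, K p &
  forall k, K k -> hnorm (u - p) <= hnorm (u - k).
Proof.
pose D := [set hnorm (u - k) | k in K].
have D0 : has_inf D.
  split; first by exists (hnorm (u - 0)), 0 => //; exact: cs0.
  by exists 0 => _ [k _ <-].
have dle k : K k -> inf D <= hnorm (u - k).
  by move=> kK; apply: ge_inf; [case: D0 | exists k].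
have d0 : 0 <= inf D by apply: lb_le_inf; [case: D0 | move=> _ [k _ <-]].
have aux n : exists k, K k /\ hnorm (u - k) < inf D + n.+1%:R^-1.
  have [_ [k kK <-] hk] := inf_adherent (ltac:(by rewrite invr_gt0) : 0 < n.+1%:R^-1 :> R) D0.
  by exists k.
have [s hs] := choice aux.
have sK n : K (s n) by case: (hs n).
have sle n : hnorm (u - s n) <= inf D + n.+1%:R^-1 by apply/ltW; case: (hs n).
have cau m n : hnorm (s m - s n) ^+ 2 <=
   2 * ((inf D + m.+1%:R^-1) ^+ 2 + (inf D + n.+1%:R^-1) ^+ 2) - 4 * inf D ^+ 2.
  have := parallelogram (u - s m) (u - s n).
  have -> : u - s m - (u - s n) = s n - s m by vec.
  have -> : u - s m + (u - s n) = (2 : R)%:C%C *: (u - (2^-1 : R)%:C%C *: (s m + s n)).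
    rewrite scalerBr scalerA -rmorphM /= divff ?pnatr_eq0// scale1r rmorph_nat.
    by rewrite scaler_nat mulr2n opprD addrACA.
  rewrite hnormZr ger0_norm// (hnormBC (s n)) exprMn.
  have := dle _ (csZ (2^-1 : R)%:C%C (csD (sK m) (sK n))).
  set y := hnorm (u - (2^-1 : R)%:C%C *: _) => hy.
  have : inf D ^+ 2 <= y ^+ 2 by rewrite ler_pXn2r// nnegrE ?hnorm_ge0.
  have h1 k : hnorm (u - s k) ^+ 2 <= (inf D + k.+1%:R^-1) ^+ 2.
    by rewrite ler_pXn2r// nnegrE ?hnorm_ge0 ?addr_ge0// invr_ge0.
  move: (h1 m) (h1 n); rewrite (_ : 2 ^+ 2 = 4 :> R); last by rewrite -natrX.
  move: (y ^+ 2) (hnorm (u - s m) ^+ 2) (hnorm (u - s n) ^+ 2) (hnorm (s m - s n) ^+ 2).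
  move: ((inf D + m.+1%:R^-1) ^+ 2) ((inf D + n.+1%:R^-1) ^+ 2) (inf D ^+ 2).
  move=> *; lra.
have [|p hp] := @hcauchy_cvg s.
  move=> e e0.
  have [N [N0 hN]] : exists N : nat, 0 < N.+1%:R^-1 :> R /\
      4 * (inf D + N.+1%:R^-1) ^+ 2 - 4 * inf D ^+ 2 < e ^+ 2.
    have : (fun n : nat => 4 * (inf D + n.+1%:R^-1) ^+ 2 - 4 * inf D ^+ 2) @ \oo --> (0 : R).
      have -> : 0 = 4 * (inf D + 0) ^+ 2 - 4 * inf D ^+ 2 :> R by rewrite addr0 subrr.
      apply: cvgB; last exact: cvg_cst.
      apply: cvgM; first exact: cvg_cst.
      have hc : (fun n : nat => inf D + n.+1%:R^-1) @ \oo --> inf D + 0.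
        by apply: cvgD; [exact: cvg_cst | exact: cvg_inv_nat].
      exact: (cvgM hc hc).
    move=> /cvgr0P/(_ (e ^+ 2))[|N hN]; first by rewrite exprn_gt0.
    by exists N; rewrite invr_gt0 ltr0n; split => //; exact: le_lt_trans (ler_norm _) (hN _ _).
  exists N => m n Nm Nn; rewrite -(@ltr_pXn2r _ 2)// ?nnegrE ?hnorm_ge0 ?(ltW e0)//.
  apply: le_lt_trans hN; apply: (le_trans (cau m n)).
  have mono k : (N <= k)%N -> (inf D + k.+1%:R^-1) ^+ 2 <= (inf D + N.+1%:R^-1) ^+ 2.
    move=> Nk; rewrite ler_pXn2r// ?nnegrE ?addr_ge0 ?invr_ge0// lerD2l.
    by rewrite lef_pV2 ?posrE ?ltr0n// ler_nat.
  have aux4 (a b c d : R) : a <= c -> b <= c -> 2 * (a + b) - 4 * d <= 4 * c - 4 * d.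
    by move=> ? ?; lra.
  by apply: aux4; exact: mono.
have pK : K p by apply: csC hp.
exists p => // k kK; apply: le_trans (dle k kK).
have e1 : (fun n => hnorm (u - s n)) @ \oo --> hnorm (u - p).
  by apply: hcvg_hnorm; apply: hcvgB => //; exact: hcvg_cst.
apply: (ler_cvg_to e1 (_ : (fun n => inf D + n.+1%:R^-1) @ \oo --> inf D)).
  by rewrite -[X in _ --> X]addr0; apply: cvgD; [exact: cvg_cst | exact: cvg_inv_nat].
exact: nearW.
Qed.

Lemma csub_proj u : exists p, K p /\ forall k, K k -> ip (u - p) k = 0.
Proof.
have [p pK hp] := csub_dist_min u; exists p; split => // k kK.
apply: ip_eq0P => c; move: (csZ c kK); move: (c *: k) => {c kK}k kK.
(* Moving [p] along [k] cannot shorten the distance to [u], so a quadratic polynomial with zero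
   constant term is nonnegative; its discriminant forces the linear coefficient to vanish. *)
suff : rip (u - p) k ^+ 2 <= 0 * rip k k.
  by rewrite mul0r => h; apply/eqP; rewrite -sqrf_eq0 eq_le h sqr_ge0.
apply: quad_disc => // [|t]; first exact: rip_ge0.
have := hp _ (csD pK (csZ (- t)%:C%C kK)).
rewrite -(@ler_pXn2r _ 2)// ?nnegrE ?hnorm_ge0// !hnorm2 opprD addrA.
rewrite -!/(ip _ _) !ip_sqrB ripZr ripZl ripZr; lra.
Qed.
End Csub.

Definition proj (K : set H) (u : H) : H :=
  xget 0 [set p | K p /\ forall k, K k -> ip (u - p) k = 0].

Definition orth (K : set H) : set H := [set u | forall k, K k -> ip u k = 0].

Lemma ip_sym0 u v : ip u v = 0 -> ip v u = 0.
Proof. by move=> h; rewrite ipC h rmorph0. Qed.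

Section Proj.
Context {K : set H} (hK : csub K).

Lemma projP u : K (proj K u) /\ forall k, K k -> ip (u - proj K u) k = 0.
Proof. exact: (xgetPex 0 (csub_proj hK u)). Qed.
Lemma proj_in u : K (proj K u). Proof. by case: (projP u). Qed.
Lemma proj_orth u : orth K (u - proj K u). Proof. by case: (projP u). Qed.
Lemma proj_uniq u p : K p -> orth K (u - p) -> proj K u = p.
Proof.
move=> pK hp; apply/eqP; rewrite -subr_eq0; apply/eqP/ip_eq0.
have dK : K (proj K u - p) by apply: csB => //; exact: proj_in.
rewrite {1}(_ : proj K u - p = (u - p) - (u - proj K u)).
  by rewrite ipBl (proj_orth _ dK) hp// subrr.
vec.
Qed.
Lemma proj_id u : K u -> proj K u = u.
Proof. by move=> uK; apply: proj_uniq => // k _; rewrite subrr ip0l. Qed.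
Lemma proj_linear : linear (proj K).
Proof.
move=> c u v; apply: proj_uniq; first by apply: csL => //; exact: proj_in.
move=> k kK; rewrite opprD addrACA -scalerBr ipDl ipZl.
by rewrite !(proj_orth _ kK) mulr0 addr0.
Qed.
Lemma proj_sa u v : ip (proj K u) v = ip u (proj K v).
Proof.
have -> : ip (proj K u) v = ip (proj K u) (proj K v).
  have := ip_sym0 (proj_orth v (proj_in u)).
  by rewrite ipBr => /eqP; rewrite subr_eq0 => /eqP.
have := proj_orth u (proj_in v).
by rewrite ipBl => /eqP; rewrite subr_eq0 => /eqP <-.
Qed.
Lemma projK u : proj K (proj K u) = proj K u.
Proof. by apply: proj_id; exact: proj_in. Qed.
Lemma proj_pyth u : hnorm u ^+ 2 = hnorm (proj K u) ^+ 2 + hnorm (u - proj K u) ^+ 2.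
Proof.
have {1}-> : u = (u - proj K u) + proj K u by rewrite subrK.
rewrite !hnorm2 ip_sqrD.
have -> : rip (u - proj K u) (proj K u) = 0 by rewrite /rip (proj_orth _ (proj_in u)).
ring.
Qed.
Lemma proj_le u : hnorm (proj K u) <= hnorm u.
Proof.
rewrite -(@ler_pXn2r _ 2)// ?nnegrE ?hnorm_ge0// [leRHS]proj_pyth lerDl.
exact: sqr_ge0.
Qed.
Lemma proj_rip u : rip (proj K u) u = hnorm (proj K u) ^+ 2.
Proof. by rewrite hnorm2 /rip -proj_sa projK. Qed.
Lemma proj_fix u : hnorm (proj K u) ^+ 2 = hnorm u ^+ 2 -> K u.
Proof.
rewrite [in RHS]proj_pyth => /eqP; rewrite -subr_eq0 opprD addrA subrr sub0r oppr_eq0.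
rewrite sqrf_eq0 => /eqP/hnorm_eq0/eqP; rewrite subr_eq0 => /eqP ->; exact: proj_in.
Qed.

Lemma orth_csub : csub (orth K).
Proof.
split=> [k _|c u v hu hv k kK|s l hs sl k kK]; first exact: ip0l.
  by rewrite ipDl ipZl hu// hv// mulr0 addr0.
by apply: (ip_cvg_const sl) => n; exact: hs.
Qed.
Lemma proj_orthE u : orth K u -> proj K u = 0.
Proof. by move=> h; apply: proj_uniq; [exact: cs0 | rewrite subr0]. Qed.
End Proj.

Lemma orth_projE K : csub K -> forall u, proj (orth K) u = u - proj K u.
Proof.
move=> hK u; apply: proj_uniq; first exact: orth_csub.
  exact: proj_orth.
by rewrite opprB addrCA subrr addr0 => k kK; apply: ip_sym0; apply: kK; exact: proj_in.
Qed.
Lemma orthK K : csub K -> orth (orth K) = K.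
Proof.
move=> hK; apply/seteqP; split=> u.
  move=> h; suff: u - proj K u = 0 by move/eqP; rewrite subr_eq0 => /eqP ->; exact: proj_in.
  rewrite -orth_projE//; apply: proj_orthE => //; exact: orth_csub.
by move=> uK k kK; apply: ip_sym0; exact: kK.
Qed.
Lemma orth_subset (K L : set H) : K `<=` L -> orth L `<=` orth K.
Proof. by move=> KL u h k /KL; exact: h. Qed.

Lemma csubI K L : csub K -> csub L -> csub (K `&` L).
Proof.
move=> hK hL; split; first by split; exact: cs0.
  by move=> c u v [? ?] [? ?]; split; exact: csL.
by move=> s l h sl; split; [apply: (csC hK) sl | apply: (csC hL) sl] => n; case: (h n).
Qed.
Lemma csub_bigcap (I : Type) (K : I -> set H) : (forall i, csub (K i)) ->
  csub [set u | forall i, K i u].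
Proof.
move=> hK; split; first by move=> i; exact: cs0.
  by move=> c u v hu hv i; exact: csL.
by move=> s l h sl i; apply: (csC (hK i)) sl => n; exact: h.
Qed.
Lemma csub0 : csub ([set 0] : set H).
Proof.
split=> //; first by move=> c u v -> ->; rewrite scaler0 addr0.
by move=> s l h sl; apply: (hcvg_uniq sl); rewrite (_ : s = fun=> 0); [exact: hcvg_cst | apply/funext].
Qed.
Lemma csubT : csub ([set: H]).
Proof. by []. Qed.

Section LinearFun.
Context {f : H -> H} (hf : linear f).
Lemma lin0 : f 0 = 0.
Proof. by have := hf (-1) 0 0; rewrite scaleN1r oppr0 addr0 scaleN1r addNr. Qed.
Lemma linD u v : f (u + v) = f u + f v.
Proof. by have := hf 1 u v; rewrite !scale1r. Qed.
Lemma linZ c u : f (c *: u) = c *: f u.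
Proof. by have := hf c u 0; rewrite lin0 !addr0. Qed.
Lemma linN u : f (- u) = - f u.
Proof. by rewrite -scaleN1r linZ scaleN1r. Qed.
Lemma linB u v : f (u - v) = f u - f v.
Proof. by rewrite linD linN. Qed.
End LinearFun.

Lemma bounded_bound f : bounded_linear f ->
  exists2 B : R, 0 < B & forall u : H, hnorm (f u) <= B * hnorm u.
Proof.
move=> [_ [B hB]]; exists (`|B| + 1) => [|u]; first by rewrite ltr_pwDr.
apply: le_trans (hB u) _; apply: ler_wpM2r => //.
by rewrite (le_trans (ler_norm B))// lerDl.
Qed.

Lemma hcvg_bounded f (s : nat -> H) l : bounded_linear f -> hcvg s l ->
  hcvg (f \o s) (f l).
Proof.
move=> hf hs; have [B B0 hB] := bounded_bound hf; have [lf _] := hf.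
apply: (@hcvg_le _ _ (fun n => B * hnorm (s n - l))) => [n|].
  by rewrite /= -linB.
by rewrite -(mulr0 B); apply: cvgM => //; apply: cvg_cst.
Qed.

Lemma riesz (f : H -> C) : (forall c u v, f (c *: u + v) = c * f u + f v) ->
  (exists B : R, forall u, complex.Re (f u) <= B * hnorm u) ->
  exists w, forall u, f u = ip u w.
Proof.
move=> lf [B hB].
have f0 : f 0 = 0.
  by have := lf (-1) 0 0; rewrite scaleN1r oppr0 addr0 mulN1r addNr.
have fZ c u : f (c *: u) = c * f u by have := lf c u 0; rewrite f0 !addr0.
have fB u v : f (u - v) = f u - f v.
  by have := lf (-1) v u; rewrite scaleN1r mulN1r addrC => ->; rewrite addrC.
have hK : csub [set u | f u = 0].
  split=> //= [c u v hu hv|s l hs sl]; first by rewrite lf hu hv mulr0 addr0.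
  (* Only a one-sided bound on the real part is given; applied to the multiples by [1], [-1], [i]
     and [-i] it forces both parts of [f l] to vanish, so the kernel is closed. *)
  have h c : complex.Re (c * f l) <= 0.
    have e n : complex.Re (c * f l) <= B * hnorm (c *: s n - c *: l).
      rewrite hnormBC (le_trans _ (hB _))// fB !fZ hs mulr0 subr0//.
    apply: (ler_cvg_to (cvg_cst _) (_ : (fun n => B * hnorm (c *: s n - c *: l)) @ \oo --> 0)).
      by rewrite -(mulr0 B); apply: cvgM; [exact: cvg_cst | exact: hcvgZ].
    exact: nearW.
  have := h 1; have := h (-1); have := h 'i%C; have := h (- 'i%C).
  case: (f l) => a b /= h1 h2 h3 h4.
  by apply/eqP; rewrite eq_complex /=; apply/andP; split; apply/eqP; lra.
have [hz|/existsNP[u0 hu0]] := pselect (forall u, f u = 0).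
  by exists 0 => u; rewrite ip0r hz.
(* The kernel has codimension one, so the representing vector is a multiple of any nonzero vector
   orthogonal to it. *)
pose z := u0 - proj [set u | f u = 0] u0.
have zf : f z = f u0 by rewrite fB (proj_in hK u0) subr0.
have zn : ip z z != 0.
  by apply/eqP => /ip_eq0 h; apply: hu0; rewrite -zf h.
exists (Num.conj (f z / ip z z) *: z) => u.
rewrite ipZr conjCK.
have : ip (f z *: u - f u *: z) z = 0.
  apply: ip_sym0; apply: (proj_orth hK); rewrite /= fB !fZ; ring.
rewrite ipBl !ipZl => /eqP; rewrite subr_eq0 => /eqP h.
by rewrite mulrAC h mulfK.
Qed.

Lemma rip_boundP (f : H -> H) (B : R) : 0 <= B ->
  (forall u v, rip (f u) v <= B * hnorm u * hnorm v) ->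
  forall u, hnorm (f u) <= B * hnorm u.
Proof.
move=> B0 h u; have [->|/eqP f0] := eqVneq (f u) 0; first by rewrite hnorm0 mulr_ge0.
by rewrite -(ler_pM2r (hnorm_gt0 f0)) (le_trans _ (h u (f u)))// -expr2 hnorm2.
Qed.

Lemma adjoint_exists f : bounded_linear f ->
  exists2 g : H -> H, bounded_linear g & is_adjoint f g.
Proof.
move=> hf; have [B B0 hB] := bounded_bound hf; have [lf _] := hf.
have /choice[g hg] v : exists w, forall u, ip (f u) v = ip u w.
  apply: (@riesz (fun u => ip (f u) v)) => [c u1 u2|]; first by rewrite lf ipDl ipZl.
  exists (B * hnorm v) => u; rewrite mulrAC; apply: le_trans (rip_le _ _) _.
  by rewrite ler_wpM2r.
exists g; last by move=> u v; rewrite -!/(ip _ _) hg.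
have lg : linear g.
  by move=> c u v; apply: eq_ipr => w; rewrite -hg !(ipDr, ipZr) !hg.
split => //; exists B; apply: rip_boundP; first exact: ltW.
move=> u v; rewrite ripC /rip -hg; apply: le_trans (rip_le _ _) _.
by rewrite mulrAC ler_wpM2r.
Qed.

End HilbertBasics.
#[global] Hint Extern 0 (is_true (@Order.le _ _ _ (hnorm _))) => exact: hnorm_ge0 : core.
Ltac vec := apply: eq_ip => ?; rewrite ?(ipDl, ipNl, ipZl, ip0l); ring.

(** * Bounded self-adjoint operators *)

Lemma mono_cvg (R : realType) (s : nat -> R) b :
  (forall n, s n <= s n.+1) -> (forall n, s n <= b) ->
  exists l : R, s @ \oo --> l /\ forall n, s n <= l.
Proof.
move=> hs hb; exists (sup (range s)).
have ub : has_ubound (range s) by exists b => _ [n _ <-].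
split; first by apply: nondecreasing_cvgn => //; exact/nondecreasing_seqP.
by move=> n; apply: ub_le_sup => //; exists n.
Qed.

Lemma cvgr_uniq (R : realType) (s : nat -> R) (l m : R) :
  s @ \oo --> l -> s @ \oo --> m -> l = m.
Proof. by move=> h1 h2; exact: (cvg_unique (@Rhausdorff R) h1 h2). Qed.

Section BoundedOps.
Context {R : realType} {H : hilbert R}.
Local Notation C := R[i].
Implicit Types (u v w : H) (f g A : H -> H).

Definition sadj A := forall u v, ip (A u) v = ip u (A v).
Definition rpos A := forall u, 0 <= rip (A u) u.
Definition comm f g := forall u, f (g u) = g (f u).
Definition contr A := forall u, hnorm (A u) <= hnorm u.

Lemma sadj_rip A : sadj A -> forall u v, rip (A u) v = rip u (A v).
Proof. by move=> h u v; rewrite /rip h. Qed.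

Lemma rpos_CS A : linear A -> sadj A -> rpos A ->
  forall u v, rip (A u) v ^+ 2 <= rip (A u) u * rip (A v) v.
Proof.
move=> lA sA pA u v; apply: quad_disc => // t.
have := pA (u + t%:C%C *: v).
rewrite (linD lA) (linZ lA) !ripDl !ripDr !ripZl !ripZr.
have -> : rip (A v) u = rip (A u) v by rewrite ripC sadj_rip.
by congr (_ <= _); ring.
Qed.

Lemma contr_rip A : contr A -> forall u, rip (A u) u <= hnorm u ^+ 2.
Proof.
move=> cA u; apply: (le_trans (rip_le _ _)); rewrite expr2.
by rewrite ler_wpM2r ?(cA u).
Qed.

Lemma contr_bounded A : linear A -> contr A -> bounded_linear A.
Proof. by move=> lA cA; split => //; exists 1 => u; rewrite mul1r. Qed.

(** This is [A^2 <= b A] for [0 <= A <= b]: Cauchy-Schwarz for the form of [A] at [u] and [A u],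
    followed by cancelling [|A u|^2]. *)
Lemma rpos_sq_le A (b : R) : linear A -> sadj A -> rpos A -> 0 <= b ->
  (forall u, rip (A u) u <= b * hnorm u ^+ 2) ->
  forall u, hnorm (A u) ^+ 2 <= b * rip (A u) u.
Proof.
move=> lA sA pA b0 hb u.
have [->|/eqP n0] := eqVneq (A u) 0.
  by rewrite hnorm0 expr0n /= rip0l mulr0.
have n2 : 0 < hnorm (A u) ^+ 2 by rewrite exprn_gt0// hnorm_gt0.
rewrite -(ler_pM2r n2) -expr2.
have := rpos_CS lA sA pA u (A u); rewrite -[in X in X <= _]hnorm2 => /le_trans; apply.
by rewrite -mulrA mulrCA; apply: ler_wpM2l; [exact: pA | exact: hb].
Qed.

Section Sqrt.
Variables (X : H -> H) (lX : linear X) (sX : sadj X) (cX : contr X).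

(** The limit satisfies [2 Y = X + Y^2], so [(1 - Y)^2 = 1 - X]. The scalar sequence [sqy] is the
    same recursion at [X = 1]; it increases, stays below 1, and majorizes the norms and the
    increments of [sqY] for a contraction [X]. *)
Fixpoint sqY (n : nat) (u : H) : H :=
  if n is m.+1 then (2^-1 : R)%:C%C *: (X u + sqY m (sqY m u)) else 0.
Fixpoint sqy (n : nat) : R :=
  if n is m.+1 then 2^-1 * (1 + sqy m * sqy m) else 0.

Lemma sqy_bound n : 0 <= sqy n <= 1.
Proof.
elim: n => [|n /andP[h0 h1]] /=; first by rewrite lexx ler01.
have : sqy n * sqy n <= 1 by rewrite mulr_ile1.
have : 0 <= sqy n * sqy n by rewrite mulr_ge0.
move: (sqy n * sqy n) => a a0 a1; apply/andP; split; lra.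
Qed.
Lemma sqy_incr n : sqy n <= sqy n.+1.
Proof.
have /andP[h0 h1] := sqy_bound n.
rewrite /= -subr_ge0 (_ : _ - _ = 2^-1 * (1 - sqy n) ^+ 2); last by field.
by rewrite mulr_ge0// ?sqr_ge0// invr_ge0.
Qed.
Lemma sqY_linear n : linear (sqY n).
Proof.
elim: n => [|n IH] c u v /=; first by rewrite scaler0 addr0.
rewrite lX !IH; vec.
Qed.
Lemma sqY_comm f : linear f -> comm f X -> forall n, comm f (sqY n).
Proof.
move=> lf fX; elim=> [|n IH] u /=; first exact: lin0.
by rewrite (linZ lf) (linD lf) fX !IH.
Qed.
Lemma sqY_commm m n : comm (sqY m) (sqY n).
Proof.
apply: sqY_comm; first exact: sqY_linear.
have h : comm X (sqY m) by apply: sqY_comm.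
by move=> u; rewrite h.
Qed.
Lemma sqY_norm n u : hnorm (sqY n u) <= sqy n * hnorm u.
Proof.
elim: n u => [|n IH] u /=; first by rewrite hnorm0 mul0r.
have /andP[y0 _] := sqy_bound n.
rewrite hnormZr ger0_norm ?invr_ge0// -mulrA ler_wpM2l ?invr_ge0//.
apply: (le_trans (hnormD _ _)); rewrite mulrDl mul1r lerD//.
by apply: (le_trans (IH _)); rewrite -mulrA ler_wpM2l.
Qed.
Lemma sqY_diff n u : hnorm (sqY n.+1 u - sqY n u) <= (sqy n.+1 - sqy n) * hnorm u.
Proof.
elim: n u => [|n IH] u.
  rewrite /= subr0 addr0 mulr0 addr0 subr0 mulr1 hnormZr ger0_norm ?invr_ge0//.
  by rewrite ler_wpM2l ?invr_ge0.
(* All iterates commute, being polynomials in [X], so the difference of two squares factors. *)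
have -> : sqY n.+2 u - sqY n.+1 u = (2^-1 : R)%:C%C *:
    (sqY n.+1 (sqY n.+1 u - sqY n u) + sqY n (sqY n.+1 u - sqY n u)).
  rewrite !(linB (sqY_linear _)) (sqY_commm n n.+1) [in LHS]/= -/(sqY n.+1 _).
  rewrite [X in _ - X]/=; vec.
have -> : sqy n.+2 - sqy n.+1 = 2^-1 * ((sqy n.+1 + sqy n) * (sqy n.+1 - sqy n)).
  have e m : sqy m.+1 = 2^-1 * (1 + sqy m * sqy m) by [].
  by rewrite (e n.+1) [in X in _ - X](e n); field.
rewrite hnormZr ger0_norm ?invr_ge0// -mulrA ler_wpM2l ?invr_ge0//.
apply: (le_trans (hnormD _ _)); rewrite -mulrA mulrDl.
have /andP[? _] := sqy_bound n; have /andP[? _] := sqy_bound n.+1.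
by apply: lerD; apply: (le_trans (sqY_norm _ _)); rewrite ler_wpM2l.
Qed.
Lemma sqY_diffm n k u : hnorm (sqY (n + k) u - sqY n u) <= (sqy (n + k) - sqy n) * hnorm u.
Proof.
elim: k => [|k IH]; first by rewrite addn0 !subrr hnorm0 mul0r.
rewrite addnS; apply: (le_trans (hnormDB _ (sqY (n + k) u) _)).
have := sqY_diff (n + k) u; move: IH; rewrite !mulrBl; lra.
Qed.
Lemma sqY_cvg u : exists l, hcvg (sqY^~ u) l.
Proof.
apply: hcauchy_cvg => e e0.
have [|y [hy hle]] := @mono_cvg R sqy 1 sqy_incr.
  by move=> n; have /andP[] := sqy_bound n.
have u1 : 0 < hnorm u + 1 by have := hnorm_ge0 u; lra.
have e1 : 0 < e / (2 * (hnorm u + 1)) by rewrite divr_gt0// mulr_gt0.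
move/cvgrPdist_lt: hy => /(_ _ e1)[N _ hN].
have aux n : (N <= n)%N -> hnorm (sqY n u - sqY N u) < e / 2.
  move=> Nn; rewrite -(subnKC Nn); apply: (le_lt_trans (sqY_diffm _ _ _)).
  rewrite subnKC//; have := hN N (leqnn _); rewrite /= ger0_norm ?subr_ge0//.
  have := hle n => h1 h2; apply: (@le_lt_trans _ _ ((sqy n - sqy N) * (hnorm u + 1))).
    apply: ler_wpM2l; last by rewrite lerDl.
    rewrite subr_ge0 -(subnKC Nn); elim: (n - N)%N => [|k IH]; first by rewrite addn0.
    by rewrite addnS (le_trans IH)// sqy_incr.
  rewrite -ltr_pdivlMr//; apply: (@le_lt_trans _ _ (y - sqy N)); first by rewrite lerB.
  by rewrite (lt_le_trans h2)// invfM mulrA.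
exists N => m n Nm Nn; apply: (le_lt_trans (hnormDB _ (sqY N u) _)).
rewrite [e]splitr; apply: ltrD; first exact: aux.
by rewrite hnormBC; exact: aux.
Qed.
End Sqrt.

Lemma conj_real (r : R) : Num.conj (r%:C%C : R[i]) = r%:C%C.
Proof. by apply/eqP; rewrite eq_complex /= eqxx oppr0 eqxx. Qed.

Lemma rip_sadj A : linear A -> (forall u v, rip (A u) v = rip u (A v)) -> sadj A.
Proof. by move=> lA h u v; rewrite !ipE !h (linZ lA). Qed.

(** With [X = 1 - A] the root is [S = 1 - Y]. As a limit of polynomials in [A] it commutes with
    every bounded operator that commutes with [A]; this is what later keeps square roots inside a
    von Neumann algebra. *)
Lemma sqrt_contr A : linear A -> sadj A -> rpos A -> contr A ->
  exists S, [/\ linear S, sadj S, rpos S, contr S &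
    (forall u, S (S u) = A u) /\
    forall f, bounded_linear f -> comm f A -> comm f S].
Proof.
move=> lA sA pA cA.
pose X u := u - A u.
have lX : linear X by move=> c u v; rewrite /X lA; vec.
have sX : sadj X by move=> u v; rewrite /X ipBl ipBr sA.
have AA u : hnorm (A u) ^+ 2 <= rip (A u) u.
  rewrite -[leRHS]mul1r; apply: rpos_sq_le => // v; rewrite mul1r.
  exact: contr_rip.
have cX : contr X.
  move=> u; rewrite -(@ler_pXn2r _ 2)// ?nnegrE//.
  rewrite [X in X <= _]hnorm2 [X in _ <= X]hnorm2 ip_sqrB.
  have := AA u; rewrite (ripC u) hnorm2 => h; have := pA u; lra.
have /choice[Y hY] u := sqY_cvg lX cX u.
have lY : linear Y.
  move=> c u v; apply: (hcvg_uniq (hY _)).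
  have -> : (sqY X)^~ (c *: u + v) = fun n => c *: sqY X n u + sqY X n v.
    by apply/funext => n; exact: sqY_linear.
  by apply: hcvgD => //; exact: hcvgZ.
have cY : contr Y.
  move=> u; apply: (ler_cvg_to (hcvg_hnorm (hY u)) (cvg_cst (hnorm u))).
  apply: nearW => n /=; apply: (le_trans (sqY_norm cX _ _)).
  by rewrite ler_piMl//; have /andP[] := sqy_bound n.
have bY := contr_bounded lY cY.
have sY : sadj Y.
  apply: rip_sadj => // u v.
  have sn n a b : rip (sqY X n a) b = rip a (sqY X n b).
    elim: n a b => [|n IH] a b /=; first by rewrite rip0l rip0r.
    by rewrite ripZl ripZr ripDl ripDr (sadj_rip sX) !IH.
  apply: (cvgr_uniq (hcvg_rip (w := v) (hY u))).
  under eq_fun do rewrite sn ripC.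
  by rewrite ripC; exact: hcvg_rip.
have eY u : Y u = (2^-1 : R)%:C%C *: (X u + Y (Y u)).
  apply: (hcvg_uniq (hcvg_shift 1 (hY u))).
  under [fun _ => _]eq_fun do rewrite addn1 /=.
  apply: hcvgZ; apply: hcvgD; first exact: hcvg_cst.
  apply: (@hcvg_le _ _ _ _ (fun n => hnorm (sqY X n u - Y u) + hnorm (sqY X n (Y u) - Y (Y u)))).
    move=> n; apply: (le_trans (hnormDB _ (sqY X n (Y u)) _)); rewrite lerD2r.
    rewrite -(linB (sqY_linear lX n)); apply: (le_trans (sqY_norm cX _ _)).
    by rewrite ler_piMl//; have /andP[] := sqy_bound n.
  by rewrite -(addr0 0); apply: cvgD; exact: hY.
pose S u := u - Y u.
have lS : linear S by move=> c u v; rewrite /S lY; vec.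
have sS : sadj S by move=> u v; rewrite /S ipBl ipBr sY.
have SS u : S (S u) = A u.
  rewrite {2}/S (linB lS) /S.
  have : (2 : R)%:C%C *: Y u = X u + Y (Y u).
    by rewrite {1}eY scalerA -rmorphM /= divff ?pnatr_eq0// scale1r.
  rewrite rmorph_nat scaler_nat mulr2n => h.
  have -> : u - Y u - (Y u - Y (Y u)) = u - (Y u + Y u) + Y (Y u) by vec.
  by rewrite h /X; vec.
have pS : rpos S.
  by move=> u; rewrite /S ripBl -hnorm2 subr_ge0 contr_rip.
exists S; split => //.
  move=> u; rewrite -(@ler_pXn2r _ 2)// ?nnegrE// hnorm2 -(sadj_rip sS) SS.
  exact: contr_rip.
split=> // f bf fA u; have [lf _] := bf.
have fX : comm f X by move=> v; rewrite /X (linB lf) fA.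
have fY : f (Y u) = Y (f u).
  apply: (hcvg_uniq (hcvg_bounded bf (hY u))).
  rewrite (_ : f \o _ = (sqY X)^~ (f u)); first exact: hY.
  by apply/funext => n /=; exact: sqY_comm.
by rewrite /S (linB lf) fY.
Qed.

Lemma sadj_comp A : sadj A -> sadj (A \o A).
Proof. by move=> sA u v; rewrite /= !sA. Qed.

Lemma bounded_comp f g : bounded_linear f -> bounded_linear g ->
  bounded_linear (f \o g).
Proof.
move=> [lf hf] [lg hg]; split; first by move=> c u v /=; rewrite lg lf.
have [B B0 hB] := bounded_bound (conj lf hf).
have [D D0 hD] := bounded_bound (conj lg hg).
exists (B * D) => u /=; apply: (le_trans (hB _)); rewrite -mulrA.
by apply: ler_wpM2l (hD u); exact: ltW.
Qed.

Lemma bounded_scale f c : bounded_linear f -> bounded_linear (fun u => c *: f u).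
Proof.
move=> [lf [B hB]]; split; first by move=> a u v /=; rewrite lf; vec.
exists (cnorm c * B) => u; rewrite hnormZ -mulrA ler_wpM2l ?cnorm_ge0//.
Qed.
Lemma bounded_add f g : bounded_linear f -> bounded_linear g ->
  bounded_linear (fun u => f u + g u).
Proof.
move=> [lf [B hB]] [lg [D hD]]; split; first by move=> a u v /=; rewrite lf lg; vec.
by exists (B + D) => u; apply: (le_trans (hnormD _ _)); rewrite mulrDl lerD.
Qed.
Lemma bounded_id : bounded_linear (id : H -> H).
Proof. by split => //; exists 1 => u; rewrite mul1r. Qed.

Lemma sqrt_bounded A : bounded_linear A -> sadj A -> rpos A ->
  exists S, [/\ bounded_linear S, sadj S, rpos S,
    (forall u, S (S u) = A u) &
    forall f, bounded_linear f -> comm f A -> comm f S].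
Proof.
move=> bA sA pA; have [lA _] := bA; have [B B0 hB] := bounded_bound bA.
pose A' u := (B^-1)%:C%C *: A u.
have BC : B%:C%C * (B^-1)%:C%C = 1 :> R[i] by rewrite -rmorphM /= divff ?gt_eqF.
have [bA' lA'] : bounded_linear A' /\ linear A' by have h := bounded_scale (B^-1)%:C%C bA; case: (h).
have [||u|S [lS sS pS cS [SS cm]]] := @sqrt_contr A' lA'.
- by move=> u v; rewrite /A' ipZl ipZr sA conj_real.
- by move=> u; rewrite /A' ripZl mulr_ge0// ?pA// invr_ge0 ltW.
- by rewrite /A' hnormZr ger0_norm ?invr_ge0 ?(ltW B0)// ler_pdivrMl.
exists (fun u => (Num.sqrt B)%:C%C *: S u); split.
- by apply: bounded_scale; exact: contr_bounded.
- by move=> u v; rewrite ipZl ipZr sS conj_real.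
- by move=> u; rewrite ripZl mulr_ge0// ?pS// sqrtr_ge0.
- move=> u; rewrite (linZ lS) SS scalerA -rmorphM /= -expr2 sqr_sqrtr ?ltW//.
  by rewrite /A' scalerA BC scale1r.
- move=> f bf fA u; have [lf _] := bf; rewrite (linZ lf) cm// => v.
  by rewrite /A' (linZ lf) fA.
Qed.

(** With [S] the square root of [D], which commutes with [A], the form of [A D] at [u] is that of
    [A] at [S u]. *)
Lemma rpos_mul A D : bounded_linear A -> sadj A -> rpos A ->
  bounded_linear D -> sadj D -> rpos D -> comm A D -> rpos (A \o D).
Proof.
move=> bA sA pA bD sD pD AD u.
have [S [bS sS pS SS cm]] := sqrt_bounded bD sD pD.
have AS := cm A bA AD.
by rewrite /= -SS AS (sadj_rip sS); exact: pA.
Qed.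

Lemma rpos0 A : bounded_linear A -> sadj A -> rpos A -> forall u,
  rip (A u) u = 0 -> A u = 0.
Proof.
move=> [lA _] sA pA u h; have := rpos_CS lA sA pA u (A u).
rewrite h mul0r -hnorm2 => h2.
apply: hnorm_eq0; apply/eqP; rewrite -sqrf_eq0 -sqrf_eq0 eq_le h2 /=.
by rewrite sqr_ge0.
Qed.

(* K is the spectral subspace of A for [0, +oo[, obtained as the kernel of
   |A| - A with |A| the square root of A^2. *)
Lemma spectral_split A : bounded_linear A -> sadj A ->
  exists K, [/\ csub K,
    (forall f, bounded_linear f -> comm f A -> forall u, K u -> K (f u)),
    (forall u, K u -> 0 <= rip (A u) u) &
    (forall u, orth K u -> u <> 0 -> rip (A u) u < 0)].
Proof.
move=> bA sA; have [lA _] := bA.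
have [||u|S [bS sS pS SS cm]] := @sqrt_bounded (A \o A).
- exact: bounded_comp.
- exact: sadj_comp.
- by rewrite /= (sadj_rip sA) rip_ge0.
have [lS _] := bS.
have SA : comm S A by move=> u; rewrite (cm A).
have hK : csub [set u | S u = A u].
  split=> /=; first by rewrite (lin0 lS) (lin0 lA).
    by move=> c u v hu hv; rewrite lS lA hu hv.
  move=> s l h sl; apply: (hcvg_uniq (hcvg_bounded bS sl)).
  rewrite (_ : S \o s = A \o s); first exact: hcvg_bounded.
  by apply/funext => n; exact: h.
exists [set u | S u = A u]; split => //.
- move=> f bf fA u /= h; rewrite -(cm f) //; first by rewrite h fA.
  by move=> v; rewrite /= !fA.
- by move=> u /= <-; exact: pS.
move=> u uK u0.
(* Since [(S - A)(S + A) = 0], the operator [S + A] maps into [K]; being self-adjoint, it kills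
   every vector orthogonal to [K]. *)
have h : S u = - A u.
  apply/eqP; rewrite -subr_eq0 opprK; apply/eqP; apply: eq_ip => w.
  rewrite ip0l ipDl sS sA -ipDr; apply: uK => /=.
  by rewrite (linD lS) (linD lA) SS -SA addrC.
rewrite lt_neqAle -oppr_ge0 -ripNl -h pS andbT; apply/eqP => h0.
have Su : S u = 0 by apply: rpos0 => //; rewrite h ripNl h0 oppr0.
have uK' : S u = A u by rewrite -[A u]opprK -h Su oppr0.
by apply: u0; apply: ip_eq0; exact: uK.
Qed.

Lemma sadj_iter A n : sadj A -> sadj (iter n A).
Proof. by move=> sA; elim: n => [|n IH] u v //=; rewrite sA IH -iterSr. Qed.

Lemma sadj_cs_orth A : bounded_linear A -> csub [set u | A u = 0].
Proof.
move=> bA; have [lA _] := bA; split=> /=; first exact: lin0.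
  by move=> c u v hu hv; rewrite lA hu hv scaler0 addr0.
move=> s l h sl; apply: (hcvg_uniq (hcvg_bounded bA sl)).
by rewrite (_ : A \o s = fun=> 0); [exact: hcvg_cst | apply/funext].
Qed.

(** The numbers [<c^n u, u>] decrease and are nonnegative, and [|c^m u - c^n u|^2] is a combination
    of those at [2m], [m+n] and [2n]; so [c^n u] converges. The limit is fixed by [c], hence in the
    kernel of [h], while [u - c^n u] stays orthogonal to that kernel. *)
Lemma iter_contr_cvg (h : H -> H) : bounded_linear h -> sadj h -> rpos h ->
  contr h -> let c u := u - h u in
  forall u, hcvg (fun n => iter n c u) (proj [set v | h v = 0] u).
Proof.
move=> bh sh ph ch c u; have [lh _] := bh.
have hh v : hnorm (h v) ^+ 2 <= rip (h v) v.
  by rewrite -[leRHS]mul1r; apply: rpos_sq_le => // w; rewrite mul1r contr_rip.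
have lc : linear c by move=> b x y; rewrite /c lh; vec.
have sc : sadj c by move=> v w; rewrite /c ipBl ipBr sh.
have pc : rpos c.
  by move=> v; rewrite /c ripBl -hnorm2 subr_ge0 contr_rip.
have cc v : hnorm (c v) ^+ 2 <= rip (c v) v.
  rewrite -[leRHS]mul1r; apply: rpos_sq_le => // w; rewrite mul1r /c ripBl -hnorm2.
  by rewrite gerBl ph.
have bc : bounded_linear c.
  split=> //; exists 2 => v; apply: (le_trans (hnormB _ _)).
  by have := ch v; lra.
pose a n := rip (iter n c u) u.
have aE m n : a (m + n)%N = rip (iter m c u) (iter n c u).
  by rewrite /a addnC iterD (sadj_rip (sadj_iter n sc)).
have iterl n : linear (iter n c).
  by elim: n => [|n IH] b x y //=; rewrite IH lc.
have hc : comm h c by move=> v; rewrite /c (linB lh).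
(* Even indices give [|c^k u|^2], odd ones the form of [c] at [c^k u]; both are nonnegative. *)
have a0 n : 0 <= a n.
  rewrite -(odd_double_half n) -addnn.
  case: (odd n); last by rewrite add0n aE rip_ge0.
  by rewrite addnA addnC addnA addn1 addnC aE -[X in rip _ X]/(iter _ c u) ripC pc.
have ad n : a n.+1 <= a n.
  rewrite -(odd_double_half n) -addnn; case: (odd n); last first.
    rewrite add0n -addSn !aE /= {1}/c ripBl lerBlDr lerDl.
    by rewrite ph.
  rewrite add1n (_ : (n./2 + n./2).+2 = n./2.+1 + n./2.+1)%N; last by rewrite addSn addnS.
  rewrite (_ : (n./2 + n./2).+1 = n./2.+1 + n./2)%N; last by rewrite addSn.
  by rewrite !aE /= -hnorm2 cc.
have [l [hl la]] : exists l, a @ \oo --> l /\ forall n, l <= a n.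
  have [||l [hl la]] := @mono_cvg R (fun n => - a n) 0.
  - by move=> n; rewrite lerN2.
  - by move=> n; rewrite oppr_le0.
  exists (- l); split; last by move=> n; rewrite lerNl.
  suff -> : a = (fun n => - (- a n)) by exact: cvgN.
  by apply/funext => n; rewrite opprK.
have [e he] : exists e, hcvg (fun n => iter n c u) e.
  apply: hcauchy_cvg => e e0.
  move/cvgrPdist_lt: hl => /(_ (e ^+ 2 / 4))[|N _ hN]; first by rewrite divr_gt0// exprn_gt0.
  have {}hN n : (N <= n)%N -> a n - l < e ^+ 2 / 4.
    by move=> /hN /=; rewrite distrC ger0_norm// subr_ge0.
  exists N => m n Nm Nn; rewrite -(@ltr_pXn2r _ 2)// ?nnegrE ?(ltW e0)//.
  rewrite hnorm2 ip_sqrB -!aE.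
  have h1 := hN (m + m)%N (leq_trans Nm (leq_addr _ _)).
  have h2 := hN (n + n)%N (leq_trans Nn (leq_addr _ _)).
  have := la (m + n)%N; have : 0 < e ^+ 2 by rewrite exprn_gt0.
  move: h1 h2; move: (e ^+ 2) (a _) (a _) (a _) => E x y z; lra.
have eK : h e = 0.
  have : e = c e.
    apply: (hcvg_uniq (hcvg_shift 1 he)).
    under [fun _ => _]eq_fun do rewrite addn1 /=.
    exact: hcvg_bounded.
  by rewrite /c => /esym/eqP; rewrite subr_eq addrC -subr_eq subrr => /eqP.
rewrite (proj_uniq (sadj_cs_orth bh) eK)// => k /= hk.
apply: (ip_cvg_const (hcvgB (hcvg_cst u) he)) => n.
rewrite ipBl; suff -> : ip (iter n c u) k = ip u k by rewrite subrr.
  rewrite (sadj_iter n sc) (_ : iter n c k = k)//.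
  by elim: n => //= n ->; rewrite /c hk subr0.
Qed.

End BoundedOps.

(** * Monotone sequences of closed subspaces *)

Section SubspaceSequences.
Context {R : realType} {H : hilbert R}.
Implicit Types (u v w : H) (K L : set H).

Lemma proj_nest_in K L : csub K -> csub L -> K `<=` L ->
  forall u, proj L (proj K u) = proj K u.
Proof. by move=> hK hL KL u; apply: proj_id => //; apply: KL; exact: proj_in. Qed.
Lemma proj_nest K L : csub K -> csub L -> K `<=` L ->
  forall u, proj K (proj L u) = proj K u.
Proof.
move=> hK hL KL u; apply: eq_ip => w.
by rewrite (proj_sa hK) (proj_sa hL) proj_nest_in// -(proj_sa hK).
Qed.
Lemma proj_diff K L : csub K -> csub L -> K `<=` L -> forall u,
  hnorm (proj L u - proj K u) ^+ 2 = hnorm (proj L u) ^+ 2 - hnorm (proj K u) ^+ 2.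
Proof.
move=> hK hL KL u; rewrite [in RHS](proj_pyth hK (proj L u)) proj_nest//.
by rewrite addrAC subrr add0r.
Qed.
Lemma proj_mono K L : csub K -> csub L -> K `<=` L -> forall u,
  hnorm (proj K u) ^+ 2 <= hnorm (proj L u) ^+ 2.
Proof. by move=> hK hL KL u; rewrite -subr_ge0 -proj_diff// sqr_ge0. Qed.

Lemma decr_subset (K : nat -> set H) : (forall n, K n.+1 `<=` K n) ->
  forall m n, (m <= n)%N -> K n `<=` K m.
Proof.
move=> h m n mn; rewrite -(subnKC mn); elim: (n - m)%N => [|k IH]; first by rewrite addn0.
by rewrite addnS; apply: subset_trans IH; exact: h.
Qed.

(** For nested subspaces [|P_m u - P_n u|^2] is a difference of the monotone bounded numbers
    [|P_n u|^2], so the projections form a Cauchy sequence. *)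
Lemma decr_cvg (K : nat -> set H) : (forall n, csub (K n)) ->
  (forall n, K n.+1 `<=` K n) -> forall u,
  hcvg (fun n => proj (K n) u) (proj [set v | forall n, K n v] u).
Proof.
move=> hK hd u; pose a n := - hnorm (proj (K n) u) ^+ 2.
have [||l [hl la]] := @mono_cvg R a 0.
- by move=> n; rewrite lerN2 proj_mono.
- by move=> n; rewrite oppr_le0 sqr_ge0.
have mn m n : (m <= n)%N -> hnorm (proj (K m) u - proj (K n) u) ^+ 2 = a n - a m.
  by move=> mn; rewrite proj_diff//; [rewrite /a; ring | exact: decr_subset].
have [p hp] : exists p, hcvg (fun n => proj (K n) u) p.
  apply: hcauchy_cvg => e e0.
  move/cvgrPdist_lt: hl => /(_ (e ^+ 2)); rewrite exprn_gt0// => /(_ isT)[N _ hN].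
  exists N => m n.
  wlog mlen : m n / (m <= n)%N.
    move=> h Nm Nn; case: (leqP m n) => [mn'|/ltnW mn']; first exact: h.
    by rewrite hnormBC; exact: h.
  move=> Nm Nn; rewrite -(@ltr_pXn2r _ 2)// ?nnegrE ?(ltW e0)// mn//.
  have := hN m Nm; rewrite /= ger0_norm ?subr_ge0//; apply: le_lt_trans.
  by rewrite lerD2r.
have pK n : K n p.
  apply: (csC (hK n) _ (hcvg_shift n hp)) => k.
  apply: (decr_subset hd (leq_addl k n)); exact: proj_in.
rewrite (proj_uniq (csub_bigcap hK) pK)// => k kK.
apply: (ip_cvg_const (hcvgB (hcvg_cst u) hp)) => n.
exact: (proj_orth (hK n)).
Qed.

Lemma incr_cvg (K : nat -> set H) : (forall n, csub (K n)) ->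
  (forall n, K n `<=` K n.+1) -> forall u,
  hcvg (fun n => proj (K n) u) (u - proj [set v | forall n, orth (K n) v] u).
Proof.
move=> hK hd u.
have hO n : csub (orth (K n)) := orth_csub.
have h := decr_cvg hO (fun n => orth_subset (hd n)) u.
rewrite [X in hcvg X _](_ : _ = fun n => u - proj (orth (K n)) u).
  by apply: hcvgB => //; exact: hcvg_cst.
by apply/funext => n; rewrite orth_projE// opprB addrC subrK.
Qed.

Lemma hcvg_sq (s : nat -> H) l : hcvg s l ->
  (fun n => hnorm (s n) ^+ 2) @ \oo --> hnorm l ^+ 2.
Proof. by move=> /hcvg_hnorm h; exact: (cvgM h h). Qed.

Lemma proj_bounded K : csub K -> bounded_linear (proj K).
Proof.
move=> hK; split; first exact: proj_linear.
by exists 1 => u; rewrite mul1r; exact: proj_le.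
Qed.

Lemma sadj0 (A : H -> H) : linear A -> sadj A -> (forall u, rip (A u) u = 0) ->
  forall u, A u = 0.
Proof.
move=> lA sA h u; have pA : rpos A by move=> v; rewrite h.
have := rpos_CS lA sA pA u (A u); rewrite h mul0r -hnorm2 => h2.
apply: hnorm_eq0; apply/eqP; rewrite -sqrf_eq0 -sqrf_eq0 eq_le h2 /=.
by rewrite sqr_ge0.
Qed.

Lemma orth_of_norms K L : csub K -> csub L ->
  (forall u, hnorm (proj K u) ^+ 2 + hnorm (proj L u) ^+ 2 <= hnorm u ^+ 2) ->
  K `<=` orth L.
Proof.
move=> hK hL h u uK; have := h u; rewrite (proj_id hK uK) gerDl => h0.
have : proj L u = 0.
  by apply: hnorm_eq0; apply/eqP; rewrite -sqrf_eq0 eq_le h0 sqr_ge0.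
by move=> p0; rewrite -(subr0 u) -p0; exact: proj_orth.
Qed.


Lemma proj0_orth K u : csub K -> proj K u = 0 -> orth K u.
Proof. by move=> hK h; rewrite -(subr0 u) -h; exact: proj_orth. Qed.
End SubspaceSequences.

(** * Existence of spectral measures *)

Section Resolution.
Context {R : realType} {H : hilbert R}.
Local Notation mT := (measurableTypeR R).
Implicit Types (u v w : H) (K L : set H) (A B : set mT).
Variable m : H -> {measure set mT -> \bar R}.

(** [K] is the candidate range of the spectral projection of [A]: the scalar measures [m u] are
    given, and the projection-valued measure is recovered from the subspaces that represent them. *)
Definition represents A K := csub K /\
  forall u, m u A = (hnorm (proj K u) ^+ 2)%:E.

Hypothesis mtot : forall u, m u setT = (hnorm u ^+ 2)%:E.

Lemma repr_C A K : measurable A -> represents A K -> represents (~` A) (orth K).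
Proof.
move=> mA [hK h]; split=> [|u]; first exact: orth_csub.
rewrite orth_projE//.
have -> : hnorm (u - proj K u) ^+ 2 = hnorm u ^+ 2 - hnorm (proj K u) ^+ 2.
  by rewrite [in RHS](proj_pyth hK u) addrAC subrr add0r.
have : (m u (~` A) + m u A = (hnorm u ^+ 2)%:E)%E.
  rewrite -measureU//; first by rewrite setUC setUv; exact: mtot.
    exact: measurableC.
  by rewrite setIC setICr.
rewrite h; case: (m u (~` A)) => [r|//|//] /=.
by rewrite -EFinD => -[<-]; rewrite addrK.
Qed.

(** The [K n] are mutually orthogonal because the measures add. Their closed span is written as the
    complement of the common complement, so that it is reached through the decreasing [L n], the
    complements of the first [n] of them. *)
Lemma repr_bigcup (F : nat -> set mT) (K : nat -> set H) :
  (forall n, measurable (F n)) -> trivIset setT F ->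
  (forall n, represents (F n) (K n)) ->
  represents (\bigcup_n F n) (orth [set u | forall n, orth (K n) u]).
Proof.
move=> mF tF hF; split=> [|u]; first exact: orth_csub.
have hK n : csub (K n) by case: (hF n).
pose L n : set H := [set u | forall i, (i < n)%N -> orth (K i) u].
have hL n : csub (L n).
  split=> [i _|c a b ha hb i i_n|s l h sl i i_n].
  - exact: (cs0 orth_csub).
  - by apply: (csL orth_csub); [exact: ha | exact: hb].
  - by apply: (csC orth_csub _ sl) => k; exact: h.
have Ld n : L n.+1 `<=` L n by move=> v h i i_n; apply: h; exact: ltnW.
have Kor i j : i != j -> K i `<=` orth (K j).
  move=> ij; apply: orth_of_norms => // v.
  rewrite -lee_fin EFinD -(proj2 (hF i)) -(proj2 (hF j)) -mtot -measureU//.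
    by apply: le_measure; rewrite ?inE//; exact: measurableU.
  by move/trivIsetP : tF; apply.
have pL n v : proj (L n) v = v - \sum_(i < n) proj (K i) v.
  elim: n => [|n IH].
    rewrite big_ord0 subr0; apply: proj_id => //.
  rewrite big_ord_recr /= opprD addrA -IH.
  apply: proj_uniq => // [i i_n|k hk].
    have [ei|ni] := eqVneq i n.
      rewrite ei -(proj_nest (hK n) (hL n)); last first.
        by move=> k kn j jn; apply: (Kor n j) => //; rewrite gtn_eqF.
      exact: proj_orth.
    apply: (csB (orth_csub)).
      by apply: (proj_in (hL n)); rewrite ltn_neqAle ni.
    by apply: (Kor n i); [rewrite eq_sym | exact: proj_in].
  have -> : v - (proj (L n) v - proj (K n) v) = (v - proj (L n) v) + proj (K n) v by vec.
  rewrite ipDl (proj_orth (hL n)) ?add0r; last exact: Ld.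
  by apply: ip_sym0; apply: (hk n) => //; exact: proj_in.
have nL n : hnorm (proj (L n) u) ^+ 2 = hnorm u ^+ 2 - \sum_(i < n) hnorm (proj (K i) u) ^+ 2.
  elim: n => [|n IH].
    by rewrite big_ord0 subr0 pL big_ord0 subr0.
  rewrite big_ord_recr /= opprD addrA -IH.
  have Kn : K n `<=` L n by move=> k kn j jn; apply: (Kor n j) => //; rewrite gtn_eqF.
  have -> : proj (L n.+1) u = proj (L n) u - proj (K n) u.
    by rewrite !pL big_ord_recr /= opprD addrA.
  by rewrite proj_diff.
have -> : [set u | forall n, orth (K n) u] = [set u | forall n, L n u].
  by apply/seteqP; split=> v h; [move=> n i _; exact: h | move=> n; exact: (h n.+1)].
rewrite orth_projE; last exact: csub_bigcap.
have hc := hcvg_sq (decr_cvg hL Ld u).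
set p := proj _ u in hc *.
have -> : hnorm (u - p) ^+ 2 = hnorm u ^+ 2 - hnorm p ^+ 2.
  by rewrite [in RHS](proj_pyth (csub_bigcap hL) u) addrAC subrr add0r.
have h1 : (fun n => m u (\bigcup_(i < n) F i)) @ \oo --> m u (\bigcup_n F n).
  have := @nondecreasing_cvg_mu _ mT R (m u) (fun n => \bigcup_(i < n) F i).
  have -> : \bigcup_n \bigcup_(i < n) F i = \bigcup_n F n.
    apply/seteqP; split=> [x [n _ [i _ Fi]]|x [n _ Fn]]; first by exists i.
    by exists n.+1 => //; exists n => /=.
  apply.
  - by move=> n; apply: bigcup_measurable => i _; exact: mF.
  - by apply: bigcup_measurable => n _; exact: mF.
  - move=> a b ab; apply/subsetPset => x [i /= ia Fi]; exists i => //=.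
    exact: leq_trans ab.
have h2 n : m u (\bigcup_(i < n) F i) = (hnorm u ^+ 2 - hnorm (proj (L n) u) ^+ 2)%:E.
  rewrite nL opprB addrC subrK.
  rewrite bigcup_mkord measure_bigsetU//.
    by rewrite -sumEFin; apply: eq_bigr => i _; exact: (proj2 (hF i) u).
have h3 : (fun n => m u (\bigcup_(i < n) F i)) @ \oo --> (hnorm u ^+ 2 - hnorm p ^+ 2)%:E.
  under eq_fun do rewrite h2.
  apply: cvg_EFin; first exact: nearW.
  by apply: cvgB => //; exact: cvg_cst.
exact: (cvg_unique (@ereal_hausdorff R) h1 h3).
Qed.

Hypothesis mK : forall A, measurable A -> exists K, represents A K.

Definition ranK A : set H := xget setT [set K | represents A K].
Definition res_of A : H -> H := proj (ranK A).

Lemma ranKP A : measurable A -> represents A (ranK A).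
Proof. by move=> /mK hA; exact: (xgetPex setT hA). Qed.

Lemma ranK_subset A B : measurable A -> measurable B -> A `<=` B ->
  ranK A `<=` ranK B.
Proof.
move=> mA mB AB u uA; have [hA eA] := ranKP mA; have [hB eB] := ranKP mB.
apply: (proj_fix hB); apply/eqP; rewrite eq_le -!lee_fin -eB -mtot.
apply/andP; split; first by apply: le_measure; rewrite ?inE//.
by rewrite mtot -{1}(proj_id hA uA) -eA; apply: le_measure; rewrite ?inE.
Qed.

Lemma ranK_disj A B : measurable A -> measurable B -> A `&` B = set0 ->
  ranK A `<=` orth (ranK B).
Proof.
move=> mA mB AB; have [hA eA] := ranKP mA; have [hB eB] := ranKP mB.
apply: orth_of_norms => // u; rewrite -lee_fin EFinD -eA -eB -mtot -measureU//.
by apply: le_measure; rewrite ?inE//; exact: measurableU.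
Qed.

(** A self-adjoint operator with vanishing quadratic form is zero, and additivity of the measures
    gives equality of the forms. *)
Lemma res_ofU A B : measurable A -> measurable B -> A `&` B = set0 ->
  forall u, res_of (A `|` B) u = res_of A u + res_of B u.
Proof.
move=> mA mB AB; have [hA eA] := ranKP mA; have [hB eB] := ranKP mB.
have mAB := measurableU _ _ mA mB; have [hAB eAB] := ranKP mAB.
pose D u := res_of (A `|` B) u - (res_of A u + res_of B u).
have DE : forall u, D u = 0.
  apply: sadj0.
  - by move=> c u v; rewrite /D /res_of !proj_linear//; vec.
  - by move=> u v; rewrite /D /res_of ipBl ipBr ipDl ipDr !proj_sa.
  - move=> u; rewrite /D /res_of ripBl ripDl !proj_rip//; apply/eqP.
    rewrite subr_eq0; apply/eqP/EFin_inj.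
    by rewrite EFinD -eAB -eA -eB -measureU.
by move=> u; apply/eqP; rewrite -subr_eq0; apply/eqP/DE.
Qed.

Lemma res_of_resolution : resolution res_of.
Proof.
split.
- move=> A mA; have [hA eA] := ranKP mA; split; first exact: proj_bounded.
    by move=> u v; exact: proj_sa.
  by apply/funext => u; exact: projK.
- apply/funext => u; have [hA eA] := ranKP measurableT.
  apply: proj_id => //; apply: proj_fix => //.
  by apply: EFin_inj; rewrite -eA mtot.
- move=> A B mA mB; apply/funext => u /=.
  have mAB := measurableI _ _ mA mB; have mD := measurableD mA mB.
  have [hA eA] := ranKP mA; have [hB eB] := ranKP mB.
  have [hAB eAB] := ranKP mAB; have [hD eD] := ranKP mD.
  have -> : res_of A (res_of B u) = res_of (A `&` B) (res_of B u) + res_of (A `\` B) (res_of B u).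
    rewrite -res_ofU//; first by rewrite setUIDK.
    by rewrite setDE setIACA setICr setI0.
  rewrite [X in _ + X](_ : _ = 0) ?addr0.
    rewrite /res_of proj_nest//; exact: ranK_subset.
  apply: proj_orthE => //.
  apply: (ranK_disj mB mD); last exact: proj_in.
  by rewrite setIC setDE -setIA setICl setI0.
- move=> u; exists (m u) => A mA; have [hA eA] := ranKP mA.
  by rewrite eA /res_of -/(ip _ _) -/(rip _ _) proj_rip.
Qed.

Lemma res_of_scalar u : scalar_measure res_of u (m u).
Proof.
move=> A mA; have [hA eA] := ranKP mA.
by rewrite eA /res_of -/(ip _ _) -/(rip _ _) proj_rip.
Qed.

End Resolution.

(** * From an increasing family of subspaces to a resolution of the identity *)

Section SpectralFamily.
Context {R : realType} {H : hilbert R}.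
Local Notation mT := (measurableTypeR R).
Implicit Types (u v w : H).
Variable E : R -> set H.
Hypothesis hE : forall a, csub (E a).
Hypothesis monoE : forall a b, a <= b -> E a `<=` E b.
Hypothesis rcE : forall a u, (forall b, a < b -> E b u) -> E a u.
Hypothesis negE : forall a : R, a < 0 -> E a `<=` [set 0].
Hypothesis topE : forall u, (forall n : nat, orth (E n%:R) u) -> u = 0.

Definition cumf u (a : R) : R := hnorm (proj (E a) u) ^+ 2.

Lemma cumf_mono u : nondecreasing (cumf u).
Proof. by move=> a b ab; apply: proj_mono => //; exact: monoE. Qed.

Lemma cumf_rc u : right_continuous (cumf u).
Proof.
move=> a; apply/cvgrPdist_lt => e e0.
have hd n : E (a + n.+2%:R^-1) `<=` E (a + n.+1%:R^-1).
  by apply: monoE; rewrite lerD2l lef_pV2 ?posrE ?ltr0n// ler_nat.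
have := hcvg_sq (decr_cvg (fun n => hE (a + n.+1%:R^-1)) hd u).
have -> : [set v | forall n : nat, E (a + n.+1%:R^-1) v] = E a.
  apply/seteqP; split=> v h; last by move=> n; apply: monoE h; rewrite lerDl invr_ge0.
  apply: rcE => b ab.
  have ba : 0 < b - a by rewrite subr_gt0.
  have := h (Num.truncn (b - a)^-1); apply: monoE.
  rewrite -lerBrDl invf_ple ?posrE ?ltr0n//.
  by apply/ltW/truncnS_gt.
move=> /cvgrPdist_lt/(_ e e0)[N _ hN].
have := hN N (leqnn N); rewrite /= distrC ger0_norm ?subr_ge0; last first.
  by apply: cumf_mono; rewrite lerDl invr_ge0.
move=> h; exists N.+1%:R^-1; first by rewrite /= invr_gt0.
move=> b /= ab ltab; rewrite distrC ger0_norm ?subr_ge0; last exact/cumf_mono/ltW.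
apply: le_lt_trans h; rewrite lerD2r; apply: cumf_mono.
by rewrite -lerBlDl; apply: ltW; move: ab; rewrite distrC gtr0_norm// subr_gt0.
Qed.

Definition cum u : cumulative R R :=
  HB.pack (cumf u) (isCumulative.Build R _ R (cumf u) (cumf_mono u) (@cumf_rc u)).

Definition smeas u : {measure set mT -> \bar R} := lebesgue_stieltjes_measure (cum u).

Lemma smeas_oc u a b : a <= b ->
  smeas u `]a, b]%classic = (hnorm (proj (E b) u) ^+ 2 - hnorm (proj (E a) u) ^+ 2)%:E.
Proof.
move=> ab; rewrite /smeas /= /lebesgue_stieltjes_measure /measure_extension.
rewrite measurable_mu_extE/=; last exact: is_ocitv.
by rewrite wlength_itv_bnd.
Qed.

Lemma smeas_T u : smeas u setT = (hnorm u ^+ 2)%:E.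
Proof.
(* The left endpoint is negative already for [n = 0], so that the subspace there is zero. *)
have h1 : (fun n : nat => smeas u `]-1 - n%:R, n%:R]%classic) @ \oo --> smeas u setT.
  have := @nondecreasing_cvg_mu _ mT R (smeas u) (fun n : nat => `]-1 - n%:R, n%:R]%classic).
  have -> : \bigcup_n `](-1 - n%:R : R), n%:R]%classic = setT.
    apply/seteqP; split => // x _; exists (Num.truncn `|x|).+1 => //=.
    rewrite in_itv /=; have := truncnS_gt `|x|.
    by move: (_.+1%:R) => N; rewrite ltr_norml => /andP[h1 h2]; apply/andP; split; lra.
  apply.
  - by move=> n; apply: sub_sigma_algebra; exact: is_ocitv.
  - exact: measurableT.
  - move=> a b ab; apply/subsetPset => x /=; rewrite !in_itv /=.
    have : a%:R <= b%:R :> R by rewrite ler_nat.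
    by move=> h /andP[h1 h2]; apply/andP; split; lra.
have h2 : (fun n : nat => smeas u `]-1 - n%:R, n%:R]%classic) @ \oo --> (hnorm u ^+ 2)%:E.
  have e n : smeas u `]-1 - n%:R, n%:R]%classic = (hnorm (proj (E n%:R) u) ^+ 2)%:E.
    rewrite smeas_oc; last by have : 0 <= n%:R :> R by []; lra.
    have /negE h : -1 - n%:R < 0 :> R by have : 0 <= n%:R :> R by []; lra.
    have -> : proj (E (-1 - n%:R)) u = 0 := h _ (proj_in (hE _) u).
    by rewrite hnorm0 expr0n subr0.
  under eq_fun do rewrite e.
  apply: cvg_EFin; first exact: nearW.
  have hi n : E n%:R `<=` E n.+1%:R by apply: monoE; rewrite ler_nat.
  have := hcvg_sq (incr_cvg (fun n => hE n%:R) hi u).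
  rewrite (_ : proj _ u = 0) ?subr0//.
  apply: topE; apply: (proj_in (csub_bigcap (fun n => @orth_csub _ _ (E n%:R)))).
exact: (cvg_unique (@ereal_hausdorff R) h1 h2).
Qed.

(** Dynkin's theorem: a half-open interval is represented by the part of [E b] orthogonal to [E a],
    and the class of representable sets is closed under complements and disjoint countable
    unions. *)
Lemma smeas_repr A : measurable A -> exists K, represents smeas A K.
Proof.
move=> mA; apply: (@dynkin_induction _ mT (@ocitv R) (fun A => exists K, represents smeas A K)) => //.
- exact: ocitvI.
- by exists setT; split=> [|u]; [exact: csubT | rewrite smeas_T proj_id].
- move=> _ [[a b] _ <-] /=.
  have [ab|ba] := leP a b; last first.
    exists [set 0]; split; first exact: csub0.
    move=> u; rewrite set_itv_ge ?measure0; last by rewrite bnd_simp -leNgt ltW.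
    by have /= -> := proj_in csub0 u; rewrite hnorm0 expr0n.
  exists (E b `&` orth (E a)); split; first by apply: csubI => //; exact: orth_csub.
  move=> u; rewrite smeas_oc// -proj_diff//; last exact: monoE.
  congr (hnorm _ ^+ 2)%:E; apply/esym/proj_uniq.
  + by apply: csubI => //; exact: orth_csub.
  + split; first by apply: csB => //; [exact: proj_in | apply: (monoE ab); exact: proj_in].
    rewrite -(proj_nest (hE a) (hE b)); last exact: monoE.
    exact: proj_orth.
  + move=> k [kb ka].
    have -> : u - (proj (E b) u - proj (E a) u) = (u - proj (E b) u) + proj (E a) u by vec.
    rewrite ipDl (proj_orth (hE b))// add0r; apply: ip_sym0; apply: ka; exact: proj_in.
- by move=> A' mA' [K hK]; exists (orth K); apply: repr_C => //; exact: smeas_T.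
- move=> F mF tF /choice[K hK]; exists (orth [set u | forall n, orth (K n) u]).
  by apply: repr_bigcup => //; exact: smeas_T.
Qed.

Definition fam_res := res_of smeas.
Lemma fam_resolution : resolution fam_res.
Proof. by apply: res_of_resolution; [exact: smeas_T | exact: smeas_repr]. Qed.
Lemma fam_scalar u : scalar_measure fam_res u (smeas u).
Proof. by apply: res_of_scalar; exact: smeas_repr. Qed.

End SpectralFamily.

(** * The Hilbert space of pairs, in which graphs live *)

Section ProdHilbert.
Context {R : realType} (H : hilbert R).
Local Notation C := R[i].
Definition pdot (a b : H * H) : C := ip a.1 b.1 + ip a.2 b.2.
Lemma pdot_bilinear : bilinear_for ( *%R : GRing.Scale.law _ _) (Num.conj \; *%R : GRing.Scale.law _ _) pdot.
Proof.
split=> [b|a] c u v; rewrite /pdot /= ?ipDl ?ipDr ?ipZl ?ipZr; ring.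
Qed.
HB.instance Definition _ := @bilinear_isBilinear.Build C (H * H)%type (H * H)%type C *%R (Num.conj \; *%R) pdot pdot_bilinear.
Lemma pdot_herm a b : pdot a b = (-1) ^+ false * Num.conj (pdot b a).
Proof. by rewrite expr0 mul1r /pdot rmorphD /= -!ipC. Qed.
HB.instance Definition _ := @isHermitianSesquilinear.Build C (H * H)%type false (@Num.conj C) pdot pdot_herm.
Lemma pdot_pos a : a != 0 -> 0 < pdot a a.
Proof.
case: a => a b; rewrite xpair_eqE negb_and /pdot /= => /orP[] h.
  by rewrite ltr_wpDr ?ip_ge0// (@neq0_dnorm_gt0 _ _ _ (hdot H)).
by rewrite ltr_wpDl ?ip_ge0// (@neq0_dnorm_gt0 _ _ _ (hdot H)).
Qed.
HB.instance Definition _ := @isDotProduct.Build C (H * H)%type pdot pdot_pos.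
Definition pdotf : {dot (H * H)%type for @Num.conj C} := pdot.

Lemma pnorm2 (a : H * H) : dot_norm pdotf a ^+ 2 = hnorm a.1 ^+ 2 + hnorm a.2 ^+ 2.
Proof.
rewrite /dot_norm /= /pdot ReDc -/(rip a.1 a.1) -/(rip a.2 a.2) -!hnorm2.
by rewrite sqr_sqrtr// addr_ge0// sqr_ge0.
Qed.
Lemma pnorm_ge0 (a : H * H) : 0 <= dot_norm pdotf a. Proof. exact: sqrtr_ge0. Qed.
Lemma pnorm_ge1 (a : H * H) : hnorm a.1 <= dot_norm pdotf a.
Proof. by rewrite -(@ler_pXn2r _ 2)// ?nnegrE ?pnorm_ge0// pnorm2 lerDl sqr_ge0. Qed.
Lemma pnorm_ge2 (a : H * H) : hnorm a.2 <= dot_norm pdotf a.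
Proof. by rewrite -(@ler_pXn2r _ 2)// ?nnegrE ?pnorm_ge0// pnorm2 lerDr sqr_ge0. Qed.
Lemma pnorm_le (a : H * H) : dot_norm pdotf a <= hnorm a.1 + hnorm a.2.
Proof.
rewrite -(@ler_pXn2r _ 2)// ?nnegrE ?pnorm_ge0 ?addr_ge0// pnorm2 sqrrD.
by rewrite lerD2r lerDl mulrn_wge0// mulr_ge0.
Qed.

Lemma pcomplete (u : nat -> H * H) : (forall e : R, 0 < e -> exists n0, forall m n,
   (n0 <= m)%N -> (n0 <= n)%N -> dot_norm pdotf (u m - u n) < e) ->
   exists l, dot_norm pdotf (u n - l) @[n --> \oo] --> (0 : R).
Proof.
move=> h.
have [l1 h1] : exists l, hcvg (fun n => (u n).1) l.
  apply: hcauchy_cvg => e /h[N hN]; exists N => m n Nm Nn.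
  exact: le_lt_trans (pnorm_ge1 (u m - u n)) (hN m n Nm Nn).
have [l2 h2] : exists l, hcvg (fun n => (u n).2) l.
  apply: hcauchy_cvg => e /h[N hN]; exists N => m n Nm Nn.
  exact: le_lt_trans (pnorm_ge2 (u m - u n)) (hN m n Nm Nn).
exists (l1, l2); apply: (@squeeze0 _ _ (fun n => hnorm ((u n).1 - l1) + hnorm ((u n).2 - l2))).
  by move=> n; rewrite pnorm_ge0 (le_trans (pnorm_le _)).
by rewrite -(addr0 0); apply: cvgD.
Qed.
Definition prodH : hilbert R := @Hilbert R (H * H)%type pdotf pcomplete.

Lemma prod_hcvg (s : nat -> prodH) (l : prodH) : hcvg s l <->
  hcvg (fun n => (s n).1) l.1 /\ hcvg (fun n => (s n).2) l.2.
Proof.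
split=> [h|[h1 h2]].
  split; apply: (squeeze0 _ h) => n; rewrite hnorm_ge0 /=.
    exact: (pnorm_ge1 (s n - l)).
  exact: (pnorm_ge2 (s n - l)).
apply: (@squeeze0 _ _ (fun n => hnorm ((s n).1 - l.1) + hnorm ((s n).2 - l.2))).
  by move=> n; rewrite hnorm_ge0 (le_trans (pnorm_le _)).
by rewrite -(addr0 0); apply: cvgD.
Qed.
End ProdHilbert.

(** * Closed operators as graphs; the resolvent of a positive self-adjoint operator *)

Section Graphs.
Context {R : realType} {H : hilbert R}.
Implicit Types (x y : graph H) (u v w : H).

Lemma graph_closureP x l m : graph_closure x (l, m) <->
  exists s t, [/\ forall n : nat, x (s n, t n), hcvg s l & hcvg t m].
Proof.
split=> [h|[s [t [hx hs ht]]]].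
  have {}h (n : nat) : exists z, [/\ x z, hnorm (l - z.1) <= n.+1%:R^-1 & hnorm (m - z.2) <= n.+1%:R^-1].
    have [|z xz [h1 h2]] := h n.+1%:R^-1; first by rewrite invr_gt0.
    by exists z; split => //; exact: ltW.
  have [z hz] := choice h.
  exists (fun n => (z n).1), (fun n => (z n).2); split.
  - by move=> n; have [+ _ _] := hz n; case: (z n).
  - apply: (@hcvg_le _ _ _ _ (fun n => n.+1%:R^-1)); last exact: cvg_inv_nat.
    by move=> n; rewrite hnormBC; have [] := hz n.
  - apply: (@hcvg_le _ _ _ _ (fun n => n.+1%:R^-1)); last exact: cvg_inv_nat.
    by move=> n; rewrite hnormBC; have [] := hz n.
move=> e e0; have /hcvgP/(_ _ e0)[N hN] := hs; have /hcvgP/(_ _ e0)[N' hN'] := ht.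
exists (s (maxn N N'), t (maxn N N')) => //=.
by rewrite hnormBC hN ?leq_maxl// hnormBC hN' ?leq_maxr.
Qed.

Lemma cdd_seq x (s t : nat -> H) l m : closed_dd x -> (forall n, x (s n, t n)) ->
  hcvg s l -> hcvg t m -> x (l, m).
Proof.
move=> hx h hs ht; apply: (cdd_closed hx); apply/graph_closureP.
by exists s, t.
Qed.

Lemma cdd_D x u v a b : closed_dd x -> x (u, a) -> x (v, b) -> x (u + v, a + b).
Proof. by move=> hx h1 h2; have := cdd_lin hx 1 h1 h2; rewrite /= !scale1r. Qed.
Lemma cdd_Z x c u a : closed_dd x -> x (u, a) -> x (c *: u, c *: a).
Proof. by move=> hx h1; have := cdd_lin hx c h1 (cdd_0 hx); rewrite /= !addr0. Qed.
Lemma cdd_B x u v a b : closed_dd x -> x (u, a) -> x (v, b) -> x (u - v, a - b).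
Proof.
move=> hx h1 h2; apply: cdd_D => //.
by rewrite -[- v]scaleN1r -[- b]scaleN1r; exact: cdd_Z.
Qed.
Lemma cdd_uniq x u a b : closed_dd x -> x (u, a) -> x (u, b) -> a = b.
Proof.
move=> hx h1 h2; have := cdd_B hx h1 h2; rewrite subrr => /(cdd_fun hx)/eqP.
by rewrite subr_eq0 => /eqP.
Qed.

Lemma psa_sym y u a v b : positive_sa y -> y (u, a) -> y (v, b) -> ip a v = ip u b.
Proof. by case=> hy hs _ h1 h2; move: h2; rewrite -hs => /(_ _ h1). Qed.
Lemma psa_pos y u a : positive_sa y -> y (u, a) -> 0 <= rip a u.
Proof. by case=> hy hs hp /hp; rewrite lecE => /andP[_]. Qed.

(** [B] is [(1 + y)^-1]. Positivity gives [|v| <= |v + y v|], so the range of [1 + y] is closed; a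
    vector [z] orthogonal to it satisfies [y z = - z] by self-adjointness and hence is zero. *)
Lemma psa_resolvent y : positive_sa y -> exists B : H -> H,
  [/\ linear B, sadj B, rpos B, contr B &
    (forall u, y (B u, u - B u)) /\ (forall u a, y (u, a) -> B (u + a) = u)].
Proof.
move=> hy; have [cy hs _] := hy.
pose K : set H := [set u | exists v, y (v, u - v)].
have hle v a : y (v, a) -> hnorm v <= hnorm (v + a) /\ hnorm a <= hnorm (v + a).
  move=> h; have h0 := psa_pos hy h.
  have e : hnorm (v + a) ^+ 2 = hnorm v ^+ 2 + 2 * rip a v + hnorm a ^+ 2.
    by rewrite !hnorm2 ip_sqrD (ripC v).
  by split; rewrite -(@ler_pXn2r _ 2)// ?nnegrE// e;
    have := sqr_ge0 (hnorm v); have := sqr_ge0 (hnorm a); lra.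
have hK : csub K.
  split.
  - by exists 0; rewrite subr0; exact: cdd_0.
  - move=> c u v [u' hu] [v' hv]; exists (c *: u' + v').
    have := cdd_D cy (cdd_Z c cy hu) hv.
    by congr (y (_, _)); vec.
  - move=> s l /choice[t ht] sl.
    have [p hp] : exists p, hcvg t p.
      apply: hcauchy_cvg => e e0; have /hcvgP/(_ (e / 2))[|N hN] := sl; first by rewrite divr_gt0.
      exists N => m n Nm Nn.
      have [h1 _] := hle _ _ (cdd_B cy (ht m) (ht n)).
      apply: (le_lt_trans h1).
      have -> : t m - t n + (s m - t m - (s n - t n)) = s m - s n by vec.
      apply: (le_lt_trans (hnormDB _ l _)); rewrite (hnormBC l).
      by have := hN m Nm; have := hN n Nn; lra.
    by exists p; apply: (cdd_seq cy ht hp); exact: hcvgB.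
have KT u : K u.
  suff: orth K = [set 0].
    move=> h; rewrite -(orthK hK) h => k ->; exact: ip0r.
  apply/seteqP; split=> [z hz|z ->]; last by move=> k _; exact: ip0l.
  have : y (z, - z).
    rewrite -hs => -[a b] /= hab; rewrite -/(ip _ _) -/(ip a _).
    have /ip_sym0 : ip z (a + b) = 0 by apply: hz; exists a; rewrite addrC addKr.
    by rewrite ipDl ipNr => /eqP; rewrite addrC addr_eq0 => /eqP.
  move/(psa_pos hy); rewrite ripNl oppr_ge0 -hnorm2 => h0.
  by apply: hnorm_eq0; apply/eqP; rewrite -sqrf_eq0 eq_le h0 sqr_ge0.
have /choice[B hB] u : exists v, y (v, u - v) by exact: KT.
have Bu u a : y (u, a) -> B (u + a) = u.
  move=> h; have [h1 _] := hle _ _ (cdd_B cy (hB (u + a)) h).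
  move: h1; rewrite (_ : _ - _ + _ = 0); last by vec.
  rewrite hnorm0 => h1; apply/eqP; rewrite -subr_eq0; apply/eqP/hnorm_eq0/eqP.
  by rewrite eq_le h1 hnorm_ge0.
have lB : linear B.
  move=> c u v; have := cdd_D cy (cdd_Z c cy (hB u)) (hB v).
  by move=> /Bu; rewrite (_ : _ + _ + _ = c *: u + v) //; vec.
exists B; split => //.
- move=> u v; have := psa_sym hy (hB u) (hB v).
  rewrite ipBl ipBr => h; apply/eqP; rewrite -subr_eq0.
  have -> : ip (B u) v - ip u (B v) = - (ip u (B v) - ip (B u) (B v)) + (ip (B u) v - ip (B u) (B v)) by ring.
  by rewrite h addNr.
- move=> u; have := psa_pos hy (hB u); rewrite ripBl subr_ge0 ripC => h.
  by rewrite ripC (le_trans (rip_ge0 (B u)))// ripC.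
- by move=> u; have [+ _] := hle _ _ (hB u); rewrite addrC subrK.
Qed.

End Graphs.

(** * The spectral family of a positive operator, read off its resolvent *)

Section ContractionFamily.
Context {R : realType} {H : hilbert R}.
Implicit Types (u v w : H) (a b c : R).
Variable B : H -> H.
Hypotheses (lB : linear B) (sB : sadj B) (pB : rpos B) (cB : contr B).
Hypothesis injB : forall u, B u = 0 -> u = 0.

Let bB : bounded_linear B := contr_bounded lB cB.
(** With [B = (1 + y)^-1] and [a >= 0] this operator is nonnegative exactly where [y <= a], so its
    spectral subspace for nonnegative values is that of [y] for values at most [a]. *)
Definition cut a u := B u - ((1 + a)^-1)%:C%C *: u.

Lemma cut_bounded a : bounded_linear (cut a).
Proof.
split; first by move=> c u v; rewrite /cut lB; vec.
exists (1 + `|(1 + a)^-1|) => u; apply: (le_trans (hnormB _ _)).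
by rewrite hnormZr mulrDl mul1r lerD2r.
Qed.
Lemma cut_sadj a : sadj (cut a).
Proof. by move=> u v; rewrite /cut ipBl ipBr sB ipZl ipZr conj_real. Qed.
Lemma cut_comm f a : linear f -> comm f B -> comm f (cut a).
Proof. by move=> lf fB u; rewrite /cut (linB lf) (linZ lf) fB. Qed.
Lemma cut_rip a u : rip (cut a u) u = rip (B u) u - (1 + a)^-1 * hnorm u ^+ 2.
Proof. by rewrite /cut ripBl ripZl hnorm2. Qed.

Definition lowK a : set H := xget setT [set K | [/\ csub K,
    (forall f, bounded_linear f -> comm f (cut a) -> forall u, K u -> K (f u)),
    (forall u, K u -> 0 <= rip (cut a u) u) &
    (forall u, orth K u -> u <> 0 -> rip (cut a u) u < 0)]].

Lemma lowKP a : [/\ csub (lowK a),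
    (forall f, bounded_linear f -> comm f (cut a) -> forall u, lowK a u -> lowK a (f u)),
    (forall u, lowK a u -> 0 <= rip (cut a u) u) &
    (forall u, orth (lowK a) u -> u <> 0 -> rip (cut a u) u < 0)].
Proof. exact: (xgetPex setT (spectral_split (cut_bounded a) (@cut_sadj a))). Qed.

(** Negative levels get the zero subspace by hand: [cut a] describes [y <= a] only when [1 + a] is
    positive. *)
Definition lowE a : set H := if a < 0 then [set 0] else lowK a.

Lemma lowE_csub a : csub (lowE a).
Proof. by rewrite /lowE; case: ifP => _; [exact: csub0 | case: (lowKP a)]. Qed.
Lemma lowE_inv f a : bounded_linear f -> comm f B -> forall u, lowE a u -> lowE a (f u).
Proof.
move=> bf fB u; rewrite /lowE; case: ifP => _ /=.
  by move=> ->; rewrite lin0//; case: bf.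
by case: (lowKP a) => _ h _ _; apply: h => //; apply: cut_comm => //; case: bf.
Qed.
Lemma lowE_ge a u : 0 <= a -> lowE a u -> (1 + a)^-1 * hnorm u ^+ 2 <= rip (B u) u.
Proof.
move=> a0; rewrite /lowE ltNge a0 /=; case: (lowKP a) => _ _ h _ /h.
by rewrite cut_rip subr_ge0.
Qed.
Lemma lowE_lt a u : 0 <= a -> orth (lowE a) u -> u <> 0 ->
  rip (B u) u < (1 + a)^-1 * hnorm u ^+ 2.
Proof.
move=> a0; rewrite /lowE ltNge a0 /=; case: (lowKP a) => _ _ _ h h1 h2.
by have := h u h1 h2; rewrite cut_rip subr_lt0.
Qed.
Lemma orth_lowE_inv f a : bounded_linear f -> sadj f -> comm f B ->
  forall u, orth (lowE a) u -> orth (lowE a) (f u).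
Proof. by move=> bf sf fB u hu k hk; rewrite sf; apply: hu; exact: lowE_inv. Qed.
Lemma comm_proj f K : csub K -> linear f -> (forall u, K u -> K (f u)) ->
  (forall u, orth K u -> orth K (f u)) -> comm f (proj K).
Proof.
move=> hK lf h1 h2 u; apply/esym; apply: proj_uniq => //.
  by apply: h1; exact: proj_in.
by rewrite -(linB lf); apply: h2; exact: proj_orth.
Qed.
Lemma lowE_comm f a : bounded_linear f -> sadj f -> comm f B -> comm f (proj (lowE a)).
Proof.
move=> bf sf fB; apply: comm_proj; first exact: lowE_csub.
- by case: bf.
- by move=> u; exact: lowE_inv.
- by move=> u; exact: orth_lowE_inv.
Qed.
Lemma projE_commB a : comm (proj (lowE a)) B.
Proof. by move=> u; rewrite (lowE_comm _ bB). Qed.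
Lemma projE_bounded a : bounded_linear (proj (lowE a)).
Proof. exact/proj_bounded/lowE_csub. Qed.
Lemma projE_in a b u : lowE a u -> lowE a (proj (lowE b) u).
Proof. by apply: lowE_inv; [exact: projE_bounded | exact: projE_commB]. Qed.

Lemma lowE_neg a : a < 0 -> lowE a `<=` [set 0].
Proof. by rewrite /lowE => ->. Qed.

Lemma inv1_le a b : 0 <= a -> a <= b -> (1 + b)^-1 <= (1 + a)^-1.
Proof. by move=> a0 ab; rewrite lef_pV2 ?posrE; lra. Qed.

Lemma lowE_mono a b : a <= b -> lowE a `<=` lowE b.
Proof.
move=> ab u; have [a0|a0] := ltP a 0.
  by move/(lowE_neg a0) => ->; exact: cs0 (lowE_csub b).
move=> ua; pose q := u - proj (lowE b) u.
suff q0 : q = 0.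
  by move/eqP: q0; rewrite subr_eq0 => /eqP ->; exact: proj_in (lowE_csub b) u.
have qo : orth (lowE b) q by exact: proj_orth (lowE_csub b) u.
have qa : lowE a q by apply: (csB (lowE_csub a)) => //; exact: projE_in.
apply: contrapT => qn; have := lowE_lt (le_trans a0 ab) qo qn.
have := lowE_ge a0 qa; have := inv1_le a0 ab.
move=> h1 h2 h3; suff : (1 + b)^-1 * hnorm q ^+ 2 <= (1 + a)^-1 * hnorm q ^+ 2 by lra.
by apply: ler_wpM2r => //; exact: sqr_ge0.
Qed.

Lemma lowE_rc a u : (forall b, a < b -> lowE b u) -> lowE a u.
Proof.
move=> h; have [a0|a0] := ltP a 0.
  have /lowE_neg hn : a / 2 < 0 by lra.
  have : lowE (a / 2) u by apply: h; lra.
  by move/hn => ->; exact: cs0 (lowE_csub a).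
pose q := u - proj (lowE a) u.
suff q0 : q = 0.
  by move/eqP: q0; rewrite subr_eq0 => /eqP ->; exact: proj_in (lowE_csub a) u.
have qo : orth (lowE a) q by exact: proj_orth (lowE_csub a) u.
have qb b : a < b -> lowE b q.
  move=> ab; apply: (csB (lowE_csub b)); first exact: h.
  by apply: projE_in; exact: h.
apply: contrapT => qn; have := lowE_lt a0 qo qn.
have n0 : 0 < hnorm q ^+ 2 by rewrite exprn_gt0// hnorm_gt0.
rewrite -ltr_pdivrMr//; set r := _ / _ => rc.
have r0 : 0 <= r by rewrite divr_ge0// ?pB// ltW.
(* [s] lies strictly between the quotient of [<B q, q>] by [|q|^2] and [(1 + a)^-1]. The level
   [s^-1 - 1] exceeds [a], and membership of [q] there forces the quotient to be at least [s]. *)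
pose s := (r + (1 + a)^-1) / 2.
have c0 : 0 < (1 + a)^-1 by rewrite invr_gt0; lra.
have s0 : 0 < s by rewrite /s; lra.
have sa : s < (1 + a)^-1 by rewrite /s; lra.
have ab : a < s^-1 - 1.
  rewrite ltrBrDl -[X in X < _]invrK ltf_pV2 ?posrE ?invr_gt0//; lra.
have := lowE_ge _ (qb _ ab); rewrite addrCA subrr addr0 invrK => /(_ ltac:(lra)).
by rewrite -ler_pdivlMr// -/r /s; lra.
Qed.

Lemma lowE_top u : (forall n : nat, orth (lowE n%:R) u) -> u = 0.
Proof.
move=> h; apply: contrapT => un; have n0 : 0 < hnorm u ^+ 2 by rewrite exprn_gt0// hnorm_gt0.
have : rip (B u) u <= 0.
  have e : (fun n : nat => n.+1%:R^-1 * hnorm u ^+ 2) @ \oo --> (0 : R).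
    rewrite -(mul0r (hnorm u ^+ 2)); apply: cvgM; [exact: cvg_inv_nat | exact: cvg_cst].
  apply: (ler_cvg_to (cvg_cst _) e); apply: nearW => n.
  apply/ltW; have := lowE_lt (ler0n R n) (h n) un.
  by rewrite -natr1 [n%:R + 1]addrC.
move=> h0; have : rip (B u) u = 0 by apply/eqP; rewrite eq_le h0 pB.
by move/(rpos0 bB sB pB)/injB.
Qed.

(** On [lowE a] the operator [B] is bounded below, so its image is closed; a vector of [lowE a]
    orthogonal to the image satisfies [<B q, q> = 0] and vanishes. Consequently these subspaces lie
    in the domain of [y]. *)
Lemma lowE_onto a u : 0 <= a -> lowE a u -> exists2 v, lowE a v & u = B v.
Proof.
move=> a0 ua; have c0 : 0 < (1 + a)^-1 by rewrite invr_gt0; lra.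
have hE := lowE_csub a.
have EB v : lowE a v -> lowE a (B v) by apply: lowE_inv.
have lo v : lowE a v -> (1 + a)^-1 * hnorm v <= hnorm (B v).
  move=> va; have [->|/eqP vn] := eqVneq v 0; first by rewrite hnorm0 mulr0.
  rewrite -(ler_pM2r (hnorm_gt0 vn)) -mulrA -expr2.
  by rewrite (le_trans (lowE_ge a0 va))// rip_le.
pose K : set H := [set w | exists2 v, lowE a v & w = B v].
have hK : csub K.
  split; first by exists 0; [exact: cs0 | rewrite (lin0 lB)].
    by move=> c w1 w2 [v1 h1 ->] [v2 h2 ->]; exists (c *: v1 + v2); [exact: csL | rewrite lB].
  move=> s l hs sl.
  have /choice[t ht] n : exists v, lowE a v /\ s n = B v by have [v h1 h2] := hs n; exists v.
  have [p hp] : exists p, hcvg t p.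
    apply: hcauchy_cvg => e e0; have /hcvgP/(_ ((1 + a)^-1 * e / 2))[|N hN] := sl.
      by rewrite divr_gt0// mulr_gt0.
    exists N => m n Nm Nn; have [tm sm] := ht m; have [tn sn] := ht n.
    rewrite -(ltr_pM2l c0); apply: (le_lt_trans (lo _ (csB hE tm tn))).
    rewrite (linB lB) -sm -sn; apply: (le_lt_trans (hnormDB _ l _)); rewrite (hnormBC l).
    by have := hN m Nm; have := hN n Nn; lra.
  exists p; first by apply: (csC hE _ hp) => n; case: (ht n).
  apply: (hcvg_uniq sl); have := hcvg_bounded bB hp.
  by rewrite (_ : B \o t = s)//; apply/funext => n /=; case: (ht n).
pose q := u - proj K u.
have KE : K `<=` lowE a by move=> _ [v va ->]; exact: EB.
have qa : lowE a q by apply: csB => //; apply: KE; exact: proj_in.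
have q0 : q = 0.
  have : ip q (B q) = 0 by apply: (proj_orth hK); exists q.
  move=> /ip_sym0 h; have := lowE_ge a0 qa; rewrite /rip h /= => h1.
  apply: hnorm_eq0; apply/eqP; rewrite -sqrf_eq0 eq_le sqr_ge0 andbT.
  by rewrite -(ler_pM2l c0) mulr0.
have : K u by move/eqP: q0; rewrite subr_eq0 => /eqP ->; exact: proj_in.
by [].
Qed.

Lemma orth_lowE_pre a v : orth (lowE a) (B v) -> orth (lowE a) v.
Proof.
move=> h; apply: proj0_orth; first exact: lowE_csub.
by apply: injB; rewrite -projE_commB; apply: proj_orthE h; exact: lowE_csub.
Qed.

Lemma sqrtB : exists S, [/\ bounded_linear S, sadj S, (forall u, S (S u) = B u) & comm S B].
Proof.
have [S [bS sS _ SS cm]] := sqrt_bounded bB sB pB; exists S; split => // u.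
by rewrite -!SS.
Qed.

(** [v - B v] is the value of [y] at [B v]. The bound is [lowE_ge] at [S v] with [S] the square root
    of [B], which turns the form of [B] into [|B v|^2] and [|S v|^2] into [<v, B v>]. *)
Lemma lowE_form_le a v : 0 <= a -> lowE a v ->
  rip (v - B v) (B v) <= a * hnorm (B v) ^+ 2.
Proof.
move=> a0 va; have [S [bS sS SS cS]] := sqrtB; have [lS _] := bS.
have h := lowE_ge a0 (lowE_inv bS cS va).
have a1 : 0 < 1 + a by lra.
have e1 : rip (B (S v)) (S v) = hnorm (B v) ^+ 2.
  by rewrite -cS (sadj_rip sS) SS hnorm2.
have e2 : hnorm (S v) ^+ 2 = rip v (B v) by rewrite hnorm2 (sadj_rip sS) SS.
move: h; rewrite e1 e2 ler_pdivrMl// ripBl -hnorm2; lra.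
Qed.

Lemma lowE_form_gt a v : 0 <= a -> orth (lowE a) v -> v <> 0 ->
  a * hnorm (B v) ^+ 2 < rip (v - B v) (B v).
Proof.
move=> a0 va vn; have [S [bS sS SS cS]] := sqrtB; have [lS _] := bS.
have Sn : S v <> 0.
  by move=> h; apply: vn; apply: injB; rewrite -SS h (lin0 lS).
have h := lowE_lt a0 (orth_lowE_inv bS sS cS va) Sn.
have a1 : 0 < 1 + a by lra.
have e1 : rip (B (S v)) (S v) = hnorm (B v) ^+ 2.
  by rewrite -cS (sadj_rip sS) SS hnorm2.
have e2 : hnorm (S v) ^+ 2 = rip v (B v) by rewrite hnorm2 (sadj_rip sS) SS.
move: h; rewrite e1 e2 ltr_pdivlMl// ripBl -hnorm2; lra.
Qed.

End ContractionFamily.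

(** * Stieltjes integrals of monotone weights *)

Section Bracket.
Context {R : realType}.
Local Notation mT := (measurableTypeR R).
Variables (m : {measure set mT -> \bar R}) (c g w : R -> R).
Hypothesis mfin : (m setT < +oo)%E.
Hypothesis mc : forall a b, a <= b -> m `]a, b]%classic = (c b - c a)%:E.
Hypothesis wmono : forall a b : R, 0 <= a -> a <= b -> w a <= w b.
Hypothesis w0 : w 0 = 0.
Hypothesis glo : forall a b : R, 0 <= a -> a <= b -> w a * (c b - c a) <= g b - g a.
Hypothesis ghi : forall a b : R, 0 <= a -> a <= b -> g b - g a <= w b * (c b - c a).
Variable f : R -> R.
Hypothesis mf : measurable_fun [set: mT] (f : mT -> R).
Hypothesis f0 : forall l : R, 0 <= f l.
Hypothesis fw : forall l : R, 0 <= l -> f l = w l.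

Lemma moc (a b : R) : measurable (`]a, b]%classic : set mT).
Proof. by apply: sub_sigma_algebra; exact: is_ocitv. Qed.

Let I (a b : R) : \bar R := (\int[m]_(l in `]a, b]%classic) (f l)%:E)%E.

Let mfE (D : set mT) : measurable D -> measurable_fun D (EFin \o f : mT -> \bar R).
Proof.
by move=> mD; apply/measurable_EFinP; apply: measurable_funS mf.
Qed.

(** The increment of [g] obeys the same two bounds by hypothesis. The difference of the two
    quantities is therefore controlled by the oscillation of [w], and refining the partition
    identifies them. *)
Lemma bracket_I (a b : R) : 0 <= a -> a <= b ->
  ((w a * (c b - c a))%:E <= I a b <= (w b * (c b - c a))%:E)%E.
Proof.
move=> a0 ab; apply/andP; split.
  rewrite EFinM -mc// -integral_cst; last exact: moc.
  apply: ge0_le_integral => //.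
  - by move=> l _; rewrite lee_fin -w0 wmono.
  - apply: mfE; exact: moc.
  - move=> l /=; rewrite in_itv /= => /andP[al lb].
    by rewrite lee_fin fw ?(le_trans a0 (ltW al))// wmono// ltW.
rewrite EFinM -mc// -integral_cst; last exact: moc.
apply: ge0_le_integral => //.
- by move=> l _; rewrite lee_fin.
- apply: mfE; exact: moc.
- move=> l /=; rewrite in_itv /= => /andP[al lb].
  by rewrite lee_fin fw ?(le_trans a0 (ltW al))// wmono// (le_trans a0 (ltW al)).
Qed.

Lemma bracket_add (a d b : R) : 0 <= a -> a <= d -> d <= b -> (I a b = I a d + I d b)%E.
Proof.
move=> a0 ad db; rewrite /I -ge0_integral_setU//.
- congr (integral _ _ _); apply/seteqP; split=> l /=; rewrite !in_itv /=.
    move=> /andP[al lb]; have [ld|dl] := leP l d; [left|right]; by rewrite ?al ?lb.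
  by move=> [] /andP[h1 h2]; apply/andP; split; lra.
- by apply: mfE; apply: measurableU; exact: moc.
- by move=> l _; rewrite lee_fin.
- rewrite disj_set2E; apply/eqP/seteqP; split=> l //=; rewrite !in_itv /=.
  by move=> [/andP[_ h1] /andP[h2 _]]; lra.
Qed.

Lemma bracket_fin (a b : R) : 0 <= a -> a <= b -> I a b = (fine (I a b))%:E.
Proof.
move=> a0 ab; have /andP[h1 h2] := bracket_I a0 ab.
rewrite fineK// fin_numE; apply/andP; split; apply/eqP => h.
  by move: h1; rewrite h.
by move: h2; rewrite h.
Qed.

(* Halving the interval k times divides the defect of the bracket by 2^k. *)
Lemma bracket_halving (L : R) : 0 <= L ->
  forall k (a b : R), 0 <= a -> a <= b ->
  (forall a' b', a <= a' -> a' <= b' -> b' <= b -> w b' - w a' <= L * (b' - a')) ->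
  `|fine (I a b) - (g b - g a)| <= L * (b - a) * (c b - c a) / 2 ^+ k.
Proof.
move=> L0; elim=> [|k IH] a b a0 ab wL.
  have h0 : 0 <= c b - c a by rewrite -lee_fin -mc// measure_ge0.
  have /andP[h1 h2] := bracket_I a0 ab; move: h1 h2.
  rewrite bracket_fin// !lee_fin => h1 h2.
  have := glo a0 ab; have := ghi a0 ab => h3 h4.
  have : (w b - w a) * (c b - c a) <= L * (b - a) * (c b - c a).
    by apply: ler_wpM2r => //; exact: wL.
  rewrite expr0 divr1 mulrBl ler_norml => h5.
  apply/andP; split; lra.
pose d := (a + b) / 2; have ad : a <= d by rewrite /d; lra.
have db : d <= b by rewrite /d; lra.
have d0 : 0 <= d by lra.
have h1 := IH a d a0 ad; have h2 := IH d b d0 db.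
have e : fine (I a b) = fine (I a d) + fine (I d b).
  have := bracket_add a0 ad db.
  rewrite {1}(bracket_fin a0 ab) {1}(bracket_fin a0 ad) {1}(bracket_fin d0 db).
  by rewrite -EFinD => -[].
have -> : fine (I a b) - (g b - g a) = (fine (I a d) - (g d - g a)) + (fine (I d b) - (g b - g d)).
  by rewrite e; lra.
apply: (le_trans (ler_normD _ _)); apply: (le_trans (lerD (h1 _) (h2 _))).
- by move=> a' b' ? ? ?; apply: wL => //; lra.
- by move=> a' b' ? ? ?; apply: wL => //; lra.
have -> : d - a = (b - a) / 2 by rewrite /d; field.
have -> : b - d = (b - a) / 2 by rewrite /d; field.
rewrite exprS le_eqVlt; apply/orP; left; apply/eqP; field.
by rewrite expf_neq0.
Qed.

Lemma bracket_eq (L b : R) : 0 <= L -> 0 <= b ->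
  (forall a' b', 0 <= a' -> a' <= b' -> b' <= b -> w b' - w a' <= L * (b' - a')) ->
  I 0 b = (g b - g 0)%:E.
Proof.
move=> L0 b0 wL; rewrite bracket_fin//; congr _%:E.
apply/eqP; rewrite -subr_eq0 -normr_le0.
set C := L * (b - 0) * (c b - c 0).
have e : (fun k : nat => C / 2 ^+ k) @ \oo --> (0 : R).
  rewrite -(mulr0 C); apply: cvgM; first exact: cvg_cst.
  under eq_fun do rewrite -exprVn.
  by apply: cvg_expr; rewrite ger0_norm ?invr_ge0// invf_lt1// ltr1n.
apply: (ler_cvg_to (cvg_cst _) e); apply: nearW => k.
exact: bracket_halving.
Qed.

Hypothesis cneg : forall a : R, a < 0 -> c a = 0.
Hypothesis wL : forall b : R, 0 <= b -> exists2 L : R, 0 <= L &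
  forall a' b', 0 <= a' -> a' <= b' -> b' <= b -> w b' - w a' <= L * (b' - a').

Lemma m_neg : m [set l : mT | (l < 0)%R] = 0%E.
Proof.
have mF n : measurable (`]-1 - n%:R, - n.+1%:R^-1]%classic : set mT) by exact: moc.
have U : \bigcup_n (`](-1 - n%:R : R), - n.+1%:R^-1]%classic : set mT) = [set l | l < 0].
  apply/seteqP; split=> [l [n _ /=]|l /= l0].
    rewrite in_itv /= => /andP[_ h]; apply: (le_lt_trans h).
    by rewrite oppr_lt0 invr_gt0.
  have l1 : 0 < - l by rewrite oppr_gt0.
  exists (maxn (Num.truncn (- l)) (Num.truncn (- l)^-1)) => //=.
  rewrite in_itv /=; apply/andP; split.
    have := truncnS_gt (- l); set N := Num.truncn (- l) => h.
    have : N%:R <= (maxn N (Num.truncn (- l)^-1))%:R :> R by rewrite ler_nat leq_maxl.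
    by move: h; rewrite -natr1; lra.
  rewrite lerNr -[leRHS]invrK lef_pV2 ?posrE ?invr_gt0//.
  apply: (le_trans (ltW (truncnS_gt _))); rewrite ler_nat ltnS; exact: leq_maxr.
have h := @nondecreasing_cvg_mu _ mT R m _ mF.
have h1 : (m \o (fun n : nat => `]-1 - n%:R, - n.+1%:R^-1]%classic)) @ \oo --> m [set l : mT | (l < 0)%R].
  rewrite -U; apply: h; first by rewrite U -U; exact: bigcup_measurable.
  apply/nondecreasing_seqP => n; apply/subsetPset => l /=; rewrite !in_itv /=.
  move=> /andP[h1 h2]; apply/andP; split; first by rewrite -natr1; lra.
  by rewrite (le_trans h2)// lerN2 lef_pV2 ?posrE// ler_nat.
apply: (cvg_unique (@ereal_hausdorff R) h1).
rewrite (_ : _ \o _ = cst 0%E); first exact: cvg_cst.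
apply/funext => n /=.
have n0 : 0 < n.+1%:R^-1 :> R by rewrite invr_gt0.
have n1 : n.+1%:R^-1 <= 1 :> R by rewrite invf_le1// ler1n.
have n2 : 0 <= n%:R :> R by [].
have n3 : -1 - n%:R < 0 :> R by lra.
have n4 : -1 - n%:R <= - n.+1%:R^-1 :> R.
  by move: (n.+1%:R^-1) n1 => i i1; lra.
by rewrite mc// !cneg ?subrr// oppr_lt0.
Qed.

Lemma m_neg_meas : measurable [set l : mT | (l < 0)%R].
Proof.
have -> : [set l : mT | (l < 0)%R] = `]-oo, 0[%classic by apply/seteqP; split=> l /=; rewrite in_itv.
exact: (@measurable_itv R).
Qed.

Lemma bracket_total : (fun n : nat => (g n%:R - g 0)%:E) @ \oo -->
  (\int[m]_(l in setT) (f l)%:E)%E.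
Proof.
have mN := m_neg_meas.
have h1 : (\int[m]_(l in setT) (f l)%:E = \int[m]_(l in setT `\` [set l : mT | (l < 0)%R]) (f l)%:E)%E.
  apply: ge0_negligible_integral => //; first exact: mfE.
    by move=> l _; rewrite lee_fin.
  exact: m_neg.
have m0 : measurable ([set 0] : set mT) by exact: (@measurable_set1 R).
have U : setT `\` [set l : mT | (l < 0)%R] = [set 0] `|` \bigcup_n (`](0 : R), n%:R]%classic : set mT).
  apply/seteqP; split=> [l [_ /= /negP]|l].
    rewrite -leNgt le_eqVlt => /orP[/eqP <-|l0]; first by left.
    right; exists (Num.truncn l).+1 => //=; rewrite in_itv /= l0 /=.
    exact/ltW/truncnS_gt.
  move=> [->|[n _ /=]]; first by split => //=; rewrite ltxx.
  by rewrite in_itv /= => /andP[l0 _]; split => //; apply/negP; rewrite -leNgt ltW.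
have mU : measurable (\bigcup_n (`](0 : R), n%:R]%classic : set mT)).
  by apply: bigcup_measurable => n _; exact: moc.
rewrite h1 U ge0_integral_setU//; last 3 first.
- by apply: mfE; exact: measurableU.
- by move=> l _; rewrite lee_fin.
- rewrite disj_set2E; apply/eqP/seteqP; split=> // l [->] [n _ /=].
  by rewrite in_itv /= ltxx.
rewrite [X in (X + _)%E](_ : _ = 0%E) ?add0e; last first.
  by apply: integral0_eq => l ->; rewrite fw// w0.
have -> : (fun n : nat => (g n%:R - g 0)%:E) = (fun n : nat => I 0 n%:R).
  apply/funext => n; have [L L0 hL] := wL (ler0n R n).
  by rewrite (bracket_eq L0).
apply: (@ge0_nondecreasing_set_cvg_integral _ mT).
- apply/nondecreasing_seqP => n; apply/subsetPset => l /=; rewrite !in_itv /=.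
  by move=> /andP[-> h] /=; rewrite (le_trans h)// ler_nat.
- by move=> n; exact: moc.
- by move=> n; apply: mfE; exact: moc.
- by move=> n l _; rewrite lee_fin.
Qed.

End Bracket.

(** * Truncations of [y] and their moments *)

Section SpectralExistence.
Context {R : realType} {H : hilbert R}.
Local Notation mT := (measurableTypeR R).
Implicit Types (u v w : H) (a b c : R).
Variables (y : graph H) (hy : positive_sa y) (B : H -> H).
Hypotheses (lB : linear B) (sB : sadj B) (pB : rpos B) (cB : contr B).
Hypothesis yB : forall u, y (B u, u - B u).
Hypothesis By : forall u w, y (u, w) -> B (u + w) = u.

Let cy : closed_dd y. Proof. by case: hy. Qed.
Lemma res_inj u : B u = 0 -> u = 0.
Proof. by move=> h; have := yB u; rewrite h subr0 => /(cdd_fun cy). Qed.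

Local Notation E := (lowE B).
Local Notation P a := (proj (lowE B a)).
Let hE a : csub (E a) := lowE_csub lB sB cB a.
Let Em a b : a <= b -> E a `<=` E b := @lowE_mono _ _ B lB sB cB a b.

Lemma y_inv a u w : y (u, w) -> y (P a u, P a w).
Proof.
move=> h; have e : B (P a (u + w)) = P a u by rewrite -projE_commB// By.
have := yB (P a (u + w)); rewrite e; congr (y (_, _)).
by rewrite (linD (proj_linear (hE a))) addrC addKr.
Qed.

(** The bounded truncation [y P_b], everywhere defined for [b >= 0] because [lowE B b] lies in the
    domain of [y]. *)
Definition Yop b u : H := xget 0 [set w | y (P b u, w)].

Lemma Yop_ex b u : 0 <= b -> exists w, y (P b u, w).
Proof.
move=> b0; have [v _ ->] := lowE_onto lB sB cB b0 (proj_in (hE b) u).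
by exists (v - B v).
Qed.
Lemma YopP b u : 0 <= b -> y (P b u, Yop b u).
Proof. by move=> b0; exact: (xgetPex 0 (Yop_ex u b0)). Qed.
Lemma Yop_consist a b u : 0 <= a -> a <= b -> P a (Yop b u) = Yop a u.
Proof.
move=> a0 ab; have := y_inv a (YopP u (le_trans a0 ab)).
rewrite proj_nest//; last exact: Em.
by move=> h; exact: cdd_uniq cy h (YopP u a0).
Qed.
Lemma Yop_in b u : 0 <= b -> E b (Yop b u).
Proof. by move=> b0; rewrite -(Yop_consist u b0 (lexx b)); exact: proj_in. Qed.
Lemma Yop_linear b : 0 <= b -> linear (Yop b).
Proof.
move=> b0 c u v; apply: (cdd_uniq cy (YopP _ b0)).
rewrite (proj_linear (hE b)); apply: (cdd_D cy); last exact: YopP.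
by apply: (cdd_Z _ cy); exact: YopP.
Qed.
Lemma Yop_proj b u v : 0 <= b -> ip (Yop b u) v = ip (Yop b u) (P b v).
Proof. by move=> b0; rewrite -(proj_sa (hE b)) proj_id//; exact: Yop_in. Qed.
Lemma Yop_sadj b : 0 <= b -> sadj (Yop b).
Proof.
move=> b0 u v; rewrite Yop_proj// (psa_sym hy (YopP u b0) (YopP v b0)).
by rewrite ipC [in RHS]ipC [in RHS]Yop_proj.
Qed.
Lemma Yop_form b u : 0 <= b -> E b u -> forall w, y (u, w) -> rip w u <= b * hnorm u ^+ 2.
Proof.
move=> b0 ub w h; have [v vb e] := lowE_onto lB sB cB b0 ub.
have := lowE_form_le lB sB pB cB b0 vb; rewrite -e => h1.
by rewrite (cdd_uniq cy h (_ : y (u, v - u)))// e.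
Qed.
Lemma Yop_rpos b : 0 <= b -> rpos (Yop b).
Proof.
by move=> b0 u; rewrite /rip Yop_proj//; exact: (psa_pos hy (YopP u b0)).
Qed.
Lemma Yop_le b u : 0 <= b -> rip (Yop b u) u <= b * hnorm u ^+ 2.
Proof.
move=> b0; rewrite /rip Yop_proj//.
apply: (le_trans (Yop_form b0 (proj_in (hE b) u) (YopP u b0))).
by rewrite ler_wpM2l// ler_pXn2r ?nnegrE// proj_le.
Qed.
Lemma Yop_norm b u : 0 <= b -> hnorm (Yop b u) ^+ 2 <= b ^+ 2 * hnorm u ^+ 2.
Proof.
move=> b0; rewrite expr2 -mulrA.
apply: (le_trans (rpos_sq_le (Yop_linear b0) (Yop_sadj b0) (Yop_rpos b0) b0 (fun u => Yop_le u b0) u)).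
by rewrite ler_wpM2l// Yop_le.
Qed.

Section OneVector.
Variable xi : H.
Local Notation c := (cumf E xi).
(** [g1] and [g2] are the first and second moments of [xi] up to level [b]. They are the functions
    [g] of the bracket argument, with weights [l] and [l^2]. *)
Definition g1 b : R := rip (Yop b xi) (P b xi).
Definition g2 b : R := hnorm (Yop b xi) ^+ 2.
Local Notation d a b := (P b xi - P a xi).
Local Notation ee a b := (Yop b xi - Yop a xi).

Lemma d_y a b : 0 <= a -> a <= b -> y (d a b, ee a b).
Proof. by move=> a0 ab; apply: (cdd_B cy); apply: YopP => //; lra. Qed.
Lemma d_in a b : a <= b -> E b (d a b).
Proof.
move=> ab; apply: (csB (hE b)); first exact: proj_in.
by apply: (Em ab); exact: proj_in.
Qed.
Lemma d_orth a b : a <= b -> orth (E a) (d a b).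
Proof.
move=> ab; rewrite -(proj_nest (hE a) (hE b)); last exact: Em.
exact: proj_orth.
Qed.
Lemma d_norm a b : a <= b -> hnorm (d a b) ^+ 2 = c b - c a.
Proof. by move=> ab; rewrite proj_diff//; exact: Em. Qed.
Lemma g1_diff a b : 0 <= a -> a <= b -> g1 b - g1 a = rip (ee a b) (d a b).
Proof.
move=> a0 ab; rewrite /g1 ripBl !ripBr.
have e1 : rip (Yop b xi) (P a xi) = rip (Yop a xi) (P a xi).
  by rewrite /rip -(Yop_consist xi a0 ab) proj_sa// projK.
have e2 : rip (Yop a xi) (P b xi) = rip (Yop a xi) (P a xi).
  rewrite /rip Yop_proj//; congr (complex.Re (ip _ _)).
  by rewrite proj_nest//; exact: Em.
rewrite e1 e2; ring.
Qed.
Lemma g2_diff a b : 0 <= a -> a <= b -> g2 b - g2 a = hnorm (ee a b) ^+ 2.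
Proof.
move=> a0 ab; rewrite /g2 [in LHS](proj_pyth (hE a) (Yop b xi)) Yop_consist//.
by rewrite addrAC subrr add0r.
Qed.
Lemma e_low a b : 0 <= a -> a <= b -> a * hnorm (d a b) ^+ 2 <= rip (ee a b) (d a b).
Proof.
move=> a0 ab; set D := d a b; set e := ee a b.
have [->|/eqP dn] := eqVneq D 0; first by rewrite hnorm0 expr0n /= mulr0 rip0r.
have dy : y (D, e) by exact: d_y.
have eD : B (D + e) = D by exact: By.
have hn : D + e <> 0 by move=> h; apply: dn; rewrite -eD h (lin0 lB).
(* [D + e] is the preimage of [D] under [B]; it inherits from [D] the orthogonality to [E a], which
   makes the lower bound of the form applicable. *)
have ho : orth (E a) (D + e).
  by apply: (orth_lowE_pre lB sB cB res_inj); rewrite eD; exact: d_orth.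
have := lowE_form_gt lB sB pB cB res_inj a0 ho hn.
by rewrite eD addrAC subrr add0r => /ltW.
Qed.
Lemma e_high a b : 0 <= a -> a <= b -> rip (ee a b) (d a b) <= b * hnorm (d a b) ^+ 2.
Proof.
move=> a0 ab; apply: Yop_form; [lra | exact: d_in | exact: d_y].
Qed.
Lemma e_norm_low a b : 0 <= a -> a <= b ->
  a ^+ 2 * hnorm (d a b) ^+ 2 <= hnorm (ee a b) ^+ 2.
Proof.
move=> a0 ab; have h := le_trans (e_low a0 ab) (rip_le _ _).
rewrite -exprMn ler_pXn2r ?nnegrE ?mulr_ge0//.
have [->|/eqP dn] := eqVneq (d a b) 0; first by rewrite hnorm0 mulr0.
by rewrite -(ler_pM2r (hnorm_gt0 dn)) -mulrA -expr2.
Qed.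
Lemma e_norm_high a b : 0 <= a -> a <= b ->
  hnorm (ee a b) ^+ 2 <= b ^+ 2 * hnorm (d a b) ^+ 2.
Proof.
move=> a0 ab; have b0 : 0 <= b by lra.
have -> : ee a b = Yop b (d a b).
  have := YopP (d a b) b0; rewrite proj_id//; last exact: d_in.
  by move=> h; exact: cdd_uniq cy (d_y a0 ab) h.
exact: Yop_norm.
Qed.

Definition fmeas := smeas hE Em (fun a u => @lowE_rc _ _ B lB sB pB cB a u) xi.

Lemma lowE_neg' a : a < 0 -> E a `<=` [set 0]. Proof. exact: lowE_neg. Qed.

Lemma fmeas_oc a b : a <= b -> fmeas `]a, b]%classic = (c b - c a)%:E.
Proof. exact: smeas_oc. Qed.

Lemma c_neg a : a < 0 -> c a = 0.
Proof.
move=> a0; have h : P a xi = 0 := lowE_neg' a0 (proj_in (hE a) xi).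
by rewrite /cumf h hnorm0 expr0n.
Qed.

Lemma Yop0 : Yop 0 xi = 0.
Proof.
have := Yop_norm xi (lexx 0); rewrite expr0n /= mul0r => h.
by apply: hnorm_eq0; apply/eqP; rewrite -sqrf_eq0 eq_le h sqr_ge0.
Qed.
Lemma g10 : g1 0 = 0. Proof. by rewrite /g1 Yop0 rip0l. Qed.
Lemma g20 : g2 0 = 0. Proof. by rewrite /g2 Yop0 hnorm0 expr0n. Qed.

Lemma measurable_abs : measurable_fun [set: mT] ((fun l : R => `|l|) : mT -> R).
Proof. exact: (@normr_measurable R setT). Qed.
Lemma measurable_sq : measurable_fun [set: mT] ((fun l : R => l ^+ 2) : mT -> R).
Proof. exact: (@exprn_measurable R setT 2). Qed.

(** The integrand is [|l|] so that integration of nonnegative functions applies; the measure has no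
    mass on the negative axis, so it agrees with [l] almost everywhere. *)
Lemma int_abs : (fun n : nat => (g1 n%:R)%:E) @ \oo -->
  (\int[fmeas]_(l in setT) (`|l|%R)%:E)%E.
Proof.
have -> : (fun n : nat => (g1 n%:R)%:E) = (fun n : nat => (g1 n%:R - g1 0)%:E).
  by apply/funext => n; rewrite g10 subr0.
apply: (@bracket_total R fmeas c g1 id fmeas_oc) => //.
- by move=> a b a0 ab; rewrite g1_diff// -d_norm// e_low.
- by move=> a b a0 ab; rewrite g1_diff// -d_norm// e_high.
- by move=> l l0; rewrite ger0_norm.
- exact: c_neg.
- by move=> b b0; exists 1 => // a' b' _ _ _; rewrite mul1r.
Qed.

Lemma int_sq : (fun n : nat => (g2 n%:R)%:E) @ \oo -->
  (\int[fmeas]_(l in setT) (l ^+ 2)%:E)%E.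
Proof.
have -> : (fun n : nat => (g2 n%:R)%:E) = (fun n : nat => (g2 n%:R - g2 0)%:E).
  by apply/funext => n; rewrite g20 subr0.
apply: (@bracket_total R fmeas c g2 (fun l => l ^+ 2) fmeas_oc).
- by move=> a b a0 ab; rewrite ler_pXn2r ?nnegrE//; lra.
- by rewrite expr0n.
- by move=> a b a0 ab; rewrite g2_diff// -d_norm// e_norm_low.
- by move=> a b a0 ab; rewrite g2_diff// -d_norm// e_norm_high.
- exact: measurable_sq.
- by move=> l; exact: sqr_ge0.
- by [].
- exact: c_neg.
- move=> b b0; exists (2 * b) => [|a' b' a0 ab bb]; first by lra.
  rewrite -subr_ge0 (_ : _ - _ = (2 * b - (a' + b')) * (b' - a')); last by ring.
  by apply: mulr_ge0; lra.
Qed.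

Lemma Pn_cvg : hcvg (fun n : nat => P n%:R xi) xi.
Proof.
have hi n : E n%:R `<=` E n.+1%:R by apply: Em; rewrite ler_nat.
have := incr_cvg (fun n => hE n%:R) hi xi.
rewrite (_ : proj _ xi = 0) ?subr0//.
apply: (lowE_top lB sB pB cB res_inj).
exact: (proj_in (csub_bigcap (fun n => @orth_csub _ _ (E n%:R)))).
Qed.

(** If the second moments stay bounded, the truncations [Yop n xi] are Cauchy, since increments of
    [g2] are squared distances; closedness of [y] then puts [xi] into the domain. *)
Lemma fmeas_dom : (exists om, y (xi, om)) <->
  (\int[fmeas]_(l in setT) (l ^+ 2)%:E < +oo)%E.
Proof.
have g2E om (n : nat) : y (xi, om) -> Yop n%:R xi = P n%:R om.
  by move=> h; exact: (cdd_uniq cy (YopP xi (ler0n R n)) (y_inv n%:R h)).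
split=> [[om h]|h].
  apply: (@le_lt_trans _ _ (hnorm om ^+ 2)%:E); last exact: ltry.
  apply: (lee_cvg_to int_sq (cvg_cst _)); apply: nearW => n.
  by rewrite lee_fin /g2 (g2E om)// ler_pXn2r ?nnegrE// proj_le.
have g2m n : g2 n%:R <= g2 n.+1%:R.
  by rewrite -subr_ge0 g2_diff ?sqr_ge0// ler_nat.
have [M hM] : exists M : R, forall n : nat, g2 n%:R <= M.
  exists (fine (\int[fmeas]_(l in setT) (l ^+ 2)%:E)%E) => n.
  rewrite -lee_fin fineK; last first.
    rewrite ge0_fin_numE//; apply: integral_ge0 => l _; rewrite lee_fin; exact: sqr_ge0.
  apply: (lee_cvg_to (cvg_cst _) int_sq); exists n => // k /= nk.
  rewrite lee_fin -(subnKC nk); elim: (k - n)%N => [|j IH]; first by rewrite addn0.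
  by rewrite addnS (le_trans IH).
have [l [hl hle]] := mono_cvg g2m hM.
have [om hom] : exists om, hcvg (fun n : nat => Yop n%:R xi) om.
  apply: hcauchy_cvg => e e0.
  move/cvgrPdist_lt: hl => /(_ (e ^+ 2)); rewrite exprn_gt0// => /(_ isT)[N _ hN].
  exists N => m n.
  wlog mn : m n / (m <= n)%N.
    move=> hw Nm Nn; case: (leqP m n) => [mn'|/ltnW mn']; first exact: hw.
    by rewrite hnormBC; exact: hw.
  move=> Nm Nn; rewrite hnormBC -(@ltr_pXn2r _ 2)// ?nnegrE ?(ltW e0)//.
  rewrite -g2_diff ?ler_nat//.
  have := hN m Nm; rewrite /= ger0_norm ?subr_ge0//; apply: le_lt_trans.
  by rewrite lerD2r.
exists om; apply: (cdd_seq cy _ Pn_cvg hom) => n; exact: YopP.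
Qed.

Lemma fmeas_val om : y (xi, om) -> (\int[fmeas]_(l in setT) (l%:E))%E = (rip om xi)%:E.
Proof.
move=> h.
have -> : (\int[fmeas]_(l in setT) l%:E = \int[fmeas]_(l in setT) (`|l|%R)%:E)%E.
  apply: ae_eq_integral => //.
  - by apply/measurable_EFinP; exact: measurable_abs.
  exists [set l : mT | (l < 0)%R]; split.
  - exact: m_neg_meas.
  - by apply: (@m_neg R fmeas c fmeas_oc); exact: c_neg.
  - move=> l /= /not_implyP[_ hl]; rewrite ltNge; apply/negP => l0; apply: hl.
    by rewrite /= ger0_norm.
apply: (cvg_unique (@ereal_hausdorff R) int_abs).
apply: cvg_EFin; first exact: nearW.
have e n : g1 n%:R = rip (P n%:R om) xi.
  rewrite /g1 (cdd_uniq cy (YopP xi (ler0n R n)) (y_inv n%:R h)).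
  by rewrite /rip -(proj_sa (hE _)) projK.
under eq_fun do rewrite e.
apply: hcvg_rip.
have hi n : E n%:R `<=` E n.+1%:R by apply: Em; rewrite ler_nat.
have := incr_cvg (fun n => hE n%:R) hi om.
rewrite (_ : proj _ om = 0) ?subr0//.
apply: (lowE_top lB sB pB cB res_inj).
exact: (proj_in (csub_bigcap (fun n => @orth_csub _ _ (E n%:R)))).
Qed.
End OneVector.

Lemma spectral_measure_aux : exists e, is_spectral_measure y e.
Proof.
pose rc := fun a u => @lowE_rc _ _ B lB sB pB cB a u.
have top u := @lowE_top _ _ B lB sB pB cB res_inj u.
exists (fam_res hE Em rc); split; first exact: (fam_resolution hE Em rc (@lowE_neg' ) top).
move=> xi m hm.
have em A : measurable A -> m A = fmeas xi A.
  move=> mA; rewrite hm//; have := fam_scalar hE Em rc (@lowE_neg') top xi mA.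
  by [].
have ei (f : mT -> \bar R) : (\int[m]_(l in setT) f l = \int[fmeas xi]_(l in setT) f l)%E.
  by apply: eq_measure_integral => A mA _; exact: em.
split; first by rewrite ei; exact: fmeas_dom.
move=> om h; rewrite /Rintegral ei (fmeas_val h) /= -/(ip om xi).
case: hy => _ _ /(_ _ h); rewrite -/(ip _ _) lecE => /andP[im _].
by apply/eqP; rewrite eq_complex /= eqxx.
Qed.
End SpectralExistence.

Lemma spectral_measure_ex (R : realType) (H : hilbert R) (y : graph H) :
  positive_sa y -> is_spectral_measure y (spectral_measure y).
Proof.
move=> hy; have [B [lB sB pB cB [yB By]]] := psa_resolvent hy.
exact: (xgetPex (fun _ _ => 0) (spectral_measure_aux hy lB sB pB cB yB By)).
Qed.

(** * Spectral subspaces of |x| *)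

Lemma geometric_growth (R : realType) (a b x C : R) : 0 <= b -> b < a ->
  (forall n, a ^+ n * x <= C * b ^+ n) -> x <= 0.
Proof.
move=> b0 ba h; have a0 : 0 < a by exact: le_lt_trans ba.
have e : (fun n : nat => C * (b / a) ^+ n) @ \oo --> (0 : R).
  rewrite -(mulr0 C); apply: cvgM; first exact: cvg_cst.
  apply: cvg_expr; rewrite ger0_norm ?divr_ge0// ?(ltW a0)//.
  by rewrite ltr_pdivrMr// mul1r.
apply: (ler_cvg_to (cvg_cst _) e); apply: nearW => n.
by rewrite expr_div_n mulrA ler_pdivlMr ?exprn_gt0// mulrC.
Qed.

Section AbstractSpectral.
Context {R : realType} {H : hilbert R}.
Local Notation mT := (measurableTypeR R).
Implicit Types (u v w : H) (a b c : R) (A B : set mT).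
Variables (y : graph H) (hy : positive_sa y) (e : set R -> H -> H).
Hypothesis he : is_spectral_measure y e.

Let cy : closed_dd y. Proof. by case: hy. Qed.
Let re : resolution e. Proof. by case: he. Qed.

Definition ran A : set H := [set u | e A u = u].

Section OneSet.
Context {A : set mT} (mA : measurable A).
Lemma e_bounded : bounded_linear (e A). Proof. by case: (res_proj re mA). Qed.
Lemma e_lin : linear (e A). Proof. by case: e_bounded. Qed.
Lemma e_sadj : sadj (e A). Proof. by case: (res_proj re mA). Qed.
Lemma e_idem u : e A (e A u) = e A u.
Proof. by have [_ _ /(congr1 (@^~ u))] := res_proj re mA. Qed.
Lemma ran_csub : csub (ran A).
Proof.
split; first by rewrite /ran /= (lin0 e_lin).
  by move=> c u v hu hv; rewrite /ran /= e_lin hu hv.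
move=> s l hs sl; apply: (hcvg_uniq (hcvg_bounded e_bounded sl)).
by rewrite (_ : _ \o s = s)//; apply/funext => n /=; exact: hs.
Qed.
Lemma e_proj u : e A u = proj (ran A) u.
Proof.
apply/esym/(proj_uniq ran_csub); first exact: e_idem.
by move=> k hk; rewrite -hk -e_sadj (linB e_lin) e_idem subrr ip0l.
Qed.
Lemma e_in u : ran A (e A u). Proof. exact: e_idem. Qed.
Lemma e_hnorm u : rip (e A u) u = hnorm (e A u) ^+ 2.
Proof. by rewrite e_proj proj_rip//; exact: ran_csub. Qed.
End OneSet.

Lemma eI A B u : measurable A -> measurable B -> e A (e B u) = e (A `&` B) u.
Proof. by move=> mA mB; rewrite (res_I re mA mB). Qed.
Lemma e_comm A B u : measurable A -> measurable B -> e A (e B u) = e B (e A u).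
Proof. by move=> mA mB; rewrite !eI// setIC. Qed.

Definition sm u : {measure set mT -> \bar R} :=
  projT1 (cid (res_meas re u)).
Lemma smP u : scalar_measure e u (sm u). Proof. exact: projT2 (cid (res_meas re u)). Qed.
Lemma smE u A : measurable A -> sm u A = (hnorm (e A u) ^+ 2)%:E.
Proof. by move=> mA; rewrite (smP u mA) -/(ip _ _) -/(rip _ _) e_hnorm. Qed.
Lemma smT u : sm u setT = (hnorm u ^+ 2)%:E.
Proof. by rewrite smE// (res_T re). Qed.

Lemma e_set0 u : e set0 u = 0.
Proof. by apply: hnorm_eq0; apply/eqP; rewrite -sqrf_eq0 -eqe -smE// measure0. Qed.

Lemma dom_sq u : (exists om, y (u, om)) <->
  (\int[sm u]_(l in setT) (l ^+ 2)%:E < +oo)%E.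
Proof. by case: he => _ /(_ u _ (smP u))[]. Qed.
Lemma dom_val u om : y (u, om) -> rip om u = \int[sm u]_(l in setT) l.
Proof.
move=> h; case: he => _ /(_ u _ (smP u))[_ /(_ om h)].
by rewrite -/(ip _ _) /rip => ->.
Qed.

Lemma ran_compl u A : measurable A -> ran A u -> sm u (~` A) = 0%E.
Proof.
move=> mA uA; rewrite smE; last exact: measurableC.
rewrite -uA eI//; last exact: measurableC.
by rewrite setICl e_set0 hnorm0 expr0n.
Qed.

(** A bounded stand-in for the identity: integrable against a finite measure, and equal to the
    identity on the set that carries the measure. *)
Definition clip a b (l : R) : R := Num.min (Num.max l a) b.
Lemma clip_id a b l : a <= l <= b -> clip a b l = l.
Proof.
move=> /andP[al lb]; rewrite /clip (max_idPl _)//; exact/min_idPl.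
Qed.
Lemma clip_bd a b l : a <= b -> a <= clip a b l <= b.
Proof. by move=> ab; rewrite /clip le_min ge_min lexx orbT le_max lexx orbT ab. Qed.
Lemma clip_meas a b : measurable_fun [set: mT] (clip a b : mT -> R).
Proof.
apply: measurable_minr; last exact: measurable_cst.
apply: measurable_maxr; last exact: measurable_cst.
exact: (@measurable_id _ R).
Qed.

Lemma rint_bounds (m : {measure set mT -> \bar R}) (f : R -> R) a b M :
  m setT = M%:E -> measurable_fun [set: mT] (f : mT -> R) ->
  (forall l, a <= f l <= b) ->
  a * M <= \int[m]_(l in setT) f l <= b * M.
Proof.
move=> mM mf hf.
have fin : (m setT < +oo)%E by rewrite mM ltry.
have icst k : m.-integrable setT (EFin \o cst k).
  apply: measurable_bounded_integrable => //.
  by exists `|k|; split; [exact: num_real | move=> x kx t _; exact: ltW].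
have i_f : m.-integrable setT (EFin \o f).
  apply: measurable_bounded_integrable => //.
  exists (`|a| + `|b|); split; [exact: num_real | move=> x kx t _].
  apply/ltW/(le_lt_trans _ kx); have /andP[h1 h2] := hf t.
  rewrite ler_norml; have := ler_norm b; have := ler_norm (- a); rewrite normrN.
  have := normr_ge0 a; have := normr_ge0 b; move=> *; apply/andP; split; lra.
have ek k : k * M = \int[m]_(l in setT) cst k l.
  by rewrite Rintegral_cst// mM.
rewrite !ek; apply/andP; split; apply: le_Rintegral => // l _; by case/andP: (hf l).
Qed.

Lemma ran_dom A u b : measurable A -> (A `<=` [set l : mT | (- b <= l <= b)%R]) ->
  ran A u -> exists w, y (u, w).
Proof.
move=> mA hA uA; apply/dom_sq.
have mC := measurableC mA.
rewrite (@ge0_negligible_integral _ _ _ _ setT (~` A))//; last 3 first.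
- by apply/measurable_EFinP; exact: measurable_sq.
- by move=> l _; rewrite lee_fin sqr_ge0.
- exact: ran_compl.
rewrite setTD setCK.
apply: (@le_lt_trans _ _ (\int[sm u]_(l in A) (b ^+ 2)%:E)%E).
  apply: ge0_le_integral => //.
  - by move=> l _; rewrite lee_fin sqr_ge0.
  - by apply/measurable_EFinP; apply: measurable_funS (@measurable_sq R).
  - move=> l /hA /= /andP[h1 h2]; rewrite lee_fin -[leLHS]ger0_norm ?sqr_ge0// normrX.
    have b0 : 0 <= b by lra.
    by rewrite ler_pXn2r ?nnegrE// ler_norml h1.
rewrite integral_cst// smE// -EFinM; exact: ltry.
Qed.

Lemma ran_form A u w a b : measurable A -> a <= b ->
  (A `<=` [set l : mT | (a <= l <= b)%R]) -> ran A u -> y (u, w) ->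
  a * hnorm u ^+ 2 <= rip w u <= b * hnorm u ^+ 2.
Proof.
move=> mA ab hA uA h; rewrite (dom_val h).
have -> : \int[sm u]_(l in setT) l = \int[sm u]_(l in setT) clip a b l.
  congr fine; apply: ae_eq_integral => //.
  - by apply/measurable_EFinP; exact: clip_meas.
  exists (~` A); split; [exact: measurableC | exact: ran_compl |].
  move=> l /= /not_implyP[_ hl] Al; apply: hl => /=.
  by rewrite clip_id//; exact: hA.
apply: rint_bounds; [exact: smT | exact: clip_meas | by move=> l; exact: clip_bd].
Qed.

Lemma e_cvg_sq (F : nat -> set mT) u : (forall n, measurable (F n)) ->
  nondecreasing_seq F -> (forall n, e (F n) u = 0) -> e (\bigcup_n F n) u = 0.
Proof.
move=> mF nF h; have mU : measurable (\bigcup_n F n) by exact: bigcupT_measurable.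
have := @nondecreasing_cvg_mu _ mT R (sm u) F mF mU nF.
have -> : sm u \o F = cst 0%E.
  by apply/funext => n /=; rewrite smE// h hnorm0 expr0n.
move=> /(cvg_unique (@ereal_hausdorff R))/(_ (cvg_cst _)) h0.
apply: hnorm_eq0; apply/eqP; rewrite -sqrf_eq0 -eqe.
by rewrite -(smE u mU) h0.
Qed.

(** The negative axis is exhausted by compact intervals away from 0. Over such an interval the form
    of [y] is at most a negative multiple of the squared norm, while positivity makes it
    nonnegative. *)
Lemma e_neg u : e [set l : mT | (l < 0)%R] u = 0.
Proof.
have U : \bigcup_n ([set l : mT | (- n.+1%:R <= l <= - n.+1%:R^-1)%R]) = [set l : mT | (l < 0)%R].
  apply/seteqP; split=> [l [n _ /= /andP[_ h]]|l /= l0].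
    by apply: (le_lt_trans h); rewrite oppr_lt0 invr_gt0.
  have l1 : 0 < - l by rewrite oppr_gt0.
  exists (maxn (Num.truncn (- l)) (Num.truncn (- l)^-1)) => //=.
  apply/andP; split.
    rewrite lerNl (le_trans (ltW (truncnS_gt _)))// ler_nat ltnS; exact: leq_maxl.
  rewrite lerNr -[leRHS]invrK lef_pV2 ?posrE ?invr_gt0//.
  apply: (le_trans (ltW (truncnS_gt _))); rewrite ler_nat ltnS; exact: leq_maxr.
have mI n : measurable ([set l : mT | (- n.+1%:R <= l <= - n.+1%:R^-1)%R]).
  have -> : [set l : mT | (- n.+1%:R <= l <= - n.+1%:R^-1)%R] = `[- n.+1%:R, - n.+1%:R^-1]%classic.
    by apply/seteqP; split=> l /=; rewrite in_itv.
  exact: (@measurable_itv R).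
rewrite -U; apply: e_cvg_sq => //.
  apply/nondecreasing_seqP => n; apply/subsetPset => l /= /andP[h1 h2].
  apply/andP; split; first by rewrite (le_trans _ h1)// lerN2 ler_nat.
  by rewrite (le_trans h2)// lerN2 lef_pV2 ?posrE// ler_nat.
move=> n; set u' := e _ u.
have ru : ran [set l : mT | (- n.+1%:R <= l <= - n.+1%:R^-1)%R] u' by exact: e_in.
have n1 : 0 < n.+1%:R :> R by [].
have n2 : n.+1%:R^-1 <= n.+1%:R :> R.
  by rewrite (@le_trans _ _ 1)// ?invf_le1// ler1n.
have [w hw] : exists w, y (u', w).
  apply: (ran_dom (b := n.+1%:R) (mI n)) => // l /= /andP[h1 h2]; rewrite h1 /=.
  rewrite (le_trans h2)// -subr_ge0 opprK addr_ge0// ltW// invr_gt0//.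
have n3 : - n.+1%:R <= - n.+1%:R^-1 :> R by rewrite lerN2.
have /andP[_] := ran_form (mI n) n3 (fun l hl => hl) ru hw.
have := psa_pos hy hw; rewrite mulNr => h1 h2.
apply: hnorm_eq0; apply/eqP; rewrite -sqrf_eq0 eq_le sqr_ge0 andbT.
have : n.+1%:R^-1 * hnorm u' ^+ 2 <= 0 by rewrite -oppr_ge0; exact: le_trans h1 h2.
by rewrite pmulr_rle0 ?invr_gt0.
Qed.

Lemma mneg : measurable [set l : mT | (l < 0)%R]. Proof. exact: m_neg_meas. Qed.

Lemma dom_abs u om : y (u, om) ->
  rip om u = fine (\int[sm u]_(l in setT) (`|l|%R)%:E)%E.
Proof.
move=> h; rewrite (dom_val h); congr fine; apply: ae_eq_integral => //.
- by apply/measurable_EFinP; exact: measurable_abs.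
exists [set l : mT | (l < 0)%R]; split; first exact: mneg.
  by rewrite smE; [rewrite e_neg hnorm0 expr0n | exact: mneg].
move=> l /= /not_implyP[_ hl]; rewrite ltNge; apply/negP => l0; apply: hl.
by rewrite /= ger0_norm.
Qed.

Lemma dom_abs_fin u om : y (u, om) ->
  ((\int[sm u]_(l in setT) (`|l|%R)%:E)%E \is a fin_num).
Proof.
move=> h; rewrite ge0_fin_numE; last by apply: integral_ge0 => l _; rewrite lee_fin.
have /dom_sq h2 : exists om, y (u, om) by exists om.
apply: (@le_lt_trans _ _ (\int[sm u]_(l in setT) (1 + l ^+ 2)%:E)%E).
  apply: ge0_le_integral => //.
  - by apply/measurable_EFinP; exact: measurable_abs.
  - apply/measurable_EFinP; apply: measurable_funD; first exact: measurable_cst.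
    exact: measurable_sq.
  - move=> l _; rewrite lee_fin -[l ^+ 2]ger0_norm ?sqr_ge0// normrX.
    rewrite -subr_ge0 (_ : _ - _ = (`|l| - 2^-1) ^+ 2 + 3 / 4); last by field.
    by rewrite addr_ge0// ?sqr_ge0// divr_ge0.
under eq_integral do rewrite EFinD.
rewrite ge0_integralD//.
- rewrite lte_add_pinfty// integral_cst// smT -EFinM; exact: ltry.
- by move=> l _; rewrite lee_fin sqr_ge0.
- by apply/measurable_EFinP; exact: measurable_sq.
Qed.

Lemma sm_add u v A : measurable A -> ran A u -> ran (~` A) v ->
  forall (f : R -> R), measurable_fun [set: mT] (f : mT -> R) -> (forall l, 0 <= f l) ->
  (\int[sm (u + v)]_(l in setT) (f l)%:E =
   \int[sm u]_(l in setT) (f l)%:E + \int[sm v]_(l in setT) (f l)%:E)%E.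
Proof.
move=> mA uA vA f mf f0; have mC := measurableC mA.
have -> : (\int[sm (u + v)]_(l in setT) (f l)%:E = \int[measure_add (sm u) (sm v)]_(l in setT) (f l)%:E)%E.
  apply: eq_measure_integral => B mB _.
  apply: (eq_trans _ (esym (measure_addE (sm u) (sm v) B))).
  rewrite !smE// -EFinD; congr _%:E.
  rewrite (linD (e_lin mB)) !hnorm2 ip_sqrD.
  have -> : rip (e B u) (e B v) = 0; last by rewrite mulr0 addr0.
  rewrite /rip -(e_sadj mB) (e_idem mB) -uA -vA (e_comm _ mB mA) (e_sadj mA).
  by rewrite eI// setICr e_set0 ip0r.
rewrite ge0_integral_measure_add//.
  by move=> l _; rewrite lee_fin.
by apply/measurable_EFinP.
Qed.

Lemma e_split A u' : measurable A -> e A u' + e (~` A) u' = u'.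
Proof.
move=> mA; have mC := measurableC mA.
have -> : e (~` A) u' = u' - e A u'; last by rewrite addrC subrK.
rewrite (e_proj mC); apply: (proj_uniq (ran_csub mC)).
  rewrite /ran /= (linB (e_lin mC)) eI// setICl e_set0 subr0.
  apply/eqP; rewrite -subr_eq0; apply/eqP; apply: hnorm_eq0; apply/eqP; rewrite -sqrf_eq0.
  have h1 := smT u'; have : (sm u' (~` A) + sm u' A = (hnorm u' ^+ 2)%:E)%E.
    rewrite -measureU//; first by rewrite setUC setUv; exact: h1.
    by rewrite setIC setICr.
  rewrite !smE// -EFinD => -[h2].
  have -> : e (~` A) u' - (u' - e A u') = e (~` A) u' + e A u' - u' by vec.
  have p : hnorm (e (~` A) u' + e A u') ^+ 2 = hnorm u' ^+ 2.
    rewrite -h2 !hnorm2 ip_sqrD; suff -> : rip (e (~` A) u') (e A u') = 0.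
      by rewrite mulr0 addr0.
    by rewrite /rip (e_sadj mC) eI// setICl e_set0 ip0r.
  rewrite hnorm2 ip_sqrB -!hnorm2 p ripDl !e_hnorm// [_ + _ ^+ 2 in X in 2 * X]h2.
  by apply/eqP; ring.
move=> k kA; rewrite opprB addrCA subrr addr0 -kA -(e_sadj mC) eI//.
by rewrite setICl e_set0 ip0l.
Qed.

(** The definition of a spectral measure controls [y] only through its form on the diagonal. For [u]
    over [A] and [v] over the complement the scalar measures add, so the cross term of
    [<y (u + v), u + v>] must vanish; thus [y u] is orthogonal to the range of the complementary
    projection. *)
Lemma ran_reduce A u w : measurable A -> ran A u -> y (u, w) -> ran A w.
Proof.
move=> mA uA hw; have mC := measurableC mA.
have key v z : ran (~` A) v -> y (v, z) -> rip w v = 0.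
  move=> vA hz; have huv := cdd_D cy hw hz.
  have := dom_abs huv; rewrite (sm_add mA uA vA (@measurable_abs R))//.
  rewrite fineD; [| exact: dom_abs_fin hw | exact: dom_abs_fin hz].
  rewrite -(dom_abs hw) -(dom_abs hz) ripDl !ripDr.
  have -> : rip z u = rip w v by rewrite /rip (psa_sym hy hz hw) -/(rip _ _) ripC.
  lra.
have wo k : ran (~` A) k -> ip w k = 0.
  move=> kA; apply: ip_eq0P => c.
  have {kA}kA : ran (~` A) (c *: k) by apply: csZ => //; exact: ran_csub.
  move: (c *: k) kA => {c}k kA.
  (* A general vector over the complement need not be in the domain of [y]; its truncations to
     bounded intervals are, and they converge to it. *)
  pose F n := [set l : mT | (- n%:R <= l <= n%:R)%R].
  have mF n : measurable (F n).
    have -> : F n = `[- n%:R, n%:R]%classic by apply/seteqP; split=> l /=; rewrite in_itv.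
    exact: (@measurable_itv R).
  have hk n : rip w (e (F n) k) = 0.
    have [z hz] : exists z, y (e (F n) k, z).
      by apply: (ran_dom (A := F n) (b := n%:R)) => //; exact: e_in.
    by apply: key hz; rewrite -kA e_comm//; exact: e_in.
  have hc : hcvg (fun n => e (F n) k) k.
    have hcv : (fun n => hnorm k ^+ 2 - hnorm (e (F n) k) ^+ 2) @ \oo --> (0 : R).
      have U : \bigcup_n F n = setT.
        apply/seteqP; split => // l _; exists (Num.truncn `|l|).+1 => //=.
        by rewrite /F /= -ler_norml ltW// truncnS_gt.
      have := @nondecreasing_cvg_mu _ mT R (sm k) F mF.
      rewrite U => /(_ measurableT) h.
      have : sm k \o F @ \oo --> sm k setT.
        apply: h; apply/nondecreasing_seqP => n; apply/subsetPset => l /= /andP[h1 h2].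
        by apply/andP; split; [rewrite (le_trans _ h1)// lerN2 ler_nat | rewrite (le_trans h2)// ler_nat].
      rewrite smT (_ : _ \o _ = fun n => (hnorm (e (F n) k) ^+ 2)%:E); last first.
        by apply/funext => n /=; rewrite smE.
      move=> /fine_cvgP[_ /=]; rewrite (_ : _ \o _ = fun n => hnorm (e (F n) k) ^+ 2)//.
      move=> hh; rewrite -(subrr (hnorm k ^+ 2)).
      by apply: cvgB => //; exact: cvg_cst.
    apply/hcvgP => eps e0; move/cvgr0P: hcv => /(_ (eps ^+ 2)); rewrite exprn_gt0// => /(_ isT)[N hN].
    exists N => n /hN hn; rewrite -(@ltr_pXn2r _ 2)// ?nnegrE ?(ltW e0)//.
    apply: le_lt_trans hn; rewrite (proj_pyth (ran_csub (mF n)) k) -!(e_proj (mF n)).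
    by rewrite addrAC subrr add0r ger0_norm ?sqr_ge0// hnormBC.
  have := hcvg_rip (w := w) hc; under eq_fun do rewrite ripC hk.
  by rewrite ripC => h; apply: (cvgr_uniq h); exact: cvg_cst.
rewrite /ran /= -{2}(e_split w mA); suff -> : e (~` A) w = 0 by rewrite addr0.
rewrite (e_proj mC); apply: (proj_orthE (ran_csub mC)) => k; exact: wo.
Qed.

(** Second moments add over [A] and its complement, so both components of [u] lie in the domain;
    each is mapped into its own range. *)
Lemma y_e_comm A u w : measurable A -> y (u, w) -> y (e A u, e A w).
Proof.
move=> mA h; have mC := measurableC mA.
have r1 : ran A (e A u) by exact: e_in.
have r2 : ran (~` A) (e (~` A) u) by exact: e_in.
have h2 := (proj1 (dom_sq u)) (ex_intro _ w h).
have hs := sm_add mA r1 r2 (@measurable_sq R) (fun l => sqr_ge0 l).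
rewrite e_split// in hs; rewrite hs in h2.
have i0 v : (0 <= \int[sm v]_(l in setT) (l ^+ 2)%:E)%E.
  by apply: integral_ge0 => l _; rewrite lee_fin sqr_ge0.
have [w1 y1] : exists w1, y (e A u, w1).
  by apply/dom_sq; apply: le_lt_trans h2; rewrite leeDl.
have [w2 y2] : exists w2, y (e (~` A) u, w2).
  by apply/dom_sq; apply: le_lt_trans h2; rewrite leeDr.
have e1 := ran_reduce mA r1 y1; have e2 := ran_reduce mC r2 y2.
have := cdd_D cy y1 y2; rewrite e_split// => /(cdd_uniq cy h) ->.
rewrite (linD (e_lin mA)) e1 -e2 eI// setICr e_set0 addr0; exact: y1.
Qed.

(** Cauchy-Schwarz for the form of [y] at [u] and [w = y u] gives [|w|^4 <= <y u, u> <y w, w>],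
    which upgrades form bounds to a norm bound. *)
Lemma form_norm_le b u w w2 : 0 <= b -> y (u, w) -> y (w, w2) ->
  rip w u <= b * hnorm u ^+ 2 -> rip w2 w <= b * hnorm w ^+ 2 ->
  hnorm w <= b * hnorm u.
Proof.
move=> b0 h1 h2 f1 f2.
have := @quad_disc R (rip w u) (hnorm w ^+ 2) (rip w2 w) (psa_pos hy h1) (psa_pos hy h2).
have sy : rip w2 u = hnorm w ^+ 2 by rewrite hnorm2 /rip (psa_sym hy h2 h1).
move=> qd; suff /qd : forall t : R, 0 <= rip w u + 2 * t * hnorm w ^+ 2 + t ^+ 2 * rip w2 w.
  have [-> |/eqP wn] := eqVneq w 0; first by rewrite hnorm0 mulr_ge0.
  move=> h; have w0 : 0 < hnorm w ^+ 2 by rewrite exprn_gt0// hnorm_gt0.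
  rewrite -(@ler_pXn2r _ 2)// ?nnegrE ?mulr_ge0// -(ler_pM2r w0) -expr2 exprMn.
  apply: (le_trans h); apply: (@le_trans _ _ ((b * hnorm u ^+ 2) * (b * hnorm w ^+ 2))).
    by apply: ler_pM => //; [exact: psa_pos hy h1 | exact: psa_pos hy h2].
  rewrite le_eqVlt; apply/orP; left; apply/eqP; ring.
move=> t; have := psa_pos hy (cdd_D cy h1 (cdd_Z t%:C%C cy h2)).
rewrite ripDl !ripDr !ripZl !ripZr sy -hnorm2; congr (_ <= _); ring.
Qed.

Definition lowset (a : R) : set mT := [set l : mT | (l <= a)%R].
Lemma lowset_meas a : measurable (lowset a).
Proof.
have -> : lowset a = `]-oo, a]%classic by apply/seteqP; split=> l /=; rewrite in_itv.
exact: (@measurable_itv R).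
Qed.

Lemma low_nonneg b u : ran (lowset b) u ->
  ran (lowset b `&` ~` [set l : mT | (l < 0)%R]) u.
Proof.
move=> h; rewrite /ran /= -eI; [|exact: lowset_meas|apply: measurableC; exact: mneg].
have := e_split u mneg; rewrite e_neg add0r => ->; exact: h.
Qed.

Lemma low_dom b u : 0 <= b -> ran (lowset b) u ->
  exists w, [/\ y (u, w), ran (lowset b) w, hnorm w <= b * hnorm u & rip w u <= b * hnorm u ^+ 2].
Proof.
move=> b0 hu; have mA := lowset_meas b.
have mB : measurable (lowset b `&` ~` [set l : mT | (l < 0)%R]).
  by apply: measurableI => //; apply: measurableC; exact: mneg.
have sub : lowset b `&` ~` [set l : mT | (l < 0)%R] `<=` [set l : mT | (0 <= l <= b)%R].
  by move=> l [/= h1 /negP]; rewrite -leNgt => ->; rewrite h1.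
have dom z : ran (lowset b) z -> exists w, y (z, w).
  move=> hz; apply: (ran_dom (b := b) mB _ (low_nonneg hz)) => l /sub /= /andP[h1 ->].
  by rewrite andbT (le_trans _ h1)// oppr_le0.
have form z w : ran (lowset b) z -> y (z, w) -> rip w z <= b * hnorm z ^+ 2.
  by move=> hz hw; have /andP[] := ran_form mB b0 sub (low_nonneg hz) hw.
have [w hw] := dom u hu; have rw := ran_reduce mA hu hw.
have [w2 hw2] := dom w rw.
exists w; split => //; last exact: form.
by apply: (form_norm_le b0 hw hw2); exact: form.
Qed.

Lemma high_form A u w a b : measurable A -> a <= b ->
  (A `<=` [set l : mT | (a <= l <= b)%R]) -> ran A u -> y (u, w) ->
  a * hnorm u ^+ 2 <= rip w u /\ a * hnorm u <= hnorm w.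
Proof.
move=> mA ab sub hu hw; have /andP[h _] := ran_form mA ab sub hu hw.
split => //; have [->|/eqP un] := eqVneq u 0; first by rewrite hnorm0 mulr0.
rewrite -(ler_pM2r (hnorm_gt0 un)) -mulrA -expr2; apply: (le_trans h).
by rewrite (le_trans (rip_le _ _)).
Qed.

(* With Z = x^* x this is the spectral subspace of |x| for [0, v]: on its
   orthogonal complement the powers of Z grow faster than v^(2n). *)
Definition growth (Z : graph H) (v : R) : set H := [set u | exists (C : R) (s : nat -> H),
  [/\ s 0%N = u, forall n, Z (s n, s n.+1) & forall n, hnorm (s n) <= C * (v ^+ 2) ^+ n]].

Lemma shell_meas (v : R) n : measurable [set l : mT | (v + n.+1%:R^-1 <= l <= v + n.+1%:R)%R].
Proof.
rewrite (_ : mkset _ = `[v + n.+1%:R^-1, v + n.+1%:R]%classic); last first.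
  by apply/seteqP; split=> l /=; rewrite in_itv.
exact: (@measurable_itv R).
Qed.
Lemma shell_bigcup (v : R) :
  \bigcup_n [set l : mT | (v + n.+1%:R^-1 <= l <= v + n.+1%:R)%R] = ~` lowset v.
Proof.
apply/seteqP; split=> [l [n _ /= /andP[h _]]|l /negP].
  rewrite /lowset /= => /(le_trans h); rewrite gerDl invr_le0 leNgt.
  by rewrite ltr0n.
rewrite /lowset /= -ltNge => vl.
have l1 : 0 < l - v by rewrite subr_gt0.
exists (maxn (Num.truncn (l - v)) (Num.truncn (l - v)^-1)) => //=.
apply/andP; split.
  rewrite -lerBrDl -[leRHS]invrK lef_pV2 ?posrE ?invr_gt0//.
  apply: (le_trans (ltW (truncnS_gt _))); rewrite ler_nat ltnS; exact: leq_maxr.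
rewrite -lerBlDl (le_trans (ltW (truncnS_gt _)))// ler_nat ltnS; exact: leq_maxl.
Qed.
Lemma shell_mono (v : R) : nondecreasing_seq (fun n =>
  [set l : mT | (v + n.+1%:R^-1 <= l <= v + n.+1%:R)%R]).
Proof.
apply/nondecreasing_seqP => n; apply/subsetPset => l /= /andP[h1 h2].
apply/andP; split.
  by rewrite (le_trans _ h1)// lerD2l lef_pV2 ?posrE ?ltr0n// ler_nat.
by rewrite (le_trans h2)// lerD2l ler_nat.
Qed.

Lemma growthP (v : R) : 0 <= v -> growth (graph_comp y y) v = ran (lowset v).
Proof.
move=> v0; apply/seteqP; split=> u; last first.
  move=> hu; pose Y z : H := xget 0 [set w | y (z, w)].
  have hY z : ran (lowset v) z -> [/\ y (z, Y z), ran (lowset v) (Y z) & hnorm (Y z) <= v * hnorm z].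
    move=> /(low_dom v0)[w [h1 h2 h3 _]].
    have yz : y (z, Y z) by exact: (xgetPex 0 (ex_intro (fun w => y (z, w)) w h1)).
    by rewrite -(cdd_uniq cy h1 yz).
  exists (hnorm u), (fun n => iter n (fun z => Y (Y z)) u); split => //.
    move=> n; have hn : ran (lowset v) (iter n (fun z => Y (Y z)) u).
      by elim: n => //= n IH; case: (hY _ IH) => _ /hY[].
    have [h1 h2 _] := hY _ hn; have [h3 _ _] := hY _ h2.
    by exists (Y (iter n (fun z => Y (Y z)) u)).
  move=> n; suff [_ ] : ran (lowset v) (iter n (fun z => Y (Y z)) u) /\
      hnorm (iter n (fun z => Y (Y z)) u) <= hnorm u * (v ^+ 2) ^+ n by [].
  elim: n => [|n [IH1 IH2]] /=; first by rewrite expr0 mulr1.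
  have [_ h2 n2] := hY _ IH1; have [_ h3 n3] := hY _ h2; split => //.
  apply: (le_trans n3); rewrite exprS mulrCA.
  apply: (@le_trans _ _ (v * (v * hnorm (iter n (fun z => Y (Y z)) u)))).
    by rewrite ler_wpM2l.
  by rewrite mulrA -expr2 ler_wpM2l// sqr_ge0.
move=> [C [s [<- hs hC]]].
have mC := measurableC (lowset_meas v).
suff z0 : e (~` lowset v) (s 0%N) = 0.
  by have := e_split (s 0%N) (lowset_meas v); rewrite z0 addr0.
rewrite -shell_bigcup; apply: e_cvg_sq => [n| |n]; [exact: shell_meas | exact: shell_mono |].
set A := mkset _; have mA : measurable A by exact: shell_meas.
(* On this shell [y] expands norms by at least [v' > v], so the component in the shell outgrows the
   bound [C v^(2k)] unless it is zero. *)
pose v' := v + n.+1%:R^-1.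
have vv : v < v' by rewrite ltrDl invr_gt0.
have n12 : v' <= v + n.+1%:R.
  by rewrite lerD2l (@le_trans _ _ 1)// ?invf_le1// ler1n.
have step k : (v' ^+ 2) * hnorm (e A (s k)) <= hnorm (e A (s k.+1)).
  have [z h1 h2] := hs k.
  have y1 := y_e_comm mA h1; have y2 := y_e_comm mA h2.
  have [_ f1] := high_form mA n12 (fun l hl => hl) (e_in mA (s k)) y1.
  have [_ f2] := high_form mA n12 (fun l hl => hl) (e_in mA z) y2.
  apply: le_trans f2; rewrite expr2 -mulrA ler_wpM2l// ltW//.
  exact: le_lt_trans vv.
have grow k : (v' ^+ 2) ^+ k * hnorm (e A (s 0%N)) <= hnorm (e A (s k)).
  elim: k => [|k IH]; first by rewrite expr0 mul1r.
  by rewrite exprS -mulrA; apply: le_trans (step k); rewrite ler_wpM2l// sqr_ge0.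
apply: hnorm_eq0; apply/eqP; rewrite eq_le hnorm_ge0 andbT.
apply: (@geometric_growth R (v' ^+ 2) (v ^+ 2) _ C).
- exact: sqr_ge0.
- by rewrite ltr_pXn2r ?nnegrE// (le_trans v0)// ltW.
- move=> k; apply: (le_trans (grow k)); apply: le_trans (hC k).
  by rewrite e_proj// proj_le//; exact: ran_csub.
Qed.

Lemma e_compl (v : R) u : e (~` lowset v) u = proj (orth (ran (lowset v))) u.
Proof.
have mL := lowset_meas v.
rewrite orth_projE; last exact: ran_csub.
by rewrite -e_proj// -{2}(e_split u mL) addrC addKr.
Qed.

Lemma growth_shell a b u w : 0 <= a -> a <= b -> ran (lowset b) u ->
  orth (ran (lowset a)) u -> y (u, w) ->
  a * hnorm u ^+ 2 <= rip w u /\ a * hnorm u <= hnorm w.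
Proof.
move=> a0 ab ub ua hw.
have mA : measurable (lowset b `&` ~` lowset a).
  by apply: measurableI; [|apply: measurableC]; exact: lowset_meas.
apply: (high_form (b := b) mA ab) hw.
  by move=> l [h1 /negP]; rewrite /lowset /= -ltNge => /ltW ->.
rewrite /ran /= -eI; [|exact: lowset_meas|apply: measurableC; exact: lowset_meas].
rewrite e_compl proj_id//; exact: orth_csub.
Qed.

Lemma low_top u : (forall n : nat, orth (ran (lowset n%:R)) u) -> u = 0.
Proof.
move=> h.
have <- : e (\bigcup_n lowset n%:R) u = u.
  have -> : \bigcup_n lowset n%:R = setT.
    apply/seteqP; split => // l _; exists (Num.truncn l).+1 => //.
    rewrite /lowset /=; exact/ltW/truncnS_gt.
  by rewrite (res_T re).
apply: e_cvg_sq => [n||n]; first exact: lowset_meas.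
- apply/nondecreasing_seqP => n; apply/subsetPset => l; rewrite /lowset /= => /le_trans.
  by apply; rewrite ler_nat.
- rewrite e_proj; last exact: lowset_meas.
  by apply: proj_orthE => //; apply: ran_csub; exact: lowset_meas.
Qed.


Lemma low_mono a b : a <= b -> ran (lowset a) `<=` ran (lowset b).
Proof.
move=> ab u ua; rewrite /ran /= -ua eI; [|exact: lowset_meas|exact: lowset_meas].
congr (e _ u); apply/seteqP; split=> l; rewrite /lowset /=; first by case.
by move=> h; split => //; exact: le_trans ab.
Qed.
End AbstractSpectral.

Section DenseSubspaces.
Context {R : realType} {H : hilbert R}.
Implicit Types (u v w : H) (D L : set H).

Record lsub D : Prop := { ls0 : D 0 ; lsL : forall c u v, D u -> D v -> D (c *: u + v) }.

Definition hclosure D : set H := [set u | exists s, (forall n : nat, D (s n)) /\ hcvg s u].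

Lemma hclosureP D u : hclosure D u <->
  (forall eps : R, 0 < eps -> exists2 d, D d & hnorm (u - d) < eps).
Proof.
split=> [[s [hs sl]] eps e0|h].
  by have /hcvgP/(_ _ e0)[N hN] := sl; exists (s N) => //; rewrite hnormBC hN.
have {}h (n : nat) : exists d, D d /\ hnorm (u - d) < n.+1%:R^-1.
  by have [|d Dd hd] := h n.+1%:R^-1; [rewrite invr_gt0 | exists d].
have [s hs] := choice h; exists s; split; first by move=> n; case: (hs n).
apply: (@hcvg_le _ _ _ _ (fun n => n.+1%:R^-1)); last exact: cvg_inv_nat.
by move=> n; rewrite hnormBC ltW//; case: (hs n).
Qed.

Lemma hclosure_csub D : lsub D -> csub (hclosure D).
Proof.
move=> lD; split.
- by exists (fun=> 0); split; [move=> _; exact: ls0 | exact: hcvg_cst].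
- move=> c u v [s [hs sl]] [t [ht tl]]; exists (fun n => c *: s n + t n); split.
    by move=> n; exact: lsL.
  by apply: hcvgD => //; exact: hcvgZ.
- move=> s l hs sl; apply/hclosureP => eps e0.
  have e2 : 0 < eps / 2 by rewrite divr_gt0.
  have /hcvgP/(_ _ e2)[N hN] := sl.
  have /hclosureP/(_ _ e2)[d Dd hd] := hs N.
  exists d => //; apply: (le_lt_trans (hnormDB _ (s N) _)).
  by have := hN N (leqnn N); rewrite hnormBC; lra.
Qed.

Lemma dense_in D L : lsub D -> csub L -> D `<=` L ->
  (forall u, L u -> (forall d, D d -> ip u d = 0) -> u = 0) ->
  L `<=` hclosure D.
Proof.
move=> lD hL DL h u Lu; have hK := hclosure_csub lD.
have DK : D `<=` hclosure D.
  by move=> d Dd; exists (fun=> d); split => //; exact: hcvg_cst.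
have KL : hclosure D `<=` L by move=> v [s [hs sl]]; apply: (csC hL _ sl) => n; exact: DL.
have : u - proj (hclosure D) u = 0.
  apply: h; first by apply: (csB hL) => //; apply: KL; exact: proj_in.
  by move=> d Dd; apply: (proj_orth hK); exact: DK.
by move/eqP; rewrite subr_eq0 => /eqP ->; exact: proj_in.
Qed.

End DenseSubspaces.

(** * The operator [x^* x] and the modulus *)

Section Modulus.
Context {R : realType} {H : hilbert R}.
Implicit Types (x y : graph H) (u v w : H).

Lemma cdd_csub x : closed_dd x -> csub (x : set (prodH H)).
Proof.
move=> cx; split; first exact: cdd_0.
  by move=> c [u1 u2] [v1 v2] hu hv; exact: (cdd_lin cx c hu hv).
move=> s [l1 l2] hs /prod_hcvg[/= h1 h2]; apply: (cdd_seq cx _ h1 h2) => n.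
by have := hs n; case: (s n).
Qed.

Lemma ip_prod (a b : prodH H) : ip a b = ip a.1 b.1 + ip a.2 b.2.
Proof. by []. Qed.

(** Projecting [(u, 0)] orthogonally onto the graph of [x] among pairs gives [(p1, p2)] with
    [x^* p2 = u - p1]; hence [B u = p1] is [(1 + x^* x)^-1 u]. *)
Lemma xx_resolvent x : closed_dd x -> exists B : H -> H,
  [/\ [/\ linear B, sadj B, rpos B & contr B],
    (forall u, exists2 w, x (B u, w) & graph_adjoint x (w, u - B u)),
    (forall u w z, x (u, w) -> graph_adjoint x (w, z) -> B (u + z) = u) &
    (forall u, B u = 0 -> u = 0)].
Proof.
move=> cx; have hK := cdd_csub cx.
have ex u : exists p, x p /\ graph_adjoint x (p.2, u - p.1).
  have [[p1 p2] [xp hp]] := csub_proj hK ((u, 0) : prodH H).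
  exists (p1, p2); split => // -[k1 k2] xk /=.
  have := hp _ xk; rewrite ip_prod /= sub0r ipNl => /eqP; rewrite subr_eq0 => /eqP h.
  by rewrite -!/(ip _ _) ipC -h -ipC.
have aP w z a b : graph_adjoint x (w, z) -> x (a, b) -> ip b w = ip a z.
  by move=> h /h /=.
have aD w z w' z' : graph_adjoint x (w, z) -> graph_adjoint x (w', z') ->
    forall c, graph_adjoint x (c *: w + w', c *: z + z').
  move=> h1 h2 c [a b] xab /=; rewrite -!/(ip _ _) !ipDr !ipZr.
  by rewrite (aP _ _ _ _ h1 xab) (aP _ _ _ _ h2 xab).
have uniq u w z u' w' z' : x (u, w) -> graph_adjoint x (w, z) ->
    x (u', w') -> graph_adjoint x (w', z') -> u + z = u' + z' -> u = u'.
  move=> h1 h2 h3 h4 e.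
  have hx := cdd_lin cx (-1) h3 h1; have ha := aD _ _ _ _ h4 h2 (-1).
  have := aP _ _ _ _ ha hx; rewrite /=.
  have -> : -1 *: z' + z = - (-1 *: u' + u).
    rewrite !scaleN1r opprD opprK; apply/eqP; rewrite -subr_eq0; apply/eqP.
    have -> : - z' + z - (u' - u) = (u + z) - (u' + z') by vec.
    by rewrite e subrr.
  rewrite ipNr !ip_self -rmorphN /= => /(congr1 (@complex.Re R)) /= h.
  have h0 : rip (-1 *: u' + u) (-1 *: u' + u) = 0.
    have := rip_ge0 (-1 *: u' + u); have := rip_ge0 (-1 *: w' + w).
    by move: h; rewrite /= -(rmorphN1 (real_complex R)) => ->; lra.
  have : -1 *: u' + u = 0 by apply: ip_eq0; rewrite ip_self h0.
  by rewrite scaleN1r addrC => /eqP; rewrite subr_eq0 => /eqP.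
have [p hp] := choice ex.
have xp u : x ((p u).1, (p u).2) by case: (hp u); case: (p u).
have ap u : graph_adjoint x ((p u).2, u - (p u).1) by case: (hp u).
pose B u := (p u).1.
have By u w z : x (u, w) -> graph_adjoint x (w, z) -> B (u + z) = u.
  by move=> h1 h2; apply: (uniq _ _ _ _ _ _ (xp (u + z)) (ap _) h1 h2); rewrite addrC subrK.
have lB : linear B.
  move=> c u v; have := By _ _ _ (cdd_lin cx c (xp u) (xp v)) (aD _ _ _ _ (ap u) (ap v) c).
  by rewrite (_ : _ + _ + _ = c *: u + v)//= ; vec.
have eB u v : ip (B u) (v - B v) = ip (p u).2 (p v).2 by rewrite -(aP _ _ _ _ (ap v) (xp u)).
exists B; split; [split | | |] => //.
- move=> u v; have e1 := eB u v; have e2 := eB v u.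
  have e3 : ip (u - B u) (B v) = ip (p u).2 (p v).2.
    by rewrite ipC e2 -ipC.
  rewrite -(subrK (B v) v) ipDr e1 -e3 -ipDl subrK//; congr (ip _ _).
  by rewrite subrK.
- move=> u; rewrite -{2}(subrK (B u) u) ripDr addr_ge0 ?rip_ge0//.
  by rewrite /rip eB; exact: rip_ge0.
- move=> u; rewrite -(@ler_pXn2r _ 2)// ?nnegrE// -{2}(subrK (B u) u).
  rewrite [leRHS]hnorm2 ip_sqrD -!hnorm2 (ripC (u - B u)).
  have h : 0 <= rip (B u) (u - B u) by rewrite /rip eB; exact: rip_ge0.
  have := sqr_ge0 (hnorm (u - B u)); lra.
- by move=> u; exists (p u).2; [exact: xp | exact: ap].
- move=> u hu; have : graph_adjoint x (0, u).
    have := ap u; rewrite -/(B u) hu subr0.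
    suff -> : (p u).2 = 0 by [].
    by apply: (cdd_fun cx); have := xp u; rewrite -/(B u) hu.
  move=> h; apply: hnorm_eq0; apply/eqP; rewrite eq_le hnorm_ge0 andbT.
  apply/ler_addgt0Pr => eps e0; rewrite add0r.
  have [[a b] xab /= hab] := cdd_dense cx u e0.
  have h0 : ip a u = 0 by rewrite -(aP _ _ _ _ h xab) ip0r.
  have [->|/eqP un] := eqVneq u 0; first by rewrite hnorm0 ltW.
  rewrite -(ler_pM2r (hnorm_gt0 un)) -expr2 hnorm2.
  have -> : rip u u = rip (u - a) u by rewrite ripBl /rip h0 subr0.
  by apply: (le_trans (rip_le _ _)); rewrite ler_wpM2r// ltW.
Qed.

(** With [B = (1 + x^* x)^-1], [C] the root of [B] and [S] the root of [1 - B], the modulus is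
    [S C^-1]. Its graph is the set of pairs [(C u, S u)], and [C^2 + S^2 = 1] makes it closed and
    self-adjoint. *)
Lemma modulus_ex x : closed_dd x -> exists y, positive_sa y /\
  graph_comp y y = graph_comp (graph_adjoint x) x.
Proof.
move=> cx; have [B [[lB sB pB cB] xB By injB]] := xx_resolvent cx.
have bB := contr_bounded lB cB.
have [C [bC sC pC CC cC]] := sqrt_bounded bB sB pB.
pose B' u := u - B u.
have bB' : bounded_linear B'.
  have h := bounded_add (bounded_id (H := H)) (bounded_scale (-1) bB).
  by rewrite (_ : B' = fun u => id u + -1 *: B u)//; apply/funext => u; rewrite scaleN1r.
have sB' : sadj B' by move=> u v; rewrite /B' ipBl ipBr sB.
have pB' : rpos B' by move=> u; rewrite /B' ripBl -hnorm2 subr_ge0 contr_rip.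
have [S [bS sS pS SS cS]] := sqrt_bounded bB' sB' pB'.
have [lC _] := bC; have [lS _] := bS.
have CB : comm C B by move=> u; rewrite -!CC.
have CB' : comm C B' by move=> u; rewrite /B' (linB lC) CB.
have CS : comm C S := cS C bC CB'.
have sum u : C (C u) + S (S u) = u by rewrite CC SS /B' addrC subrK.
have pCS : rpos (C \o S) by apply: rpos_mul.
pose y : graph H := [set z | exists u, z = (C u, S u)].
have injC u : C u = 0 -> u = 0 by move=> h; apply: injB; rewrite -CC h (lin0 lC).
have recov u v : S u = C v -> u = C (C u + S v) /\ v = S (C u + S v).
  move=> h; split.
    by rewrite (linD lC) CS -h sum.
  by rewrite (linD lS) -CS h sum.
have cy : closed_dd y.
  split.
  - by exists 0; rewrite (lin0 lC) (lin0 lS).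
  - by move=> c _ _ [u ->] [v ->]; exists (c *: u + v); rewrite lC lS.
  - by move=> om [u [h1 ->]]; rewrite (injC u)// (lin0 lS).
  - move=> [l m] /graph_closureP[s [t [hy hs ht]]].
    have /choice[k hk] n : exists u, (s n, t n) = (C u, S u) by exact: hy.
    have hkc : hcvg k (C l + S m).
      rewrite (_ : k = fun n => C (s n) + S (t n)).
        by apply: hcvgD; [exact: (hcvg_bounded bC hs) | exact: (hcvg_bounded bS ht)].
      by apply/funext => n; have [-> ->] := hk n; rewrite sum.
    exists (C l + S m); congr (_, _).
      apply: (hcvg_uniq hs); have := hcvg_bounded bC hkc.
      by rewrite (_ : C \o k = s)//; apply/funext => n /=; have [-> _] := hk n.
    apply: (hcvg_uniq ht); have := hcvg_bounded bS hkc.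
    by rewrite (_ : S \o k = t)//; apply/funext => n /=; have [_ ->] := hk n.
  - move=> xi eps e0.
    have lD : lsub [set w | exists u, w = C u].
      split; first by exists 0; rewrite (lin0 lC).
      by move=> c _ _ [u ->] [v ->]; exists (c *: u + v); rewrite lC.
    have := dense_in lD (csubT (H := H)) => /(_ (fun _ _ => I)) h.
    have /h/(_ xi I)/hclosureP/(_ _ e0)[_ [u ->] hu] : forall u, setT u ->
        (forall d, (exists u, d = C u) -> ip u d = 0) -> u = 0.
      move=> u _ hu; apply: injC; apply: eq_ip => w; rewrite ip0l sC.
      by apply: hu; exists w.
    by exists (C u, S u) => //; exists u.
have ay : graph_adjoint y = y.
  apply/seteqP; split=> [[a b] h|_ [u ->] _ [v ->] /=].
    have : S a = C b.
      apply: eq_ip => w; rewrite sS sC ipC [RHS]ipC; congr (Num.conj _).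
      by have /= := h (C w, S w) (ex_intro _ w erefl).
    by move=> /recov[e1 e2]; exists (C a + S b); rewrite -e1 -e2.
  by rewrite -!/(ip _ _) sS -CS sC.
exists y; split.
  split => // _ [u ->] /=; rewrite -/(ip _ _) lecE.
  have e : ip (S u) (C u) = ip (C (S u)) u by rewrite sC.
  rewrite e; have := pCS u; rewrite /rip /= => ->; rewrite andbT.
  suff -> : complex.Im (ip (C (S u)) u) = 0 by [].
  have : ip (C (S u)) u = Num.conj (ip (C (S u)) u) by rewrite -ipC sC sS CS.
  by move/(congr1 (@complex.Im R)); rewrite ImJ => h; lra.
apply/seteqP; split=> [[a b] /= [c [u [-> ->]] [v [e ->]]]|[a b] /= [w xw aw]].
  have [e1 e2] := recov _ _ e; set k := C u + S v in e1 e2 *.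
  have [w h1 h2] := xB k; exists w => /=.
    by rewrite e1 CC.
  by rewrite e2 SS.
have eB := By _ _ _ xw aw; set k := a + b in eB.
have e : b = B' k by rewrite /B' eB /k addrC addKr.
exists (S (C k)); first by exists (C k); rewrite CC eB.
by exists (S k); rewrite CS e SS.
Qed.

Lemma modulusP x : closed_dd x -> positive_sa (modulus x) /\
  graph_comp (modulus x) (modulus x) = graph_comp (graph_adjoint x) x.
Proof. by move=> cx; exact: (xgetPex set0 (modulus_ex cx)). Qed.

(** The domain of [x^* x] is a core of [x]: an element [(a, b)] of the graph orthogonal to all
    [(B k, x B k)] satisfies [<a, k> = 0] for every [k]. *)
Lemma xx_core x u w : closed_dd x -> x (u, w) -> exists s t z : nat -> H,
  [/\ forall n, x (s n, t n), forall n, graph_adjoint x (t n, z n), hcvg s u & hcvg t w].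
Proof.
move=> cx xuw; have [B [[lB sB pB cB] xB By injB]] := xx_resolvent cx.
have /choice[X hX] v : exists k, x (B v, k) /\ graph_adjoint x (k, v - B v).
  by have [k] := xB v; exists k.
pose D : set (prodH H) := [set p | exists k, p = (B k, X k)].
have lD : lsub D.
  split; first by exists 0; rewrite (lin0 lB); congr (_, _); apply/esym/(cdd_fun cx);
    have [] := hX 0; rewrite (lin0 lB).
  move=> c _ _ [u1 ->] [v1 ->]; exists (c *: u1 + v1); rewrite lB; congr (_, _).
  apply: (cdd_uniq cx); last by case: (hX (c *: u1 + v1)); rewrite lB => + _; apply.
  by rewrite -/(_.2); exact: (cdd_lin cx c (proj1 (hX u1)) (proj1 (hX v1))).
have DL : D `<=` (x : set (prodH H)) by move=> _ [k ->]; case: (hX k).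
have h0 p : (x : set (prodH H)) p -> (forall d, D d -> ip p d = 0) -> p = 0.
  case: p => a b xab h.
  have a0 : a = 0.
    apply: eq_ip => k; rewrite ip0l.
    have : ip ((a, b) : prodH H) ((B k, X k) : prodH H) = 0 by apply: h; exists k.
    rewrite ip_prod /=; have /(_ _ xab) /= := proj2 (hX k).
    by rewrite -!/(ip _ _) => ->; rewrite -ipDr addrC subrK.
  by move: xab; rewrite a0 => /(cdd_fun cx) ->.
have [s [hs hc]] := dense_in lD (cdd_csub cx) DL h0 xuw.
have [k hk] := choice hs.
have /prod_hcvg[/= h1 h2] := hc.
exists (fun n => (s n).1), (fun n => (s n).2), (fun n => k n - B (k n)); split => // n.
  by rewrite hk /=; case: (hX (k n)).
by rewrite hk /=; case: (hX (k n)).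
Qed.

(** On the core given by the common square both norms are determined by its form, also for
    differences, and closedness carries the equality to the whole domain. This exchanges [x] and its
    modulus in norm estimates. *)
Lemma same_square_norm x y : closed_dd x -> closed_dd y ->
  graph_comp (graph_adjoint x) x = graph_comp (graph_adjoint y) y ->
  forall u w, x (u, w) -> exists2 w', y (u, w') & hnorm w' = hnorm w.
Proof.
move=> cx cy e u w xuw; have [s [t [z [hx ha hs ht]]]] := xx_core cx xuw.
have /choice[t' ht'] n : exists k, y (s n, k) /\ graph_adjoint y (k, z n).
  have : graph_comp (graph_adjoint x) x (s n, z n) by exists (t n); [exact: hx|exact: ha].
  by rewrite e => -[k /= h1 h2]; exists k.
have aP (g : graph H) k z1 a b : graph_adjoint g (k, z1) -> g (a, b) -> ip b k = ip a z1.
  by move=> h /h /=.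
have nrm m n : hnorm (t' m - t' n) = hnorm (t m - t n).
  have [y1 a1] := ht' m; have [y2 a2] := ht' n.
  apply/eqP; rewrite -(@eqrXn2 _ 2)// !hnorm2; apply/eqP.
  rewrite /rip !ipBr !ipBl (aP _ _ _ _ _ a1 y1) (aP _ _ _ _ _ a1 y2) (aP _ _ _ _ _ a2 y1) (aP _ _ _ _ _ a2 y2).
  by rewrite (aP _ _ _ _ _ (ha m) (hx m)) (aP _ _ _ _ _ (ha m) (hx n)) (aP _ _ _ _ _ (ha n) (hx m)) (aP _ _ _ _ _ (ha n) (hx n)).
have nrm1 n : hnorm (t' n) = hnorm (t n).
  have [y1 a1] := ht' n.
  apply/eqP; rewrite -(@eqrXn2 _ 2)// !hnorm2; apply/eqP.
  by rewrite /rip (aP _ _ _ _ _ a1 y1) (aP _ _ _ _ _ (ha n) (hx n)).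
have [w' hw'] : exists w', hcvg t' w'.
  apply: hcauchy_cvg => eps e0; have /hcvgP/(_ (eps / 2))[|N hN] := ht; first by rewrite divr_gt0.
  exists N => m n Nm Nn; rewrite nrm; apply: (le_lt_trans (hnormDB _ w _)).
  by rewrite (hnormBC w); have := hN m Nm; have := hN n Nn; lra.
exists w'; first by apply: (cdd_seq cy _ hs hw') => n; case: (ht' n).
have h1 := hcvg_hnorm hw'; have h2 := hcvg_hnorm ht.
apply: (cvgr_uniq h1); move: h2; under eq_fun do rewrite -nrm1.
exact.
Qed.
End Modulus.

(** * Spectral subspaces of a general closed operator *)

Section SpectralSubspaces.
Context {R : realType} {H : hilbert R}.
Implicit Types (x : graph H) (u w : H) (v a b : R).

(** The spectral subspace of the modulus for [[0, v]], written in terms of [x^* x] alone: it is the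
    same for every choice of modulus and spectral measure, and visibly invariant when [x] is
    affiliated. *)
Definition gsp x v : set H := growth (graph_comp (graph_adjoint x) x) v.

Section GenericMeasure.
Variables (x y : graph H) (e : set R -> H -> H).
Hypotheses (cx : closed_dd x) (hy : positive_sa y) (he : is_spectral_measure y e).
Hypothesis xy : graph_comp y y = graph_comp (graph_adjoint x) x.

Lemma gsp_ran v : 0 <= v -> gsp x v = ran e (lowset v).
Proof. by move=> v0; rewrite /gsp -xy (growthP hy he v0). Qed.

Let cy : closed_dd y. Proof. by case: hy. Qed.
Let yy : graph_comp (graph_adjoint y) y = graph_comp (graph_adjoint x) x.
Proof. by case: hy => _ -> _. Qed.

(** The complement of [gsp x v] is exhausted by shells with bounded levels, because there all
    vectors are sure to lie in the domain of [x]. *)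
Lemma gsp_shells_aux v u : 0 <= v -> (forall n : nat,
  orth (gsp x (v + n.+1%:R) `&` orth (gsp x (v + n.+1%:R^-1))) u) -> gsp x v u.
Proof.
move=> v0 h; rewrite (gsp_ran v0).
have mL a : measurable (lowset a) by exact: lowset_meas.
pose F n := lowset (v + n.+1%:R) `&` ~` lowset (v + n.+1%:R^-1).
have mF n : measurable (F n) by apply: measurableI => //; exact: measurableC.
have UF : \bigcup_n F n = ~` lowset v.
  rewrite -shell_bigcup; apply/seteqP; split=> l [n _].
    by move=> [h1 /negP]; rewrite /lowset /= -ltNge => /ltW h2; exists n => //=; rewrite h1 h2.
  move=> /= /andP[h1 h2]; exists n.+1 => //; split; rewrite /lowset /=.
    by apply: (le_trans h2); rewrite lerD2l ler_nat.
  apply/negP; rewrite -ltNge; apply: (lt_le_trans _ h1).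
  by rewrite ltrD2l ltf_pV2 ?posrE ?ltr0n// ltr_nat.
suff z0 : e (~` lowset v) u = 0 by have := e_split he u (mL v); rewrite z0 addr0.
rewrite -UF; apply: (e_cvg_sq he) => //.
  apply/nondecreasing_seqP => n; apply/subsetPset => l [h1 h2]; split.
    by apply: (le_trans h1); rewrite lerD2l ler_nat.
  apply: contra_not h2; rewrite /lowset /= => /le_trans; apply.
  by rewrite lerD2l lef_pV2 ?posrE ?ltr0n// ler_nat.
move=> n; apply: ip_eq0; rewrite (e_sadj he (mF n)) (e_idem he (mF n)).
apply: (h n); have vn : 0 <= v + n.+1%:R by rewrite addr_ge0.
have vi : 0 <= v + n.+1%:R^-1 by rewrite addr_ge0// invr_ge0.
rewrite (gsp_ran vn) (gsp_ran vi); split.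
  by rewrite /ran /= (eI he)// /F setIA setIid.
move=> k kr; rewrite -kr -(e_sadj he (mL _)) (eI he)//.
by rewrite /F setIA setIAC setICr set0I (e_set0 he) ip0l.
Qed.

Lemma gsp_facts_aux :
  [/\ forall v, 0 <= v -> csub (gsp x v),
   (forall v, 0 <= v -> forall u, e (~` lowset v) u = proj (orth (gsp x v)) u),
   (forall a b, 0 <= a -> a <= b -> gsp x a `<=` gsp x b),
   (forall v u, 0 <= v -> gsp x v u -> exists2 w, x (u, w) & hnorm w <= v * hnorm u) &
   (forall a b u w, 0 <= a -> a <= b -> gsp x b u -> orth (gsp x a) u -> x (u, w) ->
      a * hnorm u <= hnorm w)].
Proof.
split.
- by move=> v v0; rewrite gsp_ran//; apply: (ran_csub he); exact: lowset_meas.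
- by move=> v v0 u; rewrite gsp_ran// (e_compl he).
- move=> a b a0 ab; rewrite !gsp_ran ?(le_trans a0)//; exact: (low_mono he).
- move=> v u v0; rewrite gsp_ran// => /(low_dom hy he v0)[w [h _ hn _]].
  by have [w' hw' en] := same_square_norm cy cx yy h; exists w' => //; rewrite en.
- move=> a b u w a0 ab; have b0 := le_trans a0 ab.
  rewrite !gsp_ran// => ub ua h; have [w' hw' <-] := same_square_norm cx cy (esym yy) h.
  by have [] := growth_shell he a0 ab ub ua hw'.
Qed.

Lemma gsp_core_aux u w (eps : R) : x (u, w) -> 0 < eps -> exists n k z,
  [/\ gsp x (n : nat)%:R k, x (k, z), hnorm (u - k) < eps & hnorm (w - z) < eps].
Proof.
move=> h e0; have [w' hw' en] := same_square_norm cx cy (esym yy) h.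
have mL (a : R) : measurable (lowset a) by exact: lowset_meas.
pose K (n : nat) := ran e (lowset (n%:R : R)).
have cK n : csub (K n) by exact: (ran_csub he).
have iK n : K n `<=` K n.+1 by apply: (low_mono he); rewrite ler_nat.
have top : [set z | forall n, orth (K n) z] = [set 0].
  apply/seteqP; split=> [z /(low_top he)//|_ -> n k _]; exact: ip0l.
have cv z : hcvg (fun n => proj (K n) z) z.
  have := incr_cvg cK iK z; rewrite top.
  suff -> : proj [set 0] z = 0 by rewrite subr0.
  exact: (proj_in csub0).
have /hcvgP/(_ _ e0)[N hN] := cv u; have /hcvgP/(_ _ e0)[N' hN'] := cv w'.
pose n := maxn N N'; have n0 : 0 <= n%:R :> R by [].
have yn := y_e_comm hy he (mL n%:R) hw'.
have [z xz _] := same_square_norm cy cx yy yn.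
exists n, (e (lowset n%:R) u), z; split => //.
- by rewrite gsp_ran//; exact: (e_in he).
- by rewrite hnormBC (e_proj he)// hN// leq_maxl.
have xd := cdd_B cx h xz; have [w2 h2 <-] := same_square_norm cx cy (esym yy) xd.
by rewrite -(cdd_uniq cy (cdd_B cy hw' yn) h2) hnormBC (e_proj he)// hN'// leq_maxr.
Qed.
End GenericMeasure.

Section Closed.
Variables (x : graph H) (cx : closed_dd x).
Let hm := proj1 (modulusP cx).
Let em := proj2 (modulusP cx).
Let he := spectral_measure_ex hm.
Let facts := gsp_facts_aux cx hm he em.

Lemma gsp_csub v : 0 <= v -> csub (gsp x v). Proof. by case: facts => h _ _ _ _ /h. Qed.
Lemma gsp_mono a b : 0 <= a -> a <= b -> gsp x a `<=` gsp x b.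
Proof. by case: facts => _ _ h _ _; exact: h. Qed.
Lemma gsp_dom v u : 0 <= v -> gsp x v u -> exists2 w, x (u, w) & hnorm w <= v * hnorm u.
Proof. by case: facts => _ _ _ h _; exact: h. Qed.
Lemma gsp_shell a b u w : 0 <= a -> a <= b -> gsp x b u -> orth (gsp x a) u -> x (u, w) ->
  a * hnorm u <= hnorm w.
Proof. by case: facts => _ _ _ _ h; exact: h. Qed.
Lemma gsp_shells v u : 0 <= v -> (forall n : nat,
  orth (gsp x (v + n.+1%:R) `&` orth (gsp x (v + n.+1%:R^-1))) u) -> gsp x v u.
Proof. by move=> v0 h; exact: (gsp_shells_aux hm he em v0 h). Qed.
Lemma gsp_core u w (eps : R) : x (u, w) -> 0 < eps -> exists n k z,
  [/\ gsp x (n : nat)%:R k, x (k, z), hnorm (u - k) < eps & hnorm (w - z) < eps].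
Proof. by move=> h e0; exact: (gsp_core_aux cx hm he em h e0). Qed.
Lemma spectral_gsp v : 0 <= v ->
  spectral_measure (modulus x) `]v, +oo[%classic = proj (orth (gsp x v)).
Proof.
move=> v0; apply/funext => u; case: facts => _ /(_ v v0 u) <- _ _ _.
congr (spectral_measure _ _ u); apply/seteqP; split=> l /=; rewrite in_itv /= andbT.
  by move=> h; apply/negP; rewrite /lowset /= -ltNge.
by move=> /negP; rewrite /lowset /= -ltNge.
Qed.
Lemma gsp_top u : (forall n : nat, orth (gsp x n%:R) u) -> u = 0.
Proof.
move=> h; apply: (low_top he) => n k kn; apply: (h n).
by rewrite (gsp_ran hm he em).
Qed.
End Closed.

Section Positive.
Variables (x : graph H) (hx : positive_sa x).
Let cx : closed_dd x. Proof. by case: hx. Qed.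
Let he := spectral_measure_ex hx.
Let xx : graph_comp x x = graph_comp (graph_adjoint x) x.
Proof. by case: hx => _ -> _. Qed.

Lemma gsp_shell_form a b u w : 0 <= a -> a <= b -> gsp x b u -> orth (gsp x a) u -> x (u, w) ->
  a * hnorm u ^+ 2 <= rip w u.
Proof.
move=> a0 ab; have b0 := le_trans a0 ab; rewrite !(gsp_ran hx he xx)// => h1 h2 h3.
by have [] := growth_shell he a0 ab h1 h2 h3.
Qed.

Lemma gsp_proj v u w : 0 <= v -> x (u, w) -> x (proj (gsp x v) u, proj (gsp x v) w).
Proof.
move=> v0 h; rewrite !(gsp_ran hx he xx)// -!(e_proj he); try exact: lowset_meas.
by apply: (y_e_comm hx he) => //; exact: lowset_meas.
Qed.

End Positive.
End SpectralSubspaces.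

(** * Relative dimension of invariant subspaces *)

Lemma adj_l (R : realType) (H : hilbert R) (a b : H -> H) : is_adjoint a b ->
  forall u v, ip (a u) v = ip u (b v).
Proof. by move=> h u v; exact: h. Qed.
Lemma adj_r (R : realType) (H : hilbert R) (a b : H -> H) : is_adjoint a b ->
  forall u v, ip (b u) v = ip u (a v).
Proof. by move=> h u v; rewrite ipC -(adj_l h) -ipC. Qed.
Lemma adj_sym (R : realType) (H : hilbert R) (a b : H -> H) : is_adjoint a b -> is_adjoint b a.
Proof. by move=> h u v; exact: adj_r. Qed.

Section Algebra.
Context {R : realType} (M : traced_vna R).
Local Notation H := (vspace_of M).
Local Notation A := (valg M).
Implicit Types (a b f : H -> H) (u v w : H) (K L : set H).

Lemma mem_valg f : bounded_linear f ->
  (forall b, commutant A b -> comm f b) -> A f.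
Proof.
move=> bf h; have [_ <-] := valgP M; split => // b hb.
by apply/funext => u /=; rewrite (h b hb).
Qed.
Lemma valg_bounded f : A f -> bounded_linear f.
Proof. by have [_ <-] := valgP M; case. Qed.
Lemma valg_comm f b : A f -> commutant A b -> comm f b.
Proof. by move=> hf [_ /(_ _ hf) e] u; exact: (congr1 (@^~ u) e). Qed.
Lemma commutant_bounded b : commutant A b -> bounded_linear b.
Proof. by case. Qed.
Lemma mem_commutant b : bounded_linear b -> (forall f, A f -> comm f b) -> commutant A b.
Proof. by move=> bb h; split => // f hf; apply/funext => u /=; exact: h. Qed.

Lemma valg_id : A id. Proof. by apply: mem_valg => //; exact: bounded_id. Qed.
Lemma valg_comp a b : A a -> A b -> A (a \o b).
Proof.
move=> ha hb; apply: mem_valg => [|c hc u /=]; first by apply: bounded_comp; exact: valg_bounded.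
by rewrite (valg_comm hb hc) (valg_comm ha hc).
Qed.
Lemma valg_add a b : A a -> A b -> A (fun u => a u + b u).
Proof.
move=> ha hb; apply: mem_valg => [|c hc u /=]; first by apply: bounded_add; exact: valg_bounded.
by rewrite (valg_comm hb hc) (valg_comm ha hc) (linD (proj1 (commutant_bounded hc))).
Qed.
Lemma valg_scale c a : A a -> A (fun u => c *: a u).
Proof.
move=> ha; apply: mem_valg => [|b hb u /=]; first by apply: bounded_scale; exact: valg_bounded.
by rewrite (valg_comm ha hb) (linZ (proj1 (commutant_bounded hb))).
Qed.
Lemma valg_sub a b : A a -> A b -> A (fun u => a u - b u).
Proof.
move=> ha hb; have := valg_add ha (valg_scale (-1) hb).
by congr (A _); apply/funext => u; rewrite scaleN1r.
Qed.
Lemma valg_iter n a : A a -> A (iter n a).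
Proof.
move=> ha; elim: n => [|n IH]; first exact: valg_id.
by rewrite (_ : iter n.+1 a = a \o iter n a)//; exact: valg_comp.
Qed.

Lemma pos_partP a : A a -> sadj a -> rpos a -> pos_part A a.
Proof.
move=> ha sa pa; split => // u; rewrite -/(ip _ _) lecE; have := pa u; rewrite /rip /= => ->.
rewrite andbT eq_sym; apply/eqP.
have : ip (a u) u = Num.conj (ip (a u) u) by rewrite -ipC sa.
by move/(congr1 (@complex.Im R)); rewrite ImJ => h; lra.
Qed.

Definition cunitary (u v : H -> H) : Prop :=
  [/\ commutant A u, is_adjoint u v, u \o v = id & v \o u = id].

(** Affiliation is stated through unitaries of the commutant, so this is the invariance that domains
    and spectral subspaces inherit; for a closed subspace it puts the projection into the
    algebra. *)
Definition invar K : Prop := forall u v : H -> H, cunitary u v -> forall k, K k -> K (u k).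

Lemma commutant_adj b b' : commutant A b -> bounded_linear b' -> is_adjoint b b' ->
  commutant A b'.
Proof.
move=> hb bb' ad; apply: mem_commutant => // f hf u.
have [f' hf' adf] := proj1 (valgP M) f hf.
apply: eq_ip => w; rewrite (adj_l adf) !(adj_r ad) -(valg_comm hf' hb).
by rewrite (adj_l adf).
Qed.

Lemma cunitary_sym (u v : H -> H) : bounded_linear v -> cunitary u v -> cunitary v u.
Proof.
move=> bv [h1 h2 h3 h4]; split => //; first exact: commutant_adj h2.
exact: adj_sym.
Qed.

Lemma cunitary_bij (u v : H -> H) : cunitary u v -> cunitary v u.
Proof.
move=> h; apply: (cunitary_sym _ h); have [h1 h2 h3 h4] := h.
have [g bg hg] := adjoint_exists (commutant_bounded h1).
rewrite (_ : v = g)//; apply/funext => w; apply: eq_ipr => z.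
by rewrite -(adj_l h2) (adj_l hg).
Qed.

Lemma cunitary_isom (u v : H -> H) : cunitary u v -> forall z w, ip (u z) (u w) = ip z w.
Proof. by move=> [h1 h2 h3 h4] z w; rewrite (adj_l h2) -{2}[w]/(id w) -h4. Qed.

Lemma cunitary_K (u v : H -> H) : cunitary u v -> forall z, u (v z) = z /\ v (u z) = z.
Proof. by move=> [_ _ h3 h4] z; split; [exact: (congr1 (@^~ z) h3)|exact: (congr1 (@^~ z) h4)]. Qed.

Record msub K : Prop := { ms_c : csub K ; ms_i : invar K }.

Lemma msub_commute_unitary K (u v : H -> H) : msub K -> cunitary u v -> comm (proj K) u.
Proof.
move=> [cK iK] uv z; have lu := proj1 (commutant_bounded (let: And4 h _ _ _ := uv in h)).
apply: (proj_uniq cK); first by apply: iK; [exact: uv | exact: proj_in].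
move=> k kK; have [e1 _] := cunitary_K uv k.
rewrite -(linB lu) -e1 (cunitary_isom uv); apply: (proj_orth cK).
exact: (iK _ _ (cunitary_bij uv)).
Qed.

(** [a] is the average of the unitaries [a + i S] and [a - i S], where [S] is the square root of
    [1 - a^2]; both lie in the commutant. *)
Lemma msub_commute_contr K a : msub K -> commutant A a -> sadj a ->
  (forall u, hnorm (a u) <= hnorm u) -> comm (proj K) a.
Proof.
move=> mK ha sa ca z.
have ba := commutant_bounded ha; have [la _] := ba.
pose D u := u - a (a u).
have bD : bounded_linear D.
  have := bounded_add (bounded_id (H := H)) (bounded_scale (-1) (bounded_comp ba ba)).
  by congr bounded_linear; apply/funext => u; rewrite scaleN1r.
have [lD _] := bD.
have [||S [bS sS pS SS cS]] := @sqrt_bounded _ _ D bD.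
- by move=> u v; rewrite /D ipBl ipBr !sa.
- move=> u; rewrite /D ripBl (sadj_rip sa) -!hnorm2 subr_ge0.
  by rewrite ler_pXn2r ?nnegrE//; exact: ca.
have [lS _] := bS.
have hS : commutant A S.
  apply: mem_commutant => // f hf; apply: cS; first exact: valg_bounded.
  have [lf _] := valg_bounded hf; move=> u.
  by rewrite /D (linB lf) !(valg_comm hf ha).
have aS : comm a S by apply: cS => // u; rewrite /D (linB la).
pose u w := a w + 'i%C *: S w; pose v w := a w + (- 'i%C) *: S w.
have bu c : bounded_linear (fun w => a w + c *: S w).
  by apply: bounded_add => //; exact: bounded_scale.
have hu c : commutant A (fun w => a w + c *: S w).
  apply: mem_commutant => // f hf w; have [lf _] := valg_bounded hf.
  by rewrite (linD lf) (linZ lf) (valg_comm hf ha) (valg_comm hf hS).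
have ci : Num.conj ('i%C : R[i]) = - 'i%C.
  by apply/eqP; rewrite eq_complex /= oppr0 !eqxx.
have ii : 'i%C * 'i%C = -1 :> R[i] by rewrite -expr2 sqr_i.
have mul c : c * c = -1 -> forall w, (fun w => a w + c *: S w) (a w + (- c) *: S w) = w.
  move=> cc w; rewrite (linD la) (linD lS) !(linZ la) !(linZ lS) aS SS scalerDr.
  rewrite !scalerA mulrN cc opprK scale1r /D.
  by vec.
have uv : cunitary u v.
  split.
  - exact: hu.
  - by move=> x y; rewrite -!/(ip _ _) /u /v ipDl ipDr ipZl ipZr sa sS rmorphN /= ci opprK.
  - by apply/funext => w; exact: mul.
  - apply/funext => w; have := mul (- 'i%C); rewrite mulrNN ii opprK => /(_ erefl w); exact.
have e1 := msub_commute_unitary mK uv; have e2 := msub_commute_unitary mK (cunitary_bij uv).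
have lP := proj_linear (ms_c mK).
have sum w : u w + v w = 2 *: a w.
  by rewrite /u /v; have -> : (2 : R[i]) = 1 + 1 by []; vec.
have : 2 *: proj K (a z) = 2 *: a (proj K z) by rewrite -(linZ lP) -!sum (linD lP) e1 e2.
by move/(congr1 (fun w => (2 : R[i])^-1 *: w)); rewrite !scalerA mulVf ?scale1r// pnatr_eq0.
Qed.

Lemma msub_commute K a : msub K -> commutant A a -> comm (proj K) a.
Proof.
move=> mK ha; have ba := commutant_bounded ha.
have [b bb ad] := adjoint_exists ba.
have hb := commutant_adj ha bb ad.
have lP := proj_linear (ms_c mK).
have lin c d : commutant A (fun w => c *: a w + d *: b w).
  apply: mem_commutant.
    by apply: bounded_add; exact: bounded_scale.
  move=> f hf w; have [lf _] := valg_bounded hf.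
  by rewrite (linD lf) !(linZ lf) (valg_comm hf ha) (valg_comm hf hb).
have sa_case c : commutant A c -> sadj c -> comm (proj K) c.
  move=> hc sc; have bc := commutant_bounded hc.
  have [B B0 hB] := bounded_bound bc.
  have hc' : commutant A (fun w => (B^-1)%:C%C *: c w).
    apply: mem_commutant; first exact: bounded_scale.
    by move=> f hf w; rewrite (linZ (proj1 (valg_bounded hf))) (valg_comm hf hc).
  have e := @msub_commute_contr K _ mK hc'.
  move=> w; have := e _ _ w; rewrite (linZ lP) => h.
  have {h}/(congr1 (fun w => B%:C%C *: w)) : (B^-1)%:C%C *: proj K (c w) = (B^-1)%:C%C *: c (proj K w).
    apply: h; first by move=> x y; rewrite ipZl ipZr conj_real sc.
    by move=> x; rewrite hnormZr ger0_norm ?invr_ge0 ?(ltW B0)// ler_pdivrMl.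
  by rewrite !scalerA -rmorphM /= divff ?gt_eqF// !scale1r.
have h1 := sa_case _ (lin 1 1) _.
have h2 := sa_case _ (lin 'i%C (- 'i%C)) _.
have ci : Num.conj ('i%C : R[i]) = - 'i%C.
  by apply/eqP; rewrite eq_complex /= oppr0 !eqxx.
have ii : 'i%C * 'i%C = -1 :> R[i] by rewrite -expr2 sqr_i.
have s1 : sadj (fun w => 1 *: a w + 1 *: b w).
  by move=> x y; rewrite ipDl ipDr !ipZl !ipZr (adj_l ad) (adj_r ad) rmorph1 addrC.
have s2 : sadj (fun w => 'i%C *: a w + (- 'i%C) *: b w).
  move=> x y; rewrite ipDl ipDr !ipZl !ipZr (adj_l ad) (adj_r ad) rmorphN /= ci opprK addrC.
  by [].
move=> w; have {h1}e1 := h1 s1 w; have {h2}e2 := h2 s2 w.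
(* [a] is a combination of the self-adjoint operators [a + b] and [i (a - b)], where [b] is its
   adjoint. *)
have dec z : 2 *: a z = (1 *: a z + 1 *: b z) + (- 'i%C) *: ('i%C *: a z + (- 'i%C) *: b z).
  rewrite scalerDr !scalerA mulrNN mulNr ii opprK scaleN1r !scale1r.
  by have -> : (2 : R[i]) = 1 + 1 by []; vec.
have : 2 *: proj K (a w) = 2 *: a (proj K w).
  by rewrite -(linZ lP) !dec (linD lP) (linZ lP) e1 e2.
by move/(congr1 (fun w => (2 : R[i])^-1 *: w)); rewrite !scalerA mulVf ?scale1r// pnatr_eq0.
Qed.

Lemma msub_proj K : msub K -> pos_part A (proj K).
Proof.
move=> mK; have cK := ms_c mK; apply: pos_partP.
- by apply: mem_valg; [exact: proj_bounded | move=> b; exact: msub_commute].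
- exact: proj_sa.
- by move=> u; rewrite proj_rip// sqr_ge0.
Qed.

Lemma msub_orth K : msub K -> msub (orth K).
Proof.
move=> [cK iK]; split; first exact: orth_csub.
move=> u v uv k hk z zK; have [e1 _] := cunitary_K uv z.
by rewrite -e1 (cunitary_isom uv); apply: hk; exact: (iK _ _ (cunitary_bij uv)).
Qed.
Lemma msubI K L : msub K -> msub L -> msub (K `&` L).
Proof.
move=> [cK iK] [cL iL]; split; first exact: csubI.
by move=> u v uv k [h1 h2]; split; [exact: iK uv _ h1 | exact: iL uv _ h2].
Qed.
Lemma msub_bigcap (I : Type) (K : I -> set H) : (forall i, msub (K i)) ->
  msub [set u | forall i, K i u].
Proof.
move=> h; split; first by apply: csub_bigcap => i; exact: ms_c.
by move=> u v uv k hk i; exact: (ms_i (h i) uv).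
Qed.
Lemma msub0 : msub [set 0].
Proof.
split; first exact: csub0.
by move=> u v [hu _ _ _] k ->; rewrite /= (lin0 (proj1 (commutant_bounded hu))).
Qed.
Lemma msubT : msub setT. Proof. by split => //; exact: csubT. Qed.
Lemma msub_hclosure (D : set H) : lsub D -> invar D -> msub (hclosure D).
Proof.
move=> lD iD; split; first exact: hclosure_csub.
move=> u v uv k [s [hs sl]]; exists (u \o s); split; first by move=> n; exact: (iD _ _ uv).
by case: uv => hu _ _ _; apply: hcvg_bounded => //; exact: commutant_bounded.
Qed.
End Algebra.

(** * The trace as a dimension function, and comparison of projections *)

Section Dimension.
Context {R : realType} (M : traced_vna R).
Local Notation H := (vspace_of M).
Local Notation A := (valg M).
Local Notation tau := (vtrace M).
Implicit Types (a b f : H -> H) (u v w : H) (K L : set H).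
Let tr := vtraceP M.

Lemma pos_part_rpos a : pos_part A a -> forall u, complex.Im (ip (a u) u) = 0 /\ 0 <= rip (a u) u.
Proof. by move=> [_ h] u; have := h u; rewrite lecE => /andP[/eqP -> ->]. Qed.

Lemma bleP a b : pos_part A a -> pos_part A b ->
  (forall u, rip (a u) u <= rip (b u) u) -> ble a b.
Proof.
move=> ha hb h u; rewrite -/(ip _ _) lecE -/(rip _ _) ripBl subr_ge0 h andbT /=.
rewrite ipBl; have [ea _] := pos_part_rpos ha u; have [eb _] := pos_part_rpos hb u.
by move: ea eb; case: (ip _ _) => ? ?; case: (ip _ _) => ? ? /= -> ->; rewrite subr0.
Qed.

Lemma tr_mono a b : pos_part A a -> pos_part A b ->
  (forall u, rip (a u) u <= rip (b u) u) -> (tau a <= tau b)%E.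
Proof.
move=> ha hb h; have ab := bleP ha hb h.
have hd : pos_part A (fun u => b u - a u) by split => //; apply: valg_sub; [case: hb|case: ha].
rewrite (_ : b = fun u => a u + (b u - a u)); last by apply/funext => u; rewrite addrC subrK.
by rewrite (tr_D tr ha hd) leeDl// (tr_ge0 tr).
Qed.

(** The strong limit of an increasing sequence is its least upper bound among the positive elements,
    so normality of the trace applies. *)
Lemma tr_seq_le (a : nat -> H -> H) b (c : \bar R) : (forall n, pos_part A (a n)) ->
  pos_part A b -> (forall n u, rip (a n u) u <= rip (a n.+1 u) u) ->
  (forall u, hcvg (fun n => a n u) (b u)) -> (forall n, (tau (a n) <= c)%E) -> (tau b <= c)%E.
Proof.
move=> ha hb inc cv hc.
have mono u m n : (m <= n)%N -> rip (a m u) u <= rip (a n u) u.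
  by move=> /subnK <-; elim: (n - m)%N => // k IH; rewrite addSn (le_trans IH).
have le_b u n : rip (a n u) u <= rip (b u) u.
  apply: (ler_cvg_to (cvg_cst _) (hcvg_rip (w := u) (cv u))).
  by exists n => // m /= nm; exact: mono.
have := @tr_normal _ _ _ _ tr [set a n | n in setT] b.
rewrite /is_lub => ->; first by apply: ge_ereal_sup => _ [_ [n _ <-] <-].
- by exists (a 0%N); exists 0%N.
- by move=> _ [n _ <-].
- move=> _ _ [m _ <-] [n _ <-]; exists (a (maxn m n)); first by exists (maxn m n).
  by split; apply: bleP => // u; apply: mono; rewrite ?leq_maxl ?leq_maxr.
- split => //; first by move=> _ [n _ <-]; exact: bleP.
  move=> c' hc' ub; apply: bleP => // u.
  apply: (ler_cvg_to (hcvg_rip (w := u) (cv u)) (cvg_cst _)); apply: nearW => n.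
  have /(_ u) : ble (a n) c' by apply: ub; exists n.
  by rewrite -/(ip _ _) lecE -/(rip _ _) => /andP[_]; rewrite ripBl subr_ge0.
Qed.

Definition dim K : \bar R := tau (proj K).
Definition codim K : \bar R := dim (orth K).

Lemma dim_ge0 K : msub K -> (0 <= dim K)%E.
Proof. by move=> mK; apply: (tr_ge0 tr); exact: msub_proj. Qed.
Lemma codim_ge0 K : msub K -> (0 <= codim K)%E.
Proof. by move=> mK; apply: dim_ge0; exact: msub_orth. Qed.

Lemma dim_split K L : msub K -> msub L -> K `<=` L -> dim L = (dim K + dim (L `&` orth K))%E.
Proof.
move=> mK mL KL; have cK := ms_c mK; have cL := ms_c mL.
have mI := msubI mL (msub_orth mK).
rewrite /dim -(tr_D tr (msub_proj mK) (msub_proj mI)); congr tau; apply/funext => u.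
suff -> : proj (L `&` orth K) u = proj L u - proj K u by rewrite addrC subrK.
apply: (proj_uniq (ms_c mI)).
  split; first by apply: (csB cL); [exact: proj_in | apply: KL; exact: proj_in].
  move=> k kK; have := proj_orth cK u kK; have := proj_orth cL u (KL _ kK).
  rewrite !ipBl => /eqP; rewrite subr_eq0 => /eqP ->; exact.
move=> k [kL kK].
have -> : ip (u - (proj L u - proj K u)) k = ip (u - proj L u) k + ip (proj K u) k.
  by rewrite !ipBl; ring.
rewrite (proj_orth cL _ kL) add0r.
by apply: ip_sym0; apply: kK; exact: proj_in.
Qed.

Lemma dim_mono K L : msub K -> msub L -> K `<=` L -> (dim K <= dim L)%E.
Proof.
move=> mK mL KL; rewrite (dim_split mK mL KL) leeDl//.
by apply: dim_ge0; apply: msubI => //; exact: msub_orth.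
Qed.
Lemma codim_mono K L : msub K -> msub L -> K `<=` L -> (codim L <= codim K)%E.
Proof. by move=> mK mL KL; apply: dim_mono; [exact: msub_orth|exact: msub_orth|exact: orth_subset]. Qed.

Lemma dim_seq_le (K : nat -> set H) (c : \bar R) : (forall n, msub (K n)) ->
  (forall n, K n `<=` K n.+1) -> (forall n, (dim (K n) <= c)%E) ->
  (dim (orth [set u | forall n, orth (K n) u]) <= c)%E.
Proof.
move=> mK iK hc; set Z := [set u | _].
have mZ : msub Z by apply: msub_bigcap => n; exact: msub_orth.
have cK n := ms_c (mK n).
apply: (tr_seq_le (a := fun n => proj (K n))) => //.
- by move=> n; exact: msub_proj.
- by apply: msub_proj; exact: msub_orth.
- move=> n u; rewrite !proj_rip// ler_pXn2r ?nnegrE//.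
  by rewrite -(proj_nest (cK n) (cK n.+1) (iK n)) proj_le.
- by move=> u; rewrite (orth_projE (ms_c mZ)); exact: incr_cvg.
Qed.

Lemma codim_seq_le (G : nat -> set H) (c : \bar R) : (forall n, msub (G n)) ->
  (forall n, G n.+1 `<=` G n) -> (forall n, (codim (G n) <= c)%E) ->
  (codim [set u | forall n, G n u] <= c)%E.
Proof.
move=> mG dG hc.
rewrite /codim (_ : [set u | forall n, G n u] = [set u | forall n, orth (orth (G n)) u]).
  apply: dim_seq_le => [n|n|//]; first exact: msub_orth.
  exact: orth_subset.
by apply/seteqP; split=> u h n; have := h n; rewrite orthK//; exact: (ms_c (mG n)).
Qed.

Lemma dim_eq0 K u : msub K -> dim K = 0%E -> K u -> u = 0.
Proof.
move=> mK h ku; have := tr_faithful tr (msub_proj mK) h => /(congr1 (@^~ u)) <-.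
by rewrite (proj_id (ms_c mK)).
Qed.

Section Comparison.
Variables (K L : set H) (mK : msub K) (mL : msub L).
Hypothesis KL0 : forall u, K u -> L u -> u = 0.
Let e := proj K.
Let f := proj (orth L).
Let cK := ms_c mK.
Let cL := ms_c (msub_orth mL).
Let h u := e (f (e u)).
Let k u := f (e (f u)).
Let ch u := u - h u.
Let ck u := u - k u.

Let Ae : A e. Proof. by case: (msub_proj mK). Qed.
Let Af : A f. Proof. by case: (msub_proj (msub_orth mL)). Qed.
Let le_ : linear e. Proof. exact: proj_linear. Qed.
Let lf : linear f. Proof. exact: proj_linear. Qed.
Let ee u : e (e u) = e u. Proof. exact: projK. Qed.
Let ff u : f (f u) = f u. Proof. exact: projK. Qed.
Let se : sadj e. Proof. exact: proj_sa. Qed.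
Let sf : sadj f. Proof. exact: proj_sa. Qed.
Let ce u : hnorm (e u) <= hnorm u. Proof. exact: proj_le. Qed.
Let cf u : hnorm (f u) <= hnorm u. Proof. exact: proj_le. Qed.
Let Ah : A h. Proof. exact: (valg_comp Ae (valg_comp Af Ae)). Qed.
Let Ak : A k. Proof. exact: (valg_comp Af (valg_comp Ae Af)). Qed.
Let sh : sadj h. Proof. by move=> u v; rewrite /h se sf se. Qed.
Let sk : sadj k. Proof. by move=> u v; rewrite /k sf se sf. Qed.
Let hform u : rip (h u) u = hnorm (f (e u)) ^+ 2.
Proof. by rewrite /h (sadj_rip se) -{1}[f (e u)]ff (sadj_rip sf) hnorm2. Qed.
Let kform u : rip (k u) u = hnorm (e (f u)) ^+ 2.
Proof. by rewrite /k (sadj_rip sf) -{1}[e (f u)]ee (sadj_rip se) hnorm2. Qed.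
Let lh : linear h. Proof. by case: (valg_bounded Ah). Qed.
Let lk : linear k. Proof. by case: (valg_bounded Ak). Qed.

Let ker_h : [set u | h u = 0] = orth K.
Proof.
apply/seteqP; split=> u /= hu.
  have fe : f (e u) = 0.
    by apply: hnorm_eq0; apply/eqP; rewrite -sqrf_eq0 -hform hu rip0l.
  suff eu : e u = 0 by apply: proj0_orth.
  apply: KL0; first exact: proj_in.
  by rewrite -(orthK (ms_c mL)); apply: proj0_orth.
have eu : e u = 0 by exact: proj_orthE.
by rewrite /h eu (lin0 lf) (lin0 le_).
Qed.

Let sqrt_ck : exists S, [/\ A S, sadj S & forall u, S (S u) = ck u].
Proof.
have Ac : A ck by apply: (valg_sub (valg_id M) Ak).
have [||S [bS sS pS SS cS]] := @sqrt_bounded _ _ ck (valg_bounded Ac).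
- by move=> u v; rewrite /ck ipBl ipBr sk.
- move=> u; rewrite /ck ripBl kform -hnorm2 subr_ge0 ler_pXn2r ?nnegrE//.
  exact: le_trans (cf u).
exists S; split => //; apply: mem_valg => // b hb u; apply/esym.
apply: cS; first exact: commutant_bounded.
by move=> v; rewrite (valg_comm Ac hb).
Qed.

(** Here [h = e f e] and [k = f e f] for the projections [e] onto [K] and [f] onto the complement of
    [L]. Traciality gives [(1-h)^n h] and [(1-k)^n k] equal traces, hence also [p n = 1 - (1-h)^n]
    and [q n = 1 - (1-k)^n]. As [K] and [L] meet trivially, the kernel of [h] is the complement of
    [K], so [p n] increases to [e], while [q n <= f]. *)
Lemma dim_compare : (dim K <= codim L)%E.
Proof.
have [S [AS sS SS]] := sqrt_ck; have [lS _] := valg_bounded AS.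
have Sck u : S (ck u) = ck (S u) by rewrite -!SS.
have Scki n u : S (iter n ck u) = iter n ck (S u).
  by elim: n => //= n IH; rewrite Sck IH.
have S2 n u : iter n S (iter n S u) = iter n ck u.
  elim: n u => // n IH u; rewrite iterS [iter n.+1 S u]iterSr IH Scki SS.
  by rewrite -iterSr.
have Sk u : S (k u) = k (S u).
  have kE v : k v = v - ck v by rewrite /ck opprB addrC subrK.
  by rewrite !kE (linB lS) Sck.
have Ski n u : iter n S (k u) = k (iter n S u).
  by elim: n => //= n ->; rewrite Sk.
have ack n u : e (f (iter n ck u)) = iter n ch (e (f u)).
  elim: n => //= n <-; rewrite {1}/ck (linB lf) (linB le_) /ch; congr (_ - _).
  by rewrite /k /h ff ee.
(* [c n] is [S^n f e] with [S] the root of [1 - k]; its products with its adjoint in the two orders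
   are [(1-h)^n h] and [(1-k)^n k]. *)
pose c n := iter n S \o (f \o e); pose c' n := (e \o f) \o iter n S.
have Ac n : A (c n) by apply: valg_comp; [exact: valg_iter | exact: valg_comp].
have Ac' n : A (c' n) by apply: valg_comp; [exact: valg_comp | exact: valg_iter].
have adj n : is_adjoint (c n) (c' n).
  by move=> u v; rewrite -!/(ip _ _) /c /c' /= (sadj_iter n sS) sf se.
have cc n : c' n \o c n = iter n ch \o h.
  by apply/funext => u; rewrite /c /c' /= S2 ack ff.
have cc' n : c n \o c' n = iter n ck \o k.
  by apply/funext => u; rewrite /c /c' /= ee -/(k _) -Ski S2.
have trc n : tau (iter n ch \o h) = tau (iter n ck \o k).
  by rewrite -cc -cc'; exact: (tr_tracial tr).
have form n u : rip ((iter n ch \o h) u) u = hnorm (c n u) ^+ 2.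
  by rewrite -cc /= /rip (adj_r (adj n)) hnorm2.
have form' n u : rip ((iter n ck \o k) u) u = hnorm (c' n u) ^+ 2.
  by rewrite -cc' /= /rip (adj_l (adj n)) hnorm2.
have ph n : pos_part A (iter n ch \o h).
  apply: pos_partP; first by rewrite -cc; exact: valg_comp.
    by rewrite -cc => u v /=; rewrite (adj_r (adj n)) (adj_l (adj n)).
  by move=> u; rewrite form sqr_ge0.
have pk n : pos_part A (iter n ck \o k).
  apply: pos_partP; first by rewrite -cc'; exact: valg_comp.
    by rewrite -cc' => u v /=; rewrite (adj_l (adj n)) (adj_r (adj n)).
  by move=> u; rewrite form' sqr_ge0.
have lch : linear ch by move=> b x y; rewrite /ch lh; vec.
have lck : linear ck by move=> b x y; rewrite /ck lk; vec.
have lich n : linear (iter n ch).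
  by elim: n => [|n IH] // b x y /=; rewrite IH lch.
have lick n : linear (iter n ck).
  by elim: n => [|n IH] // b x y /=; rewrite IH lck.
pose p n u := u - iter n ch u; pose q n u := u - iter n ck u.
have pS n : p n.+1 = fun u => p n u + (iter n ch \o h) u.
  apply/funext => u; rewrite /p iterSr {1}/ch (linB (lich n)) /=.
  by rewrite opprB addrCA addrC.
have qS n : q n.+1 = fun u => q n u + (iter n ck \o k) u.
  apply/funext => u; rewrite /q iterSr {1}/ck (linB (lick n)) /=.
  by rewrite opprB addrCA addrC.
have pp n : [/\ pos_part A (p n), pos_part A (q n) & tau (p n) = tau (q n)].
  elim: n => [|n [IH1 IH2 IH3]].
    have e0 : p 0%N = q 0%N by [].
    have P0 : pos_part A (p 0%N).
      apply: pos_partP.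
      - exact: (valg_sub (valg_id M) (valg_id M)).
      - by move=> u v; rewrite /p /= !subrr ip0l ip0r.
      - by move=> u; rewrite /p /= subrr rip0l.
    by split.
  rewrite pS qS (tr_D tr IH1 (ph n)) (tr_D tr IH2 (pk n)) IH3 trc; split => //.
  - split; first by apply: valg_add; [case: IH1 | case: (ph n)].
    by move=> u; rewrite -/(ip _ _) ipDl addr_ge0//; [case: IH1 => _ /(_ u)|case: (ph n) => _ /(_ u)].
  - split; first by apply: valg_add; [case: IH2 | case: (pk n)].
    by move=> u; rewrite -/(ip _ _) ipDl addr_ge0//; [case: IH2 => _ /(_ u)|case: (pk n) => _ /(_ u)].
have fP := msub_proj (msub_orth mL).
apply: (tr_seq_le (a := p)).
- by move=> n; case: (pp n).
- exact: msub_proj.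
- by move=> n u; rewrite pS ripDl lerDl; case: (pos_part_rpos (ph n) u).
- move=> u; rewrite /p (_ : proj K u = u - proj (orth K) u); last first.
    by rewrite orth_projE// opprB addrC subrK.
  rewrite -ker_h; apply: hcvgB; first exact: hcvg_cst.
  apply: iter_contr_cvg => //; first exact: valg_bounded.
    by move=> v; rewrite hform sqr_ge0.
  by move=> v; apply: le_trans (ce _) (le_trans (cf _) (ce _)).
- move=> n; have [_ hq ->] := pp n; apply: tr_mono => // u; rewrite -/f.
  have kf v : ck (f v) = f (ck (f v)) by rewrite /ck (linB lf) /k !ff.
  have inf m : f (iter m ck (f u)) = iter m ck (f u).
    by elim: m => [|m IH]; rewrite ?ff //= -IH -kf.
  (* [k] kills [u - f u], so this part is fixed by [1 - k] and drops out of [q n]. *)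
  have dec m : iter m ck u = iter m ck (f u) + (u - f u).
    elim: m => [|m IH] /=; first by rewrite addrC subrK.
    rewrite IH {1}/ck (linD lk) (_ : k (u - f u) = 0).
      by rewrite addr0 addrAC.
    by rewrite /k (linB lf) ff subrr (lin0 le_) (lin0 lf).
  rewrite /q dec (_ : u - _ = f u - iter n ck (f u)); last by vec.
  rewrite ripBl gerBl -inf (sadj_rip sf) -S2 (sadj_rip (sadj_iter n sS)) -hnorm2.
  exact: sqr_ge0.
Qed.
End Comparison.
End Dimension.

(** * Codimension and tau-dense sets *)

Section Codimension.
Context {R : realType} (M : traced_vna R).
Local Notation H := (vspace_of M).
Implicit Types (u v w : H) (K L : set H) (B D : set H).

Lemma dim0 : dim ([set 0] : set H) = 0%E.
Proof.
have h := msub_proj (msub0 M).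
rewrite /dim -[RHS](mul0e (vtrace M (proj [set 0]))) -(tr_Z (vtraceP M) (lexx 0) h).
congr (vtrace M _); apply/funext => u.
by rewrite (_ : proj [set 0] u = 0) ?scaler0//; exact: (proj_in csub0).
Qed.

(** The part of [K] orthogonal to the intersection meets [L] only in 0, so its dimension is at most
    the codimension of [L]. *)
Lemma codimI K L : msub K -> msub L -> (codim (K `&` L) <= codim K + codim L)%E.
Proof.
move=> mK mL; have mI := msubI mK mL; have oK := msub_orth mK; have oI := msub_orth mI.
have sub : orth K `<=` orth (K `&` L) by apply: orth_subset => u [].
rewrite /codim (dim_split oK oI sub) leeD2l//.
apply: dim_compare => //; first by apply: msubI => //; exact: msub_orth.
by move=> u [h1]; rewrite (orthK (ms_c mK)) => h2 h3; apply: ip_eq0; apply: h1.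
Qed.

Lemma codim_compare K L : msub K -> msub L ->
  (forall u, orth K u -> L u -> u = 0) -> (codim K <= codim L)%E.
Proof. by move=> mK mL h; apply: dim_compare => //; exact: msub_orth. Qed.

Lemma codim_bigcap (K : nat -> set H) (b : nat -> R) (c : R) : (forall n, msub (K n)) ->
  (forall n, (codim (K n) <= (b n)%:E)%E) -> (forall n, \sum_(i < n) b i <= c) ->
  (codim [set u | forall n, K n u] <= c%:E)%E.
Proof.
move=> mK hb hc; pose G n := [set u | forall i, (i < n)%N -> K i u].
have mG n : msub (G n).
  have -> : G n = [set u | forall i : nat, (if (i < n)%N then K i else setT) u].
    apply/seteqP; split=> u h i; first by case: ifP => // /h.
    by move=> ni; have := h i; rewrite ni.
  by apply: msub_bigcap => i; case: ifP => _ //; exact: msubT.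
have GS n : G n.+1 = G n `&` K n.
  apply/seteqP; split=> u; first by move=> h; split; [move=> i ni; apply: h; exact: ltnW | exact: h].
  by move=> [h1 h2] i; rewrite ltnS leq_eqVlt => /orP[/eqP ->//|/h1].
have hG n : (codim (G n) <= (\sum_(i < n) b i)%:E)%E.
  elim: n => [|n IH].
    rewrite big_ord0 (_ : G 0%N = setT); last by apply/seteqP; split.
    rewrite /codim (_ : orth setT = [set 0]).
      by rewrite dim0.
    apply/seteqP; split=> [u h|_ -> k _]; [apply: ip_eq0; exact: h|exact: ip0l].
  rewrite GS big_ord_recr EFinD; apply: le_trans (codimI (mG n) (mK n)) _.
  exact: leeD.
have -> : [set u | forall n, K n u] = [set u | forall n, G n u].
  by apply/seteqP; split=> u h n; [move=> i _; exact: h | apply: (h n.+1)].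
apply: codim_seq_le => // [n u|n]; first by rewrite GS => -[].
by apply: le_trans (hG n) _; rewrite lee_fin.
Qed.

(** If all dimensions exceeded [eps], the increasing complements of [K n] in [K 0] would have
    dimension at most [dim (K 0) - eps], and so would their closed union, which is [K 0]. *)
Lemma dim_decr0 (K : nat -> set H) : (forall n, msub (K n)) ->
  (forall n, K n.+1 `<=` K n) -> (forall u, (forall n, K n u) -> u = 0) ->
  (dim (K 0%N) < +oo)%E -> forall eps : R, 0 < eps -> exists n, (dim (K n) <= eps%:E)%E.
Proof.
move=> mK dK K0 fin eps e0; apply: contrapT => /forallNP h.
have rfin : dim (K 0%N) \is a fin_num by rewrite ge0_fin_numE// dim_ge0.
have mL n : msub (K 0%N `&` orth (K n)) by apply: msubI => //; exact: msub_orth.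
have hL n : (dim (K 0%N `&` orth (K n)) <= dim (K 0%N) - eps%:E)%E.
  have := dim_split (mK n) (mK 0%N) (decr_subset dK (leq0n n)).
  move: (h n) => /negP; rewrite -ltNge => /ltW.
  have := dim_ge0 (mK n); have := dim_ge0 (mL n).
  rewrite -(fineK rfin).
  case: (dim (K n)) => [a| |]//; case: (dim (_ `&` _)) => [b| |]//=.
  by rewrite -!EFinD !lee_fin => _ _ h1 [->]; lra.
have iL n : K 0%N `&` orth (K n) `<=` K 0%N `&` orth (K n.+1).
  by move=> u [h1 h2]; split => //; exact: (orth_subset (dK n)).
have hs := dim_seq_le mL iL hL.
have mZ : msub (orth [set u | forall n, orth (K 0%N `&` orth (K n)) u]).
  by apply: msub_orth; apply: msub_bigcap => n; exact: msub_orth.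
have sub : K 0%N `<=` orth [set u | forall n, orth (K 0%N `&` orth (K n)) u].
  move=> u uK z hz.
  have cv : hcvg (fun n => u - proj (K n) u) u.
    have := hcvgB (hcvg_cst u) (decr_cvg (fun n => ms_c (mK n)) dK u).
    rewrite (_ : proj [set v | forall n, K n v] u = 0) ?subr0//.
    by apply: K0 => n; have /(_ n) := proj_in (csub_bigcap (fun n => ms_c (mK n))) u.
  apply: (ip_cvg_const cv) => n; apply: ip_sym0; apply: (hz n); split.
    apply: (csB (ms_c (mK 0%N))) => //; apply: (decr_subset dK (leq0n n)).
    by apply: proj_in; exact: ms_c.
  by apply: proj_orth; exact: ms_c.
have := le_trans (dim_mono (mK 0%N) mZ sub) hs.
by rewrite -(fineK rfin) -EFinB lee_fin; lra.
Qed.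

(* The tau-dense sets of Nelson. *)
Definition big B : Prop := forall eps : R, 0 < eps ->
  exists L, [/\ msub L, (codim L <= eps%:E)%E & L `<=` B].


Lemma bigI B D : big B -> big D -> big (B `&` D).
Proof.
move=> hB hD eps e0; have e2 : 0 < eps / 2 by rewrite divr_gt0.
have [L [mL cL LB]] := hB _ e2; have [K [mK cK KD]] := hD _ e2.
exists (L `&` K); split; first exact: msubI.
  apply: (le_trans (codimI mL mK)); rewrite (_ : eps = eps / 2 + eps / 2); last by field.
  by rewrite EFinD leeD.
by move=> u [/LB h1 /KD h2].
Qed.

Lemma geo_sum_le (eps : R) n : 0 <= eps -> \sum_(i < n) (eps / 2 ^+ i.+1) <= eps.
Proof.
move=> e0; suff -> : \sum_(i < n) (eps / 2 ^+ i.+1) = eps - eps / 2 ^+ n.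
  by rewrite gerBl divr_ge0// exprn_ge0.
elim: n => [|n IH]; first by rewrite big_ord0 expr0 divr1 subrr.
by rewrite big_ord_recr IH /= exprS; field; rewrite expf_neq0.
Qed.

Lemma big_bigcap (B : nat -> set H) : (forall n, big (B n)) -> big [set u | forall n, B n u].
Proof.
move=> hB eps e0.
have /choice[L hL] n : exists L, [/\ msub L, (codim L <= (eps / 2 ^+ n.+1)%:E)%E & L `<=` B n].
  by apply: hB; rewrite divr_gt0// exprn_gt0.
exists [set u | forall n, L n u]; split.
- by apply: msub_bigcap => n; case: (hL n).
- apply: (codim_bigcap (b := fun n => eps / 2 ^+ n.+1)) => n.
  + by case: (hL n).
  + by case: (hL n).
  + by apply: geo_sum_le; exact: ltW.
- by move=> u hu n; case: (hL n) => _ _; apply; exact: hu.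
Qed.

Lemma big_dense D u : lsub D -> invar D -> big D -> hclosure D u.
Proof.
move=> lD iD bD; have mK := msub_hclosure lD iD; have cK := ms_c mK.
have DK : D `<=` hclosure D by move=> v hv; exists (fun=> v); split => //; exact: hcvg_cst.
have z0 : codim (hclosure D) = 0%E.
  apply/eqP; rewrite eq_le codim_ge0// andbT; apply/lee_addgt0Pr => eps e0.
  rewrite add0e; have [L [mL cL LD]] := bD _ e0; apply: le_trans cL.
  by apply: codim_mono => // v /LD /DK.
rewrite -(orthK cK) => k hk.
by rewrite (dim_eq0 (msub_orth mK) z0 hk) ip0r.
Qed.
End Codimension.

(** * tau-measurable operators *)

Lemma ip_cvg_eq (R : realType) (H : hilbert R) (s t : nat -> H) (u w a b : H) :
  hcvg s u -> hcvg t w -> (forall n, ip (s n) b = ip (t n) a) -> ip u b = ip w a.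
Proof.
move=> hs ht h; rewrite !ipE.
have e c : rip u (c *: b) = rip w (c *: a).
  apply: (cvgr_uniq (hcvg_rip (w := c *: b) hs)).
  under eq_fun do rewrite /rip ipZr h -ipZr.
  exact: (hcvg_rip (w := c *: a) ht).
by have := e 1; rewrite !scale1r => ->; rewrite e.
Qed.

Section Affiliated.
Context {R : realType} (M : traced_vna R).
Local Notation H := (vspace_of M).
Implicit Types (x y z g : graph H) (u v w : H) (K L : set H) (B D : set H) (a b c : R).

Lemma affP x : affiliated x <->
  forall (f g : H -> H), cunitary f g -> forall u w, x (u, w) -> x (f u, f w).
Proof.
split=> [h f g [h1 h2 h3 h4] u w xu|h f g h1 h2 h3 h4 [u w] xu]; first exact: (h f g h1 h2 h3 h4 (u, w)).
by apply: (h f g) => //; split.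
Qed.

Lemma aff_adjoint x : affiliated x -> affiliated (graph_adjoint x).
Proof.
move=> /affP ax; apply/affP => f g fg u w h [a b] /= xab; rewrite -!/(ip _ _).
have gf := cunitary_bij fg; have [_ ad _ _] := fg.
rewrite -!(adj_r ad); exact: (h _ (ax _ _ gf _ _ xab)).
Qed.

Lemma aff_comp x y : affiliated x -> affiliated y -> affiliated (graph_comp x y).
Proof.
move=> /affP ax /affP ay; apply/affP => f g fg u w [k /= h1 h2].
by exists (f k); [exact: ay fg _ _ h1 | exact: ax fg _ _ h2].
Qed.

Lemma aff_closure x : affiliated x -> affiliated (graph_closure x).
Proof.
move=> /affP ax; apply/affP => f g fg u w /graph_closureP[s [t [hx hs ht]]].
have bf : bounded_linear f by case: fg => h _ _ _; exact: commutant_bounded h.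
apply/graph_closureP; exists (f \o s), (f \o t); split; [|exact: hcvg_bounded..].
by move=> n; exact: ax fg _ _ (hx n).
Qed.

Lemma cunitary_hnorm (f g : H -> H) u : cunitary f g -> hnorm (f u) = hnorm u.
Proof.
by move=> fg; apply/eqP; rewrite -(@eqrXn2 _ 2)// !hnorm2 /rip (cunitary_isom fg).
Qed.

Lemma growth_invar x c : affiliated x -> invar (growth x c).
Proof.
move=> /affP ax f g fg u [C [s [<- hs hC]]]; exists C, (f \o s); split => //= n.
  exact: ax fg _ _ (hs n).
by rewrite (cunitary_hnorm _ fg).
Qed.

Definition dom x : set H := [set u | exists w, x (u, w)].

Lemma dom_invar x : affiliated x -> invar (dom x).
Proof. by move=> /affP ax f g fg u [w h]; exists (f w); exact: ax fg _ _ h. Qed.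

Section Closed.
Variables (x : graph H) (cx : closed_dd x) (ax : affiliated x).

Lemma gsp_msub a : 0 <= a -> msub (gsp x a).
Proof.
move=> a0; split; first exact: gsp_csub.
by apply: growth_invar; apply: aff_comp => //; exact: aff_adjoint.
Qed.

Lemma ddistE a : 0 <= a -> ddist x a = codim (gsp x a).
Proof. by move=> a0; rewrite /ddist spectral_gsp. Qed.

Lemma ddist_ge0 a : 0 <= a -> (0 <= ddist x a)%E.
Proof. by move=> a0; rewrite ddistE//; apply: codim_ge0; exact: gsp_msub. Qed.

Lemma ddist_mono a b : 0 <= a -> a <= b -> (ddist x b <= ddist x a)%E.
Proof.
move=> a0 ab; have b0 := le_trans a0 ab; rewrite !ddistE//.
by apply: codim_mono; [exact: gsp_msub | exact: gsp_msub | exact: gsp_mono].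
Qed.

(** A shell above [a] meets trivially the intersection of [L] with an invariant subspace of [B]. By
    comparison its dimension is at most [codim L] up to an arbitrarily small error, and the shells
    increase to the complement of [gsp x a]. *)
Lemma ddist_key_aux a L B : 0 <= a -> msub L -> big B ->
  (forall n : nat, forall u, gsp x (a + n.+1%:R) u -> orth (gsp x (a + n.+1%:R^-1)) u ->
     L u -> B u -> u = 0) ->
  (ddist x a <= codim L)%E.
Proof.
move=> a0 mL bB h; rewrite ddistE//.
have an n : 0 <= a + n.+1%:R by rewrite addr_ge0.
have ai n : 0 <= a + n.+1%:R^-1 by rewrite addr_ge0// invr_ge0.
pose K n := gsp x (a + n.+1%:R) `&` orth (gsp x (a + n.+1%:R^-1)).
have mK n : msub (K n) by apply: msubI; [exact: gsp_msub | apply: msub_orth; exact: gsp_msub].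
have iK n : K n `<=` K n.+1.
  move=> u [h1 h2]; split; first by apply: gsp_mono h1 => //; rewrite lerD2l ler_nat.
  apply: (orth_subset _ h2); apply: gsp_mono => //.
  by rewrite lerD2l lef_pV2 ?posrE ?ltr0n// ler_nat.
have hK n : (dim (K n) <= codim L)%E.
  apply/lee_addgt0Pr => eps e0; have [L' [mL' cL' LB]] := bB _ e0.
  apply: (@le_trans _ _ (codim (L `&` L'))).
    apply: dim_compare => //; first exact: msubI.
    by move=> u [h1 h2] [uL /LB uB]; exact: (h n).
  by apply: (le_trans (codimI mL mL')); rewrite leeD2l.
apply: le_trans (dim_seq_le mK iK hK); apply: dim_mono.
- by apply: msub_orth; exact: gsp_msub.
- by apply: msub_orth; apply: msub_bigcap => n; exact: msub_orth.
- by apply: orth_subset => u; exact: gsp_shells.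
Qed.

(** Half of the min-max principle: on a shell above [a] the norm of [x u] exceeds [a |u|], so
    nonzero vectors of [L] and [B] avoid it. The set [B] restricts the test to vectors where other
    operators are defined too. *)
Lemma ddist_key a L B : 0 <= a -> msub L -> big B ->
  (forall u w, L u -> B u -> x (u, w) -> hnorm w <= a * hnorm u) -> (ddist x a <= codim L)%E.
Proof.
move=> a0 mL bB h; apply: (ddist_key_aux a0 mL bB) => n u h1 h2 uL uB.
have i0 : 0 < n.+1%:R^-1 :> R by rewrite invr_gt0.
have [w xw _] := gsp_dom cx (addr_ge0 a0 (ler0n _ _)) h1.
have le1 : a + n.+1%:R^-1 <= a + n.+1%:R.
  by rewrite lerD2l (@le_trans _ _ 1)// ?invf_le1// ler1n.
have := gsp_shell cx (addr_ge0 a0 (ltW i0)) le1 h1 h2 xw.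
move=> /le_trans/(_ (h _ _ uL uB xw)); rewrite mulrDl gerDl pmulr_rle0// => h0.
by apply: hnorm_eq0; apply/eqP; rewrite eq_le h0 hnorm_ge0.
Qed.
End Closed.

Lemma ddist_key_form x a L B : positive_sa x -> affiliated x -> 0 <= a -> msub L -> big B ->
  (forall u w, L u -> B u -> x (u, w) -> rip w u <= a * hnorm u ^+ 2) -> (ddist x a <= codim L)%E.
Proof.
move=> hx ax a0 mL bB h; have cx : closed_dd x by case: hx.
apply: (ddist_key_aux cx ax a0 mL bB) => n u h1 h2 uL uB.
have i0 : 0 < n.+1%:R^-1 :> R by rewrite invr_gt0.
have [w xw _] := gsp_dom cx (addr_ge0 a0 (ler0n _ _)) h1.
have le1 : a + n.+1%:R^-1 <= a + n.+1%:R.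
  by rewrite lerD2l (@le_trans _ _ 1)// ?invf_le1// ler1n.
have := gsp_shell_form hx (addr_ge0 a0 (ltW i0)) le1 h1 h2 xw.
move=> /le_trans/(_ (h _ _ uL uB xw)); rewrite mulrDl gerDl pmulr_rle0// => h0.
by apply: hnorm_eq0; apply/eqP; rewrite -sqrf_eq0 eq_le h0 sqr_ge0.
Qed.

Section Stau.
Variables (x : graph H) (hx : Stau x).
Let cx : closed_dd x. Proof. by case: hx. Qed.
Let ax : affiliated x. Proof. by case: hx. Qed.

(** The complements of [gsp x (a + n)] decrease to zero and the first of them has finite
    dimension. *)
Lemma stau_tail (eps : R) : 0 < eps -> exists2 a, 0 <= a & (ddist x a <= eps%:E)%E.
Proof.
case: hx => _ _ [a [a0 fin]] e0.
have an n : 0 <= a + n%:R by rewrite addr_ge0// ltW.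
have [||||n hn] := @dim_decr0 _ _ (fun n => orth (gsp x (a + n%:R))) _ _ _ _ eps e0.
- by move=> n; apply: msub_orth; exact: gsp_msub.
- by move=> n; apply: orth_subset; apply: gsp_mono => //; rewrite lerD2l ler_nat.
- move=> u h; apply: (gsp_top cx) => n; apply: (orth_subset _ (h n)).
  by apply: gsp_mono => //; rewrite lerDr ltW.
- by rewrite addr0 -/(codim _) -ddistE// ltW.
by exists (a + n%:R) => //; rewrite ddistE.
Qed.

Lemma stau_big : big (dom x).
Proof.
move=> eps /stau_tail[a a0 h]; exists (gsp x a); split; first exact: gsp_msub.
  by rewrite -ddistE.
by move=> u /(gsp_dom cx a0)[w hw _]; exists w.
Qed.
End Stau.

(** On [gsp z n] the operator is bounded, so it suffices that [D] be dense there; the gap has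
    dimension at most the codimension of any invariant subspace contained in [D], hence zero. *)
Lemma graph_core z D u w : closed_dd z -> affiliated z -> lsub D -> invar D -> big D ->
  z (u, w) -> graph_closure [set p | z p /\ D p.1] (u, w).
Proof.
move=> cz az lD iD bD zuw.
suff h (eps : R) : 0 < eps -> exists2 p, (z p /\ D p.1) &
    hnorm (u - p.1) < eps /\ hnorm (w - p.2) < eps by move=> eps /h.
move=> e0; have e2 : 0 < eps / 2 by rewrite divr_gt0.
have [n [k [y [gk zk hk hy]]]] := gsp_core cz zuw e2.
have n0 : 0 <= n%:R :> R by []; have mG := gsp_msub cz az n0; have cG := ms_c mG.
set G := gsp z n%:R in gk mG cG.
have lGD : lsub (G `&` D).
  split; first by split; [exact: (cs0 cG) | exact: ls0].
  by move=> c a b [h1 h2] [h3 h4]; split; [exact: csL | exact: lsL].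
have mK : msub (hclosure (G `&` D)).
  apply: msub_hclosure => // f g fg a [h1 h2]; split; first exact: (ms_i mG fg).
  exact: (iD _ _ fg).
have cK := ms_c mK; set K := hclosure _ in mK cK.
have DK : G `&` D `<=` K by move=> a ha; exists (fun=> a); split => //; exact: hcvg_cst.
have KG : K `<=` G by move=> a [s [hs sl]]; apply: (csC cG _ sl) => i; case: (hs i).
have mI : msub (G `&` orth K) by apply: msubI => //; exact: msub_orth.
have z0 : dim (G `&` orth K) = 0%E.
  apply/eqP; rewrite eq_le dim_ge0// andbT; apply/lee_addgt0Pr => d d0.
  rewrite add0e; have [L [mL cL LD]] := bD _ d0; apply: le_trans cL.
  apply: dim_compare => // a [aG aK] /LD aD; apply: ip_eq0; apply: aK.
  by apply: DK; split.
have kK : K k.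
  have : k - proj K k = 0.
    apply: (dim_eq0 mI z0); split; last exact: proj_orth.
    by apply: (csB cG) => //; apply: KG; exact: proj_in.
  by move/eqP; rewrite subr_eq0 => /eqP ->; exact: proj_in.
have d0 : 0 < eps / 2 / n.+1%:R by rewrite !divr_gt0.
have /hclosureP/(_ _ d0)[d [dG dD] hd] := kK.
have [yd zd _] := gsp_dom cz n0 dG.
exists (d, yd) => //; split => /=.
  apply: (le_lt_trans (hnormDB _ k _)); rewrite (splitr eps) ltrD//.
  apply: (lt_le_trans hd); rewrite ler_pdivrMr//.
  by rewrite ler_peMr ?(ltW e2)// ler1n.
have [y' zy' ny'] := gsp_dom cz n0 (csB cG gk dG).
have ey := cdd_uniq cz (cdd_B cz zk zd) zy'.
apply: (le_lt_trans (hnormDB _ y _)); rewrite (splitr eps) ltrD// ey.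
apply: (le_lt_trans ny'); apply: (@le_lt_trans _ _ (n.+1%:R * hnorm (k - d))).
  by rewrite ler_wpM2r// ler_nat.
by rewrite mulrC -ltr_pdivlMr.
Qed.

Definition Ssa x : Prop := Stau x /\ graph_adjoint x = x.

(* Linear symmetric relations affiliated with M that are bounded on M-invariant
   subspaces of small codimension: their closures are self-adjoint. *)
Record symgraph g : Prop := {
  sg_0 : g (0, 0) ;
  sg_lin : forall (c : R[i]) u w u' w', g (u, w) -> g (u', w') -> g (c *: u + u', c *: w + w') ;
  sg_aff : affiliated g ;
  sg_sym : forall u w u' w', g (u, w) -> g (u', w') -> ip w u' = ip u w' ;
  sg_tb : forall eps : R, 0 < eps -> exists L a, [/\ msub L, (codim L <= eps%:E)%E, 0 <= a &
     forall u, L u -> exists2 w, g (u, w) & hnorm w <= a * hnorm u] }.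

Section Sym.
Variables (g : graph H) (hg : symgraph g).

Lemma sg_big : big (dom g).
Proof.
move=> eps /(sg_tb hg)[L [a [mL cL _ h]]]; exists L; split => // u /h[w hw _].
by exists w.
Qed.

Let lD : lsub (dom g).
Proof.
split; first by exists 0; exact: sg_0.
by move=> c u v [w hw] [w' hw']; exists (c *: w + w'); exact: sg_lin.
Qed.
Let dense u : hclosure (dom g) u.
Proof. by apply: big_dense lD _ sg_big; apply: dom_invar; exact: sg_aff. Qed.

Let adj_fun w : graph_adjoint g (0, w) -> w = 0.
Proof.
move=> h; apply: ip_eq0; have [s [hs sl]] := dense w.
apply: (ip_cvg_const sl) => n; have [z gz] := hs n.
by have := h _ gz; rewrite /= -!/(ip _ _) ip0r.
Qed.

Let sub_adj : g `<=` graph_adjoint g.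
Proof. by move=> [u w] h [u' w'] h' /=; exact: (sg_sym hg h' h). Qed.

Let adj_cl : graph_closure (graph_adjoint g) `<=` graph_adjoint g.
Proof.
move=> [u w] /graph_closureP[s [t [hx hs ht]]] [a b] gab /=; rewrite -!/(ip _ _).
rewrite ipC [RHS]ipC; congr (Num.conj _); apply: (ip_cvg_eq hs ht) => n.
by rewrite ipC [RHS]ipC; congr (Num.conj _); exact: (hx n _ gab).
Qed.

Let adj_lin (c : R[i]) u w u' w' : graph_adjoint g (u, w) -> graph_adjoint g (u', w') ->
  graph_adjoint g (c *: u + u', c *: w + w').
Proof.
move=> h h' [a b] gab /=; rewrite -!/(ip _ _) !ipDr !ipZr.
by have /= := h _ gab; have /= := h' _ gab; rewrite -!/(ip _ _) => -> ->.
Qed.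

Let adj_cdd : closed_dd (graph_adjoint g).
Proof.
split.
- by apply: sub_adj; exact: sg_0.
- by move=> c [u w] [u' w']; exact: adj_lin.
- exact: adj_fun.
- exact: adj_cl.
- move=> u eps e0; have /hclosureP/(_ _ e0)[d [w hw] hd] := dense u.
  by exists (d, w) => //; exact: sub_adj.
Qed.

(** The domain of [g] is tau-dense and therefore a core of the adjoint, where the adjoint agrees
    with [g]. So the closure of [g] already contains the adjoint. *)
Let cl_adj : graph_closure g = graph_adjoint g.
Proof.
apply/seteqP; split=> [[u w] h|[u w] h].
  apply: adj_cl; move=> eps /h[p gp hp]; exists p => //; exact: sub_adj.
have := graph_core adj_cdd (aff_adjoint (sg_aff hg)) lD (dom_invar (sg_aff hg)) sg_big h.
move=> {}h eps /h[[a b] [h1 [b' h2]] h3]; exists (a, b) => //.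
by rewrite (cdd_uniq adj_cdd h1 (sub_adj h2)).
Qed.

Let adj_closure : graph_adjoint (graph_closure g) = graph_adjoint g.
Proof.
apply/seteqP; split=> [[u w] h z gz|[u w] h].
  by apply: h => eps e0; exists z => //; rewrite !subrr hnorm0.
move=> [a b] /graph_closureP[s [t [hx hs ht]]] /=; rewrite -!/(ip _ _).
by apply: (ip_cvg_eq ht hs) => n; exact: (h _ (hx n)).
Qed.

Lemma sg_sub : g `<=` graph_closure g.
Proof. by rewrite cl_adj; exact: sub_adj. Qed.

Lemma sg_closed_dd : closed_dd (graph_closure g).
Proof. by rewrite cl_adj; exact: adj_cdd. Qed.

Lemma sg_closure_aff : affiliated (graph_closure g).
Proof. by apply: aff_closure; exact: sg_aff. Qed.

Lemma sg_sa : Ssa (graph_closure g).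
Proof.
split; last by rewrite adj_closure cl_adj.
split; [exact: sg_closed_dd | exact: sg_closure_aff |].
have [L [a [mL cL a0 h]]] := sg_tb hg ltr01.
exists (a + 1); split; first by rewrite ltr_wpDl.
apply: (@le_lt_trans _ _ (codim L)); last by rewrite (le_lt_trans cL)// ltry.
have bT : big (setT : set H).
  by move=> eps e0; have [K [mK cK _]] := sg_big e0; exists K; split.
apply: (ddist_key sg_closed_dd sg_closure_aff _ mL bT) => [|u w uL _ hw].
  by rewrite addr_ge0.
have [w' gw' hw'] := h u uL.
rewrite (cdd_uniq sg_closed_dd hw (sg_sub gw')) (le_trans hw')// ler_wpM2r//.
by rewrite lerDl.
Qed.

Lemma sg_pos : (forall u w, g (u, w) -> 0 <= rip w u) -> Stau_pos (graph_closure g).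
Proof.
move=> h; have [st ad] := sg_sa; split => //; split => //; first by case: st.
move=> [u w] hz; rewrite /= -/(ip _ _) lecE; apply/andP; split.
  have : ip w u = ip u w by move: (hz); rewrite -{1}ad => /(_ _ hz).
  by rewrite ipC => /(congr1 (@complex.Im R)); rewrite ImJ /= => e; apply/eqP; lra.
have [s [t [hx hs ht]]] := (proj1 (graph_closureP _ _ _)) hz.
change (0 <= rip w u); have c1 := hcvg_rip (w := u) ht.
have c2 : (fun n => hnorm (t n) * hnorm (s n - u)) @ \oo --> hnorm w * 0.
  by apply: cvgM hs; exact: hcvg_hnorm.
have c3 : (fun n => rip (t n) u + hnorm (t n) * hnorm (s n - u)) @ \oo --> rip w u + hnorm w * 0.
  exact: cvgD.
suff : 0 <= rip w u + hnorm w * 0 by rewrite mulr0 addr0.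
apply: (ler_cvg_to (cvg_cst (0 : R)) c3); apply: nearW => n.
have := h _ _ (hx n); rewrite -{1}(subrK u (s n)) ripDr.
move=> /le_trans; apply; rewrite addrC lerD2l.
exact: rip_le.
Qed.
End Sym.
End Affiliated.

(** * Strong sums, scalar multiples and domination *)

Section Operations.
Context {R : realType} (M : traced_vna R).
Local Notation H := (vspace_of M).
Implicit Types (x y z g : graph H) (u v w : H) (K L B : set H) (a b c : R).

Lemma Ssa_cdd x : Ssa x -> closed_dd x. Proof. by case=> -[]. Qed.
Lemma Ssa_aff x : Ssa x -> affiliated x. Proof. by case=> -[]. Qed.
Lemma Stau_pos_Ssa x : Stau_pos x -> Ssa x. Proof. by move=> [h [_ e _]]. Qed.
Lemma Stau_pos_form x u w : Stau_pos x -> x (u, w) -> 0 <= rip w u.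
Proof. by move=> [_ h]; exact: psa_pos. Qed.

Lemma cdd_closure x : closed_dd x -> graph_closure x = x.
Proof.
move=> cx; apply/seteqP; split=> [|z xz]; first exact: cdd_closed.
by move=> eps e0; exists z => //; rewrite !subrr hnorm0.
Qed.

Lemma Stau_tb x : Stau x -> forall eps : R, 0 < eps -> exists L a,
  [/\ msub L, (codim L <= eps%:E)%E, 0 <= a &
     forall u, L u -> exists2 w, x (u, w) & hnorm w <= a * hnorm u].
Proof.
move=> hx eps /(stau_tail hx)[a a0 h]; have [cx ax _] := hx.
exists (gsp x a), a; split => //; first exact: gsp_msub.
  by rewrite -ddistE.
by move=> u; exact: gsp_dom.
Qed.

Lemma Ssa_symgraph x : Ssa x -> symgraph x.
Proof.
move=> [hx e]; have [cx ax _] := hx; split => //; first exact: cdd_0.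
- by move=> c u w u' w' h h'; exact: (cdd_lin cx c h h').
- by move=> u w u' w' h; rewrite -{1}e => /(_ _ h).
- exact: Stau_tb.
Qed.

(** A self-adjoint operator has no proper symmetric extension. *)
Lemma Ssa_eq x y : Ssa x -> Ssa y -> x `<=` y -> x = y.
Proof.
move=> hx hy xy; apply/seteqP; split => // z yz; rewrite -(proj2 hx) => w xw.
by have := yz; rewrite -{1}(proj2 hy) => /(_ _ (xy _ xw)).
Qed.

Lemma sg_add x y : Ssa x -> Ssa y -> symgraph [set z | exists o1 o2,
    [/\ x (z.1, o1), y (z.1, o2) & z.2 = o1 + o2]].
Proof.
move=> sx sy; have [cx cy] := (Ssa_cdd sx, Ssa_cdd sy).
have [gx gy] := (Ssa_symgraph sx, Ssa_symgraph sy); split.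
- by exists 0, 0; rewrite addr0; split => //; exact: cdd_0.
- move=> c u w u' w' [a1 [a2 [h1 h2 /= ->]]] [b1 [b2 [h3 h4 /= ->]]].
  exists (c *: a1 + b1), (c *: a2 + b2); split; [exact: sg_lin|exact: sg_lin|by vec].
- apply/affP => f k fk u w [a1 [a2 [/= h1 h2 ->]]]; exists (f a1), (f a2); split.
  + by move/affP: (Ssa_aff sx) => /(_ _ _ fk _ _ h1).
  + by move/affP: (Ssa_aff sy) => /(_ _ _ fk _ _ h2).
  + by rewrite /= (linD (proj1 (commutant_bounded (let: And4 h _ _ _ := fk in h)))).
- move=> u w u' w' [a1 [a2 [/= h1 h2 ->]]] [b1 [b2 [/= h3 h4 ->]]].
  by rewrite ipDl ipDr (sg_sym gx h1 h3) (sg_sym gy h2 h4).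
- move=> eps e0; have e2 : 0 < eps / 2 by rewrite divr_gt0.
  have [L [a [mL cL a0 hL]]] := sg_tb gx e2; have [K [b [mK cK b0 hK]]] := sg_tb gy e2.
  exists (L `&` K), (a + b); split; first exact: msubI.
  + apply: (le_trans (codimI mL mK)); rewrite (splitr eps) EFinD leeD//.
  + exact: addr_ge0.
  + move=> u [/hL[w hw nw] /hK[w' hw' nw']]; exists (w + w'); first by exists w, w'.
    by apply: (le_trans (hnormD _ _)); rewrite mulrDl lerD.
Qed.

Lemma sadd_sa x y : Ssa x -> Ssa y -> Ssa (sadd x y).
Proof. by move=> hx hy; apply: sg_sa; exact: sg_add. Qed.

Lemma sadd_pos x y : Stau_pos x -> Stau_pos y -> Stau_pos (sadd x y).
Proof.
move=> hx hy; apply: sg_pos; first by apply: sg_add; exact: Stau_pos_Ssa.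
move=> u w [a1 [a2 [/= h1 h2 ->]]]; rewrite ripDl addr_ge0//.
  exact: (Stau_pos_form hx h1).
exact: (Stau_pos_form hy h2).
Qed.

Lemma sadd_val x y u v w : x (u, v) -> y (u, w) -> sadd x y (u, v + w).
Proof.
move=> h1 h2 eps e0; exists (u, v + w); first by exists v, w.
by rewrite !subrr hnorm0.
Qed.


Lemma sscale_val c x u w : x (u, w) -> sscale c x (u, c%:C%C *: w).
Proof.
move=> h eps e0; exists (u, c%:C%C *: w); first by exists w.
by rewrite !subrr hnorm0.
Qed.

Lemma sg_scale c x : Ssa x -> symgraph [set z | exists2 o, x (z.1, o) & z.2 = c%:C%C *: o].
Proof.
move=> sx; have gx := Ssa_symgraph sx; split.
- by exists 0; [exact: sg_0 | rewrite scaler0].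
- move=> d u w u' w' [a h /= ->] [b h' /= ->]; exists (d *: a + b); first exact: sg_lin.
  by rewrite scalerDr !scalerA mulrC.
- apply/affP => f k fk u w [a /= h ->]; exists (f a).
    by move/affP: (Ssa_aff sx) => /(_ _ _ fk _ _ h).
  by rewrite /= (linZ (proj1 (commutant_bounded (let: And4 h _ _ _ := fk in h)))).
- move=> u w u' w' [a /= h ->] [b /= h' ->].
  by rewrite ipZl ipZr conj_real (sg_sym gx h h').
- move=> eps e0; have [L [a [mL cL a0 hL]]] := sg_tb gx e0.
  exists L, (`|c| * a); split => //; first by rewrite mulr_ge0.
  move=> u /hL[w hw nw]; exists (c%:C%C *: w); first by exists w.
  by rewrite hnormZr -mulrA ler_wpM2l.
Qed.

Lemma sscale_sa c x : Ssa x -> Ssa (sscale c x).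
Proof. by move=> hx; apply: sg_sa; exact: sg_scale. Qed.

Lemma sscale_fun c x u w (z : H) : Ssa x -> x (u, w) -> sscale c x (u, z) -> z = c%:C%C *: w.
Proof.
move=> sx h1 h2; apply: (cdd_uniq (Ssa_cdd (sscale_sa c sx)) h2).
exact: sscale_val.
Qed.

Lemma sscale_pos c x : 0 <= c -> Stau_pos x -> Stau_pos (sscale c x).
Proof.
move=> c0 hx; apply: sg_pos; first by apply: sg_scale; exact: Stau_pos_Ssa.
by move=> u w [a /= h ->]; rewrite ripZl mulr_ge0//; exact: (Stau_pos_form hx h).
Qed.


Lemma sg_zero : symgraph (szero : graph H).
Proof.
split => //.
- by move=> c u w u' w'; rewrite /szero /= => -> ->; rewrite scaler0 addr0.
- apply/affP => f k [hf _ _ _] u w; rewrite /szero /= => ->.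
  by rewrite (lin0 (proj1 (commutant_bounded hf))).
- by move=> u w u' w'; rewrite /szero /= => -> ->; rewrite ip0l ip0r.
- move=> eps e0; exists (setT : set H), 0; split => //.
  + rewrite /codim (_ : orth setT = [set 0]) ?dim0 ?lee_fin ?ltW//.
    apply/seteqP; split=> [u h|_ -> k _]; [apply: ip_eq0; exact: h|exact: ip0l].
  + by move=> u _; exists 0 => //; rewrite hnorm0 mul0r.
Qed.

Lemma szero_closed : graph_closure szero = szero :> graph H.
Proof.
apply/seteqP; split; last exact: sg_sub sg_zero.
move=> [u w] /graph_closureP[s [t [h _ ht]]]; rewrite /szero /=.
by apply: (hcvg_uniq ht); rewrite (_ : t = fun=> 0); [exact: hcvg_cst | apply/funext].
Qed.

Lemma szero_pos : Stau_pos (szero : graph H).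
Proof.
rewrite -szero_closed; apply: sg_pos; first exact: sg_zero.
by move=> u w; rewrite /szero /= => ->; rewrite rip0l.
Qed.

Lemma ssub_sa x y : Ssa x -> Ssa y -> Ssa (ssub x y).
Proof. by move=> hx hy; apply: sadd_sa => //; exact: sscale_sa. Qed.

Lemma ssub_val x y u v w : x (u, v) -> y (u, w) -> ssub x y (u, v - w).
Proof.
move=> h1 h2; have := sadd_val h1 (sscale_val (-1) h2).
by rewrite rmorphN1 scaleN1r.
Qed.

Lemma sle_form x y u v w : sle x y -> x (u, v) -> y (u, w) -> rip v u <= rip w u.
Proof.
move=> h h1 h2; have := Stau_pos_form h (ssub_val h2 h1).
by rewrite ripBl subr_ge0.
Qed.


Lemma spartial_pos (x : nat -> graph H) n : (forall k, Stau_pos (x k)) -> Stau_pos (spartial x n).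
Proof. by move=> h; elim: n => [|n IH] /=; [exact: szero_pos | exact: sadd_pos]. Qed.

Lemma spartial_val (x : nat -> graph H) n u (t : nat -> H) :
  (forall k, x k (u, t k)) -> spartial x n (u, \sum_(i < n) t i).
Proof.
move=> h; elim: n => [|n IH]; first by rewrite big_ord0.
by rewrite big_ord_recr; exact: sadd_val.
Qed.

Lemma spartial_fun (x : nat -> graph H) n u (t : nat -> H) w : (forall k, Stau_pos (x k)) ->
  (forall k, x k (u, t k)) -> spartial x n (u, w) -> w = \sum_(i < n) t i.
Proof.
move=> px h h'; have c := Ssa_cdd (Stau_pos_Ssa (spartial_pos n px)).
by apply: (cdd_uniq c h'); exact: spartial_val.
Qed.

Definition doms (x : nat -> graph H) : set H := [set u | forall k, dom (x k) u].
Lemma doms_big (x : nat -> graph H) : (forall k, Stau (x k)) -> big (doms x).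
Proof. by move=> h; apply: big_bigcap => n; exact: stau_big. Qed.
Lemma domsP (x : nat -> graph H) u : doms x u -> exists t, forall k, x k (u, t k).
Proof.
move=> h; have /choice[t ht] k : exists w, x k (u, w) by exact: h.
by exists t.
Qed.

Section Domination.
Variables (z x y : graph H) (B : set H) (a b : R).
Hypotheses (sx : Stau x) (sy : Stau y) (a0 : 0 <= a) (b0 : 0 <= b) (bB : big B).
Let cx : closed_dd x. Proof. by case: sx. Qed.
Let cy : closed_dd y. Proof. by case: sy. Qed.
Let ax : affiliated x. Proof. by case: sx. Qed.
Let ay : affiliated y. Proof. by case: sy. Qed.
Let mL : msub (gsp x a `&` gsp y b). Proof. by apply: msubI; exact: gsp_msub. Qed.
Let cL : (codim (gsp x a `&` gsp y b) <= ddist x a + ddist y b)%E.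
Proof. by rewrite !ddistE//; apply: codimI; exact: gsp_msub. Qed.

(** On the intersection of the two spectral subspaces the norms are at most [a |u|] and [b |u|]; its
    codimension is at most the sum of the two distribution functions. *)
Lemma ddist_dom : closed_dd z -> affiliated z ->
  (forall u w w1 w2, B u -> z (u, w) -> x (u, w1) -> y (u, w2) -> hnorm w <= hnorm w1 + hnorm w2) ->
  (ddist z (a + b) <= ddist x a + ddist y b)%E.
Proof.
move=> cz az h; apply: le_trans cL; apply: (ddist_key cz az _ mL bB).
  exact: addr_ge0.
move=> u w [/(gsp_dom cx a0)[w1 h1 n1] /(gsp_dom cy b0)[w2 h2 n2]] uB hw.
by apply: (le_trans (h _ _ _ _ uB hw h1 h2)); rewrite mulrDl lerD.
Qed.

Lemma ddist_dom_form : positive_sa z -> affiliated z ->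
  (forall u w w1 w2, B u -> z (u, w) -> x (u, w1) -> y (u, w2) ->
     rip w u <= (hnorm w1 + hnorm w2) * hnorm u) ->
  (ddist z (a + b) <= ddist x a + ddist y b)%E.
Proof.
move=> hz az h; apply: le_trans cL; apply: (ddist_key_form hz az _ mL bB).
  exact: addr_ge0.
move=> u w [/(gsp_dom cx a0)[w1 h1 n1] /(gsp_dom cy b0)[w2 h2 n2]] uB hw.
apply: (le_trans (h _ _ _ _ uB hw h1 h2)); rewrite expr2 mulrA ler_wpM2r//.
by rewrite mulrDl lerD.
Qed.

(** Both forms are at most [a |u|^2] on the intersection, so averaging loses nothing in the level.
    This recombines the two halves produced by midpoint convexity. *)
Lemma ddist_dom_form2 : positive_sa z -> affiliated z ->
  positive_sa x -> positive_sa y ->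
  (forall u w w1 w2, B u -> z (u, w) -> x (u, w1) -> y (u, w2) ->
     2 * rip w u <= rip w1 u + rip w2 u) -> a = b ->
  (ddist z a <= ddist x a + ddist y b)%E.
Proof.
move=> hz az px py h ab; apply: le_trans cL; apply: (ddist_key_form hz az a0 mL bB).
move=> u w [/(gsp_dom cx a0)[w1 h1 n1] /(gsp_dom cy b0)[w2 h2 n2]] uB hw.
have := h _ _ _ _ uB hw h1 h2; have := rip_le w1 u; have := rip_le w2 u.
have : hnorm w1 * hnorm u <= a * hnorm u ^+ 2 by rewrite expr2 mulrA ler_wpM2r.
have : hnorm w2 * hnorm u <= a * hnorm u ^+ 2 by rewrite expr2 mulrA ler_wpM2r// ab.
by move=> *; lra.
Qed.
End Domination.
End Operations.

Lemma half_small (R : realType) (c e : R) : 0 < e -> exists N, c / 2 ^+ N < e.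
Proof.
move=> e0; exists (Num.truncn (c / e)).+1; set n := _.+1.
rewrite ltr_pdivrMr ?exprn_gt0// mulrC -ltr_pdivrMr//.
apply: (lt_trans (truncnS_gt _)); rewrite -natrX ltr_nat; exact: ltn_expl.
Qed.

Lemma ip_cvg_conj (R : realType) (H : hilbert R) (s t : nat -> H) (u w a b : H) :
  hcvg s u -> hcvg t w -> (forall n, ip (s n) b = ip a (t n)) -> ip u b = ip a w.
Proof.
move=> hs ht h.
have e c : rip u (c *: b) = rip (Num.conj c *: a) w.
  rewrite (ripC _ w); apply: (cvgr_uniq (hcvg_rip (w := c *: b) hs)).
  under eq_fun do rewrite /rip ipZr h -ipZl -/(rip _ _) ripC.
  exact: (hcvg_rip (w := Num.conj c *: a) ht).
rewrite !ipE; have := e 1; rewrite rmorph1 !scale1r => ->.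
by rewrite e /rip ipZl -ipZr.
Qed.

(** * Convergence in measure and limits of series of positive operators *)

Section Limits.
Context {R : realType} (M : traced_vna R).
Local Notation H := (vspace_of M).
Implicit Types (X Y : graph H) (u v w : H) (K L B : set H) (a b c : R).

Definition cvg_measure (x : nat -> graph H) X : Prop := forall d e : R, 0 < d -> 0 < e ->
  exists N, forall n, (N <= n)%N ->
    Stau (ssub (spartial x n) X) /\ (ddist (ssub (spartial x n) X) d <= e%:E)%E.

Section Partial.
Variables (x : nat -> graph H) (X W : graph H) (n0 : nat) (B : set H).
Hypotheses (px : forall k, Stau_pos (x k)) (sX : Stau X) (cv : cvg_measure x X).
Hypotheses (pW : Stau_pos W) (bB : big B).
Let cX : closed_dd X. Proof. by case: sX. Qed.
Let hW : positive_sa W. Proof. by case: pW. Qed.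
Let aW : affiliated W. Proof. by case: pW => -[]. Qed.
Let bB' : big (B `&` doms x `&` dom X).
Proof.
apply: bigI; last exact: stau_big.
by apply: bigI => //; apply: doms_big => k; case: (px k).
Qed.

(** A late partial sum is [X] plus a remainder whose distribution function at [d] is at most any
    given [e]. An operator below all late partial sums thus inherits the bound for [X], with the
    level shifted by [d]. *)
Lemma ddist_partial_le a d : 0 <= a -> 0 < d ->
  (forall j u w t, (n0 <= j)%N -> B u -> W (u, w) -> (forall k, x k (u, t k)) ->
     rip w u <= rip (\sum_(i < j) t i) u) ->
  (ddist W (a + d) <= ddist X a)%E.
Proof.
move=> a0 d0 h; apply/lee_addgt0Pr => e e0; have [N hN] := cv d0 e0.
have [sD dD] := hN (maxn N n0) (leq_maxl _ _).
set D := ssub _ _ in sD dD; have cD : closed_dd D by case: sD.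
apply: (@le_trans _ _ (ddist X a + ddist D d)); last by rewrite leeD2l.
apply: (ddist_dom_form sX sD a0 (ltW d0) bB' hW aW).
move=> u w w1 w2 [[uB /domsP[t ht]] _] hw h1 h2.
have e2 := cdd_uniq cD h2 (ssub_val (spartial_val (maxn N n0) ht) h1).
apply: (le_trans (h _ u w t (leq_maxr N n0) uB hw ht)).
apply: (le_trans (rip_le _ _)); rewrite ler_wpM2r//.
by rewrite -(subrK w1 (\sum_(i < _) _)) -e2 addrC hnormD.
Qed.

(** Both the [m]-th and a late partial sum are compared with [X]; in the block between them [X]
    cancels. *)
Lemma ddist_tail_le m a d : 0 <= a -> 0 < d -> Stau (ssub (spartial x m) X) ->
  (forall j u w t, (n0 <= j)%N -> B u -> W (u, w) -> (forall k, x k (u, t k)) ->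
     rip w u <= rip (\sum_(i < j) t i - \sum_(i < m) t i) u) ->
  (ddist W (a + d) <= ddist (ssub (spartial x m) X) a)%E.
Proof.
move=> a0 d0 sDm h; apply/lee_addgt0Pr => e e0; have [N hN] := cv d0 e0.
have [sD dD] := hN (maxn N n0) (leq_maxl _ _).
set Dm := ssub _ X in sDm *; have cDm : closed_dd Dm by case: sDm.
set D := ssub _ _ in sD dD; have cD : closed_dd D by case: sD.
apply: (@le_trans _ _ (ddist Dm a + ddist D d)); last by rewrite leeD2l.
apply: (ddist_dom_form sDm sD a0 (ltW d0) bB' hW aW).
move=> u w w1 w2 [[uB /domsP[t ht]] [wX hX]] hw h1 h2.
have e2 := cdd_uniq cD h2 (ssub_val (spartial_val (maxn N n0) ht) hX).
have e1 := cdd_uniq cDm h1 (ssub_val (spartial_val m ht) hX).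
apply: (le_trans (h _ u w t (leq_maxr N n0) uB hw ht)).
apply: (le_trans (rip_le _ _)); rewrite ler_wpM2r//.
have -> : \sum_(i < maxn N n0) t i - \sum_(i < m) t i = w2 - w1.
  by rewrite e1 e2 opprB addrA subrK.
by rewrite [leRHS]addrC hnormB.
Qed.
End Partial.

Definition shift (T : Type) m (x : nat -> T) : nat -> T := fun i => x (m + i)%N.

Section Existence.
Variable y : nat -> graph H.
Hypothesis py : forall k, Stau_pos (y k).
Hypothesis cy : forall d e : R, 0 < d -> 0 < e -> exists N, forall m k, (N <= m)%N ->
  (ddist (spartial (shift m y) k) d <= e%:E)%E.

Let mesh k : exists N, forall m n, (N <= m)%N ->
  (ddist (spartial (shift m y) n) ((1 / 2 ^+ k.+1) : R) <= (1 / 2 ^+ k.+1)%:E)%E.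
Proof. by apply: cy; rewrite divr_gt0// exprn_gt0. Qed.

Let N0 := projT1 (choice mesh).
Let N0P k m n : (N0 k <= m)%N ->
  (ddist (spartial (shift m y) n) ((1 / 2 ^+ k.+1) : R) <= (1 / 2 ^+ k.+1)%:E)%E.
Proof. exact: (projT2 (choice mesh)). Qed.

(** Indices as in the Riesz-Fischer argument: every block starting at the [k]-th index has
    distribution function at most [2^-(k+1)] at the level [2^-(k+1)]. *)
Fixpoint mk (k : nat) : nat := if k is j.+1 then (mk j + N0 k + 1)%N else N0 0.
Let mk_ge k : (N0 k <= mk k)%N.
Proof. by case: k => //= k; rewrite addnAC leq_addl. Qed.
Let mk_lt k : (mk k < mk k.+1)%N.
Proof. by rewrite /= addn1 ltnS leq_addr. Qed.
Let mk_id k : (k <= mk k)%N.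
Proof. by elim: k => // k IH; exact: leq_ltn_trans IH (mk_lt k). Qed.

(** The limit is taken along the subsequence [mk]; convergence in measure of the whole sequence is
    recovered afterwards from the Cauchy condition. *)
Definition limg : graph H := [set z | exists t, (forall k, y k (z.1, t k)) /\
  hcvg (fun k => \sum_(i < mk k) t i) z.2].

(* On incr K the partial sums along mk converge geometrically. *)
Let incr (K : nat) : set H := [set u | forall k : nat,
  gsp (spartial (shift (mk (K + k)) y) (mk (K + k).+1 - mk (K + k))%N) (1 / 2 ^+ (K + k).+1) u].

Let pW m n : Stau_pos (spartial (shift m y) n).
Proof. by apply: spartial_pos => k; exact: py. Qed.
Let cW m n : closed_dd (spartial (shift m y) n).
Proof. exact: Ssa_cdd (Stau_pos_Ssa (pW m n)). Qed.
Let aW m n : affiliated (spartial (shift m y) n).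
Proof. exact: Ssa_aff (Stau_pos_Ssa (pW m n)). Qed.
Let h2 k : 0 < 1 / 2 ^+ k.+1 :> R. Proof. by rewrite divr_gt0// exprn_gt0. Qed.

Let incr_msub (K : nat) : msub (incr K).
Proof. by apply: msub_bigcap => k; apply: gsp_msub => //; exact: ltW. Qed.
Let incr_codim (K : nat) : (codim (incr K) <= (1 / 2 ^+ K)%:E)%E.
Proof.
apply: (codim_bigcap (b := fun k => (1 / 2 ^+ K) / 2 ^+ k.+1)) => k.
- by apply: gsp_msub => //; exact: ltW.
- rewrite -ddistE ?(ltW (h2 _))//; apply: (le_trans (N0P _ (mk_ge _))).
  by rewrite lee_fin -addnS exprD mul1r invfM mul1r.
- by apply: geo_sum_le; rewrite divr_ge0// exprn_ge0.
Qed.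

Lemma sum_split_nat (t : nat -> H) m n : (m <= n)%N ->
  \sum_(i < n) t i = \sum_(i < m) t i + \sum_(i < (n - m)) t (m + i)%N.
Proof.
move=> mn; rewrite -(subnKC mn) big_split_ord /= addKn; congr (_ + _).
Qed.

Let W_val m n u t : (forall k, y k (u, t k)) ->
  spartial (shift m y) n (u, \sum_(i < n) t (m + i)%N).
Proof. by move=> h; apply: (@spartial_val _ _ (shift m y) n u (shift m t)) => k; exact: h. Qed.

Let step (K k : nat) u t : incr K u -> (forall k, y k (u, t k)) ->
  hnorm (\sum_(i < mk (K + k).+1) t i - \sum_(i < mk (K + k)) t i) <= hnorm u / 2 ^+ K / 2 ^+ k.+1.
Proof.
move=> hu ht; rewrite (sum_split_nat t (ltnW (mk_lt _))) addrC addKr.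
have [w hw nw] := gsp_dom (cW _ _) (ltW (h2 _)) (hu k).
rewrite (cdd_uniq (cW _ _) (W_val _ _ ht) hw) (le_trans nw)//.
by rewrite -addnS exprD mul1r invfM [leLHS]mulrC mulrA.
Qed.

Let tele (K n : nat) u t : incr K u -> (forall k, y k (u, t k)) -> forall j,
  hnorm (\sum_(i < mk (K + (j + n))) t i - \sum_(i < mk (K + j)) t i) <=
    hnorm u / 2 ^+ K / 2 ^+ j - hnorm u / 2 ^+ K / 2 ^+ (j + n).
Proof.
move=> hu ht j; elim: n => [|n IH]; first by rewrite addn0 !subrr hnorm0.
apply: (le_trans (hnormDB _ (\sum_(i < mk (K + (j + n))) t i) _)).
rewrite !addnS; have := step (j + n) hu ht; move: IH.
set a := hnorm _; set b := hnorm _; set c := hnorm u / _.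
rewrite exprS invfM [c * (_ * _)]mulrCA => h1 hb; apply: (le_trans (lerD hb h1)).
by move: (c / 2 ^+ (j + n)) (c / 2 ^+ j) => p q; lra.
Qed.

Let limit (K : nat) u t : incr K u -> (forall k, y k (u, t k)) -> exists2 w,
  hcvg (fun k => \sum_(i < mk k) t i) w &
  hnorm (\sum_(i < mk K) t i - w) <= hnorm u / 2 ^+ K.
Proof.
move=> hu ht; pose s n := \sum_(i < mk (K + n)) t i; set c := hnorm u / _.
have c0 : 0 <= c by rewrite divr_ge0// exprn_ge0.
have sj j n : (j <= n)%N -> hnorm (s n - s j) <= c / 2 ^+ j.
  move=> jn; have := tele (n - j) hu ht j; rewrite (subnKC jn) => /le_trans; apply.
  by rewrite gerBl divr_ge0// exprn_ge0.
have [w hw] : exists w, hcvg s w.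
  apply: hcauchy_cvg => e e0; have e2 : 0 < e / 2 by rewrite divr_gt0.
  have [N hN] := half_small c e2; exists N => m n Nm Nn.
  apply: (le_lt_trans (hnormDB _ (s N) _)); rewrite (splitr e).
  rewrite ltrD//; last rewrite hnormBC; exact: le_lt_trans (sj _ _ _) hN.
exists w.
  apply/hcvgP => e e0; have /hcvgP/(_ _ e0)[N hN] := hw.
  exists (K + N)%N => n Nn; have := hN (n - K)%N; rewrite /s subnKC.
    by apply; rewrite leq_subRL ?(leq_trans (leq_addr N K)).
  exact: leq_trans (leq_addr N K) Nn.
apply/ler_addgt0Pr => e e0; have /hcvgP/(_ _ e0)[N hN] := hw.
apply: (le_trans (hnormDB _ (s N) _)); apply: lerD; last exact/ltW/hN.
have := sj 0%N N (leq0n N); rewrite /s addn0 expr0 divr1 hnormBC; exact.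
Qed.

Lemma limg_symgraph : symgraph limg.
Proof.
have pS n : Stau_pos (spartial y n) by exact: spartial_pos.
split.
- exists (fun=> 0); split; first by move=> k; exact: cdd_0 (Ssa_cdd (Stau_pos_Ssa (py k))).
  by under eq_fun do rewrite big1//; exact: hcvg_cst.
- move=> c u w u' w' [t [/= ht cvt]] [t' [/= ht' cvt']].
  exists (fun k => c *: t k + t' k); split => /= [k|].
    exact: sg_lin (Ssa_symgraph (Stau_pos_Ssa (py k))) c _ _ _ _ (ht k) (ht' k).
  under eq_fun do rewrite big_split /= -scaler_sumr.
  by apply: hcvgD => //; exact: hcvgZ.
- apply/affP => f k fk u w [t [/= ht cvt]]; exists (f \o t); split => /= [i|].
    by move/affP: (Ssa_aff (Stau_pos_Ssa (py i))) => /(_ _ _ fk _ _ (ht i)).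
  have bf : bounded_linear f by case: fk => hf _ _ _; exact: commutant_bounded hf.
  have := hcvg_bounded bf cvt; congr hcvg; apply/funext => i /=.
  by rewrite (big_morph f (linD (proj1 bf)) (lin0 (proj1 bf))).
- move=> u w u' w' [t [/= ht cvt]] [t' [/= ht' cvt']].
  apply: (ip_cvg_conj cvt cvt') => n.
  exact: sg_sym (Ssa_symgraph (Stau_pos_Ssa (pS (mk n)))) _ _ _ _ (spartial_val _ ht) (spartial_val _ ht').
- move=> e e0; have e2 : 0 < e / 2 by rewrite divr_gt0.
  have [K hK] := half_small 1 e2.
  have /choice[a ha] k : exists a, 0 <= a /\ (ddist (y k) a <= (e / 2 / 2 ^+ k.+1)%:E)%E.
    have e3 : 0 < e / 2 / 2 ^+ k.+1 by rewrite divr_gt0// exprn_gt0.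
    by have [a a0 hd] := stau_tail (proj1 (py k)) e3; exists a.
  have cY k : closed_dd (y k) by exact: Ssa_cdd (Stau_pos_Ssa (py k)).
  have aY k : affiliated (y k) by exact: Ssa_aff (Stau_pos_Ssa (py k)).
  have mG k : msub (gsp (y k) (a k)) by apply: gsp_msub => //; case: (ha k).
  have mI : msub [set u | forall k, gsp (y k) (a k) u] by exact: msub_bigcap.
  have cI : (codim [set u | forall k, gsp (y k) (a k) u] <= (e / 2)%:E)%E.
    apply: (codim_bigcap (b := fun k => e / 2 / 2 ^+ k.+1)) => // k.
      by have [a0 h] := ha k; rewrite -ddistE.
    by apply: geo_sum_le; exact: ltW.
  (* On this subspace the sum of the first [mk K] terms is bounded through the [a i], and the rest
     by [2^-K |u|]. *)
  exists (incr K `&` [set u | forall k, gsp (y k) (a k) u]), (1 / 2 ^+ K + \sum_(i < mk K) a i); split.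
  + exact: msubI.
  + apply: (le_trans (codimI (incr_msub K) mI)); rewrite (splitr e) EFinD leeD//.
    by apply: (le_trans (incr_codim K)); rewrite lee_fin ltW.
  + by rewrite addr_ge0// ?divr_ge0 ?exprn_ge0// sumr_ge0// => i _; case: (ha i).
  + move=> u [uI uG].
    have /choice[t ht] k : exists w, y k (u, w) /\ hnorm w <= a k * hnorm u.
      by have [a0 _] := ha k; have [w hw nw] := gsp_dom (cY k) a0 (uG k); exists w.
    have [w cw nw] := limit uI (fun k => proj1 (ht k)).
    exists w; first by exists t; split => // k; case: (ht k).
    rewrite -(subKr (\sum_(i < mk K) t i) w) addrC mulrDl.
    apply: (le_trans (hnormD _ _)); rewrite hnormN lerD//; first by rewrite mulrC mulrA mulr1.
    rewrite mulr_suml; elim: (mk K) => [|n IH]; first by rewrite !big_ord0 hnorm0.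
    rewrite !big_ord_recr /=; apply: (le_trans (hnormD _ _)); rewrite lerD//.
    by case: (ht n).
Qed.

Lemma limg_pos : Stau_pos (graph_closure limg).
Proof.
apply: sg_pos; first exact: limg_symgraph.
move=> u w [t [/= ht cvt]].
apply: (ler_cvg_to (cvg_cst (0 : R)) (hcvg_rip (w := u) cvt)); apply: nearW => n.
exact: Stau_pos_form (spartial_pos _ py) (spartial_val _ ht).
Qed.

Lemma limg_cvg (d e : R) : 0 < d -> 0 < e -> exists N, forall n, (N <= n)%N ->
  (ddist (ssub (spartial y n) (graph_closure limg)) d <= e%:E)%E.
Proof.
move=> d0 e0; have d2 : 0 < d / 2 by rewrite divr_gt0.
have e2 : 0 < e / 2 by rewrite divr_gt0.
have [K1 hK1] := half_small 1 d2; have [K2 hK2] := half_small 1 e2.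
have [N hN] := cy d2 e2; exists N => n Nn.
(* [K1] makes [2^-K] small against the level, [K2] against the codimension, and [n] ensures
   [n <= mk K]. *)
pose K := (K1 + K2 + n)%N.
have nK : (n <= mk K)%N by apply: leq_trans (mk_id K); exact: leq_addl.
have small j (c : R) : (j <= K)%N -> 1 / 2 ^+ j < c -> 1 / 2 ^+ K <= c.
  move=> jK /ltW; apply: le_trans; rewrite !mul1r lef_pV2 ?posrE ?exprn_gt0//.
  by rewrite ler_eXn2l// ltr1n.
have sz : Ssa (ssub (spartial y n) (graph_closure limg)).
  by apply: ssub_sa; apply: Stau_pos_Ssa; [exact: spartial_pos | exact: limg_pos].
have mG : msub (gsp (spartial (shift n y) (mk K - n)%N) (d / 2)).
  by apply: gsp_msub => //; exact: ltW.
have bD : big (doms y) by apply: doms_big => k; case: (py k).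
have mL := msubI (incr_msub K) mG.
apply: (le_trans (ddist_key (Ssa_cdd sz) (Ssa_aff sz) (ltW d0) mL bD _)); last first.
  apply: (le_trans (codimI (incr_msub K) mG)); rewrite (splitr e) EFinD leeD//.
    apply: (le_trans (incr_codim K)); rewrite lee_fin; apply: small hK2.
    by rewrite /K -addnA addnCA leq_addr.
  by rewrite -ddistE ?(ltW d2)//; exact: hN.
move=> u w [uI uG] /domsP[t ht] hw.
have [l cl nl] := limit uI ht.
have gl : graph_closure limg (u, l) by apply: (sg_sub limg_symgraph); exists t.
rewrite (cdd_uniq (Ssa_cdd sz) hw (ssub_val (spartial_val n ht) gl)).
apply: (le_trans (hnormDB _ (\sum_(i < mk K) t i) _)).
rewrite [in leRHS](splitr d) mulrDl lerD//.
  rewrite hnormBC (sum_split_nat t nK) addrC addKr.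
  have [z hz nz] := gsp_dom (cW _ _) (ltW d2) uG.
  by rewrite (cdd_uniq (cW _ _) (W_val _ _ ht) hz).
apply: (le_trans nl); rewrite mulrC ler_wpM2r//.
rewrite -[leLHS]mul1r; apply: small hK1.
by rewrite /K -addnA leq_addr.
Qed.
End Existence.
End Limits.

(** * Generalized singular values and symmetric spaces *)

Section Distributions.
Context {R : realType}.
Implicit Types (d : R -> \bar R) (f g : R -> R) (s t v w a b e : R).
Local Notation lam := (@lebesgue_measure R).

(** These properties are shared by the distribution functions of operators and of functions on the
    half-line or the quadrant, so that facts about [singular] serve all of them. *)
Record dfun d : Prop := {
  df_ge0 : forall a, 0 < a -> (0 <= d a)%E ;
  df_mono : forall a b, 0 < a -> a <= b -> (d b <= d a)%E ;
  df_tail : forall e, 0 < e -> exists2 a, 0 < a & (d a <= e%:E)%E }.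

Lemma sing_ge0 d t : 0 <= singular d t.
Proof.
rewrite /singular; set S := mkset _; have [->|/set0P ne] := eqVneq S set0.
  by rewrite inf0.
by apply: lb_le_inf => // v [v0 _]; exact: ltW.
Qed.
Lemma sing_le d v t : 0 < v -> (d v <= t%:E)%E -> singular d t <= v.
Proof.
move=> v0 h; apply: ge_inf => //; exists 0 => w [w0 _]; exact: ltW.
Qed.

Section Dfun.
Variables (d : R -> \bar R) (hd : dfun d).

Lemma sing_nonempty t : 0 < t -> [set v | 0 < v /\ (d v <= t%:E)%E] !=set0.
Proof. by move=> /(df_tail hd)[a a0 h]; exists a. Qed.

Lemma sing_ge v t : 0 < t -> 0 < v -> (t%:E < d v)%E -> v <= singular d t.
Proof.
move=> t0 v0 h; apply: lb_le_inf; first exact: sing_nonempty.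
move=> w [w0 hw]; rewrite leNgt; apply/negP => wv.
by move: h; rewrite ltNge (le_trans (df_mono hd w0 (ltW wv)) hw).
Qed.

Lemma sing_lt v t : 0 < t -> singular d t < v -> (d v <= t%:E)%E.
Proof.
move=> t0 /(inf_lt (sing_nonempty t0))[w [w0 hw] wv].
exact: le_trans (df_mono hd w0 (ltW wv)) hw.
Qed.

Lemma sing_noninc s t : 0 < s -> s <= t -> singular d t <= singular d s.
Proof.
move=> s0 st; apply: lb_le_inf; first exact: sing_nonempty.
by move=> w [w0 hw]; apply: sing_le => //; apply: (le_trans hw); rewrite lee_fin.
Qed.

Lemma sing_meas : measurable_fun (@Rplus R) (singular d).
Proof.
move=> mD; apply: (measurability (@RGenCInfty.G R)) => [|/= _ [_] [r] -> <-|//].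
  exact: RGenCInfty.measurableE.
apply: is_interval_measurable => s t/=.
rewrite /Rplus /= !in_itv /= !andbT => -[s0 fs] [t0 ft] u /andP[su ut].
have u0 : 0 < u by exact: lt_le_trans su.
split; rewrite in_itv /= andbT//; apply: (le_trans ft); exact: sing_noninc.
Qed.

Lemma measurable_Rplus : measurable (@Rplus R). Proof. exact: measurable_itv. Qed.

Lemma distr_sing_meas v : measurable (@Rplus R `&` [set t | v < `|singular d t|]).
Proof.
have -> : @Rplus R `&` [set t | v < `|singular d t|] = @Rplus R `&` (singular d @^-1` `]v, +oo[).
  by apply/seteqP; split=> t [h1 /=]; rewrite ger0_norm ?sing_ge0// in_itv /= andbT.
by apply: sing_meas => //; exact: measurable_Rplus.
Qed.

Lemma distr_sing v : 0 < v -> (distr lam (@Rplus R) (singular d) v <= d v)%E.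
Proof.
move=> v0; rewrite /distr; have := df_ge0 hd v0.
have sub t : (@Rplus R `&` [set t | v < `|singular d t|]) t -> 0 < t /\ (t%:E < d v)%E.
  move=> [/=]; rewrite /Rplus /= in_itv /= andbT ger0_norm ?sing_ge0// => t0 h; split => //.
  by rewrite ltNge; apply/negP => /(sing_le v0); rewrite leNgt h.
case E : (d v) => [r| |] //= r0; last by rewrite leey.
apply: (@le_trans _ _ (lam `]0, r[)).
  apply: le_measure; rewrite ?inE; [exact: distr_sing_meas|exact: measurable_itv|].
  by move=> t /sub[t0]; rewrite E lte_fin => tr; rewrite /= in_itv /= t0 tr.
rewrite lebesgue_measure_itv /= lte_fin; case: ifP => _ //.
by rewrite oppr0 adde0.
Qed.

Lemma S1_sing : S1 (singular d).
Proof.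
split; first exact: sing_meas.
have [a a0 h] := df_tail hd ltr01; exists a; split => //.
by apply: (le_lt_trans (distr_sing a0)); apply: (le_lt_trans h); rewrite ltry.
Qed.
End Dfun.

(** The comparison may lose an arbitrarily small amount of level, since the infimum defining
    [singular] absorbs it. *)
Lemma sing_le_sing d d' t : dfun d' -> (forall v w, 0 < v -> v < w -> (d w <= d' v)%E) ->
  0 < t -> singular d t <= singular d' t.
Proof.
move=> hd' h t0; apply: lb_le_inf; first exact: sing_nonempty.
move=> v [v0 hv]; apply/ler_addgt0Pr => e e0.
apply: sing_le; first by rewrite addr_gt0.
by apply: le_trans hv; apply: h => //; rewrite ltrDl.
Qed.

(** The tail vanishes by continuity of the measure from above, starting from a level set of finite
    measure. *)
Lemma dfun_distr (dT : measure_display) (T : measurableType dT) (m : {measure set T -> \bar R})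
  (D : set T) (F : T -> R) : measurable D -> Sfun m D F -> dfun (distr m D F).
Proof.
move=> mD [mF [v0 [v0p fin]]].
have mA v : measurable (D `&` [set x | v < `|F x|]).
  have := measurableT_comp (@normr_measurable R setT) mF => /(_ mD `]v, +oo[%classic).
  move=> /(_ (measurable_itv _)); congr measurable; apply/seteqP; split=> x [Dx /=].
    by rewrite in_itv /= andbT.
  by move=> h; split => //=; rewrite in_itv /= andbT.
have mono a b : a <= b -> (distr m D F b <= distr m D F a)%E.
  move=> ab; apply: le_measure; rewrite ?inE; try exact: mA.
  by move=> x [Dx /= h]; split => //=; exact: le_lt_trans h.
split.
- by move=> a a0; exact: measure_ge0.
- by move=> a b _; exact: mono.
- move=> e e0.
  pose A n := D `&` [set x | v0 + n%:R < `|F x|].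
  have cv : m (A n) @[n --> \oo] --> m (\bigcap_n A n).
    apply: nonincreasing_cvg_mu => //.
    - by rewrite /A addr0.
    - by move=> i; exact: mA.
    - by apply: bigcapT_measurable => i; exact: mA.
    - apply/nonincreasing_seqP => n; apply/subsetPset => x [Dx /= h]; split => //=.
      by apply: le_lt_trans h; rewrite lerD2l ler_nat.
  have I0 : \bigcap_n A n = set0.
    apply/seteqP; split => // x hx; have := hx (Num.truncn `|F x|).+1 I.
    move=> [_ /=]; rewrite ltNge => /negP; apply.
    by apply: (le_trans (ltW (truncnS_gt _))); rewrite lerDr ltW.
  move: cv; rewrite I0 measure0 => /fine_cvgP[[N1 _ hN1] /cvgr0P/(_ _ e0)[N2 hN2]].
  exists (v0 + (maxn N1 N2)%:R); first by rewrite ltr_wpDr.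
  have fn := hN1 _ (leq_maxl N1 N2); have := hN2 _ (leq_maxr N1 N2).
  rewrite /distr -/(A _) -(fineK fn) lee_fin /= ger0_norm ?fine_ge0//.
  exact: ltW.
Qed.
End Distributions.

(** * Order and convergence in symmetric spaces *)

Section FunctionSpace.
Context {R : realType}.
Variables (E : qspace R (R -> R)) (hE : symmetric_quasi_banach E).
Implicit Types (d : R -> \bar R) (f g : R -> R) (s t v w a b e : R).
Local Notation lam := (@lebesgue_measure R).

Lemma dfun_S1 f : S1 f -> dfun (distr lam (@Rplus R) f).
Proof. by apply: dfun_distr; exact: measurable_Rplus. Qed.

Lemma distr_setE f v : measurable_fun (@Rplus R) f ->
  measurable (@Rplus R `&` [set x | v < `|f x|]).
Proof.
move=> mf.
have := measurableT_comp (@normr_measurable R setT) mf => /(_ (@measurable_Rplus R) `]v, +oo[%classic).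
move=> /(_ (measurable_itv _)); congr measurable; apply/seteqP; split=> x [Dx /=].
  by rewrite in_itv /= andbT.
by move=> h; split => //=; rewrite in_itv /= andbT.
Qed.

Lemma distr_le f g v : measurable_fun (@Rplus R) f -> measurable_fun (@Rplus R) g ->
  (forall t, 0 < t -> `|f t| <= `|g t|) ->
  (distr lam (@Rplus R) f v <= distr lam (@Rplus R) g v)%E.
Proof.
move=> mf mg h; apply: le_measure; rewrite ?inE; try exact: distr_setE.
move=> x [Dx /= hx]; split => //=; apply: (lt_le_trans hx); apply: h.
by move: Dx; rewrite /Rplus /= in_itv /= andbT.
Qed.

Lemma carrier_mono f g : S1 f -> carrier E g -> (forall t, 0 < t -> `|f t| <= `|g t|) ->
  carrier E f /\ qn E f <= qn E g.
Proof.
move=> Sf Eg h; have Sg := sqb_sub hE Eg; apply: (sqb_symmetric hE Sf Eg) => t t0.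
apply: sing_le_sing => //; first exact: dfun_S1.
move=> v w v0 vw; apply: (le_trans (df_mono (dfun_S1 Sf) v0 (ltW vw))).
by apply: distr_le => //; [case: Sf | case: Sg].
Qed.

Lemma carrier_sing d g : dfun d -> carrier E g -> (forall t, 0 < t -> singular d t <= `|g t|) ->
  carrier E (singular d) /\ qn E (singular d) <= qn E g.
Proof.
move=> hd Eg h; apply: carrier_mono => //; first exact: S1_sing.
by move=> t t0; rewrite ger0_norm ?sing_ge0//; exact: h.
Qed.

Lemma S1_ind e : 0 < e -> S1 (\1_(`]0, e[%classic : set R) : R -> R).
Proof.
move=> e0; have m1 : measurable_fun (@Rplus R) (\1_(`]0, e[%classic : set R) : R -> R).
  by apply: measurable_indic; exact: measurable_itv.
split => //; exists 1; split => //.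
rewrite /distr (_ : _ `&` _ = set0) ?measure0//.
apply/seteqP; split => // t [_ /=]; rewrite indicE ger0_norm//.
by case: (_ \in _); rewrite ?ltxx// ltr10.
Qed.

(** Otherwise [v] times the indicator of []0, e[] lies below [singular (d n)] for arbitrarily large
    [n], so its quasi-norm is zero, contrary to definiteness. *)
Lemma qn_cvg_distr (d : nat -> R -> \bar R) :
  (forall eta : R, 0 < eta -> exists N, forall n, (N <= n)%N ->
     [/\ dfun (d n), carrier E (singular (d n)) & qn E (singular (d n)) < eta]) ->
  forall v e, 0 < v -> 0 < e -> exists N, forall n, (N <= n)%N -> (d n v <= e%:E)%E.
Proof.
move=> hd v e v0 e0; apply: contrapT => /forallNP h.
have {}h N : exists2 n, (N <= n)%N & (e%:E < d n v)%E.
  have /existsNP[n /not_implyP[Nn]] := h N; move/negP; rewrite -ltNge => hn.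
  by exists n.
pose f := (\1_(`]0, e[%classic : set R) : R -> R); have Sf := S1_ind e0.
have key eta : 0 < eta -> carrier E f /\ v * qn E f < eta.
  move=> /hd[N hN]; have [n /hN[dn cn qn_] en] := h N.
  have Svf : S1 (fun t => v * f t).
    have [mf [a [a0 fa]]] := Sf; split.
      by apply: measurable_funM => //; exact: measurable_cst.
    exists v; split => //; rewrite /distr (_ : _ `&` _ = set0) ?measure0//.
    apply/seteqP; split => // t [_ /=]; rewrite /f indicE normrM (ger0_norm (ltW v0)).
    by case: (_ \in _); rewrite ?normr1 ?normr0 ?mulr1 ?mulr0 ?ltxx// ltNge ltW.
  have [c1 c2] : carrier E (fun t => v * f t) /\ qn E (fun t => v * f t) <= qn E (singular (d n)).
    apply: carrier_mono => // t t0; rewrite [leRHS]ger0_norm ?sing_ge0//.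
    rewrite normrM (ger0_norm (ltW v0)) /f indicE; case: (boolP (_ \in _)) => ht.
      rewrite normr1 mulr1; apply: sing_ge => //; apply: (lt_trans _ en).
      by move: ht; rewrite inE /= in_itv /= lte_fin => /andP[].
    by rewrite normr0 mulr0 sing_ge0.
  have cf : carrier E f.
    have := sqb_Z hE v^-1 c1; congr (carrier E _); apply/funext => t.
    by rewrite mulrA mulVf ?mul1r// gt_eqF.
  split => //; apply: le_lt_trans qn_; apply: le_trans c2.
  by rewrite (sqb_normZ hE) // (ger0_norm (ltW v0)).
have [cf _] := key 1 ltr01.
have q0 : qn E f = 0.
  apply/eqP; rewrite eq_le (sqb_ge0 hE cf) andbT leNgt; apply/negP => q0.
  have [_] := key (v * qn E f) (mulr_gt0 v0 q0); by rewrite ltxx.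
have [A [mA A0 hA]] : exists A : set R, [/\ measurable A, lam A = 0%E &
    ~` [set u | Rplus u -> f u = 0] `<=` A].
  by have [A [h1 h2 h3]] := sqb_definite hE cf q0; exists A; split.
have sub : (`]0%R, e[%classic : set R) `<=` A.
  move=> t ht; apply: hA => /= h0; have := ht; rewrite /= in_itv /= => /andP[t0 te].
  have t0' : @Rplus R t by rewrite /Rplus /= in_itv /= andbT.
  by have /eqP := h0 t0'; rewrite /f indicE mem_set// oner_eq0.
have mI : measurable (`]0%R, e[%classic : set R) by exact: measurable_itv.
have : (lam (`]0%R, e[%classic) <= 0)%E.
  by rewrite -A0; exact: (@le_measure _ _ _ lam _ _ (mem_set mI) (mem_set mA) sub).
rewrite lebesgue_measure_itv /= lte_fin e0 oppr0 adde0 lee_fin.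
by rewrite leNgt e0.
Qed.
End FunctionSpace.

(** * Sections of the level sets of [Theta] *)

Lemma section_lower (R : realType) (A : set (R * R)) (g : R -> R) : measurable A ->
  measurable_fun (@Rplus R) g -> (forall s, 0 <= g s) ->
  (forall s t, 0 < s -> 0 < t -> t < g s -> A (s, t)) ->
  (\int[@lebesgue_measure R]_(s in @Rplus R) (g s)%:E <= leb2 A)%E.
Proof.
move=> mA mg g0 h; rewrite /leb2 /product_measure1.
have mR := @measurable_Rplus R.
rewrite integral_mkcond; apply: ge0_le_integral => //.
- by move=> s _; rewrite patchE; case: ifP => // _; rewrite lee_fin g0.
- by apply/(measurable_restrictT _ mR); apply/measurable_EFinP.
- exact: measurable_fun_xsection.
move=> s _; rewrite patchE; case: ifP => [|_]; last exact: measure_ge0.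
rewrite inE /Rplus /= in_itv /= andbT => s0.
have := g0 s; rewrite le_eqVlt => /orP[/eqP<-|ph]; first exact: measure_ge0.
apply: (@le_trans _ _ (@lebesgue_measure R `]0, g s[%classic)).
  by rewrite lebesgue_measure_itv /= lte_fin ph oppr0 adde0.
apply: le_measure; rewrite ?inE; [exact: measurable_itv|exact: measurable_xsection|].
by move=> t /=; rewrite in_itv /= => /andP[t0 ht]; rewrite /xsection /= inE; exact: h.
Qed.

Section Profile.
Context {R : realType}.
Implicit Types (r p q : R).

Definition hi p r : R := if 1 < r then r `^ p else 0.
Definition lo q r : R := if 1 < r then 0 else r `^ q.

Lemma hi_ge0 p r : 0 <= hi p r.
Proof. by rewrite /hi; case: ifP => // _; exact: powR_ge0. Qed.
Lemma lo_ge0 q r : 0 <= lo q r.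
Proof. by rewrite /lo; case: ifP => // _; exact: powR_ge0. Qed.
Lemma hi_meas p : measurable_fun [set: R] (hi p).
Proof.
have -> : hi p = (fun r => r `^ p * \1_(`]1, +oo[%classic : set R) r).
  apply/funext => r; rewrite /hi indicE; case: ifP => r1.
    by rewrite mem_set ?mulr1//= in_itv /= r1.
  by rewrite memNset ?mulr0//= in_itv /= r1.
apply: measurable_funM; first exact: measurable_powR.
by apply: measurable_indic; exact: measurable_itv.
Qed.
Lemma lo_meas q : measurable_fun [set: R] (lo q).
Proof.
have -> : lo q = (fun r => r `^ q * \1_(`]-oo, 1]%classic : set R) r).
  apply/funext => r; rewrite /lo indicE; case: (ltP 1 r) => r1.
    by rewrite memNset ?mulr0//= in_itv /= leNgt r1.
  by rewrite mem_set ?mulr1//= in_itv /= r1.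
apply: measurable_funM; first exact: measurable_powR.
by apply: measurable_indic; exact: measurable_itv.
Qed.
End Profile.

Section Theta.
Context {R : realType}.
Implicit Types (f g : R -> R) (s t v w a b e : R).
Local Notation lam := (@lebesgue_measure R).
Variables (p : R) (q : \bar R).
Hypotheses (p0 : 0 < p) (pq : (p%:E < q)%E).

Lemma recip_fin a : 0 < a -> recip a%:E = a^-1.
Proof. by move=> a0; rewrite /recip inver gt_eqF. Qed.
Lemma recip_infty : recip (+oo%E : \bar R) = 0.
Proof. by rewrite /recip invey. Qed.

(* phi (f s / v) bounds the measure of the section of {Theta f > v} at s from below. *)
Definition phi (r : R) : R := hi p r + (if q is q'%:E then lo q' r else 0).

Lemma phi_gt1 r : 1 < r -> phi r = r `^ p.
Proof. by move=> r1; rewrite /phi /hi /lo r1; case: q => [q'| |]; rewrite addr0. Qed.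
Lemma phi_le1 r : r <= 1 -> phi r = if q is q'%:E then r `^ q' else 0.
Proof. by move=> r1; rewrite /phi /hi /lo ltNge r1 add0r. Qed.

Definition weight t : R := t `^ (- recip q) * \1_(`]0, 1[ : set R) t
           + t `^ (- recip p%:E) * \1_(`[1, +oo[ : set R) t.

Lemma weight_meas : measurable_fun [set: R] weight.
Proof.
apply: measurable_funD; apply: measurable_funM.
- exact: measurable_powR.
- by apply: measurable_indic; exact: measurable_itv.
- exact: measurable_powR.
- by apply: measurable_indic; exact: measurable_itv.
Qed.

Lemma weight_ge0 t : 0 <= weight t.
Proof. by rewrite /weight !indicE addr_ge0// mulr_ge0// powR_ge0. Qed.

Lemma weight_lt1 t : 0 < t -> t < 1 -> weight t = t `^ (- recip q).
Proof.
move=> t0 t1; rewrite /weight !indicE.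
have -> : t \in (`]0, 1[%classic : set R) = true by apply: mem_set; rewrite /= in_itv /= t0 t1.
have -> : t \in (`[1, +oo[%classic : set R) = false.
  by apply/negbTE; rewrite notin_setE /= in_itv /= andbT; apply/negP; rewrite -ltNge.
by rewrite mulr1 mulr0 addr0.
Qed.
Lemma weight_ge1 t : 1 <= t -> weight t = t `^ (- p^-1).
Proof.
move=> t1; rewrite /weight !indicE recip_fin//.
have -> : t \in (`]0, 1[%classic : set R) = false.
  by apply/negbTE; rewrite notin_setE /= in_itv /=; apply/negP; rewrite negb_and -!leNgt t1 orbT.
have -> : t \in (`[1, +oo[%classic : set R) = true by apply: mem_set; rewrite /= in_itv /= t1.
by rewrite mulr0 add0r mulr1.
Qed.

Lemma powRK a r : 0 < r -> 0 <= a -> (a `^ r) `^ r^-1 = a.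
Proof. by move=> r0 a0; rewrite -powRrM divff ?gt_eqF// powRr1. Qed.

Lemma powR_le1 a r : 0 <= a -> a <= 1 -> 0 <= r -> a `^ r <= 1.
Proof.
move=> a0 a1 r0; have := ge0_ler_powR r0 a0 _ a1; rewrite powR1; apply.
by rewrite nnegrE.
Qed.

(** The weight is a power on either side of 1. The set where [r weight > 1] reaches up to [r^p] for
    [r > 1] and up to [r^q] for [r <= 1]; in the latter case it is empty when [q] is infinite. *)
Lemma weight_phi r t : 0 <= r -> 0 < t -> t < phi r -> 1 < r * weight t.
Proof.
move=> r0 t0; case: (ltP 1 r) => r1; [rewrite phi_gt1//|rewrite phi_le1//] => ht.
- have [t1|t1] := ltP t 1.
    rewrite weight_lt1//; apply: (lt_le_trans r1); rewrite ler_peMr//.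
    rewrite powRN; case: q pq => [q'| |]// pq'; last first.
      by rewrite recip_infty powRr0 invr1.
    have q0 : 0 < q' by move: pq'; rewrite lte_fin; exact: lt_trans.
    rewrite recip_fin// invf_ge1 ?powR_gt0//.
    by apply: powR_le1; rewrite ?ltW ?invr_gt0.
  rewrite weight_ge1// powRN -ltr_pdivrMr; last by rewrite invr_gt0 powR_gt0.
  rewrite mul1r invrK -[ltRHS](powRK p0)//.
  by apply: gt0_ltr_powR; rewrite ?nnegrE ?invr_gt0// ?powR_ge0// ltW.
- have := @weight_lt1 t t0; case: q pq ht => [q'| |]// pq' ht wl; last first.
    by move: (lt_trans t0 ht); rewrite ltxx.
  have q0 : 0 < q' by move: pq'; rewrite lte_fin; exact: lt_trans.
  have t1 : t < 1.
    by apply: (lt_le_trans ht); apply: powR_le1 => //; exact: ltW.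
  rewrite wl// recip_fin// powRN -ltr_pdivrMr; last by rewrite invr_gt0 powR_gt0.
  rewrite mul1r invrK -[ltRHS](powRK q0)//.
  by apply: gt0_ltr_powR; rewrite ?nnegrE ?invr_gt0// ?powR_ge0// ltW.
Qed.

Lemma Theta_weight f z : Theta p%:E q f z = f z.1 * weight z.2.
Proof. by []. Qed.

Definition quadrant : set (R * R) := @Rplus R `*` @Rplus R.
Lemma Theta_meas f : measurable_fun (@Rplus R) f -> measurable_fun quadrant (Theta p%:E q f).
Proof.
move=> mf; have mQ : measurable quadrant by apply: measurableX; exact: measurable_Rplus.
have -> : Theta p%:E q f = (f \o fst) \* (weight \o snd) by [].
apply: measurable_funM.
  apply: (measurable_comp (F := @Rplus R)) => //; first exact: measurable_Rplus.
    by move=> _ [z [h _] <-].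
  by apply: measurable_funS (@measurable_fst _ _ R R).
apply: (measurable_comp (F := setT)) => //; first exact: weight_meas.
by apply: measurable_funS (@measurable_snd _ _ R R).
Qed.

Lemma Theta_set_meas f v : measurable_fun (@Rplus R) f ->
  measurable (quadrant `&` [set z | v < `|Theta p%:E q f z|]).
Proof.
move=> mf; have mQ : measurable quadrant by apply: measurableX; exact: measurable_Rplus.
have := measurableT_comp (@normr_measurable R setT) (Theta_meas mf) => /(_ mQ `]v, +oo[%classic).
move=> /(_ (measurable_itv _)); congr measurable; apply/seteqP; split=> x [Dx /=].
  by rewrite in_itv /= andbT.
by move=> h; split => //=; rewrite in_itv /= andbT.
Qed.

Lemma phi_ge0 r : 0 <= phi r.
Proof. by rewrite /phi addr_ge0 ?hi_ge0//; case: q => [q'| |]//; exact: lo_ge0. Qed.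

Lemma phi_meas : measurable_fun [set: R] phi.
Proof.
apply: measurable_funD; first exact: hi_meas.
by case: q => [q'| |]; [exact: lo_meas|exact: measurable_cst|exact: measurable_cst].
Qed.

Lemma Theta_lower f v : 0 < v -> measurable_fun (@Rplus R) f -> (forall s, 0 < s -> 0 <= f s) ->
  (\int[lam]_(s in @Rplus R) (phi (f s / v))%:E <=
   distr leb2 (@Rplus R `*` @Rplus R) (Theta p%:E q f) v)%E.
Proof.
move=> v0 mf f0; apply: section_lower.
- exact: Theta_set_meas.
- apply: (measurableT_comp phi_meas).
  by apply: measurable_funM => //; exact: measurable_cst.
- by move=> s; exact: phi_ge0.
move=> s t s0 t0 ht; split; first by split; rewrite /Rplus /= in_itv /= andbT.
have := weight_phi (divr_ge0 (f0 _ s0) (ltW v0)) t0 ht.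
rewrite /= Theta_weight /= ger0_norm ?mulr_ge0 ?weight_ge0 ?f0//.
by rewrite mulrAC ltr_pdivlMr// mul1r.
Qed.
End Theta.

(** * Compressions *)

(** The right-hand side equals [rip (a - b) (u - v)]. The factors [2^-1] and [4] are kept apart to
    match the halves of the compressions [4 P x P]. *)
Lemma rip_cross (R : realType) (H : hilbert R) (a b u v : H) : 0 <= rip (a - b) (u - v) ->
  0 <= 2^-1 * (4 * rip a u) + 2^-1 * (4 * rip b v) - rip (a + b) (u + v).
Proof.
rewrite !(ripDl, ripDr, ripNl, ripNr).
by move: (rip a u) (rip a v) (rip b u) (rip b v) => x y z t; lra.
Qed.

Section Compression.
Context {R : realType} (M : traced_vna R).
Local Notation H := (vspace_of M).
Implicit Types (x y z W Z : graph H) (u v w : H) (K L B D G : set H) (a b c : R).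

Lemma msub_preim K G : msub K -> msub G -> msub [set u | G (proj K u)].
Proof.
move=> mK mG; have bP := proj_bounded (ms_c mK); have lP := proj_linear (ms_c mK).
split; last first.
  move=> f g fg u hu /=; rewrite (msub_commute_unitary mK fg); exact: (ms_i mG fg).
split; first by rewrite /= (lin0 lP); exact: cs0 (ms_c mG).
  by move=> c u v hu hv; rewrite /= lP; exact: csL (ms_c mG) _ _ _ hu hv.
move=> s l hs sl; apply: (csC (ms_c mG) _ (hcvg_bounded bP sl)) => n; exact: hs.
Qed.

Lemma orth_preim K G u : msub K -> msub G -> orth [set u | G (proj K u)] u ->
  K u /\ forall k, K k -> G k -> ip u k = 0.
Proof.
move=> mK mG h; have cK := ms_c mK; split.
  rewrite -(orthK cK) => k hk; apply: h; rewrite /= (proj_orthE cK hk); exact: cs0 (ms_c mG).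
by move=> k kK kG; apply: h; rewrite /= (proj_id cK).
Qed.

(** A vector orthogonal to the preimage lies in [K] and is orthogonal to [K] intersected with [G],
    so it is zero if it belongs to [G]. *)
Lemma codim_preim K G : msub K -> msub G -> (codim [set u | G (proj K u)] <= codim G)%E.
Proof.
move=> mK mG; apply: codim_compare => //; first exact: msub_preim.
by move=> u /(orth_preim mK mG)[h1 h2] h3; apply: ip_eq0; exact: h2.
Qed.

Lemma big_preim K D : msub K -> big D -> big [set u | D (proj K u)].
Proof.
move=> mK bD e /bD[L [mL cL LD]]; exists [set u | L (proj K u)]; split.
- exact: msub_preim.
- exact: le_trans (codim_preim mK mL) cL.
- by move=> u /LD.
Qed.

(* The compression c P x P, with P the projection onto K. *)
Definition cmp c K x : graph H :=
  graph_closure [set z | exists2 d, x (proj K z.1, d) & z.2 = c%:C%C *: proj K d].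

Lemma cmp_val c K x u d : x (proj K u, d) -> cmp c K x (u, c%:C%C *: proj K d).
Proof.
move=> h e e0; exists (u, c%:C%C *: proj K d); first by exists d.
by rewrite !subrr hnorm0.
Qed.

Lemma cmp_symgraph c K x : Ssa x -> msub K ->
  symgraph [set z | exists2 d, x (proj K z.1, d) & z.2 = c%:C%C *: proj K d].
Proof.
move=> sx mK; have gx := Ssa_symgraph sx; have cx := Ssa_cdd sx.
have cK := ms_c mK; have lP := proj_linear cK; split.
- by exists 0; rewrite /= ?(lin0 lP) ?scaler0//; exact: sg_0.
- move=> r u w u' w' [d /= h ->] [d' /= h' ->]; exists (r *: d + d') => /=.
    by rewrite lP; exact: sg_lin.
  by rewrite lP scalerDr !scalerA mulrC.
- apply/affP => f g fg u w [d /= h ->]; exists (f d).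
    by rewrite /= (msub_commute_unitary mK fg); move/affP: (sg_aff gx) => /(_ _ _ fg _ _ h).
  rewrite /= (linZ (proj1 (commutant_bounded (let: And4 h _ _ _ := fg in h)))).
  by rewrite (msub_commute_unitary mK fg).
- move=> u w u' w' [d /= h ->] [d' /= h' ->].
  by rewrite ipZl ipZr conj_real (proj_sa cK) -(proj_sa cK u) (sg_sym gx h h').
- move=> e e0; have [L [a [mL cL a0 hL]]] := sg_tb gx e0.
  exists [set u | L (proj K u)], (`|c| * a); split.
  + exact: msub_preim.
  + exact: le_trans (codim_preim mK mL) cL.
  + by rewrite mulr_ge0.
  + move=> u /hL[d hd nd]; exists (c%:C%C *: proj K d); first by exists d.
    rewrite hnormZr -mulrA ler_wpM2l//; apply: (le_trans (proj_le cK _)).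
    by apply: (le_trans nd); rewrite ler_wpM2l// proj_le.
Qed.

Lemma cmp_pos c K x : 0 <= c -> Stau_pos x -> msub K -> Stau_pos (cmp c K x).
Proof.
move=> c0 px mK; apply: sg_pos; first by apply: cmp_symgraph => //; exact: Stau_pos_Ssa.
move=> u w [d /= h ->]; rewrite ripZl mulr_ge0// /rip (proj_sa (ms_c mK)).
exact: Stau_pos_form px h.
Qed.

Lemma cmp_fun c K x u d w : Ssa x -> msub K -> x (proj K u, d) -> cmp c K x (u, w) ->
  w = c%:C%C *: proj K d.
Proof.
move=> sx mK h h'; have s := sg_sa (cmp_symgraph c sx mK).
by apply: (cdd_uniq (Ssa_cdd s) h'); exact: cmp_val.
Qed.

(** The restriction of [z] to [D] has a self-adjoint closure contained in [z], hence equal to it,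
    and positivity passes to the closure. *)
Lemma pos_core z D : Ssa z -> lsub D -> invar D -> big D ->
  (forall u w, z (u, w) -> D u -> 0 <= rip w u) -> Stau_pos z.
Proof.
move=> sz lD iD bD h.
have sg : symgraph [set p | z p /\ D p.1].
  have gz := Ssa_symgraph sz; split.
  - by split; [exact: sg_0 | exact: ls0].
  - by move=> c u w u' w' [h1 h2] [h3 h4]; split; [exact: sg_lin | exact: lsL].
  - apply/affP => f g fg u w [h1 h2]; split; last exact: iD fg _ h2.
    by move/affP: (sg_aff gz) => /(_ _ _ fg _ _ h1).
  - by move=> u w u' w' [h1 _] [h2 _]; exact: sg_sym gz _ _ _ _ h1 h2.
  - move=> e e0; have e2 : 0 < e / 2 by rewrite divr_gt0.
    have [L [a [mL cL a0 hL]]] := sg_tb gz e2; have [L' [mL' cL' LD]] := bD _ e2.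
    exists (L `&` L'), a; split => //; first exact: msubI.
      by apply: (le_trans (codimI mL mL')); rewrite (splitr e) EFinD leeD.
    by move=> u [/hL[w hw nw] /LD uD]; exists w.
suff <- : graph_closure [set p | z p /\ D p.1] = z.
  by apply: sg_pos => // u w [h1 h2]; exact: h.
apply: Ssa_eq => //; first exact: sg_sa.
rewrite -{2}(cdd_closure (Ssa_cdd sz)) => p hp e /hp[q [zq _] hq]; by exists q.
Qed.

Lemma dom_lsub x : closed_dd x -> lsub (dom x).
Proof.
move=> cx; split; first by exists 0; exact: cdd_0.
by move=> c u v [w hw] [w' hw']; exists (c *: w + w'); exact: (cdd_lin cx c hw hw').
Qed.

(* x <= 2 P x P + 2 P' x P' for complementary projections P and P', because the
   form of x is nonnegative at P u - P' u. *)
Lemma sle_cmp K x : Stau_pos x -> msub K ->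
  sle x (sadd (sscale 2^-1 (cmp 4 K x)) (sscale 2^-1 (cmp 4 (orth K) x))).
Proof.
move=> px mK; have sx := Stau_pos_Ssa px; have cx := Ssa_cdd sx.
have cK := ms_c mK; have lP := proj_linear cK; have mK' := msub_orth mK.
have s1 : Ssa (sscale 2^-1 (cmp 4 K x)) by apply: sscale_sa; exact: Stau_pos_Ssa (cmp_pos _ px mK).
have s2 : Ssa (sscale 2^-1 (cmp 4 (orth K) x)).
  by apply: sscale_sa; exact: Stau_pos_Ssa (cmp_pos _ px mK').
pose D := dom x `&` [set u | dom x (proj K u)].
have bx : big (dom x) by apply: stau_big; case: px.
have ix : invar (dom x) by apply: dom_invar; exact: Ssa_aff.
have lx := dom_lsub cx.
apply: (@pos_core _ D).
- by apply: ssub_sa => //; exact: sadd_sa.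
- split; first by split => /=; rewrite ?(lin0 lP); exact: ls0.
  by move=> c u v [h1 h2] [h3 h4]; split => /=; rewrite ?lP; exact: lsL.
- move=> f g fg u [h1 h2]; split => /=; first exact: ix fg _ h1.
  by rewrite (msub_commute_unitary mK fg); exact: ix fg _ h2.
- by apply: bigI => //; exact: big_preim.
move=> u w hw [[d hd] [d1 h1]].
have h2 := cdd_B cx hd h1.
have h2' : x (proj (orth K) u, d - d1) by rewrite orth_projE.
have v1 := sscale_val 2^-1 (cmp_val 4 h1).
have v2 := sscale_val 2^-1 (cmp_val 4 h2').
have hs := ssub_val (sadd_val v1 v2) hd.
have sy := ssub_sa (sadd_sa s1 s2) sx.
rewrite (cdd_uniq (Ssa_cdd sy) hw hs) ripBl ripDl !ripZl.
rewrite !(sadj_rip (proj_sa _))//; last exact: ms_c.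
rewrite orth_projE//; set u1 := proj K u in h1 h2 *.
have := Stau_pos_form px (cdd_B cx h1 h2).
have e3 : rip d u = rip (d1 + (d - d1)) (u1 + (u - u1)).
  by congr rip; rewrite addrC subrK.
rewrite e3; exact: rip_cross.
Qed.

(** A spectral projection of [x] commutes with it, so the right-hand side extends [x];
    self-adjointness of both gives equality. *)
Lemma cmp_split x a : Stau_pos x -> 0 <= a ->
  x = sadd (cmp 1 (orth (gsp x a)) x) (cmp 1 (gsp x a) x).
Proof.
move=> px a0; have sx := Stau_pos_Ssa px; have cx := Ssa_cdd sx.
have mG := gsp_msub cx (Ssa_aff sx) a0; have mG' := msub_orth mG; have cG := ms_c mG.
apply: Ssa_eq => //.
  by apply: sadd_sa; apply: Stau_pos_Ssa; apply: cmp_pos.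
move=> [u w] h; have h1 := gsp_proj (proj2 px) a0 h; have h2 := cdd_B cx h h1.
have h2' : x (proj (orth (gsp x a)) u, w - proj (gsp x a) w) by rewrite orth_projE.
have := sadd_val (cmp_val 1 h2') (cmp_val 1 h1).
rewrite orth_projE// !scale1r (linB (proj_linear cG)) !projK// subrr subr0 subrK.
exact.
Qed.

Section Estimates.
Variables (W Z : graph H) (c a : R) (B : set H).
Hypotheses (pW : Stau_pos W) (pZ : Stau_pos Z) (c0 : 0 < c) (a0 : 0 <= a) (bB : big B).
Let sW : Ssa W := Stau_pos_Ssa pW.
Let sZ : Ssa Z := Stau_pos_Ssa pZ.
Let cW := Ssa_cdd sW.
Let cZ := Ssa_cdd sZ.
Let mG b (b0 : 0 <= b) : msub (gsp W b) := gsp_msub cW (Ssa_aff sW) b0.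
Let cG b (b0 : 0 <= b) : csub (gsp W b) := ms_c (mG b0).

(** Here [Z] is [c P' W P'] with [P'] the projection above level [a]. If [b / c >= a], then [P' u]
    stays at levels at most [b / c] for [u] in [gsp W (b / c)]; if [b / c < a], then [P'] vanishes
    on [gsp W a]. *)
Lemma cmp_high_ddist b : 0 <= b ->
  (forall (u z : H), B u -> Z (u, z) -> exists2 d, W (proj (orth (gsp W a)) u, d) &
     z = c%:C%C *: proj (orth (gsp W a)) d) ->
  (ddist Z b <= ddist W (Num.max (b / c) a)%R)%E.
Proof.
move=> b0 h; have bc : 0 <= b / c by rewrite divr_ge0// ltW.
have m0 : 0 <= Num.max (b / c) a by rewrite le_max a0 orbT.
rewrite (ddistE cW m0).
apply: (ddist_key cZ (Ssa_aff sZ) b0 (mG m0) bB) => u z uL uB hz.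
have [d hd ->] := h u z uB hz; rewrite hnormZr (ger0_norm (ltW c0)).
have [ab|ba] := leP a (b / c); last first.
  move: uL hd; rewrite (max_idPr (ltW ba)) => uL; rewrite (orth_projE (cG a0)).
  rewrite (proj_id (cG a0) uL) subrr => /(cdd_fun cW) ->.
  by rewrite (lin0 (proj_linear orth_csub)) hnorm0 mulr0 mulr_ge0.
move: uL; rewrite (max_idPl ab) => uL.
have Pu : gsp W (b / c) (proj (orth (gsp W a)) u).
  rewrite (orth_projE (cG a0)); apply: (csB (cG bc)) => //.
  by apply: (gsp_mono cW a0 ab); exact: proj_in (cG a0) u.
have [d' hd' nd] := gsp_dom cW bc Pu; rewrite -(cdd_uniq cW hd hd') in nd.
apply: (@le_trans _ _ (c * hnorm d)).
  by rewrite ler_wpM2l ?(ltW c0)// proj_le//; exact: orth_csub.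
apply: (@le_trans _ _ (c * (b / c * hnorm (proj (orth (gsp W a)) u)))).
  by rewrite ler_wpM2l ?(ltW c0).
rewrite mulrA mulrCA divff ?gt_eqF// mulr1 ler_wpM2l// proj_le//; exact: orth_csub.
Qed.

Hypothesis hlow : forall (u z : H), B u -> Z (u, z) -> exists2 d, W (proj (gsp W a) u, d) &
     z = c%:C%C *: proj (gsp W a) d.

Lemma cmp_low_ddist0 b : c * a <= b -> ddist Z b = 0%E.
Proof.
move=> ab; have b0 : 0 <= b by apply: le_trans ab; rewrite mulr_ge0// ltW.
apply/eqP; rewrite eq_le (ddist_ge0 cZ (Ssa_aff sZ) b0) andbT.
have oT : orth [set: H] = [set 0].
  by apply/seteqP; split=> [u h|_ -> k _]; [apply: ip_eq0; exact: h|exact: ip0l].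
rewrite -(dim0 M) -oT; apply: (ddist_key cZ (Ssa_aff sZ) b0 (msubT M) bB) => u z _ uB hz.
have [d hd ->] := hlow uB hz; rewrite hnormZr (ger0_norm (ltW c0)).
have [d' hd' nd] := gsp_dom cW a0 (proj_in (cG a0) u); rewrite -(cdd_uniq cW hd hd') in nd.
apply: (le_trans (ler_wpM2l (ltW c0) (proj_le (cG a0) _))).
apply: (le_trans (ler_wpM2l (ltW c0) nd)); rewrite mulrA.
by apply: ler_pM => //; [rewrite mulr_ge0// ltW | exact: proj_le (cG a0) u].
Qed.

(** The distribution function of [W] at [b / c] exceeds that at [a] by the dimension of the spectral
    subspace between these levels, and [Z = c P W P] can exceed [b] only there. *)
Lemma cmp_low_ddist b : 0 <= b -> b <= c * a ->
  (ddist W a + ddist Z b <= ddist W (b / c)%R)%E.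
Proof.
move=> b0 ba; have bc : 0 <= b / c by rewrite divr_ge0// ltW.
have bca : b / c <= a by rewrite ler_pdivrMr// mulrC.
have mL := msub_preim (mG a0) (mG bc).
have sub : orth (gsp W a) `<=` orth (gsp W (b / c)) by apply: orth_subset; exact: gsp_mono.
rewrite !(ddistE cW)// /codim.
rewrite (dim_split (msub_orth (mG a0)) (msub_orth (mG bc)) sub) leeD2l//.
apply: (@le_trans _ _ (codim [set u | gsp W (b / c) (proj (gsp W a) u)])).
  apply: (ddist_key cZ (Ssa_aff sZ) b0 mL bB) => u z uL uB hz.
  have [d hd ->] := hlow uB hz; rewrite hnormZr (ger0_norm (ltW c0)).
  have [d' hd' nd] := gsp_dom cW bc uL; rewrite -(cdd_uniq cW hd hd') in nd.
  apply: (le_trans (ler_wpM2l (ltW c0) (proj_le (cG a0) _))).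
  apply: (le_trans (ler_wpM2l (ltW c0) nd)); rewrite mulrA mulrCA divff ?gt_eqF// mulr1.
  by rewrite ler_wpM2l// proj_le//; exact: cG.
apply: dim_mono; first exact: msub_orth.
  by apply: msubI; [exact: msub_orth (mG bc)|exact: msub_orth (msub_orth (mG a0))].
move=> u /(orth_preim (mG a0) (mG bc))[h1 h2]; split.
  by move=> k hk; apply: h2 => //; exact: gsp_mono hk.
by rewrite (orthK (cG a0)).
Qed.
End Estimates.
End Compression.

(** * Translation invariance of Lebesgue integrals *)

Section Translation.
Context {R : realType}.
Local Notation lam := (@lebesgue_measure R).
Local Notation mT := (measurableTypeR R).

Definition transl (a : R) (t : mT) : mT := (t : R) + a.
Lemma transl_meas (a : R) : measurable_fun [set: mT] (transl a).
Proof. by apply: measurable_funD; [exact: measurable_id | exact: measurable_cst]. Qed.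

Let shiftm (a : R) : {measure set mT -> \bar R}.
Proof. by refine [the measure _ _ of pushforward lam (transl a)]; exact: transl_meas. Defined.

Lemma lebesgue_shift (a : R) (A : set mT) : measurable A ->
  lam A = lam (transl a @^-1` A).
Proof.
move=> mA; apply: (@lebesgue_measure_unique R (shiftm a)) => // X [[x y] _ <-].
rewrite /= /pushforward.
have -> : transl a @^-1` [set` `]x, y]] = `]x - a, y - a]%classic.
  by apply/seteqP; split=> t /=; rewrite !in_itv /= ltrBlDr lerBrDr.
rewrite !lebesgue_measure_itv /= !lte_fin ltrD2r; case: ifP => // _.
by rewrite -!EFinD; congr (_%:E); ring.
Qed.

Lemma integral_shift (h : R -> \bar R) (a : R) : measurable_fun [set: R] h ->
  (forall s, (0 <= h s)%E) ->
  (\int[lam]_(t in @Rplus R) h ((t : R) + a)%R = \int[lam]_(s in `]a, +oo[) h s)%E.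
Proof.
move=> mh h0.
have mI : measurable (`]a, +oo[%classic : set mT) by exact: measurable_itv.
have -> : (\int[lam]_(s in `]a, +oo[) h s = \int[shiftm a]_(s in `]a, +oo[) h s)%E.
  apply: eq_measure_integral => A mA _; exact: lebesgue_shift.
rewrite (ge0_integral_pushforward (transl_meas a))//.
- congr (integral _ _ _); apply/seteqP; split=> t /=; rewrite /Rplus /= !in_itv /= !andbT.
    by rewrite /transl ltrDr.
  by rewrite /transl ltrDr.
- exact: measurable_funS mh.
Qed.
End Translation.

(** * Singular values of the parts above and below a level *)

Section Cuts.
Context {R : realType}.
Local Notation lam := (@lebesgue_measure R).
Implicit Types (s t b r : R).

Variables (dW dZ : R -> \bar R) (hW : dfun dW) (hZ : dfun dZ) (c w : R).
Hypotheses (c0 : 0 < c) (w0 : 0 < w).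
Hypothesis rcW : forall t, (forall b, w < b -> (dW b <= t%:E)%E) -> (dW w <= t%:E)%E.
Let f := singular dW.
Let g := singular dZ.

Lemma cut_le t : 0 < t -> f t <= w -> (dW w <= t%:E)%E.
Proof. by move=> t0 ft; apply: rcW => b wb; apply: (sing_lt hW t0); exact: le_lt_trans wb. Qed.

(** Where [f > w] the upper part has singular values at most [c f]; where [f <= w] nothing of it is
    left. *)
Lemma cut_high t : 0 < t -> (forall b, 0 < b -> (dZ b <= dW (Num.max (b / c) w)%R)%E) ->
  forall p, 0 < p -> g t `^ p <= (c * w) `^ p * hi p (f t / w).
Proof.
move=> t0 h p p0; have cw : 0 <= c * w by rewrite mulr_ge0// ltW.
rewrite /hi ltr_pdivlMr// mul1r; case: ltP => ft.
  have f0 : 0 <= f t by exact: sing_ge0.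
  rewrite -powRM ?divr_ge0 ?(ltW w0)//; apply: ge0_ler_powR; rewrite ?nnegrE ?(ltW p0)//.
  - exact: sing_ge0.
  - by rewrite mulr_ge0// divr_ge0// ltW.
  rewrite -mulrA [w * _]mulrC divfK ?gt_eqF//; apply/ler_addgt0Pr => e e0.
  have b0 : 0 < c * f t + e by rewrite ltr_wpDl// mulr_ge0// ltW.
  apply: sing_le => //; apply: (le_trans (h _ b0)).
  have fb : f t < (c * f t + e) / c by rewrite ltr_pdivlMr// mulrC ltrDl.
  rewrite (max_idPl _); last by rewrite ltW// (lt_trans ft).
  exact: (sing_lt hW t0).
rewrite mulr0; have -> : g t = 0; last by rewrite powR0 ?gt_eqF.
apply/eqP; rewrite eq_le sing_ge0 andbT; apply/ler_addgt0Pr => e e0; rewrite add0r.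
apply: sing_le => //; apply: (le_trans (h _ e0)); apply: le_trans (cut_le t0 ft).
by apply: (df_mono hW w0); rewrite le_max lexx orbT.
Qed.

(** The part of [W] above [w] occupies the first [D] units of the axis, so the singular values of
    the lower part are at most [c f(t + D)]. *)
Lemma cut_low t D : 0 < t -> dW w = D%:E -> 0 <= D ->
  (forall b, 0 < b -> b <= c * w -> (dW w + dZ b <= dW (b / c)%R)%E) ->
  (forall b, c * w <= b -> dZ b = 0%E) ->
  forall q, 0 < q -> g t `^ q <= (c * w) `^ q * lo q (f (t + D) / w).
Proof.
move=> t0 eD D0 h1 h2 q q0; have cw : 0 <= c * w by rewrite mulr_ge0// ltW.
have tD : 0 < t + D by rewrite ltr_wpDr.
have fw : f (t + D) <= w by apply: sing_le => //; rewrite eD lee_fin lerDr ltW.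
rewrite /lo ltr_pdivlMr// mul1r ltNge fw /=.
have f0 : 0 <= f (t + D) by exact: sing_ge0.
rewrite -powRM ?divr_ge0 ?(ltW w0)//; apply: ge0_ler_powR; rewrite ?nnegrE ?(ltW q0)//.
- exact: sing_ge0.
- by rewrite mulr_ge0// divr_ge0// ltW.
rewrite -mulrA [w * _]mulrC divfK ?gt_eqF//; apply/ler_addgt0Pr => e e0.
have b0 : 0 < c * f (t + D) + e by rewrite ltr_wpDl// mulr_ge0// ltW.
apply: sing_le => //.
have [bw|bw] := leP (c * f (t + D) + e) (c * w); last first.
  by rewrite h2 ?(ltW bw)// lee_fin ltW.
have fb : f (t + D) < (c * f (t + D) + e) / c by rewrite ltr_pdivlMr// mulrC ltrDl.
have := le_trans (h1 _ b0 bw) (sing_lt hW tD fb).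
by rewrite eD [t + D]addrC EFinD leeD2lE.
Qed.

Lemma cut_inf t : (forall b, c * w <= b -> dZ b = 0%E) -> 0 < t -> g t <= c * w.
Proof. by move=> h t0; apply: sing_le; [exact: mulr_gt0 | rewrite h// lee_fin ltW]. Qed.

Lemma f_scaled_meas : measurable_fun (@Rplus R) (fun s => f s / w).
Proof. by apply: measurable_funM; [exact: sing_meas | exact: measurable_cst]. Qed.

Lemma hi_int_meas p : measurable_fun (@Rplus R) (fun s => (hi p (f s / w))%:E).
Proof. by apply/measurable_EFinP; apply: (measurableT_comp (hi_meas p)); exact: f_scaled_meas. Qed.
Lemma lo_int_meas q : measurable_fun (@Rplus R) (fun s => (lo q (f s / w))%:E).
Proof. by apply/measurable_EFinP; apply: (measurableT_comp (lo_meas q)); exact: f_scaled_meas. Qed.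

(** For [t] below [dW w] the singular value exceeds [w], so the integrand is at least 1. Finiteness
    of the integral thus makes the translation by [D = dW w] meaningful. *)
Lemma cut_fin p : 0 < p -> (dW w <= \int[lam]_(s in @Rplus R) (hi p (f s / w))%:E)%E.
Proof.
move=> p0; have mR := @measurable_Rplus R.
have key (I : set R) : measurable I -> I `<=` @Rplus R ->
    (forall t, I t -> (t%:E < dW w)%E) ->
    (lam I <= \int[lam]_(s in @Rplus R) (hi p (f s / w))%:E)%E.
  move=> mI IR hI; rewrite -(mul1e (lam I)) -(integral_cst lam mI).
  apply: (@le_trans _ _ (\int[lam]_(s in I) (hi p (f s / w))%:E)%E); last first.
    apply: ge0_subset_integral => //; first exact: hi_int_meas.
    by move=> s _; rewrite lee_fin hi_ge0.
  apply: ge0_le_integral => //.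
  - exact: measurable_funS (hi_int_meas p).
  - move=> t It; have tw := hI _ It; rewrite lee_fin.
    have t0 : 0 < t by move: (IR _ It); rewrite /Rplus /= in_itv /= andbT.
    have fw : w < f t by rewrite ltNge; apply/negP => /(cut_le t0); rewrite leNgt tw.
    have w1 : 1 < f t / w by rewrite ltr_pdivlMr// mul1r.
    by rewrite /hi w1; have := ler_powR (ltW w1) (ltW p0); rewrite powRr0.
case E : (dW w) => [D| |].
- have [D0|D0] := leP D 0.
    apply: (@le_trans _ _ 0%E); first by rewrite lee_fin.
    by apply: integral_ge0 => s _; rewrite lee_fin hi_ge0.
  have <- : lam `]0, D[%classic = D%:E by rewrite lebesgue_measure_itv /= lte_fin D0 oppr0 adde0.
  apply: key; first exact: measurable_itv.
    by move=> t /=; rewrite /Rplus /= !in_itv /= => /andP[-> _].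
  by move=> t /=; rewrite in_itv /= E lte_fin => /andP[].
- have <- : lam (@Rplus R) = +oo%E by rewrite lebesgue_measure_itv /= ltry.
  by apply: key => // t _; rewrite E ltry.
- by rewrite leNye.
Qed.

Lemma int_high p : 0 < p -> (forall b, 0 < b -> (dZ b <= dW (Num.max (b / c) w)%R)%E) ->
  (\int[lam]_(t in @Rplus R) (g t `^ p)%:E <=
   ((c * w) `^ p)%:E * \int[lam]_(s in @Rplus R) (hi p (f s / w))%:E)%E.
Proof.
move=> p0 h; have mR := @measurable_Rplus R.
rewrite -ge0_integralZl//; last 3 first.
- exact: hi_int_meas.
- by move=> s _; rewrite lee_fin hi_ge0.
- by rewrite lee_fin powR_ge0.
apply: ge0_le_integral => //.
- by move=> t _; rewrite lee_fin powR_ge0.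
- apply/measurable_EFinP; apply: (measurableT_comp (measurable_powR p)); exact: sing_meas.
- by apply: emeasurable_funM; [exact: measurable_cst | exact: hi_int_meas].
- move=> t; rewrite /Rplus /= in_itv /= andbT => t0.
  by rewrite -EFinM lee_fin; exact: cut_high.
Qed.

Lemma int_low q D : 0 < q -> dW w = D%:E -> 0 <= D ->
  (forall b, 0 < b -> b <= c * w -> (dW w + dZ b <= dW (b / c)%R)%E) ->
  (forall b, c * w <= b -> dZ b = 0%E) ->
  (\int[lam]_(t in @Rplus R) (g t `^ q)%:E <=
   ((c * w) `^ q)%:E * \int[lam]_(s in @Rplus R) (lo q (f s / w))%:E)%E.
Proof.
move=> q0 eD D0 h1 h2; have mR := @measurable_Rplus R.
(* Extension by zero lets the integral be translated on the whole line. *)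
pose h := (fun s => (lo q (f s / w))%:E) \_ (@Rplus R).
have mh : measurable_fun [set: R] h by apply/(measurable_restrictT _ mR); exact: lo_int_meas.
have h0 s : (0 <= h s)%E.
  by rewrite /h patchE; case: ifP => // _; rewrite lee_fin lo_ge0.
have hE s : 0 < s -> h s = (lo q (f s / w))%:E.
  by move=> s0; rewrite /h patchE mem_set// /Rplus /= in_itv /= s0.
have mI : measurable (`]D, +oo[%classic : set R) by exact: measurable_itv.
have sub : (`]D, +oo[%classic : set R) `<=` @Rplus R.
  by move=> s /=; rewrite /Rplus /= !in_itv /= !andbT; exact: le_lt_trans.
apply: (@le_trans _ _ (((c * w) `^ q)%:E * \int[lam]_(t in @Rplus R) h (t + D)%R)%E); last first.
  rewrite lee_pmul2l ?lte_fin ?powR_gt0 ?mulr_gt0//.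
  rewrite integral_shift//; apply: (@le_trans _ _ (\int[lam]_(s in @Rplus R) h s)%E).
    by apply: ge0_subset_integral => //; exact: measurable_funS mh.
  apply: ge0_le_integral => //; first exact: measurable_funS mh.
    exact: lo_int_meas.
  by move=> s; rewrite /Rplus /= in_itv /= andbT => s0; rewrite hE.
have mhD : measurable_fun (@Rplus R) (fun t => h (t + D)%R).
  apply: (measurable_comp (F := setT)) => //.
  by apply: measurable_funD; [exact: measurable_id | exact: measurable_cst].
rewrite -ge0_integralZl//; last by rewrite lee_fin powR_ge0.
apply: ge0_le_integral => //.
- by move=> t _; rewrite lee_fin powR_ge0.
- apply/measurable_EFinP; apply: (measurableT_comp (measurable_powR q)); exact: sing_meas.
- by apply: emeasurable_funM; [exact: measurable_cst | exact: mhD].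
- move=> t; rewrite /Rplus /= in_itv /= andbT => t0.
  rewrite hE ?ltr_wpDr// -EFinM lee_fin; exact: cut_low.
Qed.
End Cuts.

(** * Norms of [L^r] on the half-line *)

Section LrNorm.
Context {R : realType}.
Local Notation lam := (@lebesgue_measure R).
Implicit Types (f g : R -> R) (r t : R).

Lemma RplusE t : @Rplus R t <-> 0 < t.
Proof. by rewrite /Rplus /= in_itv /= andbT. Qed.

Lemma Lr_norm_fin r f : 0 < r -> (forall t, 0 < t -> 0 <= f t) ->
  Lr_norm r%:E f = ((\int[lam]_(t in @Rplus R) (f t `^ r)%:E) `^ r^-1)%E.
Proof.
move=> r0 f0; rewrite /Lr_norm unlock /=; congr (_ `^ _)%E.
rewrite [RHS]integral_mkcond; apply: eq_integral => t _.
rewrite /= !patchE; case: ifP => [|_]; last by rewrite normr0 powR0 ?gt_eqF.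
by rewrite inE => /RplusE t0; rewrite ger0_norm ?f0.
Qed.

(** The norm for [r = +oo] is defined by cases on whether the whole space has positive measure. *)
Lemma lam_T : (0 < lam [set: measurableTypeR R])%E.
Proof.
apply: (@lt_le_trans _ _ (lam (@Rplus R))).
  have -> : lam (@Rplus R) = +oo%E by rewrite lebesgue_measure_itv /= ltry.
  by rewrite ltry.
by apply: le_measure; rewrite ?inE//; exact: measurable_Rplus.
Qed.

Lemma Lr_norm_inf f b : 0 <= b -> (forall t, 0 < t -> 0 <= f t <= b) -> (Lr_norm +oo f <= b%:E)%E.
Proof.
move=> b0 h; rewrite /Lr_norm unlock /= lam_T; apply/ess_supP.
apply: nearW => t /=; rewrite patchE; case: ifP => [|_]; last by rewrite normr0 lee_fin.
by rewrite inE => /RplusE /h /andP[h1 h2]; rewrite ger0_norm.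
Qed.

Lemma Lr_norm_inf_ae f b : (Lr_norm +oo f <= b%:E)%E ->
  {ae lam, forall t, 0 < t -> f t <= b}.
Proof.
rewrite /Lr_norm unlock /= lam_T => /ess_supP; apply: filterS => t /= h t0.
move: h; rewrite patchE mem_set; last exact/RplusE.
by rewrite lee_fin; apply: le_trans; exact: ler_norm.
Qed.

Lemma Lr_norm_ge0 (q : \bar R) f : (0 <= Lr_norm q f)%E. Proof. exact: Lnorm_ge0. Qed.

Lemma Lr_norm_le r f g : 0 < r -> measurable_fun (@Rplus R) f -> measurable_fun (@Rplus R) g ->
  (forall t, 0 < t -> 0 <= f t <= g t) -> (Lr_norm r%:E f <= Lr_norm r%:E g)%E.
Proof.
move=> r0 mf mg h.
have f0 t : 0 < t -> 0 <= f t by move=> /h/andP[].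
have g0 t : 0 < t -> 0 <= g t by move=> /h/andP[]; exact: le_trans.
rewrite !Lr_norm_fin//.
have mI (k : R -> R) : measurable_fun (@Rplus R) k -> measurable_fun (@Rplus R) (fun t => (k t `^ r)%:E).
  by move=> mk; apply/measurable_EFinP; exact: (measurableT_comp (measurable_powR r)).
have i0 (k : R -> R) : (0 <= \int[lam]_(t in @Rplus R) (k t `^ r)%:E)%E.
  by apply: integral_ge0 => t _; rewrite lee_fin powR_ge0.
have mR := @measurable_Rplus R.
apply: gt0_ler_poweR; rewrite ?in_itv /= ?i0 ?leey//; first by rewrite invr_ge0 ltW.
apply: ge0_le_integral => //; try exact: mI.
  by move=> t _; rewrite lee_fin powR_ge0.
move=> t /RplusE t0; rewrite lee_fin; apply: ge0_ler_powR; rewrite ?nnegrE ?f0 ?g0 ?(ltW r0)//.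
by have /andP[] := h t t0.
Qed.
End LrNorm.

Section Spaces.
Context {R : realType} (M : traced_vna R).
Local Notation H := (vspace_of M).
Local Notation lam := (@lebesgue_measure R).
Implicit Types (x y z : graph H) (u w : H) (B : set H) (a b c r t : R).

Lemma dfun_ddist x : Stau x -> dfun (ddist x).
Proof.
move=> sx; have [cx ax _] := sx; split.
- by move=> a a0; apply: ddist_ge0 => //; exact: ltW.
- by move=> a b a0; apply: ddist_mono => //; exact: ltW.
- move=> e /(stau_tail sx)[a a0 h]; exists (a + 1); first by rewrite ltr_wpDl.
  by apply: le_trans h; apply: ddist_mono => //; rewrite lerDl.
Qed.

Lemma S1_mu x : Stau x -> S1 (mu x).
Proof. by move=> sx; apply: S1_sing; exact: dfun_ddist. Qed.

Lemma mu_ge0 x t : 0 <= mu x t. Proof. exact: sing_ge0. Qed.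

(** Every shell above [a] keeps a distance from [a], so its dimension is bounded by the distribution
    function at some [b > a]; the shells exhaust the complement of [gsp x a]. *)
Lemma ddist_rc x a (c : \bar R) : closed_dd x -> affiliated x -> 0 <= a ->
  (forall b, a < b -> (ddist x b <= c)%E) -> (ddist x a <= c)%E.
Proof.
move=> cx ax a0 h; rewrite ddistE//.
have an n : 0 <= a + n.+1%:R by rewrite addr_ge0.
have ai n : 0 <= a + n.+1%:R^-1 by rewrite addr_ge0// invr_ge0.
pose K n := gsp x (a + n.+1%:R) `&` orth (gsp x (a + n.+1%:R^-1)).
have mK n : msub (K n) by apply: msubI; [exact: gsp_msub | apply: msub_orth; exact: gsp_msub].
have iK n : K n `<=` K n.+1.
  move=> u [h1 h2]; split; first by apply: gsp_mono h1 => //; rewrite lerD2l ler_nat.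
  apply: (orth_subset _ h2); apply: gsp_mono => //.
  by rewrite lerD2l lef_pV2 ?posrE ?ltr0n// ler_nat.
have hK n : (dim (K n) <= c)%E.
  apply: (@le_trans _ _ (ddist x (a + n.+1%:R^-1))); last by apply: h; rewrite ltrDl invr_gt0.
  by rewrite ddistE//; apply: dim_mono => //; [apply: msub_orth; exact: gsp_msub|move=> u []].
apply: le_trans (dim_seq_le mK iK hK); apply: dim_mono.
- by apply: msub_orth; exact: gsp_msub.
- by apply: msub_orth; apply: msub_bigcap => n; exact: msub_orth.
- by apply: orth_subset => u; exact: gsp_shells.
Qed.

Lemma ddist_form_le x y B a : Stau_pos x -> Stau y -> big B -> 0 <= a ->
  (forall u w w', B u -> x (u, w) -> y (u, w') -> rip w u <= rip w' u) ->
  (ddist x a <= ddist y a)%E.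
Proof.
move=> [[cx ax _] hx] [cy ay _] bB a0 h; rewrite (ddistE cy a0).
apply: (ddist_key_form hx ax a0 (gsp_msub cy ay a0) bB) => u w uL uB hw.
have [w' hw' nw] := gsp_dom cy a0 uL; apply: (le_trans (h _ _ _ uB hw hw')).
by apply: (le_trans (rip_le _ _)); rewrite expr2 mulrA ler_wpM2r.
Qed.

Lemma mu_le_ddist x y t : Stau x -> Stau y ->
  (forall a b, 0 < a -> a < b -> (ddist x b <= ddist y a)%E) -> 0 < t -> mu x t <= mu y t.
Proof. by move=> sx sy h t0; apply: sing_le_sing => //; exact: dfun_ddist. Qed.

Lemma mu_form_le x y B t : Stau_pos x -> Stau y -> big B ->
  (forall u w w', B u -> x (u, w) -> y (u, w') -> rip w u <= rip w' u) ->
  0 < t -> mu x t <= mu y t.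
Proof.
move=> px sy bB h t0; have [sx _] := px; apply: mu_le_ddist => // a b a0 ab.
have [cx ax _] := sx.
apply: (le_trans (ddist_mono cx ax (ltW a0) (ltW ab))).
by apply: (ddist_form_le px sy bB (ltW a0)).
Qed.

Lemma NC_fin x r : 0 < r -> Stau x ->
  (\int[lam]_(t in @Rplus R) (mu x t `^ r)%:E < +oo)%E -> carrier (NC M (Lr r%:E)) x.
Proof.
move=> r0 sx h; split => //; split; first exact: S1_mu.
by rewrite Lr_norm_fin//; [exact: poweR_lty | move=> t _; exact: mu_ge0].
Qed.

Lemma NC_inf x b : 0 <= b -> Stau x -> (forall t, 0 < t -> mu x t <= b) ->
  carrier (NC M (Lr +oo)) x /\ (enorm (NC M (Lr +oo)) x <= b%:E)%E.
Proof.
move=> b0 sx h.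
have hn : (Lr_norm +oo (mu x) <= b%:E)%E.
  by apply: Lr_norm_inf => // t t0; rewrite mu_ge0 h.
have c : carrier (NC M (Lr +oo)) x.
  by split => //; split; [exact: S1_mu | apply: (le_lt_trans hn); rewrite ltry].
split => //; rewrite /enorm asboolT//= fineK// ge0_fin_numE ?Lr_norm_ge0//.
by case: c => _ [].
Qed.

Lemma enorm_NC (q : \bar R) x : carrier (NC M (Lr q)) x -> enorm (NC M (Lr q)) x = Lr_norm q (mu x).
Proof.
move=> c; rewrite /enorm asboolT//= fineK// ge0_fin_numE ?Lr_norm_ge0//.
by case: c => _ [].
Qed.

Lemma NC_pos_le (q : \bar R) x y B : (0 < q)%E -> Stau_pos x -> NC_pos M (Lr q) y -> big B ->
  (forall u w w', B u -> x (u, w) -> y (u, w') -> rip w u <= rip w' u) -> NC_pos M (Lr q) x.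
Proof.
move=> q0 px [[sy [Sy ly]] py] bB h; have [sx _] := px.
have hm t : 0 < t -> 0 <= mu x t <= mu y t.
  by move=> t0; rewrite mu_ge0; apply: (mu_form_le px sy bB).
refine (conj (conj sx (conj (S1_mu sx) _)) px).
apply: le_lt_trans ly; case: q q0 => [r| |]//; rewrite ?lte_fin => r0.
  apply: Lr_norm_le => //; [by case: (S1_mu sx) | by case: Sy].
rewrite /Lr_norm unlock /= lam_T; apply: le_ess_sup; apply: nearW => t /=.
rewrite !patchE; case: ifP => // /set_mem /RplusE /hm /andP[h1 h2].
by rewrite !ger0_norm// (le_trans h1).
Qed.

Lemma ddist_szero a : 0 <= a -> ddist (szero : graph H) a = 0%E.
Proof.
move=> a0; have s0 := Stau_pos_Ssa (szero_pos M).
have cz := Ssa_cdd s0; have az := Ssa_aff s0.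
apply/eqP; rewrite eq_le (ddist_ge0 cz az a0) andbT.
have oT : orth [set: H] = [set 0].
  by apply/seteqP; split=> [u h|_ -> k _]; [apply: ip_eq0; exact: h|exact: ip0l].
rewrite -(dim0 M) -oT; apply: (ddist_key cz az a0 (msubT M) (B := setT)).
  by move=> e e0; exists setT; split => //; rewrite /codim oT dim0 lee_fin ltW.
by move=> u w _ _; rewrite /szero /= => ->; rewrite hnorm0 mulr_ge0.
Qed.

Lemma mu_szero t : 0 < t -> mu (szero : graph H) t = 0.
Proof.
move=> t0; apply/eqP; rewrite eq_le mu_ge0 andbT; apply/ler_addgt0Pr => e e0.
by rewrite add0r; apply: sing_le => //; rewrite ddist_szero ?(ltW e0)// lee_fin ltW.
Qed.

Lemma szero_Lr (q : \bar R) : (0 < q)%E -> NC_pos M (Lr q) szero /\ enorm (NC M (Lr q)) (szero : graph H) = 0%E.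
Proof.
move=> q0; have s0 := szero_pos M; have [sz _] := s0.
have n0 : Lr_norm q (mu (szero : graph H)) = 0%E.
  case: q q0 => [r| |]//; rewrite ?lte_fin => r0.
    rewrite Lr_norm_fin//; last by move=> t _; exact: mu_ge0.
    rewrite integral0_eq ?poweR0r ?invr_neq0 ?gt_eqF// => t /RplusE t0.
    by rewrite mu_szero// powR0 ?gt_eqF.
  apply/eqP; rewrite eq_le Lr_norm_ge0 andbT; apply: Lr_norm_inf => // t t0.
  by rewrite mu_szero// lexx.
have c : carrier (NC M (Lr q)) szero by split => //; split; [exact: S1_mu | rewrite n0].
by split => //; rewrite enorm_NC.
Qed.
End Spaces.

(** * The estimate for finite sums *)

Section WeakNorm.
Context {R : realType} (N : traced_vna R).
Local Notation H := (vspace_of N).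
Implicit Types (x y Y : graph H) (a b c v Q r t : R).

Lemma sadd_szero x : closed_dd x -> sadd x szero = x.
Proof.
move=> cx; rewrite -{2}(cdd_closure cx); congr graph_closure.
apply/seteqP; split=> [[u w] [a [b [/= h]]]|[u w] h].
  by rewrite /szero /= => -> ->; rewrite addr0.
by exists w, 0; rewrite addr0.
Qed.
Lemma szero_sadd x : closed_dd x -> sadd szero x = x.
Proof.
move=> cx; rewrite -{2}(cdd_closure cx); congr graph_closure.
apply/seteqP; split=> [[u w] [a [b [/= + h]]]|[u w] h].
  by rewrite /szero /= => -> ->; rewrite add0r.
by exists 0, w; rewrite add0r.
Qed.

Lemma ssub_self x : Ssa x -> ssub x x = szero.
Proof.
move=> sx; apply: Ssa_eq; first exact: ssub_sa.
  by apply: Stau_pos_Ssa; exact: szero_pos.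
rewrite -(szero_closed N) => z hz e /hz[[u w] [a [b [/= h1 h2 h3]]] hq].
exists (u, w) => //; rewrite /szero /= h3 (sscale_fun sx h1 h2) rmorphN1 scaleN1r subrr.
by [].
Qed.

Lemma weakLr_Stau (q : \bar R) y : (weakLr N q y < +oo)%E -> Stau y.
Proof.
rewrite /weakLr; case: ifP => _; rewrite /enorm; case: ifPn => //.
  by move=> /asboolP[].
by move=> /asboolP.
Qed.

(** Otherwise some [t] beyond the bound has [mu y t >= v], and the supremum defining the weak norm
    would exceed [Q]. *)
Lemma weakLr_ddist r y Q v : 0 < r -> 0 <= Q -> 0 < v -> (weakLr N r%:E y <= Q%:E)%E ->
  (ddist y v <= ((Q / v) `^ r)%:E)%E.
Proof.
move=> r0 Q0 v0 h; have sy : Stau y by apply: (@weakLr_Stau r%:E); rewrite (le_lt_trans h)// ltry.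
move: h; rewrite /weakLr /= asboolT// => h.
have dy := dfun_ddist sy.
rewrite leNgt; apply/negP => lt.
have [t t1 t2] : exists2 t, (Q / v) `^ r < t & (t%:E < ddist y v)%E.
  case E : (ddist y v) lt => [d| |] //.
    rewrite lte_fin => lt; exists (((Q / v) `^ r + d) / 2); first by rewrite midf_lt.
    by rewrite lte_fin midf_lt.
  by move=> _; exists ((Q / v) `^ r + 1); rewrite ?ltrDl ?ltry.
have t0 : 0 < t by apply: le_lt_trans t1; exact: powR_ge0.
have hv := sing_ge dy t0 v0 t2.
have : ((t `^ recip r%:E * mu y t)%:E <= Q%:E)%E.
  by apply: le_trans h; apply: ereal_sup_ubound; exists t.
rewrite lee_fin recip_fin// => h1.
have h2 : t `^ r^-1 * v <= Q.
  by apply: le_trans h1; rewrite ler_wpM2l// powR_ge0.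
have h3 : t <= (Q / v) `^ r.
  rewrite -[leLHS](powRK (r := r^-1)) ?invr_gt0 ?(ltW t0)// invrK.
  by apply: ge0_ler_powR; rewrite ?nnegrE ?(ltW r0) ?powR_ge0 ?divr_ge0 ?(ltW v0)// ler_pdivlMr.
by move: t1; rewrite ltNge h3.
Qed.

Lemma weakLr_inf_ddist y Q v : 0 < v -> Q < v -> (weakLr N +oo y <= Q%:E)%E -> ddist y v = 0%E.
Proof.
move=> v0 Qv h; have sy : Stau y by apply: (@weakLr_Stau +oo%E); rewrite (le_lt_trans h)// ltry.
have dy := dfun_ddist sy; apply/eqP; rewrite eq_le (df_ge0 dy v0) andbT.
rewrite leNgt; apply/negP => lt.
have cy : carrier (NC N (Lr +oo)) y.
  by move: h; rewrite /weakLr eqxx /enorm; case: ifPn => [/asboolP//|_]; rewrite leye_eq.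
move: h; rewrite /weakLr eqxx enorm_NC// => /Lr_norm_inf_ae [A [mA A0 hA]].
have [t0 t00 lt0] : exists2 t0, 0 < t0 & (t0%:E < ddist y v)%E.
  case E : (ddist y v) lt => [d| |] //.
    rewrite lte_fin => lt; exists (d / 2); first by rewrite divr_gt0.
    by rewrite lte_fin ltr_pdivrMr// ltr_pMr// ltr1n.
  by move=> _; exists 1; rewrite ?ltry.
have sub : (`]0, t0[%classic : set R) `<=` A.
  move=> t /=; rewrite in_itv /= => /andP[tp tt]; apply: hA => /= h.
  have := h tp; rewrite leNgt => /negP; apply; apply: (lt_le_trans Qv).
  by apply: (sing_ge dy tp v0); apply: lt_trans lt0; rewrite lte_fin.
have mI : measurable (`]0%R, t0[%classic : set R) by exact: measurable_itv.
have : (@lebesgue_measure R `]0%R, t0[%classic <= 0)%E.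
  by rewrite -A0; exact: (@le_measure _ _ _ (@lebesgue_measure R) _ _ (mem_set mI) (mem_set mA) sub).
by rewrite lebesgue_measure_itv /= lte_fin t00 oppr0 adde0 lee_fin leNgt t00.
Qed.

Lemma series_cvg_small (nu : graph H -> \bar R) (y : nat -> graph H) Y e : 0 < e ->
  series_cvg nu y Y -> exists n0, forall n, (n0 <= n)%N -> (nu (ssub (spartial y n) Y) <= e%:E)%E.
Proof.
move=> e0 /fine_cvgP[[N1 _ h1] /cvgr0P/(_ _ e0)[N2 h2]].
exists (maxn N1 N2) => n; rewrite geq_max => /andP[n1 n2].
have f := h1 n n1; rewrite -(fineK f) lee_fin.
by apply: (le_trans (ler_norm _)); exact/ltW/h2.
Qed.

Lemma weak_cvm (q : \bar R) (y : nat -> graph H) Y : (0 < q)%E ->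
  series_cvg (weakLr N q) y Y -> cvg_measure y Y.
Proof.
move=> q0 cv d e d0 e0; case: q q0 cv => [r| |]//; rewrite ?lte_fin => r0 cv.
  have n0 : 0 < d * e `^ r^-1 by rewrite mulr_gt0// powR_gt0.
  have [n1 h] := series_cvg_small n0 cv; exists n1 => n /h hn.
  split; first by apply: (@weakLr_Stau r%:E); rewrite (le_lt_trans hn)// ltry.
  apply: (le_trans (weakLr_ddist r0 (ltW n0) d0 hn)); rewrite lee_fin.
  rewrite mulrAC divff ?gt_eqF// mul1r -{2}(invrK r) powRK ?invr_gt0//; exact: ltW.
have n0 : 0 < d / 2 by rewrite divr_gt0.
have [n1 h] := series_cvg_small n0 cv; exists n1 => n /h hn.
split; first by apply: (@weakLr_Stau +oo%E); rewrite (le_lt_trans hn)// ltry.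
rewrite (weakLr_inf_ddist d0 _ hn) ?lee_fin ?(ltW e0)//.
by rewrite ltr_pdivrMr// ltr_pMr// ltr1n.
Qed.
End WeakNorm.

(** * Weak-type bounds for finite blocks of maps *)

Section FiniteSums.
Context {R : realType} (M N : traced_vna R).
Variables (T : nat -> graph (vspace_of M) -> graph (vspace_of N)) (q : \bar R) (C : R).
Hypotheses (q0 : (0 < q)%E) (hw : weak_type T q C).
Hypothesis hT : forall k x, NC_pos M (Lr q) x -> Stau_pos (T k x).
Implicit Types (a : nat -> graph (vspace_of M)) (m n k : nat) (v d : R).

(** Places a finite family at the indices from [m] to [m + n - 1], so that the hypothesis on series
    applies to the maps with these indices. *)
Definition embed m n a : nat -> graph (vspace_of M) :=
  fun j => if (m <= j < m + n)%N then a (j - m)%N else szero.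

Lemma spartial_embed m n a j : (forall k, Stau_pos (a k)) -> (m + n <= j)%N ->
  spartial (embed m n a) j = spartial a n.
Proof.
move=> pa.
have cA k : closed_dd (spartial a k) by apply/Ssa_cdd/Stau_pos_Ssa; exact: spartial_pos.
have low i : (i <= m)%N -> spartial (embed m n a) i = szero.
  elim: i => //= i IH im; rewrite IH ?(ltnW im)// /embed leqNgt im /=.
  by apply: sadd_szero; apply/Ssa_cdd/Stau_pos_Ssa; exact: szero_pos.
have mid i : (i <= n)%N -> spartial (embed m n a) (m + i) = spartial a i.
  elim: i => [|i IH] ni; first by rewrite addn0 low.
  by rewrite addnS /= IH ?(ltnW ni)// /embed leq_addr ltn_add2l ni /= addKn.
move=> /subnK <-; elim: (j - (m + n))%N => [|i IH]; first by rewrite add0n mid.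
rewrite addSn /= IH /embed [X in _ && X]ltnNge leq_addl andbF.
exact: sadd_szero.
Qed.

(** The padding zeros may have nonzero images, but these are positive. The finite sum therefore lies
    below every late partial sum of the image series, hence below its limit [Y] up to the shift
    [d]. *)
Lemma weak_finite m n a : (forall k, NC_pos M (Lr q) (a k)) ->
  carrier (NC M (Lr q)) (spartial a n) ->
  exists Y, [/\ Stau Y, (weakLr N q Y <= C%:E * enorm (NC M (Lr q)) (spartial a n))%E &
    forall v d, 0 <= v -> 0 < d ->
      (ddist (spartial (fun k => T (m + k) (a k)) n) (v + d) <= ddist Y v)%E].
Proof.
move=> ha cA; set A := spartial a n in cA *.
have pa k : Stau_pos (a k) by case: (ha k).
have he k : NC_pos M (Lr q) (embed m n a k).
  by rewrite /embed; case: ifP => _ //; case: (szero_Lr M q0).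
have sA : Ssa A by apply: Stau_pos_Ssa; exact: spartial_pos.
have cv : series_cvg (enorm (NC M (Lr q))) (embed m n a) A.
  rewrite /series_cvg; apply: cvg_near_cst; exists (m + n)%N => // j /= mj.
  by rewrite spartial_embed// ssub_self//; case: (szero_Lr M q0).
have [Y [sY cY hY]] := hw he cA cv.
exists Y; split => // v d v0 d0.
have pT k : Stau_pos (T k (embed m n a k)) by exact: hT.
have pS : Stau_pos (spartial (fun k => T (m + k) (a k)) n).
  by apply: spartial_pos => k; exact: hT.
have bB : big (doms (fun k => T (m + k) (a k))).
  by apply: doms_big => k; case: (hT (m + k) (ha k)).
apply: (ddist_partial_le (n0 := (m + n)%N) pT sY (weak_cvm q0 cY) pS bB v0 d0).
move=> j u w t mj /domsP[s hs] hw' ht.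
have pTa k : Stau_pos (T (m + k) (a k)) by exact: hT.
rewrite (spartial_fun pTa hs hw').
have pos i : 0 <= rip (t i) u by exact: Stau_pos_form (pT i) (ht i).
have st i : (i < n)%N -> t (m + i)%N = s i.
  move=> ni; have := ht (m + i)%N; rewrite /embed leq_addr ltn_add2l ni /= addKn => h.
  exact: cdd_uniq (Ssa_cdd (Stau_pos_Ssa (pTa i))) h (hs i).
rewrite (sum_split_nat t (leq_trans (leq_addr n m) mj)) ripDl.
have nj : (n <= j - m)%N by rewrite leq_subRL// (leq_trans (leq_addr n m)).
rewrite (sum_split_nat (fun i => t (m + i)%N) nj) ripDl.
have sum0 (F : nat -> vspace_of N) l : (forall i, 0 <= rip (F i) u) -> 0 <= rip (\sum_(i < l) F i) u.
  move=> hF; elim: l => [|l IH]; first by rewrite big_ord0 rip0l.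
  by rewrite big_ord_recr ripDl addr_ge0.
have -> : \sum_(i < n) t (m + i)%N = \sum_(i < n) s i by apply: eq_bigr => i _; exact: st.
have := sum0 t m pos; have := sum0 (fun i => t (m + (n + i))%N) (j - m - n)%N (fun i => pos _).
by move=> h1 h2; rewrite addrC -addrA lerDl addr_ge0.
Qed.

End FiniteSums.

Section Corollaries.
Context {R : realType} (M N : traced_vna R).
Variables (T : nat -> graph (vspace_of M) -> graph (vspace_of N)) (C : R).
Hypothesis C0 : 0 <= C.
Implicit Types (a : nat -> graph (vspace_of M)) (m n k : nat) (v d r I b : R).

Lemma weak_finite_r r m n a v d I : 0 < r -> weak_type T r%:E C ->
  (forall k x, NC_pos M (Lr r%:E) x -> Stau_pos (T k x)) ->
  (forall k, NC_pos M (Lr r%:E) (a k)) ->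
  (\int[@lebesgue_measure R]_(t in @Rplus R) (mu (spartial a n) t `^ r)%:E <= I%:E)%E ->
  0 < v -> 0 < d ->
  (ddist (spartial (fun k => T (m + k) (a k)) n) (v + d) <= ((C / v) `^ r * I)%:E)%E.
Proof.
move=> r0 hw hT ha hI v0 d0.
have sA : Stau (spartial a n) by case: (spartial_pos n (fun k => proj2 (ha k))).
have I0 : 0 <= I.
  by rewrite -lee_fin; apply: le_trans hI; apply: integral_ge0 => t _; rewrite lee_fin powR_ge0.
have cA : carrier (NC M (Lr r%:E)) (spartial a n).
  by apply: NC_fin => //; apply: (le_lt_trans hI); rewrite ltry.
have q0 : (0 < r%:E)%E by rewrite lte_fin.
have [Y [sY wY hY]] := weak_finite q0 hw hT m ha cA.
apply: (le_trans (hY v d (ltW v0) d0)).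
have Q0 : 0 <= C * I `^ r^-1 by rewrite mulr_ge0// powR_ge0.
have wY' : (weakLr N r%:E Y <= (C * I `^ r^-1)%:E)%E.
  apply: (le_trans wY); rewrite EFinM lee_wpmul2l ?lee_fin// enorm_NC//.
  rewrite Lr_norm_fin//; last by move=> t _; exact: mu_ge0.
  rewrite -poweR_EFin; apply: gt0_ler_poweR => //; rewrite ?in_itv /= ?leey ?andbT ?lee_fin//.
    by rewrite invr_ge0 ltW.
  by apply: integral_ge0 => t _; rewrite lee_fin powR_ge0.
apply: (le_trans (weakLr_ddist r0 Q0 v0 wY')); rewrite lee_fin mulrAC.
rewrite [leLHS]powRM ?divr_ge0 ?(ltW v0) ?powR_ge0//.
by have -> : (I `^ r^-1) `^ r = I by rewrite -{2}(invrK r) powRK ?invr_gt0.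
Qed.

Lemma weak_finite_inf m n a v d b : weak_type T +oo C ->
  (forall k x, NC_pos M (Lr +oo) x -> Stau_pos (T k x)) ->
  (forall k, NC_pos M (Lr +oo) (a k)) ->
  (forall t, 0 < t -> mu (spartial a n) t <= b) -> 0 <= b -> C * b <= v -> 0 < v -> 0 < d ->
  (ddist (spartial (fun k => T (m + k) (a k)) n) (v + d) <= 0)%E.
Proof.
move=> hw hT ha hb b0 Cb v0 d0.
have sA : Stau (spartial a n) by case: (spartial_pos n (fun k => proj2 (ha k))).
have [cA nA] := NC_inf b0 sA hb.
have [Y [sY wY hY]] := weak_finite (ltry 0) hw hT m ha cA.
have d2 : 0 < d / 2 by rewrite divr_gt0.
have v2 : 0 <= v + d / 2 by rewrite addr_ge0// ltW.
rewrite (splitr d) addrA; apply: (le_trans (hY _ _ v2 d2)).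
have wY' : (weakLr N +oo Y <= (C * b)%:E)%E.
  by apply: (le_trans wY); rewrite EFinM lee_wpmul2l ?lee_fin.
rewrite (weakLr_inf_ddist _ _ wY')//; first by rewrite ltr_wpDr ?(ltW d2).
by apply: (le_lt_trans Cb); rewrite ltrDl.
Qed.
End Corollaries.

(** * Cutting at a level and membership in [L^p + L^q] *)

Section MainEstimate.
Context {R : realType} (M N : traced_vna R).
Local Notation lam := (@lebesgue_measure R).
Variables (p : R) (q : \bar R) (p0 : 0 < p) (pq : (p%:E < q)%E).
Implicit Types (x y : graph (vspace_of M)) (xs a b : nat -> graph (vspace_of M)).
Implicit Types (m n k : nat) (v d w : R).

Let q0 : (0 < q)%E. Proof. by apply: lt_trans pq; rewrite lte_fin. Qed.
Let p0' : (0 < p%:E)%E. Proof. by rewrite lte_fin. Qed.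

Lemma Lsum_left x : NC_pos M (Lr p%:E) x -> Lsum_pos M p%:E q x.
Proof.
move=> h; exists x, szero; split => //; first by case: (szero_Lr M q0).
by rewrite sadd_szero//; apply/Ssa_cdd/Stau_pos_Ssa; case: h.
Qed.
Lemma Lsum_right x : NC_pos M (Lr q) x -> Lsum_pos M p%:E q x.
Proof.
move=> h; exists szero, x; split => //; first by case: (szero_Lr M p0').
by rewrite szero_sadd//; apply/Ssa_cdd/Stau_pos_Ssa; case: h.
Qed.

Section Pieces.
Variables (W Z : graph (vspace_of M)) (c w : R).
Hypotheses (pW : Stau_pos W) (pZ : Stau_pos Z) (c0 : 0 < c) (w0 : 0 < w).
Let sW : Stau W. Proof. by case: pW. Qed.
Let sZ : Stau Z. Proof. by case: pZ. Qed.
Let rc (t : R) : (forall b : R, w < b -> (ddist W b <= t%:E)%E) -> (ddist W w <= t%:E)%E.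
Proof. by case: sW => cx ax _; apply: ddist_rc => //; exact: ltW. Qed.

Lemma piece_high : (forall b : R, 0 <= b -> (ddist Z b <= ddist W (Num.max (b / c) w)%R)%E) ->
  (\int[lam]_(t in @Rplus R) (mu Z t `^ p)%:E <=
   ((c * w) `^ p)%:E * \int[lam]_(s in @Rplus R) (hi p (mu W s / w))%:E)%E.
Proof.
move=> h; apply: (int_high (dfun_ddist sW) (dfun_ddist sZ) c0 w0 rc p0) => b b0.
by apply: h; exact: ltW.
Qed.

Hypothesis hI : (\int[lam]_(s in @Rplus R) (hi p (mu W s / w))%:E < +oo)%E.
Hypothesis h1 : forall b : R, 0 <= b -> b <= c * w -> (ddist W w + ddist Z b <= ddist W (b / c)%R)%E.
Hypothesis h2 : forall b : R, c * w <= b -> ddist Z b = 0%E.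

Lemma piece_low r : 0 < r ->
  (\int[lam]_(t in @Rplus R) (mu Z t `^ r)%:E <=
   ((c * w) `^ r)%:E * \int[lam]_(s in @Rplus R) (lo r (mu W s / w))%:E)%E.
Proof.
move=> r0; have hf := le_lt_trans (cut_fin (dfun_ddist sW) w0 rc p0) hI.
have h0 := df_ge0 (dfun_ddist sW) w0.
have fn : ddist W w \is a fin_num by rewrite ge0_fin_numE.
apply: (int_low (dfun_ddist sW) (dfun_ddist sZ) c0 w0 (D := fine (ddist W w)) r0) => //.
- by rewrite fineK.
- exact: fine_ge0.
- by move=> b b0; apply: h1; exact: ltW.
Qed.

Lemma piece_inf t : 0 < t -> mu Z t <= c * w.
Proof. exact: (cut_inf c0 w0 h2). Qed.
End Pieces.

Lemma phi_int (f : R -> R) : measurable_fun (@Rplus R) f ->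
  (\int[lam]_(s in @Rplus R) (phi p q (f s))%:E =
   \int[lam]_(s in @Rplus R) (hi p (f s))%:E +
   (if q is r%:E then \int[lam]_(s in @Rplus R) (lo r (f s))%:E else 0))%E.
Proof.
move=> mf; have mR := @measurable_Rplus R; rewrite /phi.
case: q => [r| |]; last 2 first.
- by rewrite adde0; apply: eq_integral => s _; rewrite addr0.
- by rewrite adde0; apply: eq_integral => s _; rewrite addr0.
under eq_integral do rewrite EFinD.
rewrite ge0_integralD//.
- by move=> s _; rewrite lee_fin hi_ge0.
- by apply/measurable_EFinP; apply: (measurableT_comp (hi_meas p)).
- by move=> s _; rewrite lee_fin lo_ge0.
- by apply/measurable_EFinP; apply: (measurableT_comp (lo_meas r)).
Qed.

(** Cut at level [w], now with compression factor 1: the part above is in [L^p] and the part below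
    in [L^q], each controlled by one of the two summands of [phi]. *)
Lemma Lsum_of_integrable x w : Stau_pos x -> 0 < w ->
  (\int[lam]_(s in @Rplus R) (phi p q (mu x s / w))%:E < +oo)%E -> Lsum_pos M p%:E q x.
Proof.
move=> px w0; have sx := Stau_pos_Ssa px; have w0' := ltW w0.
rewrite (phi_int (f_scaled_meas (dfun_ddist (proj1 px)) w)) => hphi.
have mG := gsp_msub (Ssa_cdd sx) (Ssa_aff sx) w0'; have mG' := msub_orth mG.
have hp : (\int[lam]_(s in @Rplus R) (hi p (mu x s / w))%:E < +oo)%E.
  apply: le_lt_trans hphi; rewrite leeDl//; case: q => [r| |]//.
  by apply: integral_ge0 => s _; rewrite lee_fin lo_ge0.
have py := cmp_pos ler01 px mG'; have pz := cmp_pos ler01 px mG.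
have bD : big (dom x) by apply: stau_big; case: px.
have [h1 h0] : (forall b : R, 0 <= b -> b <= 1 * w ->
    (ddist x w + ddist (cmp 1 (gsp x w) x) b <= ddist x (b / 1)%R)%E) /\
    forall b : R, 1 * w <= b -> ddist (cmp 1 (gsp x w) x) b = 0%E.
  have hz (u z : vspace_of M) : dom x (proj (gsp x w) u) -> cmp 1 (gsp x w) x (u, z) ->
      exists2 e, x (proj (gsp x w) u, e) & z = 1%:C%C *: proj (gsp x w) e.
    by move=> [e he] hz; exists e => //; exact: cmp_fun sx mG he hz.
  split=> b; first exact: (cmp_low_ddist px pz ltr01 w0' (big_preim mG bD) hz).
  exact: (cmp_low_ddist0 px pz ltr01 w0' (big_preim mG bD) hz).
exists (cmp 1 (orth (gsp x w)) x), (cmp 1 (gsp x w) x); split.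
- split => //; apply: NC_fin => //; first by case: py.
  apply: (@le_lt_trans _ _ (((1 * w) `^ p)%:E * \int[lam]_(s in @Rplus R) (hi p (mu x s / w))%:E)%E).
    apply: (piece_high px py ltr01 w0) => b b0.
    apply: (cmp_high_ddist px py ltr01 w0' (big_preim mG' bD) b0) => u z [e he] hz.
    by exists e => //; exact: cmp_fun sx mG' he hz.
  by rewrite lte_mul_pinfty// lee_fin powR_ge0.
- split => //; case: q pq hphi => [r| |]// pr hphi.
    have r0 : 0 < r by move: pr; rewrite lte_fin; exact: lt_trans.
    apply: NC_fin => //; first by case: pz.
    apply: (le_lt_trans (piece_low px pz ltr01 w0 hp h1 h0 r0)).
    rewrite lte_mul_pinfty// ?lee_fin ?powR_ge0//.
    apply: le_lt_trans hphi; rewrite leeDr//.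
    by apply: integral_ge0 => s _; rewrite lee_fin hi_ge0.
  have c1 : 0 <= 1 * w by rewrite mul1r.
  have [] // := @NC_inf _ M (cmp 1 (gsp x w) x) (1 * w) c1 (proj1 pz).
  by move=> t; apply: (piece_inf ltr01 w0 h0).
- exact: cmp_split.
Qed.

Lemma eq_spartial (K : traced_vna R) (y z : nat -> graph (vspace_of K)) n :
  (forall k, (k < n)%N -> y k = z k) -> spartial y n = spartial z n.
Proof.
elim: n => //= n IH h; rewrite h// IH// => k kn; apply: h; exact: ltnW.
Qed.

Lemma rip_sum_ge (H : hilbert R) (t : nat -> H) (u : H) n k : (forall i, 0 <= rip (t i) u) ->
  (k < n)%N -> rip (t k) u <= rip (\sum_(i < n) t i) u.
Proof.
move=> ht; elim: n => // n IH; rewrite ltnS leq_eqVlt big_ord_recr /= ripDl => /orP[/eqP->|kn].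
  rewrite lerDr; elim: n {IH} => [|n IH]; first by rewrite big_ord0 rip0l.
  by rewrite big_ord_recr ripDl addr_ge0.
by apply: (le_trans (IH kn)); rewrite lerDl.
Qed.

Section Compressed.
Variables (xs : nat -> graph (vspace_of M)) (n : nat) (K : set (vspace_of M)).
Hypotheses (px : forall k, Stau_pos (xs k)) (hx0 : forall k, (n <= k)%N -> xs k = szero).
Hypothesis mK : msub K.
Let W := spartial xs n.
Let cs k := cmp 4 K (xs k).
Let pc k : Stau_pos (cs k). Proof. by apply: cmp_pos. Qed.

Lemma cmp_spartial (u z : vspace_of M) : doms xs (proj K u) -> spartial cs n (u, z) ->
  exists2 e, W (proj K u, e) & z = 4%:C%C *: proj K e.
Proof.
move=> /domsP[t ht] hz; exists (\sum_(i < n) t i); first exact: spartial_val.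
rewrite (spartial_fun (t := fun i => 4%:C%C *: proj K (t i)) pc _ hz).
  have lP := proj_linear (ms_c mK).
  by rewrite -scaler_sumr (big_morph _ (linD lP) (lin0 lP)).
by move=> k; exact: cmp_val.
Qed.

(** A positive term is below the sum of all of them in the sense of forms; for [k >= n] the term is
    zero. *)
Lemma cmp_NC (r : \bar R) k : (0 < r)%E -> NC_pos M (Lr r) (spartial cs n) -> NC_pos M (Lr r) (cs k).
Proof.
move=> r0 hA; have bD : big (doms cs) by apply: doms_big => i; case: (pc i).
apply: (NC_pos_le r0 (pc k) hA bD) => u w w' /domsP[t ht] hw hw'.
rewrite (spartial_fun pc ht hw') (cdd_uniq (Ssa_cdd (Stau_pos_Ssa (pc k))) hw (ht k)).
have pos i : 0 <= rip (t i) u by exact: Stau_pos_form (pc i) (ht i).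
have [kn|nk] := ltnP k n; first exact: rip_sum_ge.
suff -> : t k = 0.
  rewrite rip0l; elim: (n) => [|j IH]; first by rewrite big_ord0 rip0l.
  by rewrite big_ord_recr ripDl addr_ge0.
have z0 : xs k (proj K u, 0) by rewrite hx0.
rewrite (cmp_fun (Stau_pos_Ssa (px k)) mK z0 (ht k)) (lin0 (proj_linear (ms_c mK))).
exact: scaler0.
Qed.
End Compressed.
End MainEstimate.

(** The two powers combine to [(C0 / C)^r <= 1]. This fixes the cut level [v / (4 C)] and puts the
    factor [4 C] inside [Theta]. *)
Lemma powR_absorb (R : realType) (r C0 C v I : R) : 0 < r -> 0 <= C0 -> C0 <= C -> 0 < C -> 0 < v -> 0 <= I ->
  (C0 / v) `^ r * ((4 * (v / (4 * C))) `^ r * I) <= I.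
Proof.
move=> r0 c0 cC C1 v0 I0; rewrite mulrA -powRM; first last.
- by rewrite mulr_ge0// divr_ge0 ?mulr_ge0// ltW.
- by rewrite divr_ge0// ltW.
apply: ler_piMl => //; apply: powR_le1; last exact: ltW.
  apply: mulr_ge0; first by rewrite divr_ge0// ltW.
  by rewrite mulr_ge0// divr_ge0 ?mulr_ge0// ltW.
have -> : C0 / v * (4 * (v / (4 * C))) = C0 / C.
  by field; rewrite !gt_eqF.
by rewrite ler_pdivrMr// mul1r.
Qed.

Lemma rip_sum_le2 (R : realType) (H : hilbert R) (s f g : nat -> H) (u : H) n :
  (forall i, 2 * rip (s i) u <= rip (f i) u + rip (g i) u) ->
  2 * rip (\sum_(i < n) s i) u <= rip (\sum_(i < n) f i) u + rip (\sum_(i < n) g i) u.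
Proof.
move=> h; elim: n => [|n IH]; first by rewrite !big_ord0 rip0l mulr0 addr0.
rewrite !big_ord_recr !ripDl mulrDr addrACA; exact: lerD.
Qed.

(** * Distribution estimate for a finite sum *)

Section MainFinite.
Context {R : realType} (M N : traced_vna R).
Local Notation lam := (@lebesgue_measure R).
Variables (p : R) (q : \bar R) (p0 : 0 < p) (pq : (p%:E < q)%E).
Variables (T : nat -> graph (vspace_of M) -> graph (vspace_of N)) (Cp Cq : R).
Hypothesis hTpos : forall k, positive_map (Lsum_pos M p%:E q) (T k).
Hypothesis hTconv : forall k, midpoint_convex (Lsum_pos M p%:E q) (T k).
Hypotheses (Cp0 : 0 < Cp) (Cq0 : 0 < Cq).
Hypotheses (hwp : weak_type T p%:E Cp) (hwq : weak_type T q Cq).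
Implicit Types (x y : graph (vspace_of M)) (xs a b : nat -> graph (vspace_of M)).
Implicit Types (m n k : nat) (v d w : R).
Local Notation C := (Num.max Cp Cq).

Let q0 : (0 < q)%E. Proof. by apply: lt_trans pq; rewrite lte_fin. Qed.
Let p0' : (0 < p%:E)%E. Proof. by rewrite lte_fin. Qed.
Let C0 : 0 < C. Proof. by rewrite lt_max Cp0. Qed.

Lemma half_NC (r : \bar R) x : (0 < r)%E -> NC_pos M (Lr r) x -> NC_pos M (Lr r) (sscale 2^-1 x).
Proof.
move=> r0 hx; have px : Stau_pos x by case: hx.
have h0 : 0 <= 2^-1 :> R by rewrite invr_ge0.
apply: (NC_pos_le r0 (sscale_pos h0 px) hx (B := dom x)).
  by apply: stau_big; case: px.
move=> u w w' _ h1 h2; rewrite (sscale_fun (Stau_pos_Ssa px) h2 h1) ripZl.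
have := Stau_pos_form px h2; lra.
Qed.

(** Order preservation leads from [x] to the midpoint, and midpoint convexity from there to the
    average of the images. The forms are compared at one vector lying in the domains of all four
    images. *)
Lemma T_halves k x y z (u s f g : vspace_of N) (e : vspace_of N) :
  Lsum_pos M p%:E q x -> NC_pos M (Lr p%:E) y -> NC_pos M (Lr q) z ->
  sle x (sadd (sscale 2^-1 y) (sscale 2^-1 z)) ->
  T k x (u, s) -> T k y (u, f) -> T k z (u, g) ->
  T k (sadd (sscale 2^-1 y) (sscale 2^-1 z)) (u, e) ->
  2 * rip s u <= rip f u + rip g u.
Proof.
move=> hx hy hz hle h1 h2 h3 h4.
have [_ mono] := hTpos k.
have Ly := Lsum_left p0 pq hy; have Lz := Lsum_right p0 hz.
have Lw : Lsum_pos M p%:E q (sadd (sscale 2^-1 y) (sscale 2^-1 z)).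
  by exists (sscale 2^-1 y), (sscale 2^-1 z); split => //; exact: half_NC.
have k1 := sle_form (mono _ _ hx Lw hle) h1 h4.
have k2 := sle_form (hTconv k Ly Lz) h4 (sadd_val (sscale_val 2^-1 h2) (sscale_val 2^-1 h3)).
move: k1 k2; rewrite ripDl !ripZl => k1 k2; lra.
Qed.

Lemma main_finite xs n m v d : (forall k, Stau_pos (xs k)) ->
  (forall k, Lsum_pos M p%:E q (xs k)) -> (forall k, (n <= k)%N -> xs k = szero) -> 0 < v -> 0 < d ->
  (ddist (spartial (fun k => T (m + k)%N (xs k)) n) (v + d) <=
   \int[lam]_(s in @Rplus R) (phi p q (4 * C * mu (spartial xs n) s / v))%:E)%E.
Proof.
move=> px hL hx0 v0 d0; set W := spartial xs n.
have pW : Stau_pos W by exact: spartial_pos.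
have sW := Stau_pos_Ssa pW; have dW := dfun_ddist (proj1 pW).
set w := v / (4 * C); have w0 : 0 < w by rewrite divr_gt0// mulr_gt0.
have w0' := ltW w0.
have -> : (\int[lam]_(s in @Rplus R) (phi p q (4 * C * mu W s / v))%:E =
   \int[lam]_(s in @Rplus R) (phi p q (mu W s / w))%:E)%E.
  apply: eq_integral => s _; congr (phi _ _ _)%:E; rewrite /w.
  by field; rewrite !gt_eqF.
rewrite (@phi_int _ p q (fun s => mu W s / w)); last exact: f_scaled_meas.
have Hi0 : (0 <= \int[lam]_(s in @Rplus R) (hi p (mu W s / w))%:E)%E.
  by apply: integral_ge0 => s _; rewrite lee_fin hi_ge0.
have Lo0 r : (0 <= \int[lam]_(s in @Rplus R) (lo r (mu W s / w))%:E)%E.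
  by apply: integral_ge0 => s _; rewrite lee_fin lo_ge0.
(* If either integral is infinite there is nothing to prove; otherwise the two parts lie in [L^p]
   and [L^q], and the weak-type hypotheses apply. *)
have [hfin|] := ltP (\int[lam]_(s in @Rplus R) (hi p (mu W s / w))%:E)%E +oo%E; last first.
  rewrite leye_eq => /eqP->; rewrite addye ?leey//; case: (q) => // r.
  by rewrite -ltNye; apply: lt_le_trans (Lo0 r).
have [lfin|] := ltP (if q is r%:E then \int[lam]_(s in @Rplus R) (lo r (mu W s / w))%:E else 0)%E +oo%E;
  last first.
  by rewrite leye_eq => /eqP->; rewrite addey ?leey// -ltNye; exact: lt_le_trans Hi0.
have mG := gsp_msub (Ssa_cdd sW) (Ssa_aff sW) w0'; have mG' := msub_orth mG.
set K := gsp W w in mG mG'.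
set a := fun k => cmp 4 (orth K) (xs k); set b := fun k => cmp 4 K (xs k).
have c4 : 0 < 4 :> R by [].
have c4' := ltW c4.
have pa k : Stau_pos (a k) by exact: cmp_pos.
have pb k : Stau_pos (b k) by exact: cmp_pos.
have pA : Stau_pos (spartial a n) by exact: spartial_pos.
have pB : Stau_pos (spartial b n) by exact: spartial_pos.
have bD : big (doms xs) by apply: doms_big => k; case: (px k).
have cA u z := @cmp_spartial _ _ xs n (orth K) px mG' u z.
have cB u z := @cmp_spartial _ _ xs n K px mG u z.
have hA := piece_high p0 pW pA c4 w0 (fun e e0 => cmp_high_ddist pW pA c4 w0' (big_preim mG' bD) e0 cA).
have hB1 := cmp_low_ddist pW pB c4 w0' (big_preim mG bD) cB.
have hB0 := cmp_low_ddist0 pW pB c4 w0' (big_preim mG bD) cB.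
have Cp_le : Cp <= C by rewrite le_max lexx.
have Cq_le : Cq <= C by rewrite le_max lexx orbT.
have TL k (x : graph (vspace_of M)) : NC_pos M (Lr p%:E) x -> Stau_pos (T k x).
  by move=> hx; apply: (proj1 (hTpos k)); exact: Lsum_left.
have TR k (x : graph (vspace_of M)) : NC_pos M (Lr q) x -> Stau_pos (T k x).
  by move=> hx; apply: (proj1 (hTpos k)); exact: Lsum_right.
(* The weak-type constant and the factor 4 of the compression are absorbed by the choice of [w], in
   the same way for both exponents. *)
have scaled r C1 I : 0 < r -> 0 < C1 -> C1 <= C -> (0 <= I)%E -> (I < +oo)%E ->
    exists2 J : R, (((4 * w) `^ r)%:E * I = J%:E)%E & (((C1 / v) `^ r * J)%:E <= I)%E.
  move=> r0 C10 C1C I0 If; have fI : I \is a fin_num by rewrite ge0_fin_numE.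
  exists ((4 * w) `^ r * fine I); first by rewrite EFinM fineK.
  rewrite -[leRHS]fineK// lee_fin; apply: powR_absorb => //; first exact: ltW.
  exact: fine_ge0.
have NA : forall k, NC_pos M (Lr p%:E) (a k).
  move=> k; have := @cmp_NC _ M xs n (orth K) px hx0 mG' p%:E k p0'; apply; split => //; apply: NC_fin => //; first by case: pA.
  by apply: (le_lt_trans hA); rewrite lte_mul_pinfty// lee_fin powR_ge0.
have SA : (ddist (spartial (fun k => T (m + k)%N (a k)) n) (v + d) <=
    \int[lam]_(s in @Rplus R) (hi p (mu W s / w))%:E)%E.
  have [J eJ hJ] := scaled p Cp _ p0 Cp0 Cp_le Hi0 hfin.
  apply: le_trans hJ; apply: (weak_finite_r (ltW Cp0) m p0 hwp TL NA) => //.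
  by rewrite -eJ; exact: hA.
have [NB SB] : (forall k, NC_pos M (Lr q) (b k)) /\
    (ddist (spartial (fun k => T (m + k)%N (b k)) n) (v + d) <=
    (if q is r%:E then \int[lam]_(s in @Rplus R) (lo r (mu W s / w))%:E else 0))%E.
  have TR' := TR; move: lfin; case E : q pq => [r| |] // qr lfin.
    have r0 : 0 < r by move: qr; rewrite lte_fin; exact: lt_trans.
    have hB := piece_low p0 pW pB c4 w0 hfin hB1 hB0 r0.
    have NB k : NC_pos M (Lr r%:E) (b k).
      have := @cmp_NC _ M xs n K px hx0 mG r%:E k; apply => //; split => //.
      apply: NC_fin => //; first by case: pB.
      by apply: (le_lt_trans hB); rewrite lte_mul_pinfty// lee_fin powR_ge0.
    split=> //; have [J eJ hJ] := scaled r Cq _ r0 Cq0 Cq_le (Lo0 r) lfin.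
    apply: le_trans hJ; rewrite E in TR'; have hwr := hwq; rewrite E in hwr.
    apply: (weak_finite_r (ltW Cq0) m r0 hwr TR' NB) => //.
    by rewrite -eJ; exact: hB.
  have w4 : 0 <= 4 * w by rewrite mulr_ge0.
  have hB t := piece_inf (t := t) c4 w0 hB0.
  have NB k : NC_pos M (Lr +oo) (b k).
    have := @cmp_NC _ M xs n K px hx0 mG +oo%E k; apply => //; split => //.
    by apply: (proj1 (NC_inf w4 (proj1 pB) hB)).
  split=> //; rewrite E in TR'; have hwr := hwq; rewrite E in hwr.
  apply: (weak_finite_inf (ltW Cq0) m hwr TR' NB hB) => //.
  have -> : 4 * w = v / C by rewrite /w; field; rewrite gt_eqF.
  by rewrite mulrA ler_pdivrMr// mulrC ler_wpM2l// ltW.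
apply: (le_trans _ (leeD SA SB)).
have pTx k : Stau_pos (T (m + k) (xs k)) by apply: (proj1 (hTpos _)).
have pTa k : Stau_pos (T (m + k) (a k)) by exact: TL.
have pTb k : Stau_pos (T (m + k) (b k)) by exact: TR.
have pTz k : Stau_pos (T (m + k) (sadd (sscale 2^-1 (a k)) (sscale 2^-1 (b k)))).
  apply: (proj1 (hTpos _)); exists (sscale 2^-1 (a k)), (sscale 2^-1 (b k)).
  by split => //; exact: half_NC.
have vd0 : 0 <= v + d by rewrite addr_ge0// ltW.
have pS := spartial_pos n pTx.
(* The inequality term by term makes sense only at vectors in the domains of all images, for all [k]
   at once; these vectors still form a tau-dense set. *)
have big4 := bigI (doms_big (fun k => proj1 (pTx k))) (bigI (doms_big (fun k => proj1 (pTa k)))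
  (bigI (doms_big (fun k => proj1 (pTb k))) (doms_big (fun k => proj1 (pTz k))))).
apply: (ddist_dom_form2 (proj1 (spartial_pos n pTa)) (proj1 (spartial_pos n pTb)) vd0 vd0 big4) => //.
- exact: (proj2 pS).
- exact: Ssa_aff (Stau_pos_Ssa pS).
- exact: (proj2 (spartial_pos n pTa)).
- exact: (proj2 (spartial_pos n pTb)).
move=> u z z1 z2 [/domsP[s hs] [/domsP[f hf] [/domsP[g hg] /domsP[e he]]]].
move=> /(spartial_fun pTx hs)-> /(spartial_fun pTa hf)-> /(spartial_fun pTb hg)->.
apply: rip_sum_le2 => i.
apply: (T_halves (hL i) (NA i) (NB i) _ (hs i) (hf i) (hg i) (he i)).
have := sle_cmp (px i) mG'; rewrite orthK//; exact: (ms_c mG).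
Qed.
End MainFinite.

(** * Convergence of the image series *)

Section ThetaDistr.
Context {R : realType} (p : R) (q : \bar R) (p0 : 0 < p) (pq : (p%:E < q)%E).
Local Notation quadrant := (@Rplus R `*` @Rplus R).

Lemma dfun_leb2 (F : R * R -> R) : S2 F -> dfun (distr leb2 quadrant F).
Proof.
apply: (@dfun_distr _ _ _ (@lebesgue_measure R \x @lebesgue_measure R)%E).
by apply: measurableX; exact: measurable_Rplus.
Qed.

Lemma Theta_distr_mono (f g : R -> R) v : measurable_fun (@Rplus R) f -> measurable_fun (@Rplus R) g ->
  (forall t, 0 < t -> 0 <= f t <= g t) ->
  (distr leb2 quadrant (Theta p%:E q f) v <= distr leb2 quadrant (Theta p%:E q g) v)%E.
Proof.
move=> mf mg h; apply: (@le_measure _ _ _ (@lebesgue_measure R \x @lebesgue_measure R)%E).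
- by rewrite inE; exact: Theta_set_meas.
- by rewrite inE; exact: Theta_set_meas.
move=> [s t] [[/= s0 t0] hv]; split => //=; apply: (lt_le_trans hv).
have /h/andP[f0 fg] : 0 < s by move: s0; rewrite /Rplus /= in_itv /= andbT.
rewrite !Theta_weight /= !normrM ler_wpM2r// ger0_norm// ger0_norm//; exact: le_trans fg.
Qed.
End ThetaDistr.

(** * From finite sums to the image series *)

Section MainTheta.
Context {R : realType} (M N : traced_vna R).
Local Notation lam := (@lebesgue_measure R).
Variables (p : R) (q : \bar R) (p0 : 0 < p) (pq : (p%:E < q)%E).
Variables (T : nat -> graph (vspace_of M) -> graph (vspace_of N)) (Cp Cq : R).
Hypothesis hTpos : forall k, positive_map (Lsum_pos M p%:E q) (T k).
Hypothesis hTconv : forall k, midpoint_convex (Lsum_pos M p%:E q) (T k).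
Hypotheses (Cp0 : 0 < Cp) (Cq0 : 0 < Cq).
Hypotheses (hwp : weak_type T p%:E Cp) (hwq : weak_type T q Cq).
Local Notation C := (Num.max Cp Cq).
Local Notation quadrant := (@Rplus R `*` @Rplus R).
Let C0 : 0 < 4 * C. Proof. by rewrite mulr_gt0// lt_max Cp0. Qed.
Let q0 : (0 < q)%E. Proof. by apply: lt_trans pq; rewrite lte_fin. Qed.

Definition Fmu (K : traced_vna R) (Z : graph (vspace_of K)) : R -> R := fun t => 4 * C * mu Z t.
(** By unfolding, [singular (Dmu Z)] is [mu2] of [Theta] applied to [4 C mu(Z)], so its quasi-norm
    is the one that the norm of [Theta] bounds. *)
Definition Dmu (K : traced_vna R) (Z : graph (vspace_of K)) : R -> \bar R :=
  distr leb2 quadrant (Theta p%:E q (Fmu Z)).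

Lemma Fmu_meas (K : traced_vna R) (Z : graph (vspace_of K)) : Stau Z ->
  measurable_fun (@Rplus R) (Fmu Z).
Proof.
move=> sZ; apply: measurable_funM; first exact: measurable_cst.
exact: (sing_meas (dfun_ddist sZ)).
Qed.

Lemma Fmu_ge0 (K : traced_vna R) (Z : graph (vspace_of K)) t : 0 <= Fmu Z t.
Proof. by rewrite mulr_ge0 ?mu_ge0// ltW. Qed.

Lemma main_Theta (xs : nat -> graph (vspace_of M)) (Z : graph (vspace_of M)) n m (v d : R) :
  (forall k, Stau_pos (xs k)) -> (forall k, Lsum_pos M p%:E q (xs k)) ->
  Stau Z -> (forall t, 0 < t -> mu (spartial xs n) t <= mu Z t) -> 0 < v -> 0 < d ->
  (ddist (spartial (fun k => T (m + k)%N (xs k)) n) (v + d) <= Dmu Z v)%E.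
Proof.
move=> px hL sZ hZ v0 d0.
pose ys k := if (k < n)%N then xs k else szero.
have eS : spartial ys n = spartial xs n by apply: eq_spartial => k kn; rewrite /ys kn.
have -> : spartial (fun k => T (m + k)%N (xs k)) n = spartial (fun k => T (m + k)%N (ys k)) n.
  by apply: eq_spartial => k kn; rewrite /ys kn.
have py k : Stau_pos (ys k) by rewrite /ys; case: ifP => _ //; exact: szero_pos.
have hy k : Lsum_pos M p%:E q (ys k).
  rewrite /ys; case: ifP => _ //; apply: Lsum_right => //.
  by case: (szero_Lr M q0).
have y0 k : (n <= k)%N -> ys k = szero by rewrite /ys ltnNge => ->.
apply: (le_trans (main_finite p0 pq hTpos hTconv Cp0 Cq0 hwp hwq m py hy y0 v0 d0)).
have sW : Stau (spartial ys n) by case: (spartial_pos n py).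
apply: (le_trans (Theta_lower p0 pq v0 (Fmu_meas sW) (fun s _ => Fmu_ge0 _ s))).
apply: Theta_distr_mono; [exact: Fmu_meas|exact: Fmu_meas|move=> t t0].
by rewrite Fmu_ge0 ler_wpM2l ?(ltW C0)// eS hZ.
Qed.

Section Assembly.
Variables (E : qspace R (R -> R)) (hE : symmetric_quasi_banach E) (c : R) (c0 : 0 <= c).
Hypothesis hc : forall f, carrier E f ->
  carrier (Espace2 E) (Theta p%:E q f) /\ qn (Espace2 E) (Theta p%:E q f) <= c * qn E f.

Lemma NC_Fmu (Z : graph (vspace_of M)) : carrier (NC M E) Z ->
  carrier E (Fmu Z) /\ qn E (Fmu Z) = 4 * C * qn (NC M E) Z.
Proof.
move=> [sZ cZ]; split; first exact: sqb_Z.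
by rewrite (sqb_normZ hE)// ger0_norm// ltW.
Qed.

Lemma Theta_Fmu (Z : graph (vspace_of M)) : carrier (NC M E) Z ->
  [/\ dfun (Dmu Z), carrier E (singular (Dmu Z)) &
    qn E (singular (Dmu Z)) <= c * (4 * C) * qn (NC M E) Z].
Proof.
move=> /NC_Fmu[cF eF]; have [[h1 h2] h3] := hc cF.
by split => //; [exact: dfun_leb2|rewrite -mulrA -eF].
Qed.

(** Boundedness of [Theta] makes the distribution function of [Theta f] finite at some level; it
    dominates the integral of [phi], which is the criterion for membership in [L^p + L^q]. *)
Lemma Lsum_NC (x : graph (vspace_of M)) : NC_pos M E x -> Lsum_pos M p%:E q x.
Proof.
move=> [cx px]; have [dD _ _] := Theta_Fmu cx; have sx := proj1 px.
have [v v0 hv] := df_tail dD ltr01.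
have w0 : 0 < v / (4 * C) by rewrite divr_gt0.
apply: (Lsum_of_integrable p0 pq px w0).
apply: (@le_lt_trans _ _ (1%:E)); last exact: ltry.
apply: le_trans hv; apply: le_trans (Theta_lower p0 pq v0 (Fmu_meas sx) (fun s _ => Fmu_ge0 _ s)).
rewrite le_eqVlt; apply/orP; left; apply/eqP; apply: eq_integral => s _.
congr (phi _ _ _)%:E; rewrite /Fmu; have := C0; move: (4 * C) => b b0.
by field; rewrite !gt_eqF.
Qed.

Variables (x : nat -> graph (vspace_of M)) (X : graph (vspace_of M)).
Hypotheses (hx : forall k, NC_pos M E (x k)) (hX : carrier (NC M E) X).
Hypothesis cv : series_cvg (enorm (NC M E)) x X.
Let px k : Stau_pos (x k). Proof. by case: (hx k). Qed.
Let sX : Stau X. Proof. by case: hX. Qed.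
Let Z m := ssub (spartial x m) X.
Let y k := T k (x k).
Let py k : Stau_pos (y k). Proof. by apply: (proj1 (hTpos k)); exact: Lsum_NC. Qed.

Let Z_small (e : R) : 0 < e -> exists n0, forall n, (n0 <= n)%N ->
  carrier (NC M E) (Z n) /\ qn (NC M E) (Z n) < e.
Proof.
move=> e0; have e2 : 0 < e / 2 by rewrite divr_gt0.
have [n0 h] := series_cvg_small e2 cv; exists n0 => n /h.
rewrite /enorm; case: ifPn => [/asboolP hZ|_]; last by rewrite leye_eq.
by rewrite lee_fin => h1; split => //; apply: (le_lt_trans h1); rewrite ltr_pdivrMr// ltr_pMr// ltr1n.
Qed.

Let Z_cvm : cvg_measure x X.
Proof.
move=> d e d0 e0; have [n1 h1] := Z_small ltr01.
have [|n2 h2] := qn_cvg_distr hE (d := fun n => ddist (Z n)) _ d0 e0.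
  move=> eta eta0; have [n0 h] := Z_small eta0; exists n0 => n /h[[sZ cZ] qZ].
  by split => //; exact: dfun_ddist.
exists (maxn n1 n2) => n; rewrite geq_max => /andP[/h1[[sZ _] _] /h2 hd]; by split.
Qed.

(** A block after [m] lies below later partial sums minus the [m]-th one, and these differences tend
    in measure to the negative of [Z m]. *)
Let mu_tail m n (t : R) : Stau (Z m) -> 0 < t -> mu (spartial (shift m x) n) t <= mu (Z m) t.
Proof.
move=> sZ t0; have pW : Stau_pos (spartial (shift m x) n) by apply: spartial_pos => k; exact: px.
apply: mu_le_ddist => //; first by case: pW.
move=> a b a0 ab; rewrite -(subrK a b) addrC.
have d0 : 0 < b - a by rewrite subr_gt0.
apply: (ddist_tail_le (n0 := (m + n)%N) px sX Z_cvm pW (doms_big (fun k => proj1 (px k))) (ltW a0) d0 sZ).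
move=> j u w s mj _ hw hs.
rewrite (spartial_fun (t := shift m s) _ _ hw); last 2 first.
- by move=> k; exact: px.
- by move=> k; exact: hs.
rewrite (sum_split_nat s (leq_trans (leq_addr n m) mj)) addrC addKr.
have nj : (n <= j - m)%N by rewrite leq_subRL// (leq_trans (leq_addr n m)).
rewrite (sum_split_nat (fun i => s (m + i)%N) nj) ripDl lerDl.
elim: (_ - n)%N => [|l IH]; first by rewrite big_ord0 rip0l.
by rewrite big_ord_recr ripDl addr_ge0//; exact: Stau_pos_form (px _) (hs _).
Qed.

Let mu_partial n (t : R) : 0 < t -> mu (spartial x n) t <= mu X t.
Proof.
move=> t0; have pW : Stau_pos (spartial x n) by exact: spartial_pos.
apply: mu_le_ddist => //; first by case: pW.
move=> a b a0 ab; rewrite -(subrK a b) addrC.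
have d0 : 0 < b - a by rewrite subr_gt0.
apply: (ddist_partial_le (n0 := n) px sX Z_cvm pW (doms_big (fun k => proj1 (px k))) (ltW a0) d0).
move=> j u w s nj _ hw hs.
rewrite (spartial_fun px hs hw) (sum_split_nat s nj) ripDl lerDl.
elim: (_ - n)%N => [|l IH]; first by rewrite big_ord0 rip0l.
by rewrite big_ord_recr ripDl addr_ge0//; exact: Stau_pos_form (px _) (hs _).
Qed.

Let hL k : Lsum_pos M p%:E q (x k). Proof. exact: Lsum_NC. Qed.

Let T_tail m n (v d : R) : Stau (Z m) -> 0 < v -> 0 < d ->
  (ddist (spartial (shift m y) n) (v + d) <= Dmu (Z m) v)%E.
Proof.
move=> sZ v0 d0.
exact: (@main_Theta (shift m x) (Z m) n m v d (fun k => px _) (fun k => hL _) sZ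
  (fun t => @mu_tail m n t sZ) v0 d0).
Qed.

Let T_partial n (v d : R) : 0 < v -> 0 < d -> (ddist (spartial y n) (v + d) <= Dmu X v)%E.
Proof. by move=> v0 d0; exact: (@main_Theta x X n 0%N v d px hL sX (@mu_partial n) v0 d0). Qed.

Let cy (d e : R) : 0 < d -> 0 < e -> exists N, forall m k, (N <= m)%N ->
  (ddist (spartial (shift m y) k) d <= e%:E)%E.
Proof.
move=> d0 e0; have d2 : 0 < d / 2 by rewrite divr_gt0.
have [n1 h1] := Z_small ltr01.
have [|n2 h2] := qn_cvg_distr hE (d := fun n => Dmu (Z n)) _ d2 e0.
  (* Adding 1 keeps the divisor positive when [c = 0]. *)
  move=> eta eta0; have k0 : 0 < c * (4 * C) + 1 by rewrite ltr_wpDl// mulr_ge0// ltW.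
  have [n0 h] := Z_small (divr_gt0 eta0 k0); exists n0 => n /h[cZ qZ].
  have [a1 a2 a3] := Theta_Fmu cZ; split => //; apply: (le_lt_trans a3).
  rewrite ltr_pdivlMr// in qZ; apply: le_lt_trans qZ.
  by rewrite mulrDr mulr1 mulrC lerDl (sqb_ge0 hE)//; case: cZ.
exists (maxn n1 n2) => m k; rewrite geq_max => /andP[/h1[[sZ _] _] /h2].
by apply: le_trans; rewrite {1}(splitr d); exact: (@T_tail m k _ _ sZ d2 d2).
Qed.

Let Y := graph_closure (limg cy).
Let pY : Stau_pos Y. Proof. exact: limg_pos. Qed.
Let sub_pos m : Ssa (ssub (spartial y m) Y).
Proof. by apply: ssub_sa; apply: Stau_pos_Ssa => //; exact: spartial_pos. Qed.

(** Transfers to the limit a bound valid for blocks of every length: [W] is dominated by a block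
    together with the difference of a late partial sum and [Y], which is small in measure. *)
Let Y_split (W : graph (vspace_of N)) (D : R -> \bar R) m : Ssa W ->
  (forall n (v d : R), 0 < v -> 0 < d -> (ddist (spartial (shift m y) n) (v + d) <= D v)%E) ->
  (forall n (u w z z' : vspace_of N), W (u, w) -> doms y u -> dom Y u ->
    spartial (shift m y) n (u, z) -> ssub (spartial y (m + n)) Y (u, z') ->
    hnorm w <= hnorm z + hnorm z') ->
  forall v d : R, 0 < v -> 0 < d -> (ddist W (v + d) <= D v)%E.
Proof.
move=> sW hD hW v d v0 d0; apply/lee_addgt0Pr => e e0.
have d2 : 0 < d / 2 by rewrite divr_gt0.
have [n0 h0] := limg_cvg py cy d2 e0.
have hn := h0 (m + n0)%N (leq_addl _ _).
apply: (le_trans _ (leeD (hD n0 v _ v0 d2) hn)).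
have pW : Stau_pos (spartial (shift m y) n0) by apply: spartial_pos => k; exact: py.
rewrite {1}(splitr d) addrA.
apply: (ddist_dom (B := doms y `&` dom Y) (proj1 pW) (proj1 (sub_pos _))).
- by rewrite addr_ge0// ltW.
- exact: ltW.
- by apply: bigI; [exact: doms_big (fun k => proj1 (py k))|apply: stau_big; case: pY].
- exact: Ssa_cdd.
- exact: Ssa_aff.
- by move=> u w w1 w2 [hu hu'] h h1 h2; apply: (hW n0) h hu hu' h1 h2.
Qed.

Let Y_le (v d : R) : 0 < v -> 0 < d -> (ddist Y (v + d) <= Dmu X v)%E.
Proof.
apply: (@Y_split Y (Dmu X) 0); first exact: Stau_pos_Ssa.
  exact: T_partial.
move=> n u w z z' hw hu _ hz hz'; have [s hs] := domsP hu.
have ez := spartial_fun py hs hz.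
have := ssub_val (spartial_val n hs) hw => h.
have -> : z' = z - w.
  by rewrite ez; apply: (cdd_uniq (Ssa_cdd (sub_pos n)) hz' h).
have -> : hnorm w = hnorm (z - (z - w)) by congr hnorm; rewrite opprB addrC subrK.
exact: hnormB.
Qed.

Let sub_le m (v d : R) : Stau (Z m) -> 0 < v -> 0 < d ->
  (ddist (ssub (spartial y m) Y) (v + d) <= Dmu (Z m) v)%E.
Proof.
move=> sZ; apply: (@Y_split (ssub (spartial y m) Y) (Dmu (Z m)) m (sub_pos m)).
  by move=> n v' d' v0 d0; exact: (@T_tail m n v' d' sZ v0 d0).
move=> n u w z z' hw hu [a ha] hz hz'; have [s hs] := domsP hu.
have ez := spartial_fun (x := shift m y) (fun k => py _) (t := shift m s) (fun k => hs _) hz.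
have ew := cdd_uniq (Ssa_cdd (sub_pos m)) hw (ssub_val (spartial_val m hs) ha).
have ez' := cdd_uniq (Ssa_cdd (sub_pos (m + n))) hz' (ssub_val (spartial_val (m + n) hs) ha).
have -> : w = z' - z.
  rewrite ew ez' ez (sum_split_nat s (leq_addr n m)) addKn -[in RHS]addrA [- a - _]addrC.
  by rewrite addrA addrK.
by rewrite [leRHS]addrC; exact: hnormB.
Qed.

Let NC_le (W : graph (vspace_of N)) (V : graph (vspace_of M)) : Stau W -> carrier (NC M E) V ->
  (forall v d : R, 0 < v -> 0 < d -> (ddist W (v + d) <= Dmu V v)%E) ->
  carrier (NC N E) W /\ qn (NC N E) W <= qn E (singular (Dmu V)).
Proof.
move=> sW cV h; have [dD cD _] := Theta_Fmu cV.
have [|h1 h2] := carrier_sing hE (dfun_ddist sW) cD; last by split.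
move=> t t0; rewrite ger0_norm ?sing_ge0//; apply: sing_le_sing => // v w v0 vw.
by rewrite -(subrK v w) addrC; apply: h => //; rewrite subr_gt0.
Qed.

Lemma series_image : exists Y : graph (vspace_of N),
  [/\ carrier (NC N E) Y, series_cvg (enorm (NC N E)) (fun k => T k (x k)) Y &
    qn (NC N E) Y <= qn E (singular (Dmu X))].
Proof.
have [cY qY] := NC_le (proj1 pY) hX Y_le; exists Y; split => //.
(* The added 1 makes the constant positive even for [c = 0], so that the upper bound is [+oo]
   whenever [Z n] is outside the carrier. *)
have k0 : 0 <= c * (4 * C) + 1 by rewrite addr_ge0// mulr_ge0// ltW.
have k1 : 0 < c * (4 * C) + 1 by rewrite ltr_wpDl// mulr_ge0// ltW.
have nonneg (K : traced_vna R) (V : graph (vspace_of K)) : (0 <= enorm (NC K E) V)%E.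
  by rewrite /enorm; case: ifPn => [/asboolP[_ cV]|//]; rewrite lee_fin (sqb_ge0 hE).
apply: (squeeze_cvge (f := fun=> 0%E)
  (h := fun n => ((c * (4 * C) + 1)%:E * enorm (NC M E) (Z n))%E)).
- near=> n; rewrite nonneg /=; rewrite {2}/enorm.
  case: ifPn => [/asboolP hZ|_]; last by rewrite gt0_muley ?leey ?lte_fin.
  have [h1 h2] := NC_le (proj1 (sub_pos n)) hZ (fun v d => @sub_le n v d (proj1 hZ)).
  rewrite /enorm asboolT// -EFinM lee_fin (le_trans h2)//.
  have [_ _ h3] := Theta_Fmu hZ; apply: (le_trans h3).
  by apply: ler_wpM2r; [rewrite (sqb_ge0 hE)//; case: hZ|rewrite lerDl].
- exact: cvg_cst.
- by rewrite -[0%E](mule0 (c * (4 * C) + 1)%:E); apply: cvgeZl.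
Unshelve. all: by end_near. Qed.
End Assembly.
End MainTheta.

(** * Boundedness of Theta *)

Section Sums.
Context {R : realType}.
Variables (E : qspace R (R -> R)) (hE : symmetric_quasi_banach E).
Implicit Types (d : R -> \bar R) (f g : R -> R) (s t v w a b e : R).
Local Notation lam := (@lebesgue_measure R).

Lemma S1_le f g : measurable_fun (@Rplus R) f -> S1 g -> (forall t, 0 < t -> `|f t| <= `|g t|) -> S1 f.
Proof.
move=> mf [mg [v [v0 hv]]] h; split => //; exists v; split => //.
by apply: le_lt_trans hv; exact: distr_le.
Qed.

Lemma carrierN f : carrier E f -> carrier E (fun t => - f t) /\ qn E (fun t => - f t) = qn E f.
Proof.
move=> cf; have -> : (fun t => - f t) = (fun t => -1 * f t) by apply/funext => t; rewrite mulN1r.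
by split; [exact: sqb_Z|rewrite (sqb_normZ hE)// normrN1 mul1r].
Qed.

Lemma carrierB f g : carrier E f -> carrier E g -> carrier E (f \- g).
Proof. by move=> cf cg; apply: (sqb_D hE) => //; case: (carrierN cg). Qed.

Lemma quasi_const : exists2 K, 1 <= K & forall f g, carrier E f -> carrier E g ->
  qn E (f \+ g) <= K * (qn E f + qn E g).
Proof.
have [K hK] := sqb_quasi hE; exists (Num.max 1 K); first by rewrite le_max lexx.
move=> f g cf cg; apply: (le_trans (hK _ _ cf cg)); apply: ler_wpM2r.
  by apply: addr_ge0; exact: (sqb_ge0 hE).
by rewrite le_max lexx orbT.
Qed.

Lemma carrier_sing_ae d g (A : set R) : dfun d -> carrier E g -> measurable A -> lam A = 0%E ->
  (forall t, 0 < t -> ~ A t -> singular d t <= g t) ->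
  carrier E (singular d) /\ qn E (singular d) <= qn E g.
Proof.
move=> hd cg mA A0 h; have Sg := sqb_sub hE cg; have Sd := S1_sing hd.
apply: (sqb_symmetric hE Sd cg) => t t0; apply: sing_le_sing => //; first exact: dfun_S1.
move=> v w v0 vw; apply: (le_trans (df_mono (dfun_S1 Sd) v0 (ltW vw))).
have mg := distr_setE v (proj1 Sg); have md := distr_setE v (proj1 Sd).
rewrite /distr -[leRHS]adde0 -[X in (_ + X)%E]A0.
apply: (@le_trans _ _ (lam ((@Rplus R `&` [set x : R | (v < `|g x|)%R]) `|` A))); last exact: measureU2.
apply: le_measure; rewrite ?inE //; first exact: measurableU.
move=> x [Rx /= hx]; have [Ax|nA] := pselect (A x); [by right|left; split => //=].
apply: (lt_le_trans hx); rewrite ger0_norm ?sing_ge0//.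
apply: le_trans (ler_norm _); apply: h => //.
by move: Rx; rewrite /Rplus /= in_itv /= andbT.
Qed.

Section Series.
Variables (K A rho : R) (H : nat -> R -> R).
Hypotheses (K1 : 1 <= K) (hK : forall f g, carrier E f -> carrier E g ->
  qn E (f \+ g) <= K * (qn E f + qn E g)).
Hypotheses (A0 : 0 <= A) (r0 : 0 <= rho) (Kr : 2 * K * rho <= 1).
Hypotheses (cH : forall k, carrier E (H k)) (H0 : forall k t, 0 < t -> 0 <= H k t).
Hypothesis nH : forall k, qn E (H k) <= A * rho ^+ k.
Let K0 : 0 <= K. Proof. exact: le_trans K1. Qed.

Let S m j : R -> R := fun t => \sum_(k < j) H (m + k)%N t.

Let S_recl m j : S m j.+1 = H m \+ S m.+1 j.
Proof.
apply/funext => t; rewrite /S big_ord_recl addn0; congr (_ + _).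
by apply: eq_bigr => k _; rewrite /bump /= addnA addn1.
Qed.

(** Splitting off the first term costs one factor [K]; the induction closes because
    [K (1 + 2 K rho) <= 2 K], so the quasi-triangle constant does not accumulate. *)
Let S_bound j m : carrier E (S m j) /\ qn E (S m j) <= 2 * K * A * rho ^+ m.
Proof.
elim: j m => [|j IH] m.
  have e0 : S m 0 = fun=> 0 by apply/funext => t; rewrite /S big_ord0.
  have c0 := sqb_0 hE; rewrite e0; split => //.
  have -> : (fun=> 0) = (fun t : R => 0 * (fun=> 0) t) :> (R -> R) by apply/funext => t; rewrite mul0r.
  by rewrite (sqb_normZ hE)// normr0 mul0r !mulr_ge0// exprn_ge0.
have [cS nS] := IH m.+1; rewrite S_recl; split; first exact: sqb_D.
apply: (le_trans (hK (cH m) cS)).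
have h : qn E (H m) + qn E (S m.+1 j) <= A * rho ^+ m * (1 + 2 * K * rho).
  rewrite mulrDr mulr1 lerD//; apply: (le_trans nS).
  by rewrite exprS le_eqVlt; apply/orP; left; apply/eqP; ring.
apply: (le_trans (ler_wpM2l K0 h)).
have x0 : 0 <= K * (A * rho ^+ m) by rewrite !mulr_ge0// exprn_ge0.
rewrite mulrA; apply: (@le_trans _ _ (K * (A * rho ^+ m) * 2)).
  by apply: ler_wpM2l => //; have := lerD (lexx 1) Kr.
by rewrite le_eqVlt; apply/orP; left; apply/eqP; ring.
Qed.

(** The limit dominates each term almost everywhere: the positive part of [H k - g] lies below
    [|u n - g|] for [n > k], and the quasi-norm of [u n - g] tends to zero. *)
Lemma series_carrier : exists g (N : set R), [/\ carrier E g, qn E g <= 2 * K ^+ 2 * A,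
  measurable N, lam N = 0%E & forall k t, 0 < t -> ~ N t -> H k t <= g t].
Proof.
pose u n := S 0 n.
have cu n : carrier E (u n) by case: (S_bound n 0).
have uB m n : (n <= m)%N -> u m \- u n = S n (m - n).
  move=> nm; apply/funext => t; have := subnKC nm; move: (m - n)%N => j <-.
  rewrite /u /S /= big_split_ord /= [LHS]addrAC subrr add0r.
  by apply: eq_bigr => i _; rewrite add0n.
have cauchy e : 0 < e -> exists n0, forall m n, (n0 <= m)%N -> (n0 <= n)%N -> qn E (u m \- u n) < e.
  move=> e0.
  have rho1 : rho < 1 by move: Kr; rewrite -mulrA => Kr'; have := ler_wpM2r r0 K1; rewrite mul1r; lra.
  have /cvgrPdist_lt/(_ e e0)[n0 _ h] : (2 * K * A * rho ^+ n) @[n --> \oo] --> (0 : R).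
    rewrite -(mulr0 (2 * K * A)); apply: cvgMr; apply: cvg_expr.
    by rewrite ger0_norm.
  have small n m : (n0 <= n)%N -> (n <= m)%N -> qn E (u m \- u n) < e.
    move=> /h + nm; rewrite sub0r normrN => hn; rewrite uB//.
    apply: le_lt_trans (proj2 (S_bound _ _)) _; exact: (le_lt_trans (ler_norm _) hn).
  exists n0 => m n hm hn; have [nm|mn] := leqP n m; first exact: small.
  have [_ <-] := carrierN (carrierB (cu m) (cu n)).
  have -> : (fun t => - (u m \- u n) t) = u n \- u m by apply/funext => t /=; rewrite opprB.
  by apply: small => //; exact: ltnW.
have [g cg hg] := sqb_complete hE cu cauchy.
have small e : 0 < e -> exists n0, forall n, (n0 <= n)%N -> qn E (u n \- g) < e.
  move=> e0; have /cvgrPdist_lt/(_ e e0)[n0 _ h] := hg; exists n0 => n /h.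
  by rewrite sub0r normrN; apply: le_lt_trans; exact: ler_norm.
have nae k : {ae lam, forall t, Rplus t -> Num.max 0 (H k t - g t) = 0}.
  have Sg := sqb_sub hE cg; have SH := sqb_sub hE (cH k).
  have mf : measurable_fun (@Rplus R) (fun t => Num.max 0 (H k t - g t)).
    apply: measurable_maxr; first exact: measurable_cst.
    by apply: measurable_funB; [case: SH|case: Sg].
  have dom n t : (k < n)%N -> 0 < t -> `|Num.max 0 (H k t - g t)| <= `|(u n \- g) t|.
    move=> kn t0; rewrite ger0_norm ?le_max ?lexx// ge_max normr_ge0 /=.
    apply: le_trans (ler_norm _); rewrite /= lerB// /u /S (bigD1 (Ordinal kn)) //= add0n lerDl.
    by apply: sumr_ge0 => i _; exact: H0.
  have Sf : S1 (fun t => Num.max 0 (H k t - g t)).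
    apply: (S1_le mf (sqb_sub hE (carrierB (cu k.+1) cg))) => t t0; exact: dom.
  have cf n : (k < n)%N -> carrier E (fun t => Num.max 0 (H k t - g t)) /\
      qn E (fun t => Num.max 0 (H k t - g t)) <= qn E (u n \- g).
    by move=> kn; apply: (carrier_mono hE Sf (carrierB (cu n) cg)) => t t0; exact: dom.
  have [c1 _] := cf k.+1 (ltnSn k).
  apply: (sqb_definite hE c1); apply/eqP; rewrite eq_le (sqb_ge0 hE)// andbT.
  apply/ler_addgt0Pr => e e0; rewrite add0r; have [n0 h] := small e e0.
  apply: (le_trans (proj2 (cf (maxn n0 k.+1) (leq_maxr _ _)))); apply/ltW/h; exact: leq_maxl.
have /ae_foralln[N [mN N0 sN]] := nae.
exists g, N; split => //.
- have [c1 n1] := S_bound 0 0.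
  (* The tolerance [e / K] compensates the constant [K] in the quasi-triangle inequality for
     [g = u n0 + (g - u n0)]. *)
  apply/ler_addgt0Pr => e e0; have e1 : 0 < e / K by rewrite divr_gt0// (lt_le_trans ltr01).
  have [n0 h] := small _ e1; have hn := h n0 (leqnn _).
  have [cN nN] := carrierN (carrierB (cu n0) cg).
  have -> : g = u n0 \+ (fun t => - (u n0 \- g) t).
    by apply/funext => t /=; rewrite opprB addrC subrK.
  apply: (le_trans (hK (cu n0) cN)); rewrite nN.
  have [_] := S_bound n0 0; rewrite expr0 mulr1 => hb.
  apply: (@le_trans _ _ (K * (2 * K * A + e / K))).
    by apply: ler_wpM2l => //; rewrite lerD// ltW.
  rewrite le_eqVlt; apply/orP; left; apply/eqP; field.
  by rewrite gt_eqF// (lt_le_trans ltr01).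
- move=> k t t0 nN; apply: contrapT => hlt; apply: nN; apply: sN => /= hall.
  have Rt : Rplus t by rewrite /Rplus /= in_itv /= andbT.
  apply: hlt; have := hall k Rt => hm; rewrite -subr_le0 -hm le_max lexx orbT.
  by [].
Qed.
End Series.
End Sums.

(** * Dilations and Boyd indices *)

Section Dilations.
Context {R : realType}.
Variables (E : qspace R (R -> R)) (hE : symmetric_quasi_banach E).
Implicit Types (f g : R -> R) (s t v w a b e u r p q : R).

Definition dil_bound u r : Prop := forall f, carrier E f ->
  carrier E (dilation u^-1 f) /\ qn E (dilation u^-1 f) <= r * qn E f.

Lemma opnorm_bound u r : (opnorm E E (dilation u^-1) < r%:E)%E -> dil_bound u r.
Proof.
move=> /ereal_inf_lt[_ [c [c0 hc] <-]]; rewrite lte_fin => cr f cf.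
have [h1 h2] := hc f cf; split => //; apply: (le_trans h2).
by apply: ler_wpM2r; [exact: sqb_ge0 hE _ cf|exact: ltW].
Qed.

Lemma opnorm_ge0 u : (0 <= opnorm E E (dilation u^-1))%E.
Proof. by apply: le_ereal_inf_tmp => _ [c [c0 _] <-]; rewrite lee_fin. Qed.

Lemma boyd_quotient_fin u r : opnorm E E (dilation u^-1) = r%:E -> 0 < r -> r != 1 ->
  boyd_quotient E u = (ln u / ln r)%:E.
Proof.
move=> h r0 r1; rewrite /boyd_quotient h lne_eq0 eqe (negPf r1) lne_EFin//.
have l0 : ln r != 0 by rewrite ln_eq0.
by rewrite inver (negPf l0) EFinM.
Qed.


Lemma boyd_quotienty u : opnorm E E (dilation u^-1) = +oo%E -> boyd_quotient E u = 0%E.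
Proof. by move=> h; rewrite /boyd_quotient h /= invey mule0. Qed.

Lemma lt_powR_ln r u a : 0 < r -> 0 < u -> ln r < a * ln u -> r < u `^ a.
Proof. by move=> r0 u0; rewrite -ln_powR ltr_ln ?posrE// powR_gt0. Qed.

(** The inequality is solved for the norm, with degenerate norms apart: [+oo] gives quotient 0 and
    is excluded, 0 and 1 satisfy the conclusion since [u > 1], and a norm strictly between 0 and 1
    is excluded by a nonpositive quotient. *)
Lemma boyd_large p u : 0 < p -> 1 < u -> (p%:E < boyd_quotient E u)%E ->
  (opnorm E E (dilation u^-1) < (u `^ p^-1)%:E)%E.
Proof.
move=> p0 u1; have u0 : 0 < u by apply: lt_trans u1.
have lu : 0 < ln u by rewrite ln_gt0.
case h : (opnorm _ _ _) (opnorm_ge0 u) => [r| |] //; rewrite ?lee_fin; last first.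
  by rewrite boyd_quotienty// lte_fin ltNge (ltW p0).
rewrite le_eqVlt => /orP[/eqP r0|r0].
  by move=> _; rewrite lte_fin -r0 powR_gt0.
rewrite lte_fin; have [->|r1] := eqVneq r 1.
  by move=> _; apply: lt_powR_ln => //; rewrite ln1 mulr_gt0// invr_gt0.
rewrite (boyd_quotient_fin h r0 r1) lte_fin => hp; apply: lt_powR_ln => //.
have l0 : 0 < ln r.
  rewrite ltNge; apply/negP => l0; have : ln u / ln r <= 0.
    by rewrite mulr_ge0_le0 ?(ltW lu)// invr_le0.
  by move/(lt_le_trans hp); rewrite ltNge ltW.
by rewrite mulrC ltr_pdivlMr// mulrC -ltr_pdivlMr.
Qed.

(** For [u < 1] the norm 1 gives quotient [+oo], and larger norms, including [+oo], give a quotient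
    at most 0; the hypotheses thus leave only norms below 1. *)
Lemma boyd_small q u : 0 < q -> 0 < u -> u < 1 -> (0 < boyd_quotient E u)%E ->
  (boyd_quotient E u < q%:E)%E -> (opnorm E E (dilation u^-1) < (u `^ q^-1)%:E)%E.
Proof.
move=> q0 u0 u1; have lu : ln u < 0 by rewrite ln_lt0// u0.
case h : (opnorm _ _ _) (opnorm_ge0 u) => [r| |] //; rewrite ?lee_fin; last first.
  by rewrite boyd_quotienty// ltxx.
rewrite le_eqVlt => /orP[/eqP r0|r0].
  by move=> _ _; rewrite lte_fin -r0 powR_gt0.
rewrite lte_fin; have [r1|r1] := eqVneq r 1.
  by rewrite /boyd_quotient h r1 lne1 eqxx.
rewrite (boyd_quotient_fin h r0 r1) !lte_fin => h1 h2; apply: lt_powR_ln => //.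
have l0 : ln r < 0.
  rewrite ltNge; apply/negP => l0; have : ln u / ln r <= 0.
    by rewrite mulr_le0_ge0 ?(ltW lu)// invr_ge0.
  by move/(lt_le_trans h1); rewrite ltxx.
by rewrite ltr_ndivrMr// in h2; rewrite mulrC ltr_pdivlMr// mulrC.
Qed.

Lemma lt_fin_between (x : \bar R) p : (p%:E < x)%E -> exists2 p', p < p' & (p'%:E < x)%E.
Proof.
case: x => [r| |] //; rewrite ?lte_fin => h.
  by exists ((p + r) / 2); rewrite ?lte_fin ?midf_lt.
by exists (p + 1); rewrite ?ltrDl ?ltry.
Qed.

Lemma lt_between_fin (x : \bar R) q : (0 < x)%E -> (x < q%:E)%E ->
  exists q', [/\ 0 < q', q' < q & (x < q'%:E)%E].
Proof.
case: x => [r| |] //; rewrite !lte_fin => r0 h.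
exists ((r + q) / 2); rewrite lte_fin !midf_lt// divr_gt0// addr_gt0//; exact: lt_trans h.
Qed.

Lemma boyd_p_bound p : 0 < p -> (p%:E < boyd_p E)%E ->
  exists p' u0, [/\ p < p', 1 <= u0 & forall u, u0 <= u -> dil_bound u (u `^ p'^-1)].
Proof.
move=> p0 /[dup] hp; rewrite /boyd_p => /lt_fin_between[p' pp' hp'].
(* If the quotient diverged, its limit would be the default value 0, which the hypothesis
   excludes. *)
have cv : boyd_quotient E u @[u --> +oo%R] --> boyd_p E.
  apply: contrapT => nc; move: hp; rewrite /boyd_p dvgP//.
    by rewrite lte_fin ltNge (ltW p0).
have p'0 : 0 < p' by apply: lt_trans pp'.
have [M [Mr hM]] := cv _ (open_ereal_gt' hp').
exists p', (Num.max 2 (M + 1)); split => //; first by rewrite le_max ler1n.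
move=> u; rewrite ge_max => /andP[u2 uM]; apply: opnorm_bound; apply: boyd_large => //.
  by apply: lt_le_trans u2; rewrite ltr1n.
by apply: hM; apply: lt_le_trans uM; rewrite ltrDl.
Qed.

Lemma boyd_q_bound q : (0 < boyd_q E)%E -> (boyd_q E < q%:E)%E ->
  exists q' v0, [/\ 0 < q', q' < q, 0 < v0 & forall u, 0 < u -> u <= v0 -> dil_bound u (u `^ q'^-1)].
Proof.
move=> h0 hq; have [q' [q'0 qq' hq']] := lt_between_fin h0 hq.
have cv : boyd_quotient E u @[u --> 0^'+] --> boyd_q E.
  apply: contrapT => nc; move: h0; rewrite /boyd_q dvgP//.
    by rewrite ltxx.
have h1 : \forall u \near 0^'+, (0 < boyd_quotient E u)%E by exact: cv _ (open_ereal_gt' h0).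
have h2 : \forall u \near 0^'+, (boyd_quotient E u < q'%:E)%E by exact: cv _ (open_ereal_lt' hq').
have [e e0 he] := filterI h1 h2.
exists q', (Num.min (e / 2) 2^-1); split => //.
  by rewrite lt_min divr_gt0//= invr_gt0.
move=> u u0; rewrite le_min => /andP[ue u2]; apply: opnorm_bound.
have [|a1 a2] := he u _ u0.
  rewrite /ball /= sub0r normrN gtr0_norm//; apply: (le_lt_trans ue).
  by rewrite ltr_pdivrMr// ltr_pMr// ltr1n.
apply: boyd_small => //; apply: (le_lt_trans u2).
by rewrite invf_lt1// ltr1n.
Qed.

(** For a nonincreasing function a larger dilation factor gives a larger function, so a bound at [v]
    serves every smaller [u]. This covers factors outside the range where the index gives
    information. *)
Lemma dil_bound_le (d : R -> \bar R) u v r : dfun d -> carrier E (singular d) ->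
  0 < u -> u <= v -> dil_bound v r ->
  carrier E (dilation u^-1 (singular d)) /\ qn E (dilation u^-1 (singular d)) <= r * qn E (singular d).
Proof.
move=> hd cd u0 uv hv; have [cv nv] := hv _ cd.
have v0 : 0 < v by apply: lt_le_trans uv.
have mR := @measurable_Rplus R.
have mf : measurable_fun (@Rplus R) (dilation u^-1 (singular d)).
  apply: (measurable_comp mR (f := singular d) (g := fun t => u^-1 * t)).
  - move=> _ [t + <-]; rewrite /Rplus /= !in_itv /= !andbT => t0.
    by rewrite mulr_gt0// invr_gt0.
  - exact: sing_meas hd.
  - by apply: measurable_funM => //; exact: measurable_cst.
have dom t : 0 < t -> `|dilation u^-1 (singular d) t| <= `|dilation v^-1 (singular d) t|.
  move=> t0; rewrite !ger0_norm ?sing_ge0//; apply: (sing_noninc hd).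
    by rewrite mulr_gt0// invr_gt0.
  by rewrite ler_wpM2r ?(ltW t0)// lef_pV2 ?posrE.
have Su : S1 (dilation u^-1 (singular d)).
  have [mv [w [w0 hw]]] := sqb_sub hE cv; split => //; exists w; split => //.
  by apply: le_lt_trans hw; exact: distr_le.
have [c n] := carrier_mono hE Su cv dom; split => //; exact: le_trans nv.
Qed.
End Dilations.

Section Powers.
Context {R : realType}.
Implicit Types (a b c r t u rho gam : R).

Lemma powRXn a r k : 0 <= a -> (a ^+ k) `^ r = (a `^ r) ^+ k.
Proof. by move=> a0; rewrite -[a ^+ k]powR_mulrn// -powRrM mulrC powRrM powR_mulrn ?powR_ge0. Qed.

Lemma large_base c rho gam : 0 <= c -> 0 < rho -> 0 < gam ->
  exists2 b0, 0 <= b0 & forall b, b0 <= b -> c <= rho * b `^ gam.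
Proof.
move=> c0 r0 g0; exists ((c / rho) `^ gam^-1); first exact: powR_ge0.
move=> b hb; rewrite mulrC -ler_pdivrMr//.
have cr : 0 <= c / rho by rewrite divr_ge0// ltW.
rewrite -[leLHS](powRK (r := gam^-1)) ?invr_gt0// invrK.
by apply: ge0_ler_powR; rewrite ?nnegrE ?powR_ge0 ?(ltW g0)// (le_trans _ hb)// powR_ge0.
Qed.

Lemma pow_bracket b t : 2 <= b -> 1 <= t -> exists k, b ^+ k <= t < b ^+ k.+1.
Proof.
move=> b2 t1; have b1 : 1 <= b by apply: le_trans b2; rewrite ler1n.
have ex : exists n, t < b ^+ n.
  have [n hn] := half_small t (ltr01 : 0 < (1 : R)); exists n.
  move: hn; rewrite ltr_pdivrMr ?exprn_gt0// mul1r => h; apply: (lt_le_trans h).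
  by apply: lerXn2r; rewrite ?nnegrE// (le_trans _ b1).
case: (ex_minnP ex) => -[|k]; first by rewrite expr0 ltNge t1.
move=> h hmin; exists k; rewrite h andbT leNgt; apply/negP => /hmin; by rewrite ltnn.
Qed.
End Powers.

(** * Strips of the second variable and their dilations *)

Section Halves.
Context {R : realType} (p : R) (q : \bar R) (p0 : 0 < p) (pq : (p%:E < q)%E).
Variables (E : qspace R (R -> R)) (hE : symmetric_quasi_banach E).
Implicit Types (a b c r s t u v w rho gam : R) (d : R -> \bar R).
Local Notation lam := (@lebesgue_measure R).
Local Notation weight := (weight p q).

Definition sing_bound u r : Prop := forall d, dfun d -> carrier E (singular d) ->
  carrier E (dilation u^-1 (singular d)) /\ qn E (dilation u^-1 (singular d)) <= r * qn E (singular d).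

(** The [I k] are strips of the second variable of length at most [be k], covering [D] with weight
    at most [al k]. Allowing strip [k] the share [t / 2^(k+2)] of the measure [t] leads to a
    dilation by [2^(k+2) be k]; its norm times [al k] has to decay like [rho^k]. *)
Record half (D : set R) (A rho : R) (al be : nat -> R) (I : nat -> set R) : Prop := {
  half_al : forall k, 0 < al k ;
  half_be : forall k, 0 < be k ;
  half_meas : forall k, measurable (I k) ;
  half_lam : forall k, (lam (I k) <= (be k)%:E)%E ;
  half_cover : forall t, D t -> exists2 k, I k t & weight t <= al k ;
  half_bound : forall k, exists2 r, sing_bound (2 ^+ k.+2 * be k) r & al k * r <= A * rho ^+ k }.

Variables (p' u0 : R) (pp' : p < p') (u01 : 1 <= u0).
Hypothesis hu0 : forall u, u0 <= u -> dil_bound E u (u `^ p'^-1).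
Let p'0 : 0 < p'. Proof. exact: lt_trans pp'. Qed.

Lemma sing_bound_max u : 0 < u -> sing_bound u ((Num.max u0 u) `^ p'^-1).
Proof.
move=> up d hd cd; apply: (dil_bound_le hE hd cd up (v := Num.max u0 u)).
  by rewrite le_max lexx orbT.
by apply: hu0; rewrite le_max lexx.
Qed.

(** Up to a constant, strip [k] contributes [(b^(-1/p) (2 b)^(1/p'))^k]. As [p < p'], a large base
    [b] makes this at most [rho^k], and [b >= u0] keeps all dilation factors in the range of the
    index bound. *)
Lemma half_p rho : 0 < rho -> exists A al be I, 0 <= A /\ half [set t | 1 <= t] A rho al be I.
Proof.
move=> r0; have g0 : 0 < p^-1 - p'^-1 by rewrite subr_gt0 ltf_pV2 ?posrE.
have [b0 b00 hb0] := large_base (powR_ge0 2 p'^-1) r0 g0.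
pose b := Num.max 2 (Num.max u0 b0).
have b2 : 2 <= b by rewrite /b le_max lexx.
have bu : u0 <= b by rewrite /b !le_max lexx orbT.
have hb := hb0 b; have {}hb : 2 `^ p'^-1 <= rho * b `^ (p^-1 - p'^-1).
  by apply: hb; rewrite /b !le_max lexx !orbT.
have bp : 0 < b by apply: lt_le_trans b2.
have b1 : 1 <= b by apply: le_trans b2; rewrite ler1n.
exists ((4 * b) `^ p'^-1), (fun k => (b `^ (- p^-1)) ^+ k), (fun k => b ^+ k.+1),
  (fun k => `[b ^+ k, b ^+ k.+1[%classic); split; first exact: powR_ge0.
split.
- by move=> k; rewrite exprn_gt0// powR_gt0.
- by move=> k; rewrite exprn_gt0.
- by move=> k; exact: measurable_itv.
- move=> k; rewrite lebesgue_measure_itv /=; case: ifP => _.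
    by rewrite -EFinB lee_fin lerBlDr lerDl exprn_ge0// ltW.
  by rewrite lee_fin exprn_ge0// ltW.
- move=> t /= t1; have [k /andP[k1 k2]] := pow_bracket b2 t1; exists k; first by rewrite /= in_itv /= k1 k2.
  rewrite weight_ge1// -powRXn ?(ltW bp)// !powRN lef_pV2 ?posrE ?powR_gt0 ?exprn_gt0//; last first.
    exact: lt_le_trans t1.
  by apply: ge0_ler_powR; rewrite ?nnegrE ?invr_ge0 ?(ltW p0) ?exprn_ge0 ?(ltW bp)// (le_trans _ t1).
move=> k; exists (((2 * b) `^ p'^-1) ^+ k * (4 * b) `^ p'^-1).
  have e : 2 ^+ k.+2 * b ^+ k.+1 = (2 * b) ^+ k * (4 * b).
    by rewrite exprMn !exprS; ring.
  move=> d hd cd; have cu : u0 <= 2 ^+ k.+2 * b ^+ k.+1.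
    apply: (le_trans bu); rewrite [b ^+ k.+1]exprS mulrCA ler_peMr ?(ltW bp)//.
    by rewrite mulr_ege1// exprn_ege1// ler1n.
  have [h1 h2] := hu0 cu cd; split => //; apply: (le_trans h2).
  rewrite e powRM ?exprn_ge0 ?mulr_ge0 ?(ltW bp)// powRXn// mulr_ge0// ltW//.
rewrite mulrA -exprMn mulrC ler_wpM2l ?powR_ge0//.
apply: lerXn2r; rewrite ?nnegrE ?mulr_ge0 ?powR_ge0 ?(ltW r0)//.
rewrite powRM ?(ltW bp)// powRN mulrC ler_pdivrMr ?powR_gt0//.
apply: (le_trans (ler_wpM2r (powR_ge0 b p'^-1) hb)).
by rewrite -mulrA -powRD ?subrK// (gt_eqF bp) implybT.
Qed.

Lemma half_q_fin (q1 q' v0 rho : R) : q = q1%:E -> 0 < q' -> q' < q1 -> 0 < v0 ->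
  (forall u, 0 < u -> u <= v0 -> dil_bound E u (u `^ q'^-1)) -> 0 < rho ->
  exists A al be I, 0 <= A /\ half [set t | 0 < t < 1] A rho al be I.
Proof.
move=> eq q'0 qq' v00 hv0 r0; have q10 : 0 < q1 by apply: lt_trans qq'.
have g0 : 0 < q'^-1 - q1^-1 by rewrite subr_gt0 ltf_pV2 ?posrE.
have [b0 b00 hb0] := large_base (powR_ge0 2 q'^-1) r0 g0.
(* The term [8 / v0] makes [4 (2 / b) <= v0], so that every strip except the first has its dilation
   factor in the range of the index bound. *)
pose b := Num.max 2 (Num.max (8 / v0) b0).
have b2 : 2 <= b by rewrite /b le_max lexx.
have bu : 8 / v0 <= b by rewrite /b !le_max lexx orbT.
have hb := hb0 b; have {}hb : 2 `^ q'^-1 <= rho * b `^ (q'^-1 - q1^-1).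
  by apply: hb; rewrite /b !le_max lexx !orbT.
have bp : 0 < b by apply: lt_le_trans b2.
have b1 : 1 <= b by apply: le_trans b2; rewrite ler1n.
have pos2 : 0 <= 2 / b by rewrite divr_ge0// ltW.
set r1 := (Num.max u0 4) `^ p'^-1.
exists (b `^ q1^-1 * (r1 + 4 `^ q'^-1)), (fun k => b `^ q1^-1 * (b `^ q1^-1) ^+ k), (fun k => b^-1 ^+ k),
  (fun k => `]b^-1 ^+ k.+1, b^-1 ^+ k]%classic).
split; first by rewrite mulr_ge0 ?addr_ge0 ?powR_ge0.
split.
- by move=> k; rewrite mulr_gt0 ?exprn_gt0// powR_gt0.
- by move=> k; rewrite exprn_gt0// invr_gt0.
- by move=> k; exact: measurable_itv.
- move=> k; rewrite lebesgue_measure_itv /=; case: ifP => _.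
    by rewrite -EFinB lee_fin lerBlDr lerDl exprn_ge0// invr_ge0 ltW.
  by rewrite lee_fin exprn_ge0// invr_ge0 ltW.
- move=> t /andP[t0 t1]; have t1' : 1 <= t^-1 by rewrite invf_ge1 ?ltW.
  have [k /andP[k1 k2]] := pow_bracket b2 t1'; exists k.
    rewrite /= in_itv /= !exprVn -[t in X in X && _]invrK ltf_pV2 ?posrE ?invr_gt0 ?exprn_gt0// k2 /=.
    by rewrite -[t]invrK lef_pV2 ?posrE ?invr_gt0 ?exprn_gt0.
  have tE : t `^ (- q1^-1) = t^-1 `^ q1^-1 by rewrite -[t^-1]powR_inv1 ?(ltW t0)// -powRrM mulN1r.
  rewrite weight_lt1// eq recip_fin// tE -exprS -powRXn ?(ltW bp)//.
  by apply: ge0_ler_powR; rewrite ?nnegrE ?invr_ge0 ?(ltW q10) ?(ltW t0) ?exprn_ge0 ?(ltW bp)// ltW.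
(* The first strip has dilation factor 4, which need not be small; it is handled by the bound for
   large factors. *)
case=> [|k].
  exists r1; last by rewrite !expr0 !mulr1 ler_wpM2l ?powR_ge0// lerDl powR_ge0.
  by rewrite expr0 mulr1 (_ : 2 ^+ 2 = 4); [exact: sing_bound_max|rewrite expr2; ring].
exists (((2 / b) `^ q'^-1) ^+ k.+1 * 4 `^ q'^-1).
  have e : 2 ^+ k.+3 * b^-1 ^+ k.+1 = (2 / b) ^+ k.+1 * 4.
    by rewrite exprMn !exprS; ring.
  move=> d hd cd; rewrite e.
  have up : 0 < (2 / b) ^+ k.+1 * 4 by rewrite mulr_gt0// exprn_gt0// divr_gt0.
  have cu : (2 / b) ^+ k.+1 * 4 <= v0.
    have h8 : 2 / b * 4 <= v0.
      by rewrite mulrAC ler_pdivrMr//; move: bu; rewrite ler_pdivrMr//; lra.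
    apply: le_trans h8; rewrite ler_wpM2r// exprS ler_piMr//.
    by apply: exprn_ile1 => //; rewrite ler_pdivrMr// mul1r.
  have [h1 h2] := hv0 _ up cu _ cd; split => //; apply: (le_trans h2).
  by rewrite powRM ?exprn_ge0// powRXn.
rewrite -!mulrA ler_wpM2l ?powR_ge0// mulrA -exprMn mulrC.
apply: (@le_trans _ _ (4 `^ q'^-1 * rho ^+ k.+1)); last first.
  by rewrite ler_wpM2r ?exprn_ge0 ?(ltW r0)// lerDr powR_ge0.
rewrite ler_wpM2l ?powR_ge0//; apply: lerXn2r; rewrite ?nnegrE ?mulr_ge0 ?powR_ge0 ?(ltW r0)//.
have iE : b^-1 `^ q'^-1 = (b `^ q'^-1)^-1 by rewrite -[b^-1]powR_inv1 ?(ltW bp)// -powRrM mulN1r powRN.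
rewrite powRM ?invr_ge0 ?(ltW bp)// iE mulrA ler_pdivrMr ?powR_gt0//.
apply: (le_trans (ler_wpM2l (powR_ge0 b q1^-1) hb)).
by rewrite mulrCA -powRD ?(gt_eqF bp) ?implybT// addrC subrK.
Qed.

(** The weight is 1 on []0, 1[], which is one strip, and the other strips are empty. The [al k]
    still decay, to offset the growing dilations by [2^(k+2)]. *)
Lemma half_q_inf rho : q = +oo%E -> 0 < rho ->
  exists A al be I, 0 <= A /\ half [set t | 0 < t < 1] A rho al be I.
Proof.
move=> eq r0; have c0 : 0 < 2 `^ p'^-1 :> R by rewrite powR_gt0.
exists ((u0 * 4) `^ p'^-1), (fun k => (rho / 2 `^ p'^-1) ^+ k), (fun=> 1),
  (fun k => if k is 0 then `]0, 1[%classic else set0).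
split; first exact: powR_ge0.
split.
- by move=> k; rewrite exprn_gt0// divr_gt0.
- by [].
- by case=> [|k]; [exact: measurable_itv|exact: measurable0].
- case=> [|k]; last by rewrite measure0 lee_fin.
  by rewrite lebesgue_measure_itv /= lte_fin ltr01 -EFinB subr0.
- move=> t /andP[t0 t1]; exists 0%N; first by rewrite /= in_itv /= t0 t1.
  by rewrite weight_lt1// eq recip_infty oppr0 powRr0 expr0.
move=> k; exists ((u0 * 4) `^ p'^-1 * (2 `^ p'^-1) ^+ k).
  move=> d hd cd; rewrite mulr1.
  have u00 : 0 < u0 by apply: lt_le_trans u01.
  have e : u0 * 2 ^+ k.+2 = u0 * 4 * 2 ^+ k by rewrite !exprS; ring.
  have le : 2 ^+ k.+2 <= u0 * 2 ^+ k.+2 by rewrite ler_peMl.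
  have le' : u0 <= u0 * 2 ^+ k.+2.
    by rewrite ler_peMr ?(ltW u00)// exprn_ege1// ler1n.
  have := dil_bound_le hE hd cd _ le (hu0 le'); rewrite e powRM ?exprn_ge0 ?mulr_ge0 ?(ltW u00)//.
  by rewrite powRXn//; apply; rewrite exprn_gt0.
by rewrite mulrCA -exprMn divfK// gt_eqF.
Qed.
End Halves.

Lemma leb2_setX (R : realType) (S I : set R) : measurable S -> measurable I ->
  leb2 (S `*` I) = (@lebesgue_measure R S * @lebesgue_measure R I)%E.
Proof.
move=> mS mI; exact: (@product_measure1E _ _ _ _ R (@lebesgue_measure R) (@lebesgue_measure R)).
Qed.

(** * Boundedness of [Theta] from the two halves *)

Section ThetaUpper.
Context {R : realType} (p : R) (q : \bar R) (p0 : 0 < p) (pq : (p%:E < q)%E).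
Variables (E : qspace R (R -> R)) (hE : symmetric_quasi_banach E).
Implicit Types (a b c r s t u v w y rho : R) (d : R -> \bar R) (f g : R -> R).
Local Notation lam := (@lebesgue_measure R).
Local Notation quadrant := (@Rplus R `*` @Rplus R).
Local Notation leb2m := (@lebesgue_measure R \x @lebesgue_measure R)%E.

Section Half.
Variables (D : set R) (A rho : R) (al be : nat -> R) (I : nat -> set R).
Hypothesis hh : half p q E D A rho al be I.

Definition piece f k : R -> R := fun t => al k * dilation (2 ^+ k.+2 * be k)^-1 (mu1 f) t.

(** As [piece f k t < v], the set where [|f| > v / al k] has measure at most [t / (2^(k+2) be k)];
    its product with strip [k] has measure at most [t / 2^(k+2)], and these sum to [t / 2]. *)
Lemma half_measure f t y v : S1 f -> 0 < t -> (forall k, piece f k t <= y) -> y < v -> 0 < v ->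
  exists U : set (R * R), [/\ measurable U, (leb2 U <= (t / 2)%:E)%E &
    forall z, 0 < z.1 -> D z.2 -> v < `|f z.1| * weight p q z.2 -> U z].
Proof.
move=> Sf t0 hy yv v0; have df := dfun_S1 Sf.
pose S k := @Rplus R `&` [set s | v / al k < `|f s|].
have mS k : measurable (S k) by apply: distr_setE; case: Sf.
have mI := half_meas hh.
have mF k : measurable (S k `*` I k) by exact: measurableX.
exists (\bigcup_k (S k `*` I k)); split.
- exact: bigcupT_measurable.
- apply: (@le_trans _ _ (\sum_(0 <= k <oo) (t / 2 / (2 ^ k.+1)%:R)%:E)%E); last first.
    by apply: epsilon_trick0; rewrite divr_ge0// ltW.
  have := measure_sigma_subadditive leb2m mF (bigcupT_measurable _ mF) (@subset_refl _ _).
  move=> /le_trans; apply.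
  apply: lee_nneseries => k _; [by move=> _; exact: measure_ge0|].
  rewrite -/leb2 [leLHS](leb2_setX (mS k) (mI k)).
  have b0 := half_be hh k; have a0 := half_al hh k.
  have u0 : 0 < 2 ^+ k.+2 * be k by rewrite mulr_gt0// exprn_gt0.
  have h1 : (lam (S k) <= ((2 ^+ k.+2 * be k)^-1 * t)%:E)%E.
    apply: (sing_lt df); first by rewrite mulr_gt0// invr_gt0.
    rewrite ltr_pdivlMr// mulrC; exact: le_lt_trans (hy k) yv.
  apply: (le_trans (lee_pmul _ _ h1 (half_lam hh k))) => //.
  rewrite -EFinM lee_fin natrX le_eqVlt; apply/orP; left; apply/eqP.
  rewrite !exprS; field; rewrite !gt_eqF//; exact: exprn_gt0.
- move=> [s t'] /= s0 Dt hv; have [k It wk] := half_cover hh Dt; exists k => //; split => //=.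
  split; first by rewrite /Rplus /= in_itv /= andbT.
  rewrite /= ltr_pdivrMr ?(half_al hh)//; apply: (lt_le_trans hv).
  by rewrite ler_wpM2l.
Qed.

Lemma piece_ge0 f k t : 0 <= piece f k t.
Proof. by rewrite mulr_ge0 ?sing_ge0// ltW// (half_al hh). Qed.

Lemma mu1_carrier f : carrier E f -> carrier E (mu1 f) /\ qn E (mu1 f) <= qn E f.
Proof.
move=> cf; have df := dfun_S1 (sqb_sub hE cf).
apply: (sqb_symmetric hE (S1_sing df) cf) => t t0.
apply: sing_le_sing => // v w v0 vw; apply: (le_trans (distr_sing df (lt_trans v0 vw))).
by apply: df_mono => //; exact: ltW.
Qed.

Lemma piece_carrier f k : 0 <= A -> 0 <= rho -> carrier E f ->
  carrier E (piece f k) /\ qn E (piece f k) <= A * rho ^+ k * qn E f.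
Proof.
move=> A0 r0 cf; have [cm nm] := mu1_carrier cf; have df := dfun_S1 (sqb_sub hE cf).
have [r /(_ _ df cm)[c1 n1] hr] := half_bound hh k.
have a0 := ltW (half_al hh k).
split; first exact: sqb_Z.
rewrite (sqb_normZ hE)// ger0_norm//; apply: (le_trans (ler_wpM2l a0 n1)).
rewrite mulrA; apply: (le_trans (ler_wpM2r (sqb_ge0 hE cm) hr)).
by apply: ler_wpM2l => //; rewrite mulr_ge0// exprn_ge0.
Qed.
End Half.

Lemma Theta_bounded_halves :
  (forall rho, 0 < rho -> exists A al be I, 0 <= A /\ half p q E [set t | 1 <= t] A rho al be I) ->
  (forall rho, 0 < rho -> exists A al be I, 0 <= A /\ half p q E [set t | 0 < t < 1] A rho al be I) ->
  exists2 c, 0 <= c & forall f, carrier E f ->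
    carrier (Espace2 E) (Theta p%:E q f) /\ qn (Espace2 E) (Theta p%:E q f) <= c * qn E f.
Proof.
have [K K1 hK] := quasi_const hE; have K0 : 0 < K by apply: lt_le_trans K1.
(* This ratio satisfies [2 K rho <= 1], as summation in a quasi-norm with constant [K] requires. *)
have r0 : 0 < (2 * K)^-1 by rewrite invr_gt0 mulr_gt0.
move=> /(_ _ r0)[A [al [be [I [A0 h1]]]]] /(_ _ r0)[A' [al' [be' [I' [A0' h2]]]]].
set rho := (2 * K)^-1 in r0 h1 h2.
exists (2 * K ^+ 2 * (K * (A + A'))); first by rewrite !mulr_ge0 ?addr_ge0 ?exprn_ge0 ?(ltW K0).
move=> f cf; have Sf := sqb_sub hE cf; have qf := sqb_ge0 hE cf.
pose H k := piece al be f k \+ piece al' be' f k.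
have cH k : carrier E (H k).
  apply: sqb_D => //; first by have [] := piece_carrier h1 k A0 (ltW r0) cf.
  by have [] := piece_carrier h2 k A0' (ltW r0) cf.
have H0 k t : 0 < t -> 0 <= H k t by move=> _; rewrite addr_ge0 ?(piece_ge0 h1) ?(piece_ge0 h2).
have nH k : qn E (H k) <= K * (A + A') * qn E f * rho ^+ k.
  have [c1 n1] := piece_carrier h1 k A0 (ltW r0) cf.
  have [c2 n2] := piece_carrier h2 k A0' (ltW r0) cf.
  apply: (le_trans (hK _ _ c1 c2)); rewrite -!mulrA ler_wpM2l ?(ltW K0)//.
  by apply: (le_trans (lerD n1 n2)); rewrite le_eqVlt; apply/orP; left; apply/eqP; ring.
have B0 : 0 <= K * (A + A') * qn E f by rewrite !mulr_ge0 ?addr_ge0 ?(ltW K0).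
have Kr : 2 * K * rho <= 1 by rewrite divff// gt_eqF// mulr_gt0.
have [g [N [cg ng mN N0 hN]]] := series_carrier hE K1 hK B0 (ltW r0) Kr cH H0 nH.
have mf : measurable_fun (@Rplus R) f by case: Sf.
(* Each half contributes measure at most [t / 2]; hence [g] dominates the singular values of
   [Theta f] at every [t] outside the null set. *)
have key t v : 0 < t -> ~ N t -> g t < v -> (distr leb2 quadrant (Theta p%:E q f) v <= t%:E)%E.
  move=> t0 nN gv.
  have b1 k : piece al be f k t <= g t.
    by apply: le_trans (hN k t t0 nN); rewrite lerDl (piece_ge0 h2).
  have b2 k : piece al' be' f k t <= g t.
    by apply: le_trans (hN k t t0 nN); rewrite lerDr (piece_ge0 h1).
  have v0 : 0 < v by apply: le_lt_trans gv; apply: le_trans (b1 0%N); exact: piece_ge0 h1 _ _ _.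
  have [U [mU lU hU]] := half_measure h1 Sf t0 b1 gv v0.
  have [V [mV lV hV]] := half_measure h2 Sf t0 b2 gv v0.
  apply: (@le_trans _ _ (leb2 (U `|` V))).
    apply: (@le_measure _ _ _ leb2m); rewrite ?inE; [exact: Theta_set_meas|exact: measurableU|].
    move=> [s w] [[/= s0 w0] hv]; move: s0 w0; rewrite /Rplus /= !in_itv /= !andbT => s0 w0.
    move: hv; rewrite Theta_weight /= normrM [X in _ * X]ger0_norm ?weight_ge0// => hv.
    by have [w1|w1] := leP 1 w; [left; exact: hU|right; apply: hV => //=; rewrite w0].
  apply: (le_trans (measureU2 leb2m mU mV)); rewrite [t in leRHS]splitr EFinD.
  exact: leeD.
have [t0 t00 nN0] : exists2 t, 0 < t & ~ N t.
  apply: contrapT => /forall2NP h.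
  have sub : (`]0, 1[%classic : set R) `<=` N.
    by move=> t /=; rewrite in_itv /= => /andP[tp _]; case: (h t) => // /contrapT.
  have mI : measurable (`]0%R, 1%R[%classic : set R) by exact: measurable_itv.
  have : (lam `]0%R, 1%R[%classic <= 0)%E.
    by rewrite -N0; exact: (@le_measure _ _ _ lam _ _ (mem_set mI) (mem_set mN) sub).
  by rewrite lebesgue_measure_itv /= lte_fin ltr01 oppr0 adde0 lee_fin leNgt ltr01.
have g0 t : 0 < t -> ~ N t -> 0 <= g t by move=> tp /(hN 0%N t tp); apply: le_trans; exact: H0.
have S2T : S2 (Theta p%:E q f).
  split; first exact: Theta_meas.
  exists (g t0 + 1); split; first by rewrite ltr_wpDl// g0.
  by apply: le_lt_trans (key t0 _ t00 nN0 _) (ltry _); rewrite ltrDl.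
have dD : dfun (distr leb2 quadrant (Theta p%:E q f)).
  apply: (@dfun_distr _ _ _ leb2m) => //; by apply: measurableX; exact: measurable_Rplus.
have [|c1 n1] := carrier_sing_ae hE dD cg mN N0.
  move=> t tp nN; apply/ler_addgt0Pr => e e0; apply: sing_le.
    by rewrite ltr_wpDl// g0.
  by apply: key => //; rewrite ltrDl.
split; first by split.
by apply: (le_trans n1); apply: (le_trans ng); rewrite -!mulrA.
Qed.

Lemma Theta_bounded :
  [/\ (p%:E < boyd_p E)%E, (boyd_p E <= boyd_q E)%E, (boyd_q E < q)%E & (q < +oo)%E]
      \/ ((p%:E < boyd_p E)%E /\ q = +oo%E) ->
  exists2 c, 0 <= c & forall f, carrier E f ->
    carrier (Espace2 E) (Theta p%:E q f) /\ qn (Espace2 E) (Theta p%:E q f) <= c * qn E f.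
Proof.
move=> hi; have hp : (p%:E < boyd_p E)%E by case: hi => -[].
have [p' [u0 [pp' u01 hu0]]] := boyd_p_bound hE p0 hp.
apply: Theta_bounded_halves; first by move=> rho r0; exact: (half_p q p0 pp' hu0 r0).
move=> rho r0; case: hi => [[_ le lq qy]|[_ qe]]; last exact: (half_q_inf p hE u01 hu0).
have q0 : (0 < boyd_q E)%E by apply: lt_le_trans le; apply: lt_trans hp; rewrite lte_fin.
case eq : q lq qy => [q1| |] // lq _; last by move: lq; rewrite ltNge leNye.
have [q' [v0 [q'0 qq' v00 hv0]]] := boyd_q_bound hE q0 lq.
by rewrite -eq; exact: (half_q_fin p hE hu0 eq q'0 qq' v00 hv0 r0).
Qed.
End ThetaUpper.

(** [opnorm] is an infimum of admissible constants, so the inequality holds for each of them and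
    passes to the infimum after division by [a]; for [a = 0] a single constant settles it. *)
Lemma opnorm_pZ (R : realType) (V W : Type) (E : qspace R V) (F : qspace R W) (S : V -> W)
    (f : V) (a y c : R) : carrier E f -> qn E f = a -> 0 <= a -> 0 <= c ->
  (forall f, carrier E f -> carrier F (S f) /\ qn F (S f) <= c * qn E f) ->
  y <= qn F (S f) -> (y%:E <= opnorm E F S * a%:E)%E.
Proof.
move=> cf ea a0 c0 hc hy.
have hb c' : (forall f, carrier E f -> carrier F (S f) /\ qn F (S f) <= c' * qn E f) -> y <= c' * a.
  by move=> h; apply: (le_trans hy); rewrite -ea; case: (h f cf).
have up : (opnorm E F S <= c%:E)%E by apply: ereal_inf_lbound; exists c.
have lo : (0 <= opnorm E F S)%E by apply: le_ereal_inf_tmp => _ [c' [c'0 _] <-]; rewrite lee_fin.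
have fo : opnorm E F S \is a fin_num by rewrite ge0_fin_numE// (le_lt_trans up) ?ltry.
move: a0; rewrite le_eqVlt => /orP[/eqP a0|a0].
  by rewrite -a0 mule0 lee_fin; have := hb c hc; rewrite -a0 mulr0.
rewrite -(fineK fo) -EFinM lee_fin -ler_pdivrMr// -lee_fin fineK//.
apply: le_ereal_inf_tmp => _ [c' [c'0 h] <-]; rewrite lee_fin ler_pdivrMr//; exact: hb.
Qed.

Theorem theorem4p11 (R : realType) (E : qspace R (R -> R))
    (hE : symmetric_quasi_banach E)
    (s : R) (hs : 0 < s) (hconv : s_convex s E)
    (M N : traced_vna R)
    (p : R) (q : \bar R) (hp : 0 < p) (hpq : (p%:E < q)%E)
    (T : nat -> graph (vspace_of M) -> graph (vspace_of N))
    (hTpos : forall k, positive_map (Lsum_pos M p%:E q) (T k))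
    (hTconv : forall k, midpoint_convex (Lsum_pos M p%:E q) (T k))
    (Cp Cq : R) (hCp : 0 < Cp) (hCq : 0 < Cq)
    (hweakp : weak_type T p%:E Cp)
    (hweakq : weak_type T q Cq)
    (hindex :
      [/\ (p%:E < boyd_p E)%E, (boyd_p E <= boyd_q E)%E,
          (boyd_q E < q)%E & (q < +oo)%E]
      \/ ((p%:E < boyd_p E)%E /\ q = +oo%E)) :
  forall (x : nat -> graph (vspace_of M)) (X : graph (vspace_of M)),
    (forall k, NC_pos M E (x k)) ->
    carrier (NC M E) X ->
    series_cvg (enorm (NC M E)) x X ->
    exists Y : graph (vspace_of N),
      [/\ carrier (NC N E) Y,
          series_cvg (enorm (NC N E)) (fun k => T k (x k)) Y &
          ((qn (NC N E) Y)%:E <=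
             4%:E * Theta_norm p%:E q E * (Num.max Cp Cq)%:E
             * (qn (NC M E) X)%:E)%E].

Proof.
have [c c0 hc] := Theta_bounded hp hE hindex.
move=> x X hx hX cv.
have [Y [cY sY nY]] := series_image hp hpq hTpos hTconv hCp hCq hweakp hweakq hE c0 hc hx hX cv.
exists Y; split => //.
have C0 : 0 < 4 * Num.max Cp Cq by rewrite mulr_gt0// lt_max hCp.
have [cF nF] := NC_Fmu Cq hCp hE hX.
have X0 : 0 <= qn (NC M E) X by case: hX => _ cX; exact: sqb_ge0 hE _ cX.
(* The norm of [Theta] is applied to the function [4 C mu(X)], whose quasi-norm supplies the factor
   [4 C]. *)
have := opnorm_pZ cF nF (mulr_ge0 (ltW C0) X0) c0 hc nY.
rewrite -/(Theta_norm p%:E q E) => /le_trans; apply.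
by rewrite -[(_ * _ * _)%R]mulrA !EFinM muleCA !muleA.
Qed.
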